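(* Let $n\ge3$ and let $(M,g,u)$ be a static triple with negative cosmological constant, i.e. $M$ is a connected non-compact $n$-dimensional smooth manifold with empty boundary and finitely many ends, $g$ is a smooth Riemannian metric on $M$, and $u\in C^\infty(M)$ satisfies $u\,\mathrm{Ric}=\mathrm{D}^2u-n\,u\,g$, $\Delta u=n\,u$ and $u>0$ in $M$, with $u(x)\to+\infty$ as $x\to\infty$. Let $N$ be a connected component of $M\setminus\mathrm{MIN}(u)$. Then $$\liminf_{x\in N,\,x\to\infty}\left(u^2-u_{\min}^2-|\mathrm{D}u|^2\right)(x)\ \le\ 0 .$$ Moreover, if equality holds then, up to a normalization of $u$, the triple $(M,g,u)$ is isometric to the Anti de Sitter solution.
   Context: $\mathrm{Ric}$, $\mathrm{D}$, $\mathrm{D}^2$, $\Delta$ are the Ricci tensor, Levi-Civita connection, Hessian and Laplace-Beltrami operator of $g$. The equations imply that the scalar curvature is $\mathrm{R}\equiv-n(n-1)$. Set $u_{\min}=\min_M u$ and $\mathrm{MIN}(u)=\{p\in M:u(p)=u_{\min}\}$. ''$x\to\infty$'' means that $x$ leaves every compact subset of $M$: $u(x)\to+\infty$ as $x\to\infty$ means that for an exhaustion $\{K_i\}$ of $M$ by compact sets and any points $x_i\in M\setminus K_i$ one has $u(x_i)\to+\infty$; and $\liminf_{x\in N,\,x\to\infty}f(x)=\sup_{K}\inf_{N\setminus K}f$ over compact $K\subset M$, with values in $[-\infty,+\infty]$ (every such $N$ is unbounded, i.e. not contained in any compact subset of $M$, so this is meaningful). The Anti de Sitter solution is the triple $(M_0,g_0,u_0)$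 with $M_0=\mathbb{R}^n$, $g_0=\frac{d|x|\otimes d|x|}{1+|x|^2}+|x|^2g_{\mathbb{S}^{n-1}}$ (extended smoothly through the origin, so it is hyperbolic space), $u_0=\sqrt{1+|x|^2}$, where $g_{\mathbb{S}^{n-1}}$ is the standard round metric. ''Up to a normalization of $u$, $(M,g,u)$ is isometric to $(M_0,g_0,u_0)$'' means that there are a constant $c>0$ and an isometry $\Phi:(M,g)\to(M_0,g_0)$ with $u=c\,u_0\circ\Phi$. *)

(* Defs.v *)
From HB Require Import structures.
From mathcomp Require Import all_boot all_order all_algebra.
From mathcomp Require Import all_classical all_reals all_analysis.

Set Implicit Arguments.
Unset Strict Implicit.
Unset Printing Implicit Defensive.
Import Order.TTheory GRing.Theory Num.Theory.
Import numFieldNormedType.Exports.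
Local Open Scope classical_set_scope.
Local Open Scope ring_scope.

Definition partial (R : realType) (n : nat) (a : 'I_n)
    (f : 'rV[R]_n -> R) (x : 'rV[R]_n) : R :=
  'D_(delta_mx 0 a) f x.

Fixpoint Ck_on (R : realType) (n : nat) (k : nat) (U : set 'rV[R]_n)
    (f : 'rV[R]_n -> R) : Prop :=
  (forall x, U x -> {for x, continuous f}) /\
  (if k is k'.+1 then
     forall a : 'I_n, (forall x, U x -> derivable f x (delta_mx 0 a)) /\
                      Ck_on k' U (partial a f)
   else True).

Definition smooth_on (R : realType) (n : nat) (U : set 'rV[R]_n)
    (f : 'rV[R]_n -> R) : Prop :=
  forall k, Ck_on k U f.

Definition smooth_vec_on (R : realType) (n m : nat) (U : set 'rV[R]_n)
    (F : 'rV[R]_n -> 'rV[R]_m) : Prop :=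
  forall b : 'I_m, smooth_on U (fun x => F x 0 b).

(** Charts are total functions, meaningful only on [chart_dom i];
    [chart_inv i] is meaningful only on [chart_img A i]. *)
Record atlas (R : realType) (n : nat) (M : topologicalType) := Atlas {
  chart_ix : Type;
  chart_dom : chart_ix -> set M;
  chart : chart_ix -> M -> 'rV[R]_n;
  chart_inv : chart_ix -> 'rV[R]_n -> M;
  chart_at : M -> chart_ix
}.

Definition chart_img (R : realType) (n : nat) (M : topologicalType)
    (A : atlas R n M) (i : chart_ix A) : set 'rV[R]_n :=
  chart i @` chart_dom i.

Record smooth_atlas (R : realType) (n : nat) (M : topologicalType)
    (A : atlas R n M) : Prop := {
  atlas_cover : forall p, chart_dom (chart_at A p) p;
  atlas_dom_open : forall i : chart_ix A, open (chart_dom i);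
  atlas_img_open : forall i : chart_ix A, open (chart_img i);
  atlas_chartK : forall (i : chart_ix A) p,
    chart_dom i p -> chart_inv i (chart i p) = p;
  atlas_chart_cont : forall (i : chart_ix A) p,
    chart_dom i p -> {for p, continuous (chart i)};
  atlas_inv_cont : forall (i : chart_ix A) x,
    chart_img i x -> {for x, continuous (chart_inv i)};
  atlas_transition : forall i j : chart_ix A,
    smooth_vec_on (chart i @` (chart_dom i `&` chart_dom j))
                  (chart j \o chart_inv i)
}.

Definition smooth_manifold (R : realType) (n : nat) (M : topologicalType)
    (A : atlas R n M) : Prop :=
  [/\ hausdorff_space M, @second_countable M & smooth_atlas A].

Definition smooth_fun (R : realType) (n : nat) (M : topologicalType)
    (A : atlas R n M) (u : M -> R) : Prop :=
  forall i : chart_ix A, smooth_on (chart_img i) (u \o chart_inv i).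

Definition smooth_map (R : realType) (n n' : nat) (M M' : topologicalType)
    (A : atlas R n M) (A' : atlas R n' M') (F : M -> M') : Prop :=
  continuous F /\
  forall (i : chart_ix A) (j : chart_ix A'),
    smooth_vec_on (chart i @` (chart_dom i `&` F @^-1` chart_dom j))
                  (chart j \o F \o chart_inv i).

(** [g i p] is the matrix (g_ab) at the point p in the coordinates of the
    chart i; it is meaningful only for p in [chart_dom i]. *)
Definition metric_field (R : realType) (n : nat) (M : topologicalType)
    (A : atlas R n M) : Type :=
  chart_ix A -> M -> 'M[R]_n.

(** Matrix of the pull-back of the bilinear form G by the linear map
    v |-> v *m J (the convention of the library's ['J F x]). *)
Definition pullback (R : realType) (n m : nat) (J : 'M[R]_(n, m))
    (G : 'M[R]_m) : 'M[R]_n :=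
  J *m G *m J^T.

Record riemannian_metric (R : realType) (n : nat) (M : topologicalType)
    (A : atlas R n M) (g : metric_field A) : Prop := {
  metric_sym : forall (i : chart_ix A) p, chart_dom i p -> (g i p)^T = g i p;
  metric_pos : forall (i : chart_ix A) p, chart_dom i p ->
    forall v : 'rV[R]_n, v != 0 -> 0 < (v *m g i p *m v^T) 0 0;
  metric_smooth : forall (i : chart_ix A) (a b : 'I_n),
    smooth_on (chart_img i) (fun x => g i (chart_inv i x) a b);
  metric_change : forall (i j : chart_ix A) p,
    chart_dom i p -> chart_dom j p ->
    g i p = pullback ('J (chart j \o chart_inv i) (chart i p)) (g j p)
}.

Definition riem_isometry (R : realType) (n : nat) (M M' : topologicalType)
    (A : atlas R n M) (g : metric_field A)
    (A' : atlas R n M') (g' : metric_field A') (F : M -> M') : Prop :=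
  (exists F' : M' -> M, [/\ cancel F F', cancel F' F,
                           smooth_map A A' F & smooth_map A' A F']) /\
  forall (i : chart_ix A) (j : chart_ix A') p,
    chart_dom i p -> chart_dom j (F p) ->
    g i p = pullback ('J (chart j \o F \o chart_inv i) (chart i p))
                     (g' j (F p)).

(** Here G is the field of matrices (g_ab) on an open subset of R^n. *)

(** Gamma^k_ab, i.e. D_{d_a} d_b = \sum_k Gamma^k_ab d_k *)
Definition christoffel (R : realType) (n : nat) (G : 'rV[R]_n -> 'M[R]_n)
    (k a b : 'I_n) (x : 'rV[R]_n) : R :=
  2^-1 * \sum_(l < n) invmx (G x) k l *
    (partial a (fun y => G y b l) x + partial b (fun y => G y a l) x
     - partial l (fun y => G y a b) x).

(** R(d_a, d_b) d_c = \sum_l (riemann_coef G l c a b) d_l, where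
    R(X, Y) = D_X D_Y - D_Y D_X - D_[X, Y] *)
Definition riemann_coef (R : realType) (n : nat) (G : 'rV[R]_n -> 'M[R]_n)
    (l c a b : 'I_n) (x : 'rV[R]_n) : R :=
  partial a (christoffel G l b c) x - partial b (christoffel G l a c) x
  + \sum_(m < n) (christoffel G l a m x * christoffel G m b c x
                  - christoffel G l b m x * christoffel G m a c x).

(** Ric(Y, Z) = trace of X |-> R(X, Y) Z *)
Definition ricci_coord (R : realType) (n : nat) (G : 'rV[R]_n -> 'M[R]_n)
    (x : 'rV[R]_n) : 'M[R]_n :=
  \matrix_(b, c) \sum_(a < n) riemann_coef G a c a b x.

Definition hessian_coord (R : realType) (n : nat) (G : 'rV[R]_n -> 'M[R]_n)
    (f : 'rV[R]_n -> R) (x : 'rV[R]_n) : 'M[R]_n :=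
  \matrix_(a, b) (partial a (partial b f) x
                  - \sum_(k < n) christoffel G k a b x * partial k f x).

Section ChartExpressions.
Context (R : realType) (n : nat) (M : topologicalType) (A : atlas R n M).
Implicit Types (g : metric_field A) (u : M -> R) (i : chart_ix A) (p : M).

Definition ricci g i p : 'M[R]_n :=
  ricci_coord (fun x => g i (chart_inv i x)) (chart i p).

Definition hessian g u i p : 'M[R]_n :=
  hessian_coord (fun x => g i (chart_inv i x)) (u \o chart_inv i) (chart i p).

Definition differential u i p : 'rV[R]_n :=
  \row_a partial a (u \o chart_inv i) (chart i p).

(** [laplacian] and [grad_normsq] do not depend on the chart around p used to
    compute them; [chart_at A p] is just one choice. *)

Definition laplacian g u p : R :=
  let i := chart_at A p in \tr (invmx (g i p) *m hessian g u i p).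

(** |Du|^2 = g^{ab} d_a u d_b u *)
Definition grad_normsq g u p : R :=
  let i := chart_at A p in
  (differential u i p *m invmx (g i p) *m (differential u i p)^T) 0 0.

End ChartExpressions.

Definition exhaustion (M : topologicalType) (K : nat -> set M) : Prop :=
  [/\ forall i, compact (K i), forall i, K i `<=` (K i.+1)°
    & \bigcup_i K i = [set: M]].

Definition tends_to_pinfty (R : realType) (M : topologicalType)
    (u : M -> R) : Prop :=
  exists2 K : nat -> set M, exhaustion K &
    forall x : nat -> M, (forall i, ~ K i (x i)) -> u (x i) @[i --> \oo] --> +oo.

Definition liminf_infinity (R : realType) (M : topologicalType) (N : set M)
    (f : M -> R) : \bar R :=
  ereal_sup [set ereal_inf [set (f x)%:E | x in N `\` K]
            | K in [set K : set M | compact K]].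

Definition is_component (M : topologicalType) (B C : set M) : Prop :=
  exists2 x, B x & C = connected_component B x.

(** Freudenthal ends: compatible choices of a connected component of the
    complement of each compact set.  The last condition only fixes the values
    of e off the compact sets, so that equal ends are equal as functions. *)
Definition ends (M : topologicalType) : set (set M -> set M) :=
  [set e | [/\ forall K, compact K -> is_component (~` K) (e K),
               forall K L, compact K -> compact L -> K `<=` L -> e L `<=` e K
             & forall K, ~ compact K -> e K = set0]].

Record static_triple (R : realType) (n : nat) (M : topologicalType)
    (A : atlas R n M) (g : metric_field A) (u : M -> R) : Prop := {
  static_manifold : smooth_manifold A;
  static_connected : connected [set: M];
  static_noncompact : ~ compact [set: M];
  static_ends : finite_set (@ends M);
  static_metric : riemannian_metric g;
  static_smooth : smooth_fun A u;
  static_ric : forall (i : chart_ix A) p, chart_dom i p ->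
    u p *: ricci g i p = hessian g u i p - (n%:R * u p) *: g i p;
  static_lap : forall p, laplacian g u p = n%:R * u p;
  static_pos : forall p, 0 < u p;
  static_infinity : tends_to_pinfty u
}.

(** For a static triple the infimum is attained, u being continuous with
    u -> +oo at infinity. *)
Definition u_min (R : realType) (M : topologicalType) (u : M -> R) : R :=
  inf (range u).

Definition MINset (R : realType) (M : topologicalType) (u : M -> R) : set M :=
  [set p | u p = u_min u].

Definition euclidean_atlas (R : realType) (n : nat) : atlas R n 'rV[R]_n :=
  {| chart_ix := unit;
     chart_dom := fun=> [set: 'rV[R]_n];
     chart := fun=> id;
     chart_inv := fun=> id;
     chart_at := fun=> tt |}.

(** The Euclidean norm (the library's `|x| is the sup norm). *)
Definition enorm (R : realType) (n : nat) (x : 'rV[R]_n) : R :=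
  Num.sqrt (\sum_(a < n) x 0 a ^+ 2).

(** Components of the 1-form d|x|, for x != 0; the value at 0 is 0. *)
Definition d_enorm (R : realType) (n : nat) (x : 'rV[R]_n) : 'rV[R]_n :=
  (enorm x)^-1 *: x.

(** |x|^2 g_{S^{n-1}} is the Euclidean metric minus d|x| (x) d|x|.  At x = 0
    the formula evaluates to the identity matrix, the smooth extension. *)
Definition ads_metric (R : realType) (n : nat) :
    metric_field (euclidean_atlas R n) :=
  fun _ x =>
    let dr2 := (d_enorm x)^T *m d_enorm x in
    (1 + enorm x ^+ 2)^-1 *: dr2 + (1%:M - dr2).

Definition ads_potential (R : realType) (n : nat) (x : 'rV[R]_n) : R :=
  Num.sqrt (1 + enorm x ^+ 2).

(* Main.v *)
(** For [f = u^2 - u_min^2 - |Du|^2], Bochner's formula turns the static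
    equations into [Delta f - <Du, Df>/u = - 2 |D^2 u - u g|^2], so [f] obeys
    minimum principles.  If the liminf is nonnegative, comparison with
    [f - e u^2] gives [f >= 0] on [N].  As
    [ln (u^2 - u_min^2)] is a strict subsolution tending to [-oo] at the
    minimum set, [f] cannot stay positive on [N], and the strong minimum
    principle yields [f = 0] and [D^2 u = u g] on [N].  The minima of [u]
    adherent to [N] are then nondegenerate, hence isolated and interior to the
    closure of [N], so that [N] is dense and [f = 0] on [M]; in particular the
    liminf cannot be positive.

    In the equality case put [w = u / u_min].  The metric [h = g + dw (x) dw] is
    flat: [q = (w^2 - 1) / 2] satisfies [D^2 q = h] and [|Dq|^2 = 2 q] for [h].
    The flow of [- grad q] contracts [M] to the minimum of [q] by homotheties
    of [h].  Let [E] be its time-one map, of ratio [lam < 1].  For linear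
    functions [l] in a chart at the minimum, [lam^-k (l o E^k)] converges
    (Koenigs' linearisation) to functions [y_b] whose Hessians vanish, whose
    differentials are [h]-orthonormal, and for which [sum_b y_b^2 = 2 q].  These
    are global coordinates onto [R^n] in which [h] is Euclidean and
    [w = sqrt (1 + |y|^2)], and [g = h - dw (x) dw] is the hyperbolic metric. *)
Require Import Defs.
From HB Require Import structures.
From mathcomp Require Import all_boot all_order all_algebra.
From mathcomp Require Import all_classical all_reals all_analysis.
From mathcomp Require Import ring lra.
Set Implicit Arguments.
Unset Strict Implicit.
Unset Printing Implicit Defensive.
Import Order.TTheory GRing.Theory Num.Theory.
Import numFieldNormedType.Exports.
Local Open Scope classical_set_scope.
Local Open Scope ring_scope.

(** * Differential calculus on R^n *)

(** The drift [Du/u] is the one for which Bochner's Ricci term cancels, since the static equation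
    turns [Ric(Du, Du)] into [D^2u(Du, Du)/u - n |Du|^2]. The dimension enters through
    [L (ln Q) = 2 (u/Q)^2 (n Q - 2 |Du|^2)], where [L] is the operator with that drift and
    [Q = u^2 - u_min^2]; it is positive once [|Du|^2 <= Q].

    Flatness of [h] is never expressed by a curvature tensor; it appears as the existence of
    functions with zero Hessian. Passing from [f] to [lam^-1 (f o E)] leaves the size of [Df]
    unchanged but multiplies that of [D^2 f] by [lam], so Hessians die out under iteration. The
    iterates converge because [E] has differential [lam] times the identity at its fixed point:
    [lam^-1 (l o E) - l] vanishes there to second order, hence is [O(q)], and [q] shrinks by [lam^2]
    at each step. The flow defining [E] is global because [q] is multiplied by [exp (-2t)] along it
    and sublevel sets of [q] are compact.

    Tensors live in charts as matrices; what is transported on [M] are the scalars [|Df|^2] and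
    [|D^2 f|^2], which do not depend on the chart. *)

Lemma continuous_eps (R : realType) (V W : normedModType R) (f : V -> W) x :
  {for x, continuous f} <->
  forall e, 0 < e -> exists2 d, 0 < d & forall y, `|y - x| < d -> `|f y - f x| < e.
Proof.
split => [cf e e0|H].
  have /cvgrPdist_lt /(_ _ e0) /nbhs_ballP[d /= d0 Hd] := cf.
  exists d => // y yx; rewrite distrC; apply: Hd.
  by rewrite -ball_normE /= distrC.
apply/cvgrPdist_lt => e /H[d d0 Hd]; apply/nbhs_ballP; exists d => //= y.
by rewrite -ball_normE /= distrC => /Hd; rewrite distrC.
Qed.

Lemma nbhs_norm_ball (R : realType) (V : normedModType R) (x : V) (P : set V) :
  nbhs x P <-> exists2 d : R, 0 < d & forall y : V, `|y - x| < d -> P y.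
Proof.
split=> [/nbhs_ballP[d /= d0 Hd]|[d d0 Hd]].
  by exists d => // y yx; apply: Hd; rewrite -ball_normE /= distrC.
apply/nbhs_ballP; exists d => //= y; rewrite -ball_normE /= distrC; exact: Hd.
Qed.

Lemma open_ball_in (R : realType) (V : normedModType R) (U : set V) x :
  open U -> U x -> exists2 r, 0 < r & forall y, `|y - x| < r -> U y.
Proof.
move=> oU Ux; have /nbhs_ballP[r /= r0 Hr] := open_nbhs_nbhs (conj oU Ux).
by exists r => // y yx; apply: Hr; rewrite -ball_normE /= distrC.
Qed.

Lemma open_of_balls (R : realType) (V : normedModType R) (U : set V) :
  (forall x, U x -> exists2 r, 0 < r & forall y, `|y - x| < r -> U y) -> open U.
Proof.
move=> H; rewrite openE => x /H[r r0 Hr]; apply/nbhs_ballP; exists r => //= y.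
by rewrite -ball_normE /= distrC => /Hr.
Qed.

Lemma coord_le_norm (R : realType) n (v : 'rV[R]_n) a : `|v 0 a| <= `|v|.
Proof.
rewrite [leRHS]/Num.Def.normr /= mx_normrE.
by rewrite (@le_bigmax _ _ _ 0 (fun i : 'I_1 * 'I_n => `|v i.1 i.2|) (0, a)).
Qed.

Lemma norm_le_coord (R : realType) n (v : 'rV[R]_n) c : 0 <= c ->
  (forall a, `|v 0 a| <= c) -> `|v| <= c.
Proof.
move=> c0 H; rewrite [leLHS]/Num.Def.normr /= mx_normrE.
by apply: bigmax_le => // -[i a] _ /=; rewrite (ord1 i).
Qed.

Lemma norm_lt_coord (R : realType) n (v : 'rV[R]_n) c : 0 < c ->
  (forall a, `|v 0 a| < c) -> `|v| < c.
Proof.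
move=> c0 H; rewrite [ltLHS]/Num.Def.normr /= mx_normrE.
by apply: bigmax_lt => // -[i a] _ /=; rewrite (ord1 i).
Qed.

Lemma norm_delta_mx (R : realType) n (a : 'I_n) :
  `|delta_mx 0 a : 'rV[R]_n| = 1.
Proof.
apply/le_anti/andP; split.
  apply: norm_le_coord => // b; rewrite mxE eqxx /=.
  by case: eqP => _; rewrite ?normr1 ?normr0.
by have := coord_le_norm (delta_mx 0 a : 'rV[R]_n) a; rewrite mxE !eqxx normr1.
Qed.

Lemma diff_lin_eps (R : realType) (V : normedModType R) (f : V -> R)
    (l : {linear V -> R}) x : continuous l ->
  (forall e : R, 0 < e -> exists2 d : R, 0 < d &
     forall h : V, `|h| < d -> `|f (h + x) - f x - l h| <= e * `|h|) ->
  differentiable f x /\ 'd f x = l :> (V -> R).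
Proof.
move=> cl H.
have E : f \o shift x = cst (f x) + l +o_ 0 id.
  apply/eqaddoP => e e0; have [d d0 Hd] := H e e0.
  apply/nbhs_ballP; exists d => //= h; rewrite -ball_normE /= sub0r normrN => hd.
  by rewrite !fctE /= opprD addrA; apply: Hd.
have D := diff_unique cl E; split => //.
by apply/diff_locallyP; rewrite D; split.
Qed.

Section LinForm.
Context {R : realType} {n : nat}.

Definition linform (v : 'I_n -> R) (h : 'rV[R]_n) : R := \sum_a h 0 a * v a.

Lemma linform_is_linear v : linear (linform v).
Proof.
move=> k x y; rewrite /linform scaler_sumr -big_split; apply: eq_bigr => a _.
by rewrite !mxE mulrDl /= -mulrA.
Qed.

HB.instance Definition _ v :=
  GRing.isLinear.Build R 'rV[R]_n R _ (linform v) (linform_is_linear v).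

Lemma linform_bound v h : `|linform v h| <= `|h| * \sum_a `|v a|.
Proof.
rewrite /linform (le_trans (ler_norm_sum _ _ _)) // mulr_sumr.
by apply: ler_sum => a _; rewrite normrM ler_wpM2r // coord_le_norm.
Qed.

Lemma linform_continuous v : continuous (linform v).
Proof.
move=> x; apply/continuous_eps => e e0.
have S0 : 0 < \sum_a `|v a| + 1 by rewrite ltr_wpDl // sumr_ge0.
exists (e / (\sum_a `|v a| + 1)); first exact: divr_gt0.
move=> y; rewrite ltr_pdivlMr // => H; rewrite -linearB.
apply: le_lt_trans H; apply: (le_trans (linform_bound _ _)).
by rewrite ler_wpM2l // lerDl.
Qed.

Lemma differentiable_eps (f : 'rV[R]_n -> R) (x : 'rV[R]_n) v :
  (forall e : R, 0 < e -> exists2 d : R, 0 < d &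
     forall h : 'rV[R]_n, `|h| < d ->
       `|f (h + x) - f x - linform v h| <= e * `|h|) ->
  differentiable f x /\ forall w, 'D_w f x = linform v w.
Proof.
move=> H; have [df D] := diff_lin_eps (@linform_continuous v) H.
by split => // w; rewrite deriveE // D.
Qed.

Lemma linform_delta v a : linform v (delta_mx 0 a) = v a.
Proof.
rewrite /linform (bigD1 a) //= mxE !eqxx mul1r big1 ?addr0 // => b ba.
by rewrite mxE (negbTE ba) andbF mul0r.
Qed.
End LinForm.

Lemma is_derive_line (R : realType) (V : normedModType R) (f : V -> R) x v t :
  derivable f (x + t *: v) v ->
  is_derive t 1 (fun s : R => f (x + s *: v)) ('D_v f (x + t *: v)).
Proof.
move=> df.
have E : (fun h : R => h^-1 *: ((f \o shift (x + t *: v)) (h *: v) - f (x + t *: v)))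
   = (fun h : R => h^-1 *: (((fun s : R => f (x + s *: v)) \o shift t) (h *: 1)
        - f (x + t *: v))).
  apply/funext => h /=; congr (_ *: (f _ - _)).
  by rewrite [h *: 1]mulr1 scalerDl addrCA.
split; first by rewrite /derivable -E.
by rewrite /derive -E.
Qed.

(** The increment [b] may have either sign, so the intermediate time is located only by
    [|t| <= |b|]; increments along coordinate axes can then be treated uniformly. *)
Lemma MVT_line (R : realType) (V : normedModType R) (f : V -> R) x v (b : R) :
  (forall t : R, `|t| <= `|b| -> derivable f (x + t *: v) v) ->
  exists2 t : R, `|t| <= `|b| & f (x + b *: v) - f x = b * 'D_v f (x + t *: v).
Proof.
move=> H; pose g s : R := f (x + s *: v).
have dg (t : R) : `|t| <= `|b| -> is_derive t 1 g ('D_v f (x + t *: v)).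
  by move=> /H; apply: is_derive_line.
have cg (i : interval R) : (forall t : R, t \in i -> `|t| <= `|b|) ->
    {within [set` i], continuous g}.
  move=> Hi; apply: derivable_within_continuous => t /Hi /dg dgt.
  exact: ex_derive.
have g0 : g 0 = f x by rewrite /g scale0r addr0.
have [b0|b0] := leP 0 b.
  have Hi (t : R) : t \in `[0, b] -> `|t| <= `|b|.
    by rewrite in_itv /= => /andP[t0 tb]; rewrite !ger0_norm.
  have [t tb E] := @MVT_segment R g (fun t => 'D_v f (x + t *: v)) 0 b b0
    (fun t ht => dg t (Hi t (subset_itv_oo_cc ht))) (cg _ Hi).
  by exists t; [exact: Hi|rewrite -g0 -/(g b) E subr0 mulrC].
have Hi (t : R) : t \in `[b, 0] -> `|t| <= `|b|.
  by rewrite in_itv /= => /andP[bt t0]; rewrite !ler0_norm ?lerN2 // ltW.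
have [t tb E] := @MVT_segment R g (fun t => 'D_v f (x + t *: v)) b 0 (ltW b0)
  (fun t ht => dg t (Hi t (subset_itv_oo_cc ht))) (cg _ Hi).
exists t; first exact: Hi.
by rewrite -g0 -/(g b) -opprB E sub0r mulrN opprK mulrC.
Qed.

(** The increment of [f] is split into moves along one axis at a time. The mean value theorem turns
    each move into a partial derivative at a nearby point, and continuity at [x] replaces it by the
    one at [x]. *)
Lemma C1_differentiable (R : realType) n (f : 'rV[R]_n -> R) (x : 'rV[R]_n) (U : set 'rV[R]_n) :
  open U -> U x ->
  (forall a y, U y -> derivable f y (delta_mx 0 a)) ->
  (forall a, {for x, continuous (partial a f)}) ->
  differentiable f x /\ forall w, 'D_w f x = \sum_a w 0 a * partial a f x.
Proof.
move=> oU Ux df cf; apply: differentiable_eps => e e0.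
(* There are [n] axis moves, each with error at most [e' * |h|]; dividing by [n + 1] also covers
   [n = 0]. *)
pose e' := e / n.+1%:R; have e'0 : 0 < e' by rewrite divr_gt0.
have [d d0 Hd] : exists2 d : R, 0 < d & forall y : 'rV[R]_n, `|y - x| < d ->
    U y /\ forall a, `|partial a f y - partial a f x| < e'.
  have H1 : nbhs x U := open_nbhs_nbhs (conj oU Ux).
  have H2 : \forall y \near x, forall a, `|partial a f y - partial a f x| < e'.
    apply: (@filter_forall _ _ (fun a y => `|partial a f y - partial a f x| < e') (nbhs x) _) => a; have /cvgrPdist_lt /(_ _ e'0) := cf a.
    by apply: filterS => y; rewrite distrC.
  have H : nbhs x (fun y => U y /\ forall a, `|partial a f y - partial a f x| < e') := @filterI _ _ (nbhs_filter x) _ _ H1 H2.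
  by have [d d0 Hd] := (nbhs_norm_ball x _).1 H; exists d.
exists d => // h hd.
(* [hk k] keeps the first [k] coordinates of [h], so consecutive ones differ along a single axis and
   the sum telescopes. *)
pose hk (k : nat) : 'rV[R]_n := \row_a (if (a < k)%N then h 0 a else 0).
have E : f (h + x) - f x = \sum_(k < n) (f (x + hk k.+1) - f (x + hk k)).
  rewrite -(big_mkord predT (fun k => f (x + hk k.+1) - f (x + hk k))).
  rewrite telescope_sumr //; congr (f _ - f _).
    by rewrite addrC; congr (_ + _); apply/rowP => a; rewrite mxE ltn_ord.
  by rewrite (_ : hk 0%N = 0) ?addr0 //; apply/rowP => a; rewrite !mxE.
have hS (k : 'I_n) : hk k.+1 = hk k + h 0 k *: delta_mx 0 k.
  apply/rowP => a; rewrite !mxE eqxx /= ltnS leq_eqVlt -(inj_eq val_inj) /=.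
  case: (eqVneq (val a) (val k)) => [ak|_] /=; last by rewrite mulr0 addr0.
  by rewrite ak ltnn add0r mulr1 (val_inj ak).
have bnd (k : 'I_n) (t : R) : `|t| <= `|h 0 k| ->
    `|(x + hk k + t *: delta_mx 0 k) - x| < d.
  move=> tk; apply: le_lt_trans hd; rewrite addrAC [x + _]addrC addrK.
  apply: norm_le_coord => // a; rewrite !mxE eqxx /=.
  case: (eqVneq a k) => [->|ak]; first by rewrite ltnn add0r mulr1 (le_trans tk) // coord_le_norm.
  by rewrite mulr0 addr0; case: ifP => _; rewrite ?normr0 // coord_le_norm.
rewrite E /linform -sumrB.
apply: (le_trans (ler_norm_sum _ _ _)).
have K (k : 'I_n) : `|f (x + hk k.+1) - f (x + hk k) - h 0 k * partial k f x| <= e' * `|h|.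
  rewrite hS addrA.
  have [t tk ->] := @MVT_line _ _ f (x + hk k) (delta_mx 0 k) (h 0 k)
     (fun t ht => df _ _ (Hd _ (bnd k t ht)).1).
  rewrite -mulrBr normrM mulrC ler_pM // ?coord_le_norm //.
  exact: ltW ((Hd _ (bnd k t tk)).2 k).
apply: (le_trans (ler_sum _ (fun k _ => K k))).
rewrite sumr_const card_ord -mulr_natr mulrAC ler_wpM2r // /e'.
by rewrite -mulrA ler_piMr ?ltW // mulrC ltr_pdivrMr ?mul1r ?ltr_nat.
Qed.

(** * Algebra of functions of class C^k on an open set *)

Section CkTheory.
Context {R : realType} {n : nat}.
Implicit Types (f g : 'rV[R]_n -> R) (U V : set 'rV[R]_n) (k : nat).

Lemma Ck_cont k U f x : Ck_on k U f -> U x -> {for x, continuous f}.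
Proof. by case: k => [|k] [H _] /H. Qed.

Lemma Ck_sub k U V f : V `<=` U -> Ck_on k U f -> Ck_on k V f.
Proof.
move=> VU; elim: k f => [|k IH] f [cf H]; first by split=> // x /VU /cf.
split=> [x /VU /cf //|a].
have [df /IH Hf] := H a; split => // x /VU; exact: df.
Qed.

Lemma near_eq_open U f g x : open U -> U x -> (forall y, U y -> f y = g y) ->
  {near x, f =1 g}.
Proof.
move=> oU Ux H; have := open_nbhs_nbhs (conj oU Ux).
by apply: filterS => y /H.
Qed.

Lemma eq_partial U f g a x : open U -> U x -> (forall y, U y -> f y = g y) ->
  partial a f x = partial a g x.
Proof.
move=> oU Ux H; rewrite /partial.
have [->|d0] := eqVneq (delta_mx 0 a : 'rV[R]_n) 0; first by rewrite !derive0.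
by apply: near_eq_derive => //; apply: near_eq_open H.
Qed.

Lemma eq_derivable U f g v x : open U -> U x -> (forall y, U y -> f y = g y) ->
  derivable f x v -> derivable g x v.
Proof.
move=> oU Ux H df; have [->|d0] := eqVneq v 0; first exact: derivable0.
by apply: near_eq_derivable df => //; apply: near_eq_open H.
Qed.

Lemma eq_continuous_at U f g x : open U -> U x -> (forall y, U y -> f y = g y) ->
  {for x, continuous f} -> {for x, continuous g}.
Proof.
move=> oU Ux H cf; apply/continuous_eps => e e0.
have [d d0 Hd] := (continuous_eps f x).1 cf _ e0.
have [r r0 Hr] := open_ball_in oU Ux.
exists (Num.min d r) => [|y]; first by rewrite lt_min d0 r0.
by rewrite lt_min => /andP[yd /Hr Uy]; rewrite -!H //; apply: Hd.
Qed.

(** Derivatives are usually known by a formula valid on [U] only. On an open set such a formula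
    determines all further derivatives, so it may replace the function in the recursion defining
    [Ck_on]. *)
Lemma Ck_eq k U f g : open U -> (forall y, U y -> f y = g y) ->
  Ck_on k U f -> Ck_on k U g.
Proof.
move=> oU; elim: k f g => [|k IH] f g H [cf Hf].
  by split => // x Ux; apply: (eq_continuous_at oU Ux H); apply: cf.
split=> [x Ux|a]; first by apply: (eq_continuous_at oU Ux H); apply: cf.
have [df Ha] := Hf a; split => [x Ux|].
  by apply: (eq_derivable oU Ux H); apply: df.
by apply: IH Ha => y Uy; apply: eq_partial H.
Qed.

Lemma Ck_pred k U f : Ck_on k.+1 U f -> Ck_on k U f.
Proof.
elim: k f => [|k IH] f [cf H]; split => // a.
by have [df /IH] := H a.
Qed.

Lemma Ck_le k l U f : (k <= l)%N -> Ck_on l U f -> Ck_on k U f.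
Proof.
by move=> /subnK <-; elim: (l - k)%N => [//|m IH]; rewrite addSn => /Ck_pred.
Qed.

Lemma Ck_partial k U f a : Ck_on k.+1 U f -> Ck_on k U (partial a f).
Proof. by case=> _ /(_ a)[]. Qed.

Lemma Ck_derivable k U f a x : Ck_on k.+1 U f -> U x -> derivable f x (delta_mx 0 a).
Proof. by case=> _ /(_ a)[+ _] => /[apply]. Qed.

Lemma Ck_diff k U f x : open U -> Ck_on k.+1 U f -> U x ->
  differentiable f x /\ forall w, 'D_w f x = \sum_a w 0 a * partial a f x.
Proof.
move=> oU Hf Ux; apply: (C1_differentiable oU Ux) => [a y|a].
  exact: Ck_derivable Hf.
by apply: (@Ck_cont 0 U) Ux; apply: Ck_partial; apply: Ck_le Hf.
Qed.

Lemma Ck_cst k U (c : R) : Ck_on k U (fun=> c).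
Proof.
elim: k c => [|k IH] c; split => //; try by move=> x _; apply: cst_continuous.
move=> a; split => [x _|]; first exact: derivable_cst.
by rewrite (_ : partial a _ = fun=> 0) //; apply/funext => x; apply: derive_cst.
Qed.

Lemma Ck_add k U f g : open U -> Ck_on k U f -> Ck_on k U g ->
  Ck_on k U (fun x => f x + g x).
Proof.
move=> oU; elim: k f g => [|k IH] f g Hf Hg; split => //;
  try by move=> x Ux; apply: continuousD; [apply: Ck_cont Hf Ux|apply: Ck_cont Hg Ux].
move=> a; split => [x Ux|].
  by apply: derivableD; [apply: Ck_derivable Hf Ux|apply: Ck_derivable Hg Ux].
apply: (@Ck_eq _ _ (fun x => partial a f x + partial a g x)) => // [x Ux|].
  by rewrite /partial -deriveD //; [apply: Ck_derivable Hf Ux|apply: Ck_derivable Hg Ux].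
by apply: IH; apply: Ck_partial.
Qed.

Lemma Ck_mul k U f g : open U -> Ck_on k U f -> Ck_on k U g ->
  Ck_on k U (fun x => f x * g x).
Proof.
move=> oU; elim: k f g => [|k IH] f g Hf Hg; split => //;
  try by move=> x Ux; apply: continuousM; [apply: Ck_cont Hf Ux|apply: Ck_cont Hg Ux].
move=> a; split => [x Ux|].
  by apply: derivableM; [apply: Ck_derivable Hf Ux|apply: Ck_derivable Hg Ux].
apply: (@Ck_eq _ _ (fun x => f x * partial a g x + g x * partial a f x)) => // [x Ux|].
  by rewrite /partial -deriveM //; [apply: Ck_derivable Hf Ux|apply: Ck_derivable Hg Ux].
by apply: Ck_add => //; apply: IH; (apply: Ck_partial || apply: Ck_pred).
Qed.

Lemma Ck_inv k U f : open U -> (forall x, U x -> f x != 0) -> Ck_on k U f ->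
  Ck_on k U (fun x => (f x)^-1).
Proof.
move=> oU f0; elim: k f f0 => [|k IH] f f0 Hf; split => //;
  try by move=> x Ux; apply: continuousV; [apply: f0|apply: Ck_cont Hf Ux].
move=> a; split => [x Ux|].
  by apply: derivableV; [apply: f0|apply: Ck_derivable Hf Ux].
apply: (@Ck_eq _ _ (fun x => (-1) * ((f x)^-1 * (f x)^-1) * partial a f x)) => // [x Ux|].
  rewrite /partial (deriveV (f0 _ Ux) (Ck_derivable Hf Ux)) /=.
  by rewrite mulN1r -invfM -expr2.
have Hi : Ck_on k U (fun x => (f x)^-1) by apply: IH => //; apply: Ck_pred.
by do !apply: Ck_mul => //; [exact: Ck_cst|apply: Ck_partial].
Qed.

Lemma Ck_scale k U f (c : R) : open U -> Ck_on k U f -> Ck_on k U (fun x => c * f x).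
Proof. by move=> oU; apply: Ck_mul => //; apply: Ck_cst. Qed.

Lemma Ck_opp k U f : open U -> Ck_on k U f -> Ck_on k U (fun x => - f x).
Proof.
move=> oU /(Ck_scale (-1) oU); apply: Ck_eq => // x _; exact: mulN1r.
Qed.

Lemma Ck_subr k U f g : open U -> Ck_on k U f -> Ck_on k U g ->
  Ck_on k U (fun x => f x - g x).
Proof. by move=> oU Hf Hg; apply: Ck_add => //; apply: Ck_opp. Qed.

Lemma Ck_sum k U (I : Type) (r : seq I) (P : pred I) (F : I -> 'rV[R]_n -> R) : open U ->
  (forall i, Ck_on k U (F i)) -> Ck_on k U (fun x => \sum_(i <- r | P i) F i x).
Proof.
move=> oU H; elim: r => [|i r IH].
  by apply: Ck_eq (@Ck_cst k U 0) => // x _; rewrite big_nil.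
apply: (@Ck_eq _ _ (fun x => (if P i then F i x else 0) + \sum_(i <- r | P i) F i x)) => //.
  by move=> x _; rewrite big_cons; case: ifP => _; rewrite ?add0r.
by apply: Ck_add => //; case: (P i); [exact: H|exact: Ck_cst].
Qed.

Lemma Ck_prod k U (I : Type) (r : seq I) (P : pred I) (F : I -> 'rV[R]_n -> R) : open U ->
  (forall i, Ck_on k U (F i)) -> Ck_on k U (fun x => \prod_(i <- r | P i) F i x).
Proof.
move=> oU H; elim: r => [|i r IH].
  by apply: Ck_eq (@Ck_cst k U 1) => // x _; rewrite big_nil.
apply: (@Ck_eq _ _ (fun x => (if P i then F i x else 1) * \prod_(i <- r | P i) F i x)) => //.
  by move=> x _; rewrite big_cons; case: ifP => _; rewrite ?mul1r.
by apply: Ck_mul => //; case: (P i); [exact: H|exact: Ck_cst].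
Qed.

Lemma partial_coord (a b : 'I_n) (x : 'rV[R]_n) :
  partial b (fun x : 'rV[R]_n => x 0 a) x = (a == b)%:R.
Proof.
have [|_ E] := @differentiable_eps R n (fun x : 'rV[R]_n => x 0 a) x (fun b => (a == b)%:R).
  move=> e e0; exists 1 => // h _; rewrite mxE addrK /linform (bigD1 a) //= eqxx mulr1.
  rewrite big1 ?addr0 ?subrr ?normr0 ?(mulr_ge0 (ltW e0)) // => c; rewrite eq_sym => /negbTE ->.
  by rewrite mulr0.
by rewrite /partial E linform_delta.
Qed.

Lemma Ck_coord k U (a : 'I_n) : open U -> Ck_on k U (fun x => x 0 a).
Proof.
move=> oU; case: k => [|k]; split => //; try by move=> x _; apply: coord_continuous.
move=> b; split => [x _|]; first exact: diff_derivable (differentiable_coord _ _ _).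
apply: (@Ck_eq _ _ (fun=> (a == b)%:R)) => // [x _|]; last exact: Ck_cst.
by rewrite partial_coord.
Qed.
End CkTheory.

Section CkComp.
Context {R : realType} {n m : nat}.

Lemma rV_differentiable (F : 'rV[R]_n -> 'rV[R]_m) x :
  (forall b, differentiable (fun y => F y 0 b) x) -> differentiable F x.
Proof.
move=> H.
have -> : F = \sum_(b < m) (fun y => F y 0 b *: delta_mx 0 b).
  apply/funext => y; rewrite fct_sumE {1}[F y]row_sum_delta.
  by apply: eq_bigr.
by apply: differentiable_sum => b; apply: differentiableZl.
Qed.

Lemma partial_comp (F : 'rV[R]_n -> 'rV[R]_m) (h : 'rV[R]_m -> R) (a : 'I_n) x V :
  open V -> V (F x) -> Ck_on 1 V h ->
  (forall b, differentiable (fun y => F y 0 b) x) ->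
  derivable (h \o F) x (delta_mx 0 a) /\
  partial a (h \o F) x = \sum_b partial a (fun y => F y 0 b) x * partial b h (F x).
Proof.
move=> oV VF Hh HF.
have [dh Dh] := Ck_diff oV Hh VF.
have dF := rV_differentiable HF.
have dhF : differentiable (h \o F) x by apply: differentiable_comp.
split; first exact: diff_derivable.
rewrite /partial deriveE // diff_comp //= -[X in 'd h _ X]deriveE //.
rewrite -deriveE // Dh; apply: eq_bigr => b _; congr (_ * _).
by rewrite derive_mx ?mxE //; apply: diff_derivable.
Qed.

(** The chain rule writes a partial of [h \o F] as a sum of products in which a partial of [h] is
    again composed with [F]; this is why the induction on [k] keeps [h] general. *)
Lemma Ck_comp k (F : 'rV[R]_n -> 'rV[R]_m) (h : 'rV[R]_m -> R) U V :
  open U -> open V -> (forall x, U x -> V (F x)) ->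
  (forall b, Ck_on k U (fun x => F x 0 b)) -> Ck_on k V h ->
  Ck_on k U (h \o F).
Proof.
move=> oU oV UV; have cF k' : (forall b, Ck_on k' U (fun x => F x 0 b)) ->
    forall x, U x -> {for x, continuous F}.
  move=> HF x Ux; apply/continuous_eps => e e0.
  have H : \forall y \near x, forall b, `|F y 0 b - F x 0 b| < e.
    apply: (@filter_forall _ _ (fun b y => `|F y 0 b - F x 0 b| < e) (nbhs x) _) => b; have /cvgrPdist_lt /(_ _ e0) := Ck_cont (HF b) Ux.
    by apply: filterS => y; rewrite distrC.
  have [d d0 Hd] := (nbhs_norm_ball x _).1 H; exists d => // y yx.
  by apply: norm_lt_coord => // b; rewrite !mxE; apply: Hd.
elim: k h => [|k IH] h HF Hh; split => //;
  try by move=> x Ux; apply: continuous_comp; [exact: cF HF _ Ux|apply: Ck_cont Hh (UV _ Ux)].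
have dF x : U x -> forall b, differentiable (fun y => F y 0 b) x.
  by move=> Ux b; have [] := Ck_diff oU (HF b) Ux.
have H1 : Ck_on 1 V h by apply: Ck_le Hh.
move=> a; split => [x Ux|].
  by have [] := partial_comp a oV (UV _ Ux) H1 (dF _ Ux).
apply: (@Ck_eq _ _ _ _ (fun x => \sum_b partial a (fun y => F y 0 b) x * (partial b h \o F) x)) => //.
  by move=> x Ux; have [_ ->] := partial_comp a oV (UV _ Ux) H1 (dF _ Ux).
apply: Ck_sum => // b; apply: Ck_mul => //; first exact: Ck_partial.
by apply: IH => [c|]; [apply: Ck_pred|apply: Ck_partial].
Qed.
End CkComp.

Lemma partialE (R : realType) n (f : 'rV[R]_n -> R) a x :
  partial a f x = 'D_(delta_mx 0 a) f x.
Proof. by []. Qed.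

Opaque Ck_on.

Section PartialRules.
Context {R : realType} {n : nat}.
Implicit Types (f g : 'rV[R]_n -> R) (U : set 'rV[R]_n) (x v : 'rV[R]_n).

Lemma partialD f g a x : derivable f x (delta_mx 0 a) -> derivable g x (delta_mx 0 a) ->
  partial a (fun y => f y + g y) x = partial a f x + partial a g x.
Proof. by move=> df dg; rewrite /partial -deriveD. Qed.

Lemma partialB f g a x : derivable f x (delta_mx 0 a) -> derivable g x (delta_mx 0 a) ->
  partial a (fun y => f y - g y) x = partial a f x - partial a g x.
Proof. by move=> df dg; rewrite /partial -deriveB. Qed.

Lemma partialM f g a x : derivable f x (delta_mx 0 a) -> derivable g x (delta_mx 0 a) ->
  partial a (fun y => f y * g y) x = f x * partial a g x + g x * partial a f x.
Proof. by move=> df dg; exact: deriveM df dg. Qed.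

Lemma partial_cst a (c : R) x : partial a (fun=> c) x = 0.
Proof. exact: derive_cst. Qed.

Lemma partialZ f a (c : R) x : derivable f x (delta_mx 0 a) ->
  partial a (fun y => c * f y) x = c * partial a f x.
Proof.
move=> df; rewrite (partialM (derivable_cst c x _) df).
by rewrite (partial_cst a c x) mulr0 addr0.
Qed.

Lemma derivable_sumr (I : Type) (r : seq I) (F : I -> 'rV[R]_n -> R) x v :
  (forall i, derivable (F i) x v) -> derivable (fun y => \sum_(i <- r) F i y) x v.
Proof.
move=> H; elim: r => [|i r IH].
  rewrite (_ : (fun y => _) = cst 0); first exact: derivable_cst.
  by apply/funext => y; rewrite big_nil.
by under eq_fun do rewrite big_cons; apply: derivableD.
Qed.

Lemma partial_sum (I : Type) (r : seq I) (F : I -> 'rV[R]_n -> R) a x :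
  (forall i, derivable (F i) x (delta_mx 0 a)) ->
  partial a (fun y => \sum_(i <- r) F i y) x = \sum_(i <- r) partial a (F i) x.
Proof.
move=> H; elim: r => [|i r IH].
  rewrite big_nil -[RHS](partial_cst a 0 x); congr (partial a _ x).
  by apply/funext => y; rewrite big_nil.
under eq_fun do rewrite big_cons.
by rewrite partialD ?IH ?big_cons //; apply: derivable_sumr.
Qed.

Lemma derivable_coordr (a : 'I_n) x v : derivable (fun y : 'rV[R]_n => y 0 a) x v.
Proof. exact: diff_derivable (differentiable_coord _ _ _). Qed.

Arguments derivable_coordr : clear implicits.

Lemma derivable_subcoord (a : 'I_n) (c : R) x v :
  derivable (fun y : 'rV[R]_n => y 0 a - c) x v.
Proof.
by apply: derivableB; [exact: derivable_coordr|exact: derivable_cst].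
Qed.

Arguments derivable_subcoord : clear implicits.

Lemma partial_subcoord (a b : 'I_n) (c : R) x :
  partial b (fun y : 'rV[R]_n => y 0 a - c) x = (a == b)%:R.
Proof.
rewrite (partialB (derivable_coordr _ _ _) (derivable_cst _ _ _)).
by rewrite partial_coord partial_cst subr0.
Qed.

(** The norm on row vectors is the sup norm, which is not smooth. Barriers and quadratic
    perturbations use this square of the Euclidean distance instead. *)
Definition sqdist (y0 x : 'rV[R]_n) : R := \sum_a (x 0 a - y0 0 a) ^+ 2.

Lemma Ck_sqdist k U y0 : open U -> Ck_on k U (sqdist y0).
Proof.
move=> oU; apply: Ck_sum => // a; rewrite /=.
apply: (@Ck_eq _ _ _ _ (fun x => (x 0 a - y0 0 a) * (x 0 a - y0 0 a))) => //.
by apply: Ck_mul => //; (apply: Ck_subr => //; [exact: Ck_coord|exact: Ck_cst]).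
Qed.

Lemma partial_sqdist y0 a x : partial a (sqdist y0) x = 2 * (x 0 a - y0 0 a).
Proof.
have E b : partial a (fun y : 'rV[R]_n => (y 0 b - y0 0 b) ^+ 2) x
    = 2 * (x 0 b - y0 0 b) * (b == a)%:R.
  have dc := derivable_subcoord b (y0 0 b) x (delta_mx 0 a).
  by rewrite (partialM dc dc) partial_subcoord; ring.
have dq b : derivable (fun y : 'rV[R]_n => (y 0 b - y0 0 b) ^+ 2) x (delta_mx 0 a).
  exact: derivableM (derivable_subcoord b (y0 0 b) x _) (derivable_subcoord b (y0 0 b) x _).
rewrite /sqdist (partial_sum _ dq).
under eq_bigr do rewrite E.
rewrite (bigD1 a) //= eqxx mulr1 big1 ?addr0 // => b /negbTE ->.
by rewrite mulr0.
Qed.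

Lemma partial2_sqdist y0 a b x : partial a (partial b (sqdist y0)) x = 2 * (a == b)%:R.
Proof.
have -> : partial b (sqdist y0) = (fun x => 2 * (x 0 b - y0 0 b)).
  by apply/funext => z; exact: partial_sqdist.
by rewrite (partialZ _ (derivable_subcoord _ _ _ _)) partial_subcoord eq_sym.
Qed.

Lemma sqdist_ge0 y0 x : 0 <= sqdist y0 x.
Proof. by apply: sumr_ge0 => a _; apply: sqr_ge0. Qed.

Lemma coord_sqdist (y0 x : 'rV[R]_n) a : (x 0 a - y0 0 a) ^+ 2 <= sqdist y0 x.
Proof. by rewrite /sqdist (bigD1 a) //= lerDl sumr_ge0 // => b _; apply: sqr_ge0. Qed.

Lemma sqdist_eq0 (y0 x : 'rV[R]_n) : sqdist y0 x = 0 -> x = y0.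
Proof.
move=> H; apply/rowP => a; apply/eqP; rewrite -subr_eq0 -sqrf_eq0 eq_le sqr_ge0 andbT.
by rewrite -H coord_sqdist.
Qed.

Lemma sqdist_lt (y0 x : 'rV[R]_n) (r : R) : 0 < r -> sqdist y0 x < r ^+ 2 -> `|x - y0| < r.
Proof.
move=> r0 H; apply: norm_lt_coord => // a; rewrite !mxE.
rewrite -(@ltr_pXn2r _ 2) // ?nnegrE ?(ltW r0) //.
by rewrite real_normK ?num_real // (le_lt_trans (coord_sqdist _ _ _) H).
Qed.

Lemma sqdist_le (y0 x : 'rV[R]_n) : sqdist y0 x <= n%:R * `|x - y0| ^+ 2.
Proof.
have -> : n%:R * `|x - y0| ^+ 2 = \sum_(a < n) `|x - y0| ^+ 2.
  by rewrite sumr_const card_ord mulr_natl.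
apply: ler_sum => a _.
rewrite -(real_normK (num_real (_ - _))) lerXn2r ?nnegrE //.
by have := coord_le_norm (x - y0) a; rewrite !mxE.
Qed.

Lemma norm_sqdist (y0 x : 'rV[R]_n) : `|x - y0| ^+ 2 <= sqdist y0 x.
Proof.
rewrite -[leRHS]sqr_sqrtr ?sqdist_ge0 // lerXn2r ?nnegrE ?sqrtr_ge0 //.
apply: norm_le_coord => [|a]; first exact: sqrtr_ge0.
by rewrite !mxE -sqrtr_sqr ler_wsqrtr // coord_sqdist.
Qed.
End PartialRules.
Arguments derivable_sumr {R n I} r F {x v}.
Arguments derivable_coordr {R n}.
Arguments derivable_subcoord {R n}.

(** * Symmetry of second derivatives, Taylor's formula and local minima *)

Section SecondOrder.
Context {R : realType} {n : nat}.
Implicit Types (f g : 'rV[R]_n -> R) (U : set 'rV[R]_n) (x v : 'rV[R]_n).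

Lemma derivable_shiftr f c x v : derivable f (x + c) v ->
  derivable (fun y => f (y + c)) x v /\ 'D_v (fun y => f (y + c)) x = 'D_v f (x + c).
Proof.
move=> df.
have E : (fun h : R => h^-1 *: ((f \o shift (x + c)) (h *: v) - f (x + c)))
   = (fun h : R => h^-1 *: (((fun y => f (y + c)) \o shift x) (h *: v) - f (x + c))).
  by apply/funext => h /=; rewrite addrA.
by split; [rewrite /derivable -E|rewrite /derive -E].
Qed.

(** The left side is symmetric in [a] and [b]. The mean value theorem is applied in direction [a] to
    the increment of [f] along [b], then in direction [b] to [partial a f]. *)
Lemma second_difference f x (r : R) a b (s : R) :
  Ck_on 2 [set y | `|y - x| < r] f -> 2 * `|s| < r ->
  exists2 y, `|y - x| <= 2 * `|s| &
    f (x + s *: delta_mx 0 a + s *: delta_mx 0 b) - f (x + s *: delta_mx 0 a)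
      - f (x + s *: delta_mx 0 b) + f x = s * s * partial b (partial a f) y.
Proof.
move=> Hf sr; set ea := delta_mx 0 a; set eb := delta_mx 0 b.
have nle (t t' : R) : `|t| <= `|s| -> `|t'| <= `|s| -> `|x + t *: ea + t' *: eb - x| <= 2 * `|s|.
  move=> ts t's; rewrite -[x + _ + _]addrA [x + _]addrC addrK (le_trans (ler_normD _ _)) //.
  by rewrite !normrZ !norm_delta_mx !mulr1 [2 * _]mulr_natl mulr2n lerD.
have inU (t t' : R) : `|t| <= `|s| -> `|t'| <= `|s| -> [set y | `|y - x| < r] (x + t *: ea + t' *: eb).
  by move=> ts t's; rewrite /= (le_lt_trans (nle _ _ ts t's)).
pose g y := f (y + s *: eb) - f y.
have s0 : `|0 : R| <= `|s| by rewrite normr0.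
have dg (t : R) : `|t| <= `|s| -> derivable g (x + t *: ea) ea /\
    'D_ea g (x + t *: ea) = partial a f (x + t *: ea + s *: eb) - partial a f (x + t *: ea).
  move=> ts; have [d1 E1] := derivable_shiftr (Ck_derivable (a := a) Hf (inU t s ts (lexx _))).
  have d2 : derivable f (x + t *: ea) ea.
    by have := Ck_derivable (a := a) Hf (inU t 0 ts s0); rewrite scale0r addr0.
  split; first exact: derivableB.
  by rewrite /g [LHS](deriveB d1 d2) E1.
have [t ts E] := @MVT_line R _ g x ea s (fun t ht => (dg t ht).1).
have [t' t's E'] := @MVT_line R _ (partial a f) (x + t *: ea) eb s
  (fun t' ht' => Ck_derivable (a := b) (Ck_partial a Hf) (inU t t' ts ht')).
exists (x + t *: ea + t' *: eb); first exact: nle.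
rewrite (dg t ts).2 E' mulrA in E; rewrite -E /g.
by rewrite [x + s *: ea + _]addrAC -!addrA; congr (_ + _); rewrite opprD opprK; ring.
Qed.

Lemma close_close (p q r e : R) : `|p - q| < e / 2 -> `|p - r| < e / 2 -> `|q - r| <= e.
Proof.
move=> H1 H2; rewrite (splitr e) (le_trans (ler_distD p _ _)) // lerD // ltW //.
by rewrite distrC.
Qed.

(** The same second difference, divided by [s ^+ 2], is a value of either mixed derivative at a
    point close to [x]; continuity at [x] does the rest. *)
Lemma Schwarz f U x a b : open U -> Ck_on 2 U f -> U x ->
  partial a (partial b f) x = partial b (partial a f) x.
Proof.
move=> oU Hf Ux; apply/eqP; rewrite -subr_eq0 -normr_le0; apply/ler_addgt0Pl => e e0.
rewrite addr0.
have [r r0 Hr] := open_ball_in oU Ux.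
have Hf' : Ck_on 2 [set y | `|y - x| < r] f by apply: Ck_sub Hf => y /Hr.
have e2 : 0 < e / 2 by rewrite divr_gt0.
have c1 : {for x, continuous (partial a (partial b f))}.
  by apply: (@Ck_cont _ _ 0 U) Ux; apply: Ck_partial; apply: Ck_partial.
have c2 : {for x, continuous (partial b (partial a f))}.
  by apply: (@Ck_cont _ _ 0 U) Ux; apply: Ck_partial; apply: Ck_partial.
have [d1 d10 H1] := (continuous_eps _ _).1 c1 _ e2.
have [d2 d20 H2] := (continuous_eps _ _).1 c2 _ e2.
(* The points given by [second_difference] lie within [2 * s = d / 2] of [x]. *)
pose d := Num.min r (Num.min d1 d2); pose s := d / 4.
have d0 : 0 < d by rewrite !lt_min r0 d10 d20.
have s0 : 0 < s by rewrite divr_gt0.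
have sd : 2 * `|s| < d by rewrite gtr0_norm // /s; lra.
have sr : 2 * `|s| < r by rewrite (lt_le_trans sd) // ge_min lexx.
have [y1 yx1 E1] := second_difference b a Hf' sr.
have [y2 yx2 E2] := second_difference a b Hf' sr.
have E : partial a (partial b f) y1 = partial b (partial a f) y2.
  have ss : s * s != 0 by rewrite mulf_neq0 ?gt_eqF.
  apply: (mulfI ss); rewrite -E1 -E2 [x + s *: delta_mx 0 b + _]addrAC.
  by congr (_ + _); exact: addrAC.
have ds (y : 'rV[R]_n) d' : d <= d' -> `|y - x| <= 2 * `|s| -> `|y - x| < d'.
  by move=> dd' yx; apply: lt_le_trans dd'; apply: le_lt_trans sd.
have K1 := H1 y1 (ds y1 d1 (ltac:(by rewrite !ge_min lexx orbT)) yx1).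
have K2 := H2 y2 (ds y2 d2 (ltac:(by rewrite !ge_min lexx !orbT)) yx2).
rewrite E in K1; apply: close_close K1 K2.
Qed.

Lemma MVT01 f x v : (forall t : R, 0 <= t <= 1 -> derivable f (x + t *: v) v) ->
  exists2 t : R, 0 <= t <= 1 & f (x + v) - f x = 'D_v f (x + t *: v).
Proof.
move=> H; pose g s : R := f (x + s *: v).
have dg (t : R) : t \in `[0, 1] -> is_derive t 1 g ('D_v f (x + t *: v)).
  by rewrite in_itv => /H; apply: is_derive_line.
have cg : {within `[0, 1], continuous g}.
  by apply: derivable_within_continuous => t /dg dgt; exact: ex_derive.
have [t tb E] := @MVT_segment R g (fun t => 'D_v f (x + t *: v)) 0 1 ler01
    (fun t ht => dg t (subset_itv_oo_cc ht)) cg.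
exists t; first by move: tb; rewrite in_itv.
by move: E; rewrite /g scale1r scale0r addr0 subr0 mulr1.
Qed.

Definition hessform f x v : R := \sum_a \sum_b v 0 a * v 0 b * partial a (partial b f) x.

(** Two mean value theorems leave an unspecified factor [s] in place of the usual one half. Only the
    sign and the size of the remainder are used, so [0 <= s <= 1] is enough. *)
Lemma taylor2 f U x v : open U -> Ck_on 2 U f ->
  (forall t : R, 0 <= t <= 1 -> U (x + t *: v)) -> (forall a, partial a f x = 0) ->
  exists s t : R, [/\ 0 <= s <= 1, 0 <= t <= 1 &
    f (x + v) - f x = s * hessform f (x + t *: v) v].
Proof.
move=> oU Hf HU f0.
have [s s01 ->] : exists2 t : R, 0 <= t <= 1 & f (x + v) - f x = 'D_v f (x + t *: v).
  apply: MVT01 => t /HU Ut; apply: diff_derivable; by have [] := Ck_diff oU Hf Ut.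
rewrite (Ck_diff oU Hf (HU _ s01)).2.
pose g y := \sum_a v 0 a * partial a f y.
have Hg : Ck_on 1 U g by apply: Ck_sum => // a; apply: Ck_scale => //; apply: Ck_partial.
have st (t : R) : 0 <= t <= 1 -> 0 <= t * s <= 1.
  move=> /andP[t0 t1]; move/andP: s01 => [s0 s1].
  by rewrite mulr_ge0 //= mulr_ile1.
have [t t01 E] : exists2 t : R, 0 <= t <= 1 &
    g (x + s *: v) - g x = 'D_(s *: v) g (x + t *: (s *: v)).
  apply: MVT01 => t /st ts; rewrite scalerA; apply: diff_derivable.
  by have [] := Ck_diff oU Hg (HU _ ts).
exists s, (t * s); split => //; first exact: st.
have gx : g x = 0 by rewrite /g big1 // => a _; rewrite f0 mulr0.
rewrite -/(g _) -[LHS]subr0 -[X in _ - X]gx E scalerA.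
rewrite (Ck_diff oU Hg (HU _ (st _ t01))).2 /hessform mulr_sumr.
apply: eq_bigr => a _; rewrite mxE -mulrA; congr (_ * _).
rewrite /g partial_sum => [|b].
  rewrite mulr_sumr; apply: eq_bigr => b _; rewrite partialZ ?mulrA //.
  by apply: (Ck_derivable (k := 0) (U := U)); [apply: Ck_partial|apply: HU; apply: st].
apply: derivableM; first exact: derivable_cst.
by apply: (Ck_derivable (k := 0) (U := U)); [apply: Ck_partial|apply: HU; apply: st].
Qed.

Lemma hessform_cont f U x v : open U -> Ck_on 2 U f -> U x ->
  {for x, continuous (fun y => hessform f y v)}.
Proof.
move=> oU Hf Ux; apply: (@Ck_cont _ _ 0 U) Ux; apply: Ck_sum => // a.
by apply: Ck_sum => // b; apply: Ck_scale => //; do !apply: Ck_partial.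
Qed.

Lemma hessform_le f g x v (c : R) : (forall a b, partial a (partial b f) x =
   partial a (partial b g) x + c * (2 * (a == b)%:R)) ->
  hessform f x v = hessform g x v + 2 * c * \sum_a v 0 a ^+ 2.
Proof.
move=> H; rewrite /hessform [2 * c * _]mulr_sumr -big_split; apply: eq_bigr => a _ /=.
rewrite [X in _ = _ + X](_ : _ = \sum_b v 0 a * v 0 b * (c * (2 * (a == b)%:R))).
  by rewrite -big_split; apply: eq_bigr => b _ /=; rewrite H mulrDr.
rewrite (bigD1 a) //= eqxx big1 => [|b ba]; first by rewrite /=; ring.
by rewrite eq_sym (negbTE ba) /=; ring.
Qed.

Lemma partial_addsq f U x0 (c : R) a x : open U -> Ck_on 1 U f -> U x ->
  partial a (fun y => f y + c * sqdist x0 y) x =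
  partial a f x + c * (2 * (x 0 a - x0 0 a)).
Proof.
move=> oU Hf Ux; have cs : Ck_on 1 U (sqdist x0) by apply: Ck_sqdist.
rewrite (partialD (Ck_derivable Hf Ux) (Ck_derivable (Ck_scale c oU cs) Ux)).
by rewrite (partialZ c (Ck_derivable cs Ux)) partial_sqdist.
Qed.

Lemma partial2_addsq f U x0 (c : R) a b x : open U -> Ck_on 2 U f -> U x ->
  partial a (partial b (fun y => f y + c * sqdist x0 y)) x =
  partial a (partial b f) x + c * (2 * (a == b)%:R).
Proof.
move=> oU Hf Ux; have cs : Ck_on 2 U (sqdist x0) by apply: Ck_sqdist.
have csb := Ck_partial b cs.
rewrite (@eq_partial _ _ U _ (fun y => partial b f y + c * partial b (sqdist x0) y)) //.
  rewrite (partialD (Ck_derivable (Ck_partial b Hf) Ux) (Ck_derivable (Ck_scale c oU csb) Ux)).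
  by rewrite (partialZ c (Ck_derivable csb Ux)) partial2_sqdist.
move=> y Uy; rewrite (partialD (Ck_derivable Hf Uy) (Ck_derivable (Ck_scale c oU cs) Uy)).
by rewrite (partialZ c (Ck_derivable cs Uy)).
Qed.

Lemma sqdist_self x : sqdist x x = 0.
Proof. by rewrite /sqdist big1 // => a _; rewrite subrr expr0n. Qed.

Lemma local_min_partial f U x a : open U -> Ck_on 1 U f -> U x ->
  (forall y, U y -> f x <= f y) -> partial a f x = 0.
Proof.
move=> oU Hf Ux H; have [r r0 Hr] := open_ball_in oU Ux.
pose g s : R := f (x + s *: delta_mx 0 a).
have Us (s : R) : s \in `]-r, r[ -> U (x + s *: delta_mx 0 a).
  rewrite in_itv /= => sr; apply: Hr; rewrite addrC addKr normrZ norm_delta_mx mulr1.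
  by rewrite ltr_norml.
have dg (s : R) : s \in `]-r, r[ -> is_derive s 1 g (partial a f (x + s *: delta_mx 0 a)).
  by move=> sr; apply: is_derive_line; apply: Ck_derivable Hf (Us _ sr).
have r0' : 0 \in `]-r, r[ by rewrite in_itv /= oppr_lt0 r0.
have := @derive1_at_min R g (-r) r 0 (ltW (lt_trans (_ : -r < 0) r0)).
rewrite oppr_lt0 => /(_ r0 (fun t ht => @ex_derive _ _ _ _ _ _ _ (dg t ht)) r0') H1.
have D := H1 (fun t ht => le_trans (eq_ind_r (fun z => f z <= f x) (lexx _)
  (ltac:(by rewrite scale0r addr0) : x + 0 *: delta_mx 0 a = x)) (H _ (Us t ht))).
have E0 := dg 0 r0'; rewrite scale0r addr0 in E0.
by rewrite -(@derive_val _ _ _ _ _ _ _ E0) (@derive_val _ _ _ _ _ _ _ D).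
Qed.

Lemma small_coef (S H : R) : 0 <= S -> H < 0 -> exists2 c : R, 0 < c & H + 2 * c * S < 0.
Proof.
move=> S0 H0; have S1 : 0 < 4 * (S + 1) by lra.
exists (- H / (4 * (S + 1))); first by rewrite divr_gt0 // oppr_gt0.
have -> : H + 2 * (- H / (4 * (S + 1))) * S = H * ((S + 2) / (2 * (S + 1))).
  by field; apply: lt0r_neq0; lra.
by rewrite pmulr_llt0 // divr_gt0 //; lra.
Qed.

Lemma small_scale (V : normedModType R) (v : V) (d : R) : 0 < d ->
  exists2 e : R, 0 < e & `|e *: v| < d.
Proof.
move=> d0; have v1 : 0 < `|v| + 1 by rewrite ltr_wpDl.
exists (d / (`|v| + 1)); first by rewrite divr_gt0.
rewrite normrZ gtr0_norm ?divr_gt0 // mulrAC ltr_pdivrMr // ltr_pM2l //.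
by rewrite ltrDl.
Qed.

(** The factor [s] of [taylor2] may vanish, so a negative Hessian gives only a non-strict decrease.
    Adding [c * sqdist x], with [c] small enough to keep the Hessian negative along [v], makes the
    minimum strict and yields the contradiction. *)
Lemma local_min_hess f U x v : open U -> Ck_on 2 U f -> U x ->
  (forall y, U y -> f x <= f y) -> 0 <= hessform f x v.
Proof.
move=> oU Hf Ux H; rewrite leNgt; apply/negP => H0.
have f0 a : partial a f x = 0 by apply: (local_min_partial _ oU) => //; apply: Ck_pred.
pose S := \sum_a v 0 a ^+ 2.
have S0 : 0 <= S by apply: sumr_ge0 => a _; apply: sqr_ge0.
have [c c0 cH] := small_coef S0 H0.
pose g y := f y + c * sqdist x y.
have Hg : Ck_on 2 U g := Ck_add oU Hf (Ck_scale c oU (Ck_sqdist 2 x oU)).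
have gneg : hessform g x v < 0.
  by rewrite (@hessform_le g f x v c (fun a b => partial2_addsq x c a b oU Hf Ux)).
have g0 a : partial a g x = 0.
  by rewrite (partial_addsq x c a oU (Ck_pred Hf) Ux) f0 subrr mulr0 mulr0 addr0.
have [d d0 Hd] := (continuous_eps _ _).1 (@hessform_cont g U x v oU Hg Ux) (- hessform g x v)
  ltac:(by rewrite oppr_gt0).
have [r r0 Hr] := open_ball_in oU Ux.
have dr0 : 0 < Num.min d r by rewrite lt_min d0 r0.
have [e e0 ev] := small_scale v dr0.
have tv (t : R) : 0 <= t <= 1 -> `|x + t *: (e *: v) - x| < Num.min d r.
  move=> /andP[t0 t1]; rewrite addrC addKr normrZ ger0_norm //.
  by rewrite (le_lt_trans _ ev) // ler_piMl.
have [t /tv|s [t [/andP[s0 s1] /tv t01 E]]] := @taylor2 g U x (e *: v) oU Hg _ g0.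
  by rewrite lt_min => /andP[_ /Hr].
have Ue : U (x + e *: v).
  by have := tv 1; rewrite scale1r lt_min => /(_ _)/andP[|_ /Hr //]; rewrite ler01 lexx.
have := H _ Ue; rewrite leNgt => /negP; apply.
have K : hessform g (x + t *: (e *: v)) (e *: v) <= 0.
  have -> : hessform g (x + t *: (e *: v)) (e *: v) =
            e ^+ 2 * hessform g (x + t *: (e *: v)) v.
    rewrite /hessform mulr_sumr; apply: eq_bigr => a _; rewrite mulr_sumr.
    by apply: eq_bigr => b _; rewrite !mxE; ring.
  apply: mulr_ge0_le0; first exact: sqr_ge0.
  move: t01; rewrite lt_min => /andP[/Hd]; rewrite ltr_norml => /andP[_ K1] _.
  by apply/ltW; move: K1; rewrite ltrBlDr addNr.
have gE : g (x + e *: v) - g x <= 0 by rewrite E mulr_ge0_le0.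
have [vz|vz] := eqVneq v 0.
  by move: H0; rewrite vz /hessform big1 ?ltxx // => a _; rewrite big1 // => b _; rewrite mxE !mul0r.
have : 0 < c * sqdist x (x + e *: v).
  rewrite mulr_gt0 // lt0r sqdist_ge0 andbT; apply/eqP => /sqdist_eq0 /eqP.
  by rewrite addrC -subr_eq0 addrK scaler_eq0 (negbTE vz) gt_eqF.
move=> cpos; move: gE; rewrite /g sqdist_self mulr0 addr0 subr_le0.
by apply: lt_le_trans; rewrite ltrDl.
Qed.
End SecondOrder.

Opaque partial.

(** * Positive definite matrices *)

Section PosDef.
Context {R : realType}.

Lemma inj_unitmx n (A : 'M[R]_n) : (forall v : 'rV[R]_n, v *m A = 0 -> v = 0) -> A \in unitmx.
Proof.
move=> H; rewrite -row_free_unit -kermx_eq0; apply/eqP/row_matrixP => i.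
rewrite row0; apply: H; rewrite -row_mul mulmx_ker; exact: row0.
Qed.

Definition posdef n (P : 'M[R]_n) : Prop :=
  P^T = P /\ forall v : 'rV[R]_n, v != 0 -> 0 < (v *m P *m v^T) 0 0.

Lemma row_mul_tr_ge0 n (v : 'rV[R]_n) : 0 <= (v *m v^T) 0 0.
Proof. by rewrite mxE sumr_ge0 // => i _; rewrite mxE -expr2 sqr_ge0. Qed.

Lemma row_mul_trE n (v : 'rV[R]_n) : (v *m v^T) 0 0 = \sum_i v 0 i ^+ 2.
Proof. by rewrite mxE; apply: eq_bigr => i _; rewrite mxE -expr2. Qed.

Lemma posdef_unit n (P : 'M[R]_n) : posdef P -> P \in unitmx.
Proof.
move=> [_ H]; apply: inj_unitmx => v vP; apply/eqP; apply: contraT => /H.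
by rewrite vP mul0mx mxE ltxx.
Qed.

(** Induction on the size: one row and column are split off, and the Schur complement of the corner
    entry is again positive definite. *)
Lemma cholesky n (P : 'M[R]_n) : posdef P -> exists C : 'M[R]_n, P = C^T *m C.
Proof.
elim: n P => [|n IH] P [sP pP].
  by exists 0; apply/matrixP => -[].
rewrite -[n.+1]/(1 + n)%N in P sP pP *.
set a := P 0 0.
pose b := ursubmx P : 'rV[R]_n; pose D := drsubmx P : 'M[R]_n.
have dlE : dlsubmx P = b^T by rewrite /b trmx_ursub sP.
have ulE : ulsubmx P = a%:M.
  by apply/matrixP => i j; rewrite !ord1 !mxE eqxx mulr1n /a; congr (P _ _); apply/val_inj.
have PE : P = block_mx a%:M b b^T D by rewrite -[P]submxK ulE dlE.
have DT : D^T = D by rewrite /D trmx_drsub sP.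
have a0 : 0 < a.
  have := pP (delta_mx 0 0); rewrite -rowE => /(_ _); rewrite /a.
  have E : (row 0 P *m (delta_mx 0 0 : 'rV[R]_(1 + n))^T) 0 0 = P 0 0.
    by rewrite trmx_delta -colE !mxE.
  rewrite E; apply; apply/eqP => /matrixP /(_ 0 0); rewrite !mxE !eqxx => /eqP.
  by rewrite oner_eq0.
pose S := D - a^-1 *: (b^T *m b).
have pS : posdef S.
  split; first by rewrite /S linearB linearZ /= trmx_mul trmxK DT.
  (* This [t] solves [a t + w b^T = 0], so the form of [P] at [(t, w)] reduces to the form of the
     Schur complement at [w]. *)
  move=> w w0; pose t : 'M[R]_1 := - a^-1 *: (w *m b^T).
  have v0 : row_mx t w != 0.
    by apply: contraNneq w0 => /(congr1 rsubmx); rewrite row_mxKr => ->; rewrite linear0.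
  have := pP _ v0; rewrite PE mul_row_block tr_row_mx mul_row_col.
  have tT : t^T = - a^-1 *: (b *m w^T) by rewrite /t linearZ /= trmx_mul trmxK.
  have -> : t *m a%:M + w *m b^T = 0.
    by rewrite mul_mx_scalar /t scalerA mulrN divff ?gt_eqF // scaleN1r addNr.
  rewrite mul0mx add0r /t /S mulmxDl mulmxBr mulmxBl -scalemxAr -!scalemxAl !mulmxA scaleNr.
  by rewrite addrC.
have [C' SE] := IH S pS.
exists (block_mx (Num.sqrt a)%:M ((Num.sqrt a)^-1 *: b) 0 C').
have sa : Num.sqrt a != 0 by rewrite gt_eqF // sqrtr_gt0.
rewrite tr_block_mx mulmx_block PE !trmx0 !mul0mx !mulmx0 !addr0 tr_scalar_mx.
congr block_mx.
- by rewrite -scalar_mxM -expr2 sqr_sqrtr // ltW.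
- by rewrite mul_scalar_mx scalerA divff // scale1r.
- by rewrite mul_mx_scalar linearZ /= scalerA divff // scale1r.
- have -> : ((Num.sqrt a)^-1 *: b)^T = (Num.sqrt a)^-1 *: b^T by rewrite linearZ.
  rewrite -SE /S -scalemxAl -scalemxAr scalerA -invfM -expr2 sqr_sqrtr ?ltW //.
  by rewrite addrC subrK.
Qed.

(* The factorisation P = Q Q^T replaces the choice of an orthonormal frame. *)
Lemma posdef_factor n (P : 'M[R]_n) : posdef P ->
  exists2 Q : 'M[R]_n, Q \in unitmx & P = Q *m Q^T.
Proof.
move=> pP; have [C PE] := cholesky pP; exists C^T; last by rewrite trmxK.
by have := posdef_unit pP; rewrite PE unitmx_mul => /andP[].
Qed.

Lemma factor_inv n (Q : 'M[R]_n) : Q \in unitmx ->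
  invmx (Q *m Q^T) = (invmx Q)^T *m invmx Q.
Proof.
move=> uQ; have uQT : Q^T \in unitmx by rewrite unitmx_tr.
have uP : Q *m Q^T \in unitmx by rewrite unitmx_mul uQ.
rewrite trmx_inv -[LHS]mulmx1; apply: (canLR (mulKmx uP)); apply/esym.
by rewrite -mulmxA [Q^T *m _]mulmxA mulmxV // mul1mx mulmxV.
Qed.

Lemma posdef_inv_sym n (P : 'M[R]_n) : posdef P -> (invmx P)^T = invmx P.
Proof. by move=> [sP _]; rewrite trmx_inv sP. Qed.

Lemma trace_CtCH n (C H : 'M[R]_n) : \tr (C^T *m C *m H) = \sum_i (row i C *m H *m (row i C)^T) 0 0.
Proof.
rewrite -mulmxA mxtrace_mulC; apply: eq_bigr => i _.
rewrite !mxE; apply: eq_bigr => j _; rewrite !mxE; congr (_ * _).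
by apply: eq_bigr => k _; rewrite !mxE.
Qed.

(** With [P = Q Q^T] the trace is the sum of the values of [H] on the rows of [Q^-1], which play the
    part of an orthonormal frame. *)
Lemma trace_inv_ge0 n (P H : 'M[R]_n) : posdef P ->
  (forall v : 'rV[R]_n, 0 <= (v *m H *m v^T) 0 0) -> 0 <= \tr (invmx P *m H).
Proof.
move=> /posdef_factor[Q uQ ->] HH; rewrite factor_inv // trace_CtCH.
exact: sumr_ge0.
Qed.

Lemma inv_form_factor n (Q : 'M[R]_n) (v : 'rV[R]_n) : Q \in unitmx ->
  (v *m invmx (Q *m Q^T) *m v^T) 0 0 = \sum_i (v *m (invmx Q)^T) 0 i ^+ 2.
Proof.
move=> uQ; rewrite factor_inv // -row_mul_trE trmx_mul trmxK !mulmxA //.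
Qed.

Lemma inv_form_ge0 n (P : 'M[R]_n) (v : 'rV[R]_n) : posdef P ->
  0 <= (v *m invmx P *m v^T) 0 0.
Proof.
move=> /posdef_factor[Q uQ ->]; rewrite inv_form_factor //.
by apply: sumr_ge0 => i _; apply: sqr_ge0.
Qed.

Lemma inv_form_eq0 n (P : 'M[R]_n) (v : 'rV[R]_n) : posdef P ->
  (v *m invmx P *m v^T) 0 0 = 0 -> v = 0.
Proof.
move=> /posdef_factor[Q uQ ->]; rewrite inv_form_factor // => /eqP.
rewrite psumr_eq0 => [/allP H|i _]; last exact: sqr_ge0.
have : v *m (invmx Q)^T = 0.
  by apply/rowP => i; rewrite [RHS]mxE; apply/eqP; rewrite -sqrf_eq0; apply: H; rewrite mem_index_enum.
move=> /(congr1 (mulmx^~ Q^T)); rewrite mul0mx -mulmxA -trmx_mul mulmxV //.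
by rewrite trmx1 mulmx1.
Qed.

Lemma cauchy_schwarz_sum (I : finType) (x y : I -> R) :
  (\sum_i x i * y i) ^+ 2 <= (\sum_i x i ^+ 2) * (\sum_i y i ^+ 2).
Proof.
set X := \sum_i x i ^+ 2; set Y := \sum_i y i ^+ 2; set Z := \sum_i x i * y i.
have Y0 : 0 <= Y by apply: sumr_ge0 => i _; apply: sqr_ge0.
have : 0 <= \sum_i (Y * x i - Z * y i) ^+ 2 by apply: sumr_ge0 => i _; apply: sqr_ge0.
have -> : \sum_i (Y * x i - Z * y i) ^+ 2 = Y * (X * Y - Z ^+ 2).
  have -> : Y * (X * Y - Z ^+ 2) = Y ^+ 2 * X + (- 2 * Y * Z) * Z + Z ^+ 2 * Y by ring.
  have eX : Y ^+ 2 * X = \sum_i Y ^+ 2 * x i ^+ 2 by rewrite mulr_sumr.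
  have eZ : - 2 * Y * Z * Z = \sum_i - 2 * Y * Z * (x i * y i) by rewrite mulr_sumr.
  have eY : Z ^+ 2 * Y = \sum_i Z ^+ 2 * y i ^+ 2 by rewrite mulr_sumr.
  by rewrite eX eZ eY -!big_split; apply: eq_bigr => i _ /=; ring.
have [Yz|Yz] := eqVneq Y 0.
  have y0 i : y i = 0.
    apply/eqP; rewrite -sqrf_eq0; apply: contraTT isT => yi.
    have : 0 < Y.
      rewrite /Y (bigD1 i) //= ltr_pwDl // ?lt0r ?yi ?sqr_ge0 //.
      by apply: sumr_ge0 => j _; apply: sqr_ge0.
    by rewrite Yz ltxx.
  rewrite Yz mulr0 => _; rewrite /Z big1 ?expr0n // => i _; by rewrite y0 mulr0.
by rewrite pmulr_rge0 ?subr_ge0 // lt0r Yz.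
Qed.

(** Cauchy-Schwarz in the frame given by the factor of [P]. It converts a bound on an intrinsic norm
    into a bound on coordinate components; [sym_entry_bound] does the same for symmetric matrices,
    and both feed the convergence argument in charts. *)
Lemma covector_bound n (P : 'M[R]_n) (v : 'rV[R]_n) a : posdef P ->
  v 0 a ^+ 2 <= (v *m invmx P *m v^T) 0 0 * P a a.
Proof.
move=> /posdef_factor[Q uQ ->]; rewrite inv_form_factor //.
have -> : v 0 a = \sum_i (v *m (invmx Q)^T) 0 i * Q a i.
  have E : v = (v *m (invmx Q)^T) *m Q^T.
    by rewrite -mulmxA -trmx_mul mulmxV // trmx1 mulmx1.
  by rewrite {1}E mxE; apply: eq_bigr => i _; rewrite [Q^T _ _]mxE.
have -> : (Q *m Q^T) a a = \sum_i Q a i ^+ 2.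
  by rewrite mxE; apply: eq_bigr => i _; rewrite mxE expr2.
exact: cauchy_schwarz_sum.
Qed.

(** For symmetric [S] this is the squared norm of the bilinear form [S] in the metric [P]. *)
Definition sqtrace n (P S : 'M[R]_n) : R := \tr (invmx P *m S *m invmx P *m S).

Lemma sqtrace_factor n (Q S : 'M[R]_n) : Q \in unitmx -> S^T = S ->
  sqtrace (Q *m Q^T) S = \sum_i \sum_j (invmx Q *m S *m (invmx Q)^T) i j ^+ 2.
Proof.
move=> uQ sS; rewrite /sqtrace factor_inv //.
set B := invmx Q *m S *m (invmx Q)^T.
have BT : B^T = B by rewrite /B !trmx_mul trmxK sS mulmxA.
have -> : \tr ((invmx Q)^T *m invmx Q *m S *m ((invmx Q)^T *m invmx Q) *m S) = \tr (B *m B^T).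
  by rewrite BT /B -!mulmxA mxtrace_mulC !mulmxA.
apply: eq_bigr => i _; rewrite mxE; apply: eq_bigr => j _.
by rewrite [B^T _ _]mxE expr2.
Qed.

Lemma sqtrace_ge0 n (P S : 'M[R]_n) : posdef P -> S^T = S -> 0 <= sqtrace P S.
Proof.
move=> /posdef_factor[Q uQ ->] sS; rewrite sqtrace_factor //.
by do 2!apply: sumr_ge0 => ? _; apply: sqr_ge0.
Qed.

Lemma sym_entry_bound n (P S : 'M[R]_n) a b : posdef P -> S^T = S ->
  S a b ^+ 2 <= sqtrace P S * (P a a * P b b).
Proof.
move=> /posdef_factor[Q uQ ->] sS; rewrite sqtrace_factor //.
set B := invmx Q *m S *m (invmx Q)^T.
have -> : S a b = \sum_(p : 'I_n * 'I_n) B p.1 p.2 * (Q a p.1 * Q b p.2).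
  have E : S = Q *m B *m Q^T.
    rewrite /B !mulmxA mulmxV // mul1mx -mulmxA -trmx_mul mulmxV // trmx1.
    by rewrite mulmx1.
  rewrite {1}E mxE; under eq_bigr do rewrite mxE mulr_suml.
  rewrite exchange_big pair_big; apply: eq_bigr => -[i j] _ /=.
  by rewrite [Q^T _ _]mxE; ring.
have E c : (Q *m Q^T) c c = \sum_i Q c i ^+ 2.
  by rewrite mxE; apply: eq_bigr => i _; rewrite mxE expr2.
have -> : (Q *m Q^T) a a * (Q *m Q^T) b b =
    \sum_(p : 'I_n * 'I_n) (Q a p.1 * Q b p.2) ^+ 2.
  rewrite !E mulr_suml; under eq_bigr do rewrite mulr_sumr.
  by rewrite pair_big; apply: eq_bigr => -[i j] _ /=; rewrite exprMn.
rewrite pair_big; exact: cauchy_schwarz_sum.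
Qed.

Lemma sqtrace_eq0 n (P S : 'M[R]_n) : posdef P -> S^T = S -> sqtrace P S = 0 -> S = 0.
Proof.
move=> pP sS H; apply/matrixP => a b; rewrite [RHS]mxE; apply/eqP.
rewrite -sqrf_eq0 eq_le sqr_ge0 andbT.
by have := sym_entry_bound a b pP sS; rewrite H mul0r.
Qed.

(* [invmx] keeps a matrix unchanged when it is not invertible. *)
Lemma invmxE n (A : 'M[R]_n) : A \in unitmx -> invmx A = (\det A)^-1 *: \adj A.
Proof. by rewrite /invmx => ->. Qed.

Definition Ck_mx n m p k (U : set 'rV[R]_n) (A : 'rV[R]_n -> 'M[R]_(m, p)) : Prop :=
  forall i j, Ck_on k U (fun x => A x i j).

Lemma Ck_mulmx n m p q k (U : set 'rV[R]_n) (A : 'rV[R]_n -> 'M[R]_(m, p))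
    (B : 'rV[R]_n -> 'M[R]_(p, q)) : open U -> Ck_mx k U A -> Ck_mx k U B ->
  Ck_mx k U (fun x => A x *m B x).
Proof.
move=> oU HA HB i j.
apply: (@Ck_eq _ _ k U (fun x => \sum_l A x i l * B x l j)) => // [x _|].
  by rewrite mxE.
by apply: Ck_sum => // l; apply: Ck_mul.
Qed.

Lemma Ck_det n m k (U : set 'rV[R]_n) (A : 'rV[R]_n -> 'M[R]_m) : open U ->
  Ck_mx k U A -> Ck_on k U (fun x => \det (A x)).
Proof.
move=> oU HA; apply: Ck_sum => // s; apply: Ck_scale => //.
by apply: Ck_prod => // i; apply: HA.
Qed.

Lemma Ck_invmx n m k (U : set 'rV[R]_n) (A : 'rV[R]_n -> 'M[R]_m) : open U ->
  (forall x, U x -> A x \in unitmx) -> Ck_mx k U A -> Ck_mx k U (fun x => invmx (A x)).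
Proof.
move=> oU uA HA i j.
apply: (@Ck_eq _ _ k U (fun x => (\det (A x))^-1 * ((-1) ^+ (j + i) * \det (row' j (col' i (A x)))))) => //.
  by move=> x Ux; rewrite invmxE ?uA // !mxE.
apply: Ck_mul => //.
  apply: Ck_inv => // [x Ux|]; last exact: Ck_det.
  by rewrite -unitfE; exact: uA.
apply: Ck_scale => //; apply: Ck_det => // a b.
by apply: (@Ck_eq _ _ k U (fun x => A x (lift j a) (lift i b))) => // x _; rewrite !mxE.
Qed.

Lemma hessform_mx n (f : 'rV[R]_n -> R) x (v : 'rV[R]_n) :
  hessform f x v = (v *m (\matrix_(a, b) partial a (partial b f) x) *m v^T) 0 0.
Proof.
rewrite /hessform exchange_big mxE; apply: eq_bigr => b _; rewrite !mxE mulr_suml.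
by apply: eq_bigr => a _; rewrite !mxE; ring.
Qed.
End PosDef.

(** * Riemannian metrics on open subsets of R^n *)

(** Index bookkeeping of [contracted_commutation]: [C] stands for the Christoffel symbols, [D c] for
    their derivative in direction [c], [X] for the gradient, [Y c l] for the [c]-derivative of its
    component [l], and [Z] for its second derivatives. Symmetry of the lower indices of [C] is the
    only geometric input. *)
Lemma contracted_algebra (R : fieldType) (I : finType) (C : I -> I -> I -> R)
    (D : I -> I -> I -> I -> R) (X : I -> R) (Y : I -> I -> R) (Z : I -> R) (a : I) :
  (forall l b k, C l b k = C l k b) ->
  \sum_b (Z b + \sum_k (C b a k * Y b k + X k * D b b a k)
     + \sum_k C b b k * (Y a k + \sum_m C k a m * X m)
     - \sum_k C k b a * (Y k b + \sum_m C b k m * X m))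
  = \sum_b (Z b + \sum_k (C b b k * Y a k + X k * D a b b k))
    + \sum_m (\sum_b (D b b a m - D a b b m
       + \sum_k (C b b k * C k a m - C b a k * C k b m))) * X m.
Proof.
move=> Cs.
have L1 : \sum_b \sum_k (C b a k * Y b k + X k * D b b a k) =
  \sum_b \sum_k C b a k * Y b k + \sum_b \sum_k X k * D b b a k.
  by rewrite -big_split; apply: eq_bigr => b _; rewrite big_split.
have L2 : \sum_b \sum_k C b b k * (Y a k + \sum_m C k a m * X m) =
  \sum_b \sum_k C b b k * Y a k + \sum_b \sum_k \sum_m C b b k * C k a m * X m.
  rewrite -big_split; apply: eq_bigr => b _; rewrite -big_split; apply: eq_bigr => k _ /=.
  by rewrite mulrDr mulr_sumr; congr (_ + _); apply: eq_bigr => m _; rewrite mulrA.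
have L3 : \sum_b \sum_k C k b a * (Y k b + \sum_m C b k m * X m) =
  \sum_b \sum_k C b a k * Y b k + \sum_b \sum_k \sum_m C b a k * C k b m * X m.
  rewrite exchange_big -big_split; apply: eq_bigr => k _.
  rewrite -big_split; apply: eq_bigr => b _ /=.
  rewrite mulrDr mulr_sumr (Cs k b a); congr (_ + _).
  by apply: eq_bigr => m _; rewrite mulrA.
have R1 : \sum_b \sum_k (C b b k * Y a k + X k * D a b b k) =
  \sum_b \sum_k C b b k * Y a k + \sum_b \sum_k X k * D a b b k.
  by rewrite -big_split; apply: eq_bigr => b _; rewrite big_split.
have R2 : \sum_m (\sum_b (D b b a m - D a b b m
    + \sum_k (C b b k * C k a m - C b a k * C k b m))) * X m =
  \sum_b \sum_k X k * D b b a k - \sum_b \sum_k X k * D a b b k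
  + \sum_b \sum_k \sum_m C b b k * C k a m * X m
  - \sum_b \sum_k \sum_m C b a k * C k b m * X m.
  under eq_bigr do rewrite mulr_suml.
  rewrite exchange_big -sumrB -big_split -sumrB; apply: eq_bigr => b _ /=.
  rewrite [X in _ = _ + X - _]exchange_big [X in _ = _ - X]exchange_big.
  rewrite -sumrB -big_split -sumrB.
  apply: eq_bigr => m _ /=; rewrite mulrDl mulr_suml -addrA; congr (_ + _).
    by rewrite mulrC mulrBr.
  by rewrite -sumrB; apply: eq_bigr => k _; rewrite mulrBl.
rewrite sumrB !big_split /= L1 L2 L3 R1 R2.
by ring.
Qed.

(** Index bookkeeping of [bochner], in the notation of [contracted_algebra]; here [A] is the
    covariant derivative of the gradient and [dA] its derivatives. *)
Lemma bochner_algebra (R : fieldType) (I : finType) (C : I -> I -> I -> R)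
    (X : I -> R) (Y : I -> I -> R) (A : I -> I -> R) (dA : I -> I -> I -> R) :
  (forall l b, A l b = Y b l + \sum_k C l b k * X k) ->
  \sum_b (2 * \sum_a (X a * dA b b a + A b a * Y b a)
     + \sum_k C b b k * (2 * \sum_a X a * A k a))
  = 2 * (\sum_b \sum_a A b a * A a b
     + \sum_a X a * (\sum_b (dA b b a + \sum_k C b b k * A k a
            - \sum_k C k b a * A b k))).
Proof.
move=> HA.
have E1 : \sum_b \sum_a A b a * A a b = \sum_b \sum_a A b a * Y b a
    + \sum_b \sum_a \sum_k A b a * C a b k * X k.
  rewrite -big_split; apply: eq_bigr => b _; rewrite -big_split; apply: eq_bigr => a _ /=.
  by rewrite [A a b]HA mulrDr mulr_sumr; congr (_ + _); apply: eq_bigr => k _; rewrite mulrA.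
have E2 : \sum_b \sum_a \sum_k A b a * C a b k * X k =
    \sum_a X a * (\sum_b \sum_k C k b a * A b k).
  under [RHS]eq_bigr do rewrite mulr_sumr.
  rewrite [RHS]exchange_big; apply: eq_bigr => b _ /=.
  rewrite exchange_big; apply: eq_bigr => a _ /=; rewrite mulr_sumr.
  by apply: eq_bigr => k _; ring.
have E3 : \sum_b \sum_k C b b k * (2 * \sum_a X a * A k a) =
    2 * \sum_a X a * (\sum_b \sum_k C b b k * A k a).
  rewrite mulr_sumr; under [RHS]eq_bigr do rewrite mulrCA mulr_sumr.
  under [RHS]eq_bigr do (under eq_bigr do rewrite mulr_sumr; rewrite mulr_sumr).
  rewrite [RHS]exchange_big; apply: eq_bigr => b _ /=.
  under [RHS]eq_bigr do rewrite mulr_sumr.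
  rewrite [RHS]exchange_big; apply: eq_bigr => k _ /=; rewrite !mulr_sumr.
  by apply: eq_bigr => a _; ring.
have E4 : \sum_b 2 * \sum_a (X a * dA b b a + A b a * Y b a) =
    2 * (\sum_a X a * (\sum_b dA b b a) + \sum_b \sum_a A b a * Y b a).
  rewrite -mulr_sumr; congr (_ * _); under [X in _ = X + _]eq_bigr do rewrite mulr_sumr.
  rewrite [X in _ = X + _]exchange_big -big_split; apply: eq_bigr => b _ /=.
  by rewrite big_split.
have E5 : \sum_a X a * (\sum_b (dA b b a + \sum_k C b b k * A k a - \sum_k C k b a * A b k)) =
   \sum_a X a * (\sum_b dA b b a) + \sum_a X a * (\sum_b \sum_k C b b k * A k a)
   - \sum_a X a * (\sum_b \sum_k C k b a * A b k).
  rewrite -big_split -sumrB; apply: eq_bigr => a _ /=.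
  by rewrite sumrB big_split /= mulrBr mulrDr.
rewrite big_split /= E3 E4 E5 E1 E2; ring.
Qed.

Definition metric_on (R : realType) n (U : set 'rV[R]_n) (G : 'rV[R]_n -> 'M[R]_n) :=
  [/\ open U, forall k, Ck_mx k U G & forall x, U x -> posdef (G x)].

Section Metric.
Context {R : realType} {n : nat}.
Variables (U : set 'rV[R]_n) (G : 'rV[R]_n -> 'M[R]_n).
Hypothesis mG : metric_on U G.
Let oU : open U. Proof. by case: mG. Qed.
Let sG k : Ck_mx k U G. Proof. by case: mG. Qed.
Let pG x : U x -> posdef (G x). Proof. by case: mG => _ _; apply. Qed.
Implicit Types (f : 'rV[R]_n -> R).

Definition gradv f (l : 'I_n) (x : 'rV[R]_n) : R :=
  \sum_b invmx (G x) l b * partial b f x.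

(* Twice the Christoffel symbol of the first kind. *)
Definition chr1 (a b l : 'I_n) (x : 'rV[R]_n) : R :=
  partial a (fun y => G y b l) x + partial b (fun y => G y a l) x
  - partial l (fun y => G y a b) x.

Definition gradnorm f x : R := \sum_a gradv f a x * partial a f x.

Definition lap f x : R := \tr (invmx (G x) *m hessian_coord G f x).

Lemma chr_smooth k l a b : Ck_on k U (christoffel G l a b).
Proof.
have H (i j c : 'I_n) : Ck_on k U (partial c (fun y => G y i j)).
  by apply: Ck_partial; apply: sG.
apply: Ck_scale => //; apply: Ck_sum => // m; apply: Ck_mul => //.
  by apply: Ck_invmx => // x /pG; exact: posdef_unit.
by apply: Ck_subr => //; apply: Ck_add.
Qed.

Lemma inv_smooth k : Ck_mx k U (fun x => invmx (G x)).
Proof. by apply: Ck_invmx => // x /pG; exact: posdef_unit. Qed.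

Lemma gradv_Ck k f l : Ck_on k.+1 U f -> Ck_on k U (gradv f l).
Proof.
move=> Hf; apply: Ck_sum => // b; apply: Ck_mul => //; last exact: Ck_partial.
exact: inv_smooth.
Qed.

Lemma hess_Ck k f a b : Ck_on k.+2 U f -> Ck_on k U (fun x => hessian_coord G f x a b).
Proof.
move=> Hf; apply: (@Ck_eq _ _ k U (fun x => partial a (partial b f) x -
   \sum_(m < n) christoffel G m a b x * partial m f x)) => // [x _|]; first by rewrite mxE.
apply: Ck_subr => //; first by do 2!apply: Ck_partial.
apply: Ck_sum => // m; apply: Ck_mul => //; first exact: chr_smooth.
by apply: Ck_partial; apply: Ck_le Hf.
Qed.

Lemma Gsym x a b : U x -> G x a b = G x b a.
Proof. by move=> /pG[sP _]; rewrite -{1}sP mxE. Qed.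

Lemma invsym x a b : U x -> invmx (G x) a b = invmx (G x) b a.
Proof. by move=> /pG /posdef_inv_sym {1}<-; rewrite mxE. Qed.

Lemma dGsym x a b c : U x ->
  partial c (fun y => G y a b) x = partial c (fun y => G y b a) x.
Proof. by move=> Ux; apply: (eq_partial _ oU Ux) => y; exact: Gsym. Qed.

Lemma sum_G_inv x a b : U x -> \sum_l G x a l * invmx (G x) l b = (a == b)%:R.
Proof.
move=> /pG/posdef_unit uG; have := mulmxV uG => /matrixP/(_ a b).
by rewrite !mxE.
Qed.

Lemma sum_inv_G x a b : U x -> \sum_l invmx (G x) a l * G x l b = (a == b)%:R.
Proof.
move=> /pG/posdef_unit uG; have := mulVmx uG => /matrixP/(_ a b).
by rewrite !mxE.
Qed.

Lemma sum_delta (F : 'I_n -> R) a : \sum_b (a == b)%:R * F b = F a.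
Proof.
rewrite (bigD1 a) //= eqxx mul1r big1 ?addr0 // => b.
by rewrite eq_sym => /negbTE ->; rewrite mul0r.
Qed.

Lemma lower_gradv f x a : U x -> \sum_l G x a l * gradv f l x = partial a f x.
Proof.
move=> Ux; rewrite /gradv; under eq_bigr do rewrite mulr_sumr.
rewrite exchange_big -[RHS](sum_delta (fun b => partial b f x)).
apply: eq_bigr => b _; rewrite -(sum_G_inv a b Ux) mulr_suml.
by apply: eq_bigr => l _; rewrite mulrA.
Qed.

Lemma chr1_sym x a b l : U x -> chr1 a b l x = chr1 b a l x.
Proof.
move=> Ux; rewrite /chr1 (dGsym a b l Ux); congr (_ - _); exact: addrC.
Qed.

Lemma christoffelE k a b x : christoffel G k a b x =
  2^-1 * \sum_l invmx (G x) k l * chr1 a b l x.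
Proof. by []. Qed.

Lemma christoffel_sym k a b x : U x -> christoffel G k a b x = christoffel G k b a x.
Proof.
move=> Ux; rewrite !christoffelE; congr (_ * _); apply: eq_bigr => l _.
by rewrite chr1_sym.
Qed.

Lemma lower_christoffel x a b c : U x ->
  \sum_l G x a l * christoffel G l b c x = 2^-1 * chr1 b c a x.
Proof.
move=> Ux; under eq_bigr do rewrite christoffelE mulrCA.
rewrite -mulr_sumr; congr (_ * _); under eq_bigr do rewrite mulr_sumr.
rewrite exchange_big -[RHS](sum_delta (fun a => chr1 b c a x)).
apply: eq_bigr => m _; rewrite -(sum_G_inv a m Ux) mulr_suml.
by apply: eq_bigr => l _; rewrite mulrA.
Qed.

Lemma hessE f a b x : U x -> hessian_coord G f x a b =
  partial a (partial b f) x - 2^-1 * \sum_l gradv f l x * chr1 a b l x.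
Proof.
move=> Ux; rewrite mxE; congr (_ - _).
under eq_bigr do rewrite christoffelE -mulrA mulr_suml.
rewrite -mulr_sumr; congr (_ * _); rewrite exchange_big; apply: eq_bigr => l _.
rewrite /gradv mulr_suml; apply: eq_bigr => k _; rewrite (invsym k l Ux).
by rewrite mulrAC.
Qed.

Lemma hess_sym f x a b : U x -> Ck_on 2 U f ->
  hessian_coord G f x a b = hessian_coord G f x b a.
Proof.
move=> Ux Hf; rewrite !hessE // (Schwarz a b oU Hf Ux).
by congr (_ - _ * _); apply: eq_bigr => l _; rewrite chr1_sym.
Qed.

(** Component [l] of the covariant derivative of the gradient in direction [b]: the Hessian with one
    index raised, see [gradDE]. *)
Definition gradD f (l b : 'I_n) (x : 'rV[R]_n) : R :=
  partial b (gradv f l) x + \sum_k christoffel G l b k x * gradv f k x.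

(** This is the parallelism of the metric. Differentiating [lower_gradv] produces derivatives of
    [G], which combine with the Christoffel terms into [chr1]. *)
Lemma lower_gradD f x a b : U x -> Ck_on 2 U f ->
  \sum_l G x a l * gradD f l b x = hessian_coord G f x a b.
Proof.
move=> Ux Hf.
have dX l : derivable (gradv f l) x (delta_mx 0 b).
  by apply: (@Ck_derivable _ _ 0 U) Ux; apply: gradv_Ck.
have dG l : derivable (fun y => G y a l) x (delta_mx 0 b).
  by apply: (@Ck_derivable _ _ 0 U) Ux; apply: sG.
have E : partial a (partial b f) x =
    \sum_l (G x a l * partial b (gradv f l) x + gradv f l x * partial b (fun y => G y a l) x).
  rewrite (Schwarz a b oU Hf Ux).
  rewrite -(eq_partial b oU Ux (fun y Uy => lower_gradv f a Uy)).
  rewrite (partial_sum _ (fun l => derivableM (dG l) (dX l))).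
  by apply: eq_bigr => l _; rewrite (partialM (dG l) (dX l)).
rewrite hessE // E /gradD.
under eq_bigr do rewrite mulrDr mulr_sumr.
rewrite big_split [X in _ = X - _]big_split /= -addrA; congr (_ + _).
rewrite exchange_big /=.
have -> : \sum_k \sum_i G x a i * (christoffel G i b k x * gradv f k x) =
    \sum_k 2^-1 * chr1 b k a x * gradv f k x.
  apply: eq_bigr => k _; rewrite -(lower_christoffel a b k Ux) mulr_suml.
  by apply: eq_bigr => l _; rewrite mulrA.
rewrite mulr_sumr -sumrB; apply: eq_bigr => k _; rewrite /chr1.
rewrite (dGsym k a b Ux) (dGsym b a k Ux).
by field.
Qed.

Lemma gradDE f x l b : U x -> Ck_on 2 U f ->
  gradD f l b x = \sum_a invmx (G x) l a * hessian_coord G f x a b.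
Proof.
move=> Ux Hf; rewrite -[LHS](sum_delta (fun l => gradD f l b x)).
under [RHS]eq_bigr do rewrite -lower_gradD // mulr_sumr.
rewrite exchange_big; apply: eq_bigr => k _ /=; rewrite -(sum_inv_G l k Ux) mulr_suml.
by apply: eq_bigr => a _; rewrite mulrA.
Qed.

Lemma lapE f x : U x -> Ck_on 2 U f -> lap f x = \sum_l gradD f l l x.
Proof.
by move=> Ux Hf; rewrite /lap /mxtrace; apply: eq_bigr => l _; rewrite gradDE // !mxE.
Qed.

Lemma partial_gradnorm f x c : U x -> Ck_on 2 U f ->
  partial c (gradnorm f) x = 2 * \sum_a gradv f a x * hessian_coord G f x a c.
Proof.
move=> Ux Hf.
have dX l : derivable (gradv f l) x (delta_mx 0 c).
  by apply: (@Ck_derivable _ _ 0 U) Ux; apply: gradv_Ck.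
have df l : derivable (partial l f) x (delta_mx 0 c).
  by apply: (@Ck_derivable _ _ 0 U) Ux; apply: Ck_partial.
rewrite (partial_sum _ (fun l => derivableM (dX l) (df l))).
under eq_bigr do rewrite (partialM (dX _) (df _)).
rewrite big_split /=.
have -> : \sum_i partial i f x * partial c (gradv f i) x =
   \sum_b gradv f b x * (hessian_coord G f x b c
      - \sum_k 2^-1 * chr1 c k b x * gradv f k x).
  under eq_bigr do rewrite -(lower_gradv f _ Ux) mulr_suml.
  rewrite exchange_big; apply: eq_bigr => b _ /=.
  have -> : \sum_k 2^-1 * chr1 c k b x * gradv f k x =
            \sum_l G x b l * \sum_k christoffel G l c k x * gradv f k x.
    under [RHS]eq_bigr do rewrite mulr_sumr.
    rewrite exchange_big; apply: eq_bigr => k _ /=.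
    rewrite -(lower_christoffel b c k Ux) mulr_suml.
    by apply: eq_bigr => l _; rewrite mulrA.
  rewrite -lower_gradD // -sumrB mulr_sumr; apply: eq_bigr => l _.
  by rewrite -mulrBr /gradD addrK (Gsym l b Ux) mulrA [_ * G x b l]mulrC.
have E1 : \sum_a gradv f a x * partial c (partial a f) x =
    \sum_a gradv f a x * hessian_coord G f x a c
    + 2^-1 * \sum_a \sum_l gradv f a x * gradv f l x * chr1 c a l x.
  rewrite mulr_sumr -big_split; apply: eq_bigr => a _ /=.
  rewrite (hess_sym _ _ Ux Hf) hessE // mulrBr mulrCA mulr_sumr.
  under [X in _ - 2^-1 * X]eq_bigr do rewrite mulrA.
  by rewrite subrK.
have E2 : \sum_a gradv f a x * \sum_k 2^-1 * chr1 c k a x * gradv f k x =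
    2^-1 * \sum_a \sum_l gradv f a x * gradv f l x * chr1 c a l x.
  rewrite mulr_sumr; under [RHS]eq_bigr do rewrite mulr_sumr.
  rewrite exchange_big; apply: eq_bigr => a _ /=; rewrite mulr_sumr.
  by apply: eq_bigr => k _; ring.
under [X in _ + X]eq_bigr => a _ do rewrite mulrBr.
rewrite sumrB E1 E2 mulr_natl mulr2n -!addrA; congr (_ + _).
by rewrite addrC subrK.
Qed.

Lemma gradv_gradnorm f x b : U x -> Ck_on 2 U f ->
  gradv (gradnorm f) b x = 2 * \sum_a gradv f a x * gradD f b a x.
Proof.
move=> Ux Hf; rewrite /gradv.
under eq_bigr do rewrite partial_gradnorm // mulrCA.
rewrite -mulr_sumr; congr (_ * _).
under eq_bigr do rewrite mulr_sumr.
rewrite exchange_big; apply: eq_bigr => a _ /=.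
rewrite gradDE // mulr_sumr; apply: eq_bigr => c _.
by rewrite (hess_sym _ _ Ux Hf) mulrCA.
Qed.

(** Contracted Ricci identity for the gradient: exchanging divergence and derivative costs a Ricci
    term. *)
Lemma contracted_commutation f x a : U x -> Ck_on 3 U f ->
  \sum_b (partial b (gradD f b a) x
     + \sum_k christoffel G b b k x * gradD f k a x
     - \sum_k christoffel G k b a x * gradD f b k x)
  = \sum_b partial a (gradD f b b) x + \sum_m ricci_coord G x a m * gradv f m x.
Proof.
move=> Ux Hf.
have cX l : Ck_on 2 U (gradv f l) by apply: gradv_Ck.
have dX l c : derivable (gradv f l) x (delta_mx 0 c) by apply: Ck_derivable (cX l) Ux.
have dC l b k c : derivable (christoffel G l b k) x (delta_mx 0 c).
  by apply: (@Ck_derivable _ _ 0 U) Ux; apply: chr_smooth.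
have dCX l b k c : derivable (fun y => christoffel G l b k y * gradv f k y) x (delta_mx 0 c).
  exact: derivableM (dC l b k c) (dX k c).
have dA l b c : partial c (gradD f l b) x = partial c (partial b (gradv f l)) x
   + \sum_k (christoffel G l b k x * partial c (gradv f k) x
       + gradv f k x * partial c (christoffel G l b k) x).
  have d1 : derivable (partial b (gradv f l)) x (delta_mx 0 c).
    exact: Ck_derivable (Ck_partial b (cX l)) Ux.
  rewrite (partialD d1 (derivable_sumr _ _ (fun k => dCX l b k c))).
  rewrite (partial_sum _ (fun k => dCX l b k c)); congr (_ + _).
  by apply: eq_bigr => k _; rewrite (partialM (dC l b k c) (dX k c)).
(* Swapping the partials here makes the second derivatives of the gradient literally the same on
   both sides, as the [Z] of [contracted_algebra]. *)
have S b := etrans (dA b a b) (congr1 (+%R^~ _) (Schwarz b a oU (cX b) Ux)).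
under eq_bigr => b _ do rewrite S.
under [X in _ = X + _]eq_bigr => b _ do rewrite dA.
under [X in _ = _ + X]eq_bigr => m _ do rewrite mxE.
apply: (@contracted_algebra R 'I_n (fun l b k => christoffel G l b k x)
  (fun c l b k => partial c (christoffel G l b k) x) (fun l => gradv f l x)
  (fun c l => partial c (gradv f l) x)
  (fun b => partial a (partial b (gradv f b)) x)) => l b k.
exact: christoffel_sym.
Qed.

(** The gradient of [|Df|^2] is twice the derivative of [grad f] along itself ([gradv_gradnorm]).
    Its divergence is the squared Hessian plus a term that [contracted_commutation] turns into the
    derivative of the Laplacian and Ricci. *)
Lemma bochner f x : U x -> Ck_on 3 U f ->
  lap (gradnorm f) x = 2 * (sqtrace (G x) (hessian_coord G f x)
    + \sum_a gradv f a x * partial a (lap f) x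
    + \sum_a \sum_m gradv f a x * ricci_coord G x a m * gradv f m x).
Proof.
move=> Ux Hf; have Hf2 : Ck_on 2 U f by apply: Ck_pred.
have cX l : Ck_on 2 U (gradv f l) by apply: gradv_Ck.
have cD l a : Ck_on 1 U (gradD f l a).
  apply: (Ck_add oU (Ck_partial a (cX l))); apply: (Ck_sum _ _ oU) => k.
  exact: (Ck_mul oU (chr_smooth _ _ _ _) (Ck_pred (cX k))).
have cW : Ck_on 2 U (gradnorm f).
  apply: (Ck_sum _ _ oU) => a; exact: (Ck_mul oU (cX a) (Ck_partial a Hf)).
rewrite (lapE Ux cW).
have dX l c : derivable (gradv f l) x (delta_mx 0 c) by apply: Ck_derivable (cX l) Ux.
have dD l a c : derivable (gradD f l a) x (delta_mx 0 c) by apply: Ck_derivable (cD l a) Ux.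
have dY b : partial b (gradv (gradnorm f) b) x =
   2 * \sum_a (gradv f a x * partial b (gradD f b a) x
       + gradD f b a x * partial b (gradv f a) x).
  rewrite (eq_partial b oU Ux (fun y Uy => gradv_gradnorm b Uy Hf2)).
  have dXD a : derivable (fun y => gradv f a y * gradD f b a y) x (delta_mx 0 b).
    exact: derivableM (dX a b) (dD b a b).
  rewrite (partialZ _ (derivable_sumr _ _ dXD)) (partial_sum _ dXD).
  by congr (_ * _); apply: eq_bigr => a _; rewrite (partialM (dX a b) (dD b a b)).
have dlap a : partial a (lap f) x = \sum_b partial a (gradD f b b) x.
  rewrite (eq_partial a oU Ux (fun y Uy => lapE Uy Hf2)).
  by rewrite (partial_sum _ (fun b => dD b b a)).
have tr2 : sqtrace (G x) (hessian_coord G f x) = \sum_b \sum_a gradD f b a x * gradD f a b x.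
  rewrite /sqtrace -mulmxA; have E l b : (invmx (G x) *m hessian_coord G f x) l b = gradD f l b x.
    by rewrite gradDE // mxE.
  by apply: eq_bigr => b _; rewrite mxE; apply: eq_bigr => a _; rewrite !E.
have key : \sum_a gradv f a x * (\sum_b (partial b (gradD f b a) x
     + \sum_k christoffel G b b k x * gradD f k a x
     - \sum_k christoffel G k b a x * gradD f b k x)) =
    \sum_a gradv f a x * partial a (lap f) x
    + \sum_a \sum_m gradv f a x * ricci_coord G x a m * gradv f m x.
  rewrite -big_split; apply: eq_bigr => a _ /=; rewrite contracted_commutation // dlap mulrDr.
  by congr (_ + _); rewrite mulr_sumr; apply: eq_bigr => m _; rewrite mulrA.
rewrite -addrA -key tr2.
rewrite (eq_bigr _ (fun b _ => congr2 +%R (dY b) (eq_bigr _ (fun k _ =>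
  congr1 ( *%R _) (gradv_gradnorm k Ux Hf2))))).
exact: (@bochner_algebra R 'I_n (fun l b k => christoffel G l b k x) (fun l => gradv f l x)
  (fun c l => partial c (gradv f l) x) (fun l b => gradD f l b x)
  (fun c l b => partial c (gradD f l b) x) (fun l b => erefl)).
Qed.
End Metric.

(** Transformation law of the first-kind Christoffel symbols, with [K] for the second and [J] for
    the first derivatives of the map, [g] for the metric and [D] for its derivatives. *)
Lemma pullback_chr1_algebra (R : fieldType) (I : finType) (K : I -> I -> I -> R)
    (J : I -> I -> R) (g : I -> I -> R) (D : I -> I -> I -> R) (a b l : I) :
  (forall p q r, K p q r = K q p r) -> (forall p q, g p q = g q p) ->
  let dGt l a b := \sum_p \sum_q ((K l a p * J b q + J a p * K l b q) * g p q
                      + J a p * J b q * \sum_r J l r * D r p q) in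
  dGt a b l + dGt b a l - dGt l a b =
  2 * (\sum_p \sum_q K a b p * J l q * g p q)
  + \sum_p \sum_q \sum_r J a p * J b q * J l r * (D p q r + D q p r - D r p q).
Proof.
move=> Ks gs dGt.
pose A l a b := \sum_p \sum_q K l a p * J b q * g p q.
pose T l a b := \sum_p \sum_q \sum_r J a p * J b q * J l r * D r p q.
have E l' a' b' : dGt l' a' b' = A l' a' b' + A l' b' a' + T l' a' b'.
  have -> : A l' b' a' = \sum_p \sum_q J a' p * K l' b' q * g p q.
    rewrite /A exchange_big; apply: eq_bigr => p _; apply: eq_bigr => q _ /=.
    by rewrite (gs q p); ring.
  rewrite -!big_split; apply: eq_bigr => p _ /=; rewrite -!big_split; apply: eq_bigr => q _ /=.
  by rewrite mulrDl mulr_sumr; congr (_ + _); apply: eq_bigr => r _; rewrite !mulrA.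
have As l' a' b' : A l' a' b' = A a' l' b'.
  by apply: eq_bigr => p _; apply: eq_bigr => q _; rewrite Ks.
have T1 : T a b l = \sum_p \sum_q \sum_r J a p * J b q * J l r * D p q r.
  rewrite /T; under eq_bigr do rewrite exchange_big /=.
  rewrite exchange_big; apply: eq_bigr => p _; apply: eq_bigr => q _.
  by apply: eq_bigr => r _; ring.
have T2 : T b a l = \sum_p \sum_q \sum_r J a p * J b q * J l r * D q p r.
  rewrite /T; apply: eq_bigr => p _; rewrite exchange_big; apply: eq_bigr => q _.
  by apply: eq_bigr => r _; ring.
have -> : \sum_p \sum_q \sum_r J a p * J b q * J l r * (D p q r + D q p r - D r p q) =
    T a b l + T b a l - T l a b.
  rewrite T1 T2 -big_split -sumrB; apply: eq_bigr => p _ /=.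
  rewrite -big_split -sumrB; apply: eq_bigr => q _ /=.
  rewrite -big_split -sumrB; apply: eq_bigr => r _ /=; ring.
rewrite !E (As a l b) (As b a l) (As b l a) -/(A a b l); ring.
Qed.

(** * Pull-backs by maps that are isometric up to a constant factor: changes of chart and
    homotheties *)

Section Pullback.
Context {R : realType} {n : nat}.
Variables (U V : set 'rV[R]_n) (kap : 'rV[R]_n -> 'rV[R]_n).
Variables (Gt G : 'rV[R]_n -> 'M[R]_n) (c : R).
Hypotheses (mGt : metric_on U Gt) (mG : metric_on V G).
Hypothesis UV : forall x, U x -> V (kap x).
Hypothesis ckap : forall b, Ck_on 2 U (fun x => kap x 0 b).
Hypothesis c0 : c != 0.
Let oU : open U. Proof. by case: mGt. Qed.
Let oV : open V. Proof. by case: mG. Qed.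
Let sG k : Ck_mx k V G. Proof. by case: mG. Qed.
Let pG x : V x -> posdef (G x). Proof. by case: mG => _ _; apply. Qed.
Let pGt x : U x -> posdef (Gt x). Proof. by case: mGt => _ _; apply. Qed.

Definition jac (kap : 'rV[R]_n -> 'rV[R]_n) (x : 'rV[R]_n) : 'M[R]_n :=
  \matrix_(a, b) partial a (fun y => kap y 0 b) x.

Hypothesis GtE : forall x, U x -> Gt x = c *: pullback (jac kap x) (G (kap x)).

Lemma jac_unit x : U x -> jac kap x \in unitmx.
Proof.
move=> Ux; have := posdef_unit (pGt Ux); rewrite GtE // /pullback.
by rewrite unitmxZ ?unitfE // !unitmx_mul => /andP[/andP[]].
Qed.

Let J a p x := partial a (fun y => kap y 0 p) x.

Lemma pullback_entry x a b : U x ->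
  Gt x a b = c * \sum_p \sum_q J a p x * J b q x * G (kap x) p q.
Proof.
move=> Ux; rewrite GtE // !mxE exchange_big; congr (_ * _); apply: eq_bigr => q _ /=.
rewrite !mxE mulr_suml; apply: eq_bigr => p _; rewrite !mxE.
by rewrite mulrAC.
Qed.

Lemma kap_diff x : U x -> forall b, differentiable (fun y => kap y 0 b) x.
Proof. by move=> Ux b; have [] := Ck_diff oU (ckap b) Ux. Qed.

Lemma comp_partial f x a : U x -> Ck_on 1 V f ->
  partial a (f \o kap) x = \sum_p J a p x * partial p f (kap x).
Proof.
by move=> Ux Hf; have [_ ->] := partial_comp a oV (UV Ux) Hf (kap_diff Ux).
Qed.

Lemma comp_partial2 f x a b : U x -> Ck_on 2 V f ->
  partial a (partial b (f \o kap)) x =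
   \sum_p partial a (J b p) x * partial p f (kap x)
   + \sum_p \sum_q J a p x * J b q x * partial p (partial q f) (kap x).
Proof.
move=> Ux Hf; have Hf1 : Ck_on 1 V f by apply: Ck_pred.
rewrite (eq_partial a oU Ux (fun y Uy => comp_partial b Uy Hf1)).
have dJ p : derivable (J b p) x (delta_mx 0 a).
  exact: Ck_derivable (Ck_partial b (ckap p)) Ux.
have df p := partial_comp a oV (UV Ux) (Ck_partial p Hf) (kap_diff Ux).
rewrite (partial_sum _ (fun p => derivableM (dJ p) (df p).1)).
rewrite [X in _ = _ + X]exchange_big -big_split; apply: eq_bigr => p _ /=.
rewrite (partialM (dJ p) (df p).1) (df p).2 [RHS]addrC; congr (_ + _); last exact: mulrC.
rewrite mulr_sumr; apply: eq_bigr => q _.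
by rewrite mulrA [J b p x * _]mulrC.
Qed.

Lemma partial_Gt x l a b : U x -> partial l (fun y => Gt y a b) x =
  c * \sum_p \sum_q ((partial l (J a p) x * J b q x + J a p x * partial l (J b q) x)
          * G (kap x) p q
     + J a p x * J b q x * \sum_r J l r x * partial r (fun y => G y p q) (kap x)).
Proof.
move=> Ux; rewrite (eq_partial l oU Ux (fun y Uy => pullback_entry a b Uy)).
have dJ a' p : derivable (J a' p) x (delta_mx 0 l).
  exact: Ck_derivable (Ck_partial a' (ckap p)) Ux.
have dg p q := partial_comp l oV (UV Ux) (sG 1 p q) (kap_diff Ux).
have dJJ p q := derivableM (dJ a p) (dJ b q).
have d3 p q := derivableM (dJJ p q) (dg p q).1.
rewrite (partialZ c (derivable_sumr _ _ (fun p => derivable_sumr _ _ (fun q => d3 p q)))).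
rewrite (partial_sum _ (fun p => derivable_sumr _ _ (fun q => d3 p q))).
congr (_ * _); apply: eq_bigr => p _; rewrite (partial_sum _ (fun q => d3 p q)).
apply: eq_bigr => q _; rewrite (partialM (dJJ p q) (dg p q).1) (partialM (dJ a p) (dJ b q)).
rewrite (dg p q).2 addrC; congr (_ + _).
by rewrite mulrC [J b q x * _]mulrC [X in X * _]addrC.
Qed.

Lemma chr1_pullback x a b l : U x -> chr1 Gt a b l x =
  c * (2 * (\sum_p \sum_q partial a (J b p) x * J l q x * G (kap x) p q)
  + \sum_p \sum_q \sum_r J a p x * J b q x * J l r x * chr1 G p q r (kap x)).
Proof.
move=> Ux; rewrite /chr1 !partial_Gt // -mulrDr -mulrBr; congr (_ * _).
apply: (@pullback_chr1_algebra R 'I_n (fun l a p => partial l (J a p) x)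
  (fun a p => J a p x) (fun p q => G (kap x) p q)
  (fun r p q => partial r (fun y => G y p q) (kap x))) => [p q r|p q].
  exact: Schwarz (ckap r) Ux.
by apply: (Gsym mG); apply: UV.
Qed.

Lemma gradv_pullback f x r : U x -> Ck_on 1 V f ->
  \sum_l J l r x * gradv Gt (f \o kap) l x = c^-1 * gradv G f r (kap x).
Proof.
move=> Ux Hf; set Jx := jac kap x.
have uJ := jac_unit Ux; have uG := posdef_unit (pG (UV Ux)).
pose df : 'cV[R]_n := \col_p partial p f (kap x).
have E1 : \col_a partial a (f \o kap) x = Jx *m df.
  by apply/colP => a; rewrite !mxE comp_partial //; apply: eq_bigr => p _; rewrite !mxE.
have E2 : Jx^T *m (invmx (Gt x) *m (\col_a partial a (f \o kap) x)) =
    c^-1 *: (invmx (G (kap x)) *m df).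
  rewrite E1 GtE // /pullback -/Jx.
  have uc : c *: (Jx *m G (kap x) *m Jx^T) \in unitmx.
    by rewrite unitmxZ ?unitfE // !unitmx_mul uJ uG unitmx_tr uJ.
  apply: (can_inj (mulKmx uG)); rewrite -scalemxAr mulKVmx //.
  apply: (can_inj (mulKmx uJ)); rewrite -scalemxAr !mulmxA.
  rewrite -[Jx *m df]mul1mx -(mulmxV uc) -!scalemxAl scalerA mulVf // scale1r.
  by rewrite !mulmxA.
have := congr1 (fun M : 'cV[R]_n => M r 0) E2.
rewrite /= !mxE => E3; rewrite /gradv.
transitivity (\sum_j Jx^T r j * (invmx (Gt x) *m (\col_a partial a (f \o kap) x)) j 0).
  apply: eq_bigr => l _; rewrite !mxE; congr (_ * _); apply: eq_bigr => b _.
  by rewrite !mxE.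
by rewrite E3; congr (_ * _); apply: eq_bigr => b _; rewrite !mxE.
Qed.

(** A constant factor does not change the Levi-Civita connection, so [c] drops out. The second
    derivatives of [kap] produced by the chain rule cancel against those in the Christoffel symbols
    of [Gt]. *)
Lemma hess_pullback f x a b : U x -> Ck_on 2 V f ->
  hessian_coord Gt (f \o kap) x a b =
  \sum_p \sum_q J a p x * J b q x * hessian_coord G f (kap x) p q.
Proof.
move=> Ux Hf; have Hf1 : Ck_on 1 V f by apply: Ck_pred.
rewrite (hessE mGt) // comp_partial2 //.
have -> : 2^-1 * \sum_l gradv Gt (f \o kap) l x * chr1 Gt a b l x =
   \sum_p partial a (J b p) x * partial p f (kap x)
   + \sum_p \sum_q J a p x * J b q x * (2^-1 * \sum_r gradv G f r (kap x) * chr1 G p q r (kap x)).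
  have E1 : \sum_p partial a (J b p) x * partial p f (kap x) =
     c * \sum_p \sum_q partial a (J b p) x * G (kap x) p q *
       \sum_l J l q x * gradv Gt (f \o kap) l x.
    rewrite mulr_sumr; apply: eq_bigr => p _.
    rewrite -(lower_gradv mG f p (UV Ux)) !mulr_sumr; apply: eq_bigr => q _.
    rewrite gradv_pullback // !mulrA; congr (_ * _).
    by rewrite [c * _]mulrC -!mulrA; congr (_ * _); rewrite mulrCA mulfV ?mulr1.
  have E2 : \sum_p \sum_q J a p x * J b q x * (2^-1 * \sum_r gradv G f r (kap x) * chr1 G p q r (kap x)) =
     c * 2^-1 * \sum_p \sum_q \sum_r J a p x * J b q x * chr1 G p q r (kap x) *
       \sum_l J l r x * gradv Gt (f \o kap) l x.
    rewrite mulr_sumr; apply: eq_bigr => p _; rewrite mulr_sumr; apply: eq_bigr => q _.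
    rewrite !mulr_sumr; apply: eq_bigr => r _.
    by rewrite gradv_pullback //; field.
  rewrite E1 E2.
  under eq_bigr do rewrite chr1_pullback // mulrCA mulrDr.
  rewrite -mulr_sumr big_split /= mulrCA mulrDr mulrDr; congr (_ + _).
    congr (_ * _); under [RHS]eq_bigr do under eq_bigr do rewrite mulr_sumr.
    under eq_bigr do rewrite mulrCA mulr_sumr.
    rewrite -mulr_sumr mulKf //.
    rewrite exchange_big; apply: eq_bigr => p _ /=.
    under eq_bigr do rewrite mulr_sumr; rewrite exchange_big.
    by apply: eq_bigr => q _ /=; apply: eq_bigr => l _; ring.
  rewrite mulrA; congr (_ * _).
  under eq_bigr do rewrite mulr_sumr; rewrite exchange_big; apply: eq_bigr => p _ /=.
  under eq_bigr do rewrite mulr_sumr; rewrite exchange_big; apply: eq_bigr => q _ /=.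
  under eq_bigr do rewrite mulr_sumr; rewrite exchange_big; apply: eq_bigr => r _ /=.
  by rewrite mulr_sumr; apply: eq_bigr => l _; ring.
rewrite opprD addrACA subrr add0r -sumrB; apply: eq_bigr => p _ /=.
rewrite -sumrB; apply: eq_bigr => q _.
by rewrite -mulrBr (hessE mG) //; apply: UV.
Qed.

Lemma hess_pullback_mx f x : U x -> Ck_on 2 V f ->
  hessian_coord Gt (f \o kap) x = pullback (jac kap x) (hessian_coord G f (kap x)).
Proof.
move=> Ux Hf; apply/matrixP => a b; rewrite hess_pullback // exchange_big !mxE.
apply: eq_bigr => q _ /=; rewrite !mxE mulr_suml; apply: eq_bigr => p _; rewrite !mxE.
by rewrite mulrAC.
Qed.

Lemma gradnorm_pullback f x : U x -> Ck_on 1 V f ->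
  gradnorm Gt (f \o kap) x = c^-1 * gradnorm G f (kap x).
Proof.
move=> Ux Hf; rewrite /gradnorm.
under eq_bigr do rewrite comp_partial // mulr_sumr.
rewrite exchange_big mulr_sumr; apply: eq_bigr => p _ /=.
rewrite mulrA -gradv_pullback // mulr_suml; apply: eq_bigr => l _; ring.
Qed.

Lemma sqtrace_pullback (S : 'M[R]_n) x : U x ->
  sqtrace (Gt x) (pullback (jac kap x) S) = c^-1 ^+ 2 * sqtrace (G (kap x)) S.
Proof.
move=> Ux; have uJ := jac_unit Ux; have uG := posdef_unit (pG (UV Ux)).
set Jx := jac kap x in uJ *; have uJT : Jx^T \in unitmx by rewrite unitmx_tr.
have iE : invmx (Gt x) *m pullback Jx S = c^-1 *: (invmx Jx^T *m (invmx (G (kap x)) *m S) *m Jx^T).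
  have uc : Gt x \in unitmx := posdef_unit (pGt Ux).
  apply: (can_inj (mulKmx uc)); rewrite mulKVmx // GtE // -/Jx /pullback.
  rewrite -scalemxAr -!scalemxAl scalerA mulVf // scale1r.
  by rewrite -!mulmxA mulKVmx // mulKVmx.
rewrite /sqtrace -mulmxA iE -scalemxAr -scalemxAl scalerA -expr2 linearZ /=.
congr (_ * _); rewrite -!mulmxA [Jx^T *m _]mulmxA mulmxV // mul1mx.
rewrite mxtrace_mulC -!mulmxA mulmxV // mulmx1.
by rewrite !mulmxA.
Qed.
End Pullback.

(** * Minimum principles *)

Lemma cball_compact (R : realType) n (z : 'rV[R]_n) (r : R) :
  compact [set y | `|y - z| <= r].
Proof.
apply: bounded_closed_compact.
  exists (`|z| + `|r|); split; first exact: num_real.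
  move=> M HM y /= yz; apply: (le_trans _ (ltW HM)).
  rewrite -[y](subrK z) addrC (le_trans (ler_normD _ _)) // lerD2l.
  by rewrite (le_trans yz) // ler_norm.
rewrite (_ : [set y | _] = (fun y => `|y - z|) @^-1` [set t | t <= r]) //.
apply: closed_comp; last exact: closed_le.
move=> y _; apply: continuous_comp; last exact: norm_continuous.
by apply: continuousB; [exact: cvg_id|exact: cst_continuous].
Qed.

Section Chain.
Context {R : realType} {n : nat}.
Implicit Types (U : set 'rV[R]_n).

Lemma Ck_intro k U (F : 'rV[R]_n -> R) (g : 'I_n -> 'rV[R]_n -> R) : open U ->
  (forall x, U x -> {for x, continuous F}) ->
  (forall a x, U x -> derivable F x (delta_mx 0 a) /\ partial a F x = g a x) ->
  (forall a, Ck_on k U (g a)) -> Ck_on k.+1 U F.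
Proof.
move=> oU cF dF cg; split => // a; split => [x Ux|]; first by have [] := dF a x Ux.
by apply: (Ck_eq oU _ (cg a)) => y Uy; have [_ ->] := dF a y Uy.
Qed.

Lemma partial_comp1 U (w : 'rV[R]_n -> R) (phi : R -> R) (d : R) x a : open U ->
  Ck_on 1 U w -> U x -> is_derive (w x) 1 phi d ->
  derivable (phi \o w) x (delta_mx 0 a) /\ partial a (phi \o w) x = d * partial a w x.
Proof.
move=> oU cw Ux dphi; have [dw _] := Ck_diff oU cw Ux.
have dp : differentiable phi (w x) by apply/derivable1_diffP; apply: ex_derive.
have dc : differentiable (phi \o w) x by apply: differentiable_comp.
split; first exact: diff_derivable.
rewrite !partialE deriveE // diff_comp //= -[X in 'd phi _ X]deriveE //.
have -> : 'D_(delta_mx 0 a) w x = ('D_(delta_mx 0 a) w x) *: (1 : R) by rewrite -[RHS]/(_ * _) mulr1.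
by rewrite linearZ /= -deriveE // derive_val -[LHS]/(_ * _) mulrC /GRing.scale /= mulr1.
Qed.

Lemma Ck_expR k U (w : 'rV[R]_n -> R) : open U -> Ck_on k U w -> Ck_on k U (expR \o w).
Proof.
move=> oU; elim: k => [|k IH] cw.
  split => // x Ux; apply: continuous_comp; first exact: Ck_cont cw Ux.
  exact: continuous_expR.
have cE := IH (Ck_pred cw).
apply: (@Ck_intro k U _ (fun a x => expR (w x) * partial a w x)) => // [x Ux|a x Ux|a].
- exact: Ck_cont cE Ux.
- exact: (partial_comp1 a oU (Ck_le (isT : (1 <= k.+1)%N) cw) Ux).
- exact: (Ck_mul oU cE (Ck_partial a cw)).
Qed.

Lemma Ck_ln k U (w : 'rV[R]_n -> R) : open U -> (forall x, U x -> 0 < w x) ->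
  Ck_on k U w -> Ck_on k U (@ln R \o w).
Proof.
move=> oU w0 cw; have cln x : U x -> {for x, continuous (@ln R \o w)}.
  move=> Ux; apply: continuous_comp; first exact: Ck_cont cw Ux.
  exact: continuous_ln (w0 _ Ux).
case: k cw => [|k] cw; first by split.
apply: (@Ck_intro k U _ (fun a x => (w x)^-1 * partial a w x)) => // [a x Ux|a].
  apply: (partial_comp1 a oU (Ck_le (isT : (1 <= k.+1)%N) cw) Ux).
  exact: is_derive1_ln (w0 _ Ux).
apply: (Ck_mul oU _ (Ck_partial a cw)); apply: (Ck_inv oU _ (Ck_pred cw)) => x Ux.
by rewrite gt_eqF // w0.
Qed.
End Chain.

Section Operator.
Context {R : realType} {n : nat}.
Variables (U : set 'rV[R]_n) (G : 'rV[R]_n -> 'M[R]_n) (u : 'rV[R]_n -> R).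
Hypothesis mG : metric_on U G.
Hypothesis su : smooth_on U u.
Hypothesis u0 : forall x, U x -> 0 < u x.
Let oU : open U. Proof. by case: mG. Qed.
Let sG k : Ck_mx k U G. Proof. by case: mG. Qed.
Let pG x : U x -> posdef (G x). Proof. by case: mG => _ _; apply. Qed.

Definition Lop (w : 'rV[R]_n -> R) (x : 'rV[R]_n) : R :=
  lap G w x - (u x)^-1 * \sum_a gradv G u a x * partial a w x.

Lemma lap_sum w x : lap G w x = \sum_a \sum_b invmx (G x) a b * hessian_coord G w x b a.
Proof. by apply: eq_bigr => a _; rewrite mxE. Qed.

Lemma Lop_Ck k w : Ck_on k.+2 U w -> Ck_on k U (Lop w).
Proof.
move=> cw; apply: (Ck_subr oU).
  apply: (@Ck_eq _ _ k U (fun x => \sum_a \sum_b invmx (G x) a b * hessian_coord G w x b a) _ oU).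
    by move=> x _; rewrite lap_sum.
  apply: (Ck_sum _ _ oU) => a; apply: (Ck_sum _ _ oU) => b.
  exact: (Ck_mul oU (inv_smooth mG k a b) (hess_Ck mG b a cw)).
apply: (Ck_mul oU).
  by apply: (Ck_inv oU) => [x Ux|]; [rewrite gt_eqF // u0|exact: su].
apply: (Ck_sum _ _ oU) => a; apply: (Ck_mul oU).
  exact: (gradv_Ck mG a (su k.+1)).
exact: (Ck_partial a (Ck_pred cw)).
Qed.

Lemma Lop_local_min w W x : open W -> W `<=` U -> W x -> Ck_on 2 W w ->
  (forall y, W y -> w x <= w y) -> 0 <= Lop w x.
Proof.
move=> oW WU Wx cw H.
have d0 a : partial a w x = 0 by apply: (local_min_partial a oW (Ck_pred cw) Wx H).
rewrite /Lop big1 ?mulr0 ?subr0 => [|a _]; last by rewrite d0 mulr0.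
apply: trace_inv_ge0; first by apply: pG; apply: WU.
move=> v; have -> : hessian_coord G w x = \matrix_(a, b) partial a (partial b w) x.
  apply/matrixP => a b; rewrite !mxE big1 ?subr0 // => k _; by rewrite d0 mulr0.
by rewrite -hessform_mx; apply: (local_min_hess v oW cw Wx H).
Qed.

Lemma hess_lin w1 w2 c x a b : U x -> Ck_on 2 U w1 -> Ck_on 2 U w2 ->
  hessian_coord G (fun y => w1 y + c * w2 y) x a b =
  hessian_coord G w1 x a b + c * hessian_coord G w2 x a b.
Proof.
move=> Ux c1 c2; have E y d : U y -> partial d (fun y => w1 y + c * w2 y) y =
    partial d w1 y + c * partial d w2 y.
  move=> Uy; have c2' := Ck_scale c oU c2.
  rewrite (partialD (Ck_derivable c1 Uy) (Ck_derivable c2' Uy)).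
  by rewrite (partialZ c (Ck_derivable c2 Uy)).
rewrite !mxE (eq_partial a oU Ux (fun y Uy => E y b Uy)).
have c2b := Ck_partial b c2; have c2b' := Ck_scale c oU c2b.
rewrite (partialD (Ck_derivable (Ck_partial b c1) Ux) (Ck_derivable c2b' Ux)).
rewrite (partialZ c (Ck_derivable c2b Ux)).
under eq_bigr do rewrite (E _ _ Ux) mulrDr.
rewrite big_split /= opprD addrACA mulrBr; congr (_ + (_ - _)).
by rewrite mulr_sumr; apply: eq_bigr => k _; rewrite mulrCA.
Qed.

Lemma Lop_lin w1 w2 c x : U x -> Ck_on 2 U w1 -> Ck_on 2 U w2 ->
  Lop (fun y => w1 y + c * w2 y) x = Lop w1 x + c * Lop w2 x.
Proof.
move=> Ux c1 c2; have c2' := Ck_scale c oU c2.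
have E1 : lap G (fun y => w1 y + c * w2 y) x = lap G w1 x + c * lap G w2 x.
  rewrite !lap_sum mulr_sumr -big_split; apply: eq_bigr => a _ /=.
  rewrite mulr_sumr -big_split; apply: eq_bigr => b _ /=.
  by rewrite hess_lin // mulrDr mulrCA.
have E2 : \sum_a gradv G u a x * partial a (fun y => w1 y + c * w2 y) x =
    \sum_a gradv G u a x * partial a w1 x + c * \sum_a gradv G u a x * partial a w2 x.
  rewrite mulr_sumr -big_split; apply: eq_bigr => a _ /=.
  rewrite (partialD (Ck_derivable c1 Ux) (Ck_derivable c2' Ux)).
  by rewrite (partialZ c (Ck_derivable c2 Ux)) mulrDr mulrCA.
by rewrite /Lop E1 E2; ring.
Qed.

(** For [F = phi \o w] the function [A] is [phi'(w)] and [B] is [phi''(w x)]. Stated through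
    derivatives, the lemma covers exponentials, logarithms, squares and constants alike. *)
Lemma Lop_chain F w (A : 'rV[R]_n -> R) (B : R) x : U x -> Ck_on 2 U w -> Ck_on 1 U A ->
  (forall y a, U y -> partial a F y = A y * partial a w y) ->
  (forall a, partial a A x = B * partial a w x) ->
  Lop F x = A x * Lop w x + B * gradnorm G w x.
Proof.
move=> Ux cw cA HF HA.
have H a b : hessian_coord G F x a b =
    A x * hessian_coord G w x a b + B * (partial a w x * partial b w x).
  rewrite !mxE (eq_partial a oU Ux (fun y Uy => HF y b Uy)).
  rewrite (partialM (Ck_derivable cA Ux) (Ck_derivable (Ck_partial b cw) Ux)) HA.
  under eq_bigr do rewrite (HF _ _ Ux) mulrCA.
  by rewrite -mulr_sumr; ring.
have E1 : lap G F x = A x * lap G w x + B * gradnorm G w x.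
  rewrite !lap_sum !mulr_sumr -big_split; apply: eq_bigr => a _ /=.
  rewrite /gradv mulr_suml !mulr_sumr -big_split; apply: eq_bigr => b _ /=.
  by rewrite H; ring.
have E2 : \sum_a gradv G u a x * partial a F x = A x * \sum_a gradv G u a x * partial a w x.
  by rewrite mulr_sumr; apply: eq_bigr => a _; rewrite (HF _ _ Ux) mulrCA.
by rewrite /Lop E1 E2; ring.
Qed.

Lemma gradnorm_form w x : gradnorm G w x =
  ((\row_a partial a w x) *m invmx (G x) *m (\row_a partial a w x)^T) 0 0.
Proof.
rewrite mxE /gradnorm; under [RHS]eq_bigr do rewrite !mxE mulr_suml.
rewrite exchange_big; apply: eq_bigr => a _ /=; rewrite mulr_suml.
by apply: eq_bigr => b _; rewrite !mxE; ring.
Qed.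

Lemma gradnorm_ge0 w x : U x -> 0 <= gradnorm G w x.
Proof. by move=> /pG pGx; rewrite gradnorm_form; apply: inv_form_ge0. Qed.

Lemma gradnorm_eq0 w x a : U x -> gradnorm G w x = 0 -> partial a w x = 0.
Proof.
move=> /pG pGx; rewrite gradnorm_form => /(inv_form_eq0 pGx)/rowP/(_ a).
by rewrite !mxE.
Qed.

Lemma Lop_exp w x : U x -> Ck_on 2 U w ->
  Lop (expR \o w) x = expR (w x) * (Lop w x + gradnorm G w x).
Proof.
move=> Ux cw; have cE : Ck_on 1 U (expR \o w) by apply: Ck_expR => //; apply: Ck_pred.
rewrite mulrDr; apply: (Lop_chain Ux cw cE) => [y a Uy|a].
  exact: (partial_comp1 a oU (Ck_pred cw) Uy (is_derive_expR _)).2.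
exact: (partial_comp1 a oU (Ck_pred cw) Ux (is_derive_expR _)).2.
Qed.

Lemma Lop_ln w x : (forall y, U y -> 0 < w y) -> U x -> Ck_on 2 U w ->
  Lop (@ln R \o w) x = (w x)^-1 * Lop w x - (w x)^-1 ^+ 2 * gradnorm G w x.
Proof.
move=> w0 Ux cw; have wn y : U y -> w y != 0 by move=> Uy; rewrite gt_eqF // w0.
have cA : Ck_on 1 U (fun y => (w y)^-1) by apply: (Ck_inv oU wn); apply: Ck_pred.
rewrite -mulNr; apply: (Lop_chain Ux cw cA) => [y a Uy|a].
  exact: (partial_comp1 a oU (Ck_pred cw) Uy (is_derive1_ln (w0 _ Uy))).2.
have dw : derivable w x (delta_mx 0 a) by apply: Ck_derivable cw Ux.
have /= := deriveV (wn _ Ux) dw.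
rewrite -[LHS]/(partial a (fun y => (w y)^-1) x) => ->.
by rewrite exprVn.
Qed.

Lemma gradnorm_scale w c x : U x -> Ck_on 1 U w ->
  gradnorm G (fun y => c * w y) x = c ^+ 2 * gradnorm G w x.
Proof.
move=> Ux cw; rewrite /gradnorm mulr_sumr; apply: eq_bigr => a _.
rewrite /gradv !mulr_suml mulr_sumr; apply: eq_bigr => b _.
rewrite (partialZ c (Ck_derivable (a := b) cw Ux)) (partialZ c (Ck_derivable (a := a) cw Ux)).
by ring.
Qed.

Lemma Lop_scale w c x : U x -> Ck_on 2 U w -> Lop (fun y => c * w y) x = c * Lop w x.
Proof.
move=> Ux cw; have := Lop_lin c Ux (Ck_cst 2 U 0) cw.
have -> : (fun y => 0 + c * w y) = (fun y => c * w y) by apply/funext => y; rewrite add0r.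
move=> ->; rewrite -[RHS]add0r; congr (_ + _).
have := Lop_lin (-1) Ux (Ck_cst 2 U 0) (Ck_cst 2 U 0).
have -> : (fun y : 'rV[R]_n => 0 + -1 * (0 : R)) = (fun=> 0) by apply/funext => y; rewrite mulr0 addr0.
by rewrite mulN1r subrr.
Qed.

(** The operator applied to the exponential is, up to a positive factor,
    [al ^+ 2 * |D sqdist|^2 - al * L sqdist]. The gradient of [sqdist y] is nonzero away from [y],
    so the quadratic term wins for [al] large. Positivity at the single point [z] suffices, since
    continuity spreads it. *)
Lemma hopf_barrier (y z : 'rV[R]_n) : U z -> z != y ->
  exists2 al : R, 0 < al & 0 < Lop (expR \o (fun x => - al * sqdist y x)) z.
Proof.
move=> Uz zy; have cs k : Ck_on k U (sqdist y) by apply: Ck_sqdist.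
have g0 : 0 < gradnorm G (sqdist y) z.
  rewrite lt0r gradnorm_ge0 // andbT; apply: contra_neq zy => g0.
  apply/rowP => a; have := gradnorm_eq0 a Uz g0; rewrite partial_sqdist => /eqP.
  by rewrite mulf_eq0 pnatr_eq0 /= subr_eq0 => /eqP.
pose al := `|Lop (sqdist y) z| / gradnorm G (sqdist y) z + 1.
have al0 : 0 < al by rewrite ltr_wpDl // divr_ge0 // ltW.
exists al => //; have cw := Ck_scale (- al) oU (cs 2).
rewrite (Lop_exp Uz cw) mulr_gt0 ?expR_gt0 //.
rewrite (Lop_scale _ Uz (cs 2)) (gradnorm_scale _ Uz (cs 1)) sqrrN expr2 -mulrA mulNr addrC -mulrBr.
rewrite mulr_gt0 // subr_gt0 /al mulrDl divfK ?gt_eqF // mul1r.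
by rewrite (le_lt_trans (ler_norm _)) // ltrDl.
Qed.
End Operator.

Lemma touch_arith (R : realType) (p q s : R) : p <= s -> 0 < q -> 2 * p + 2 * s - q < 4 * s.
Proof. lra. Qed.

Lemma barrier_arith1 (R : realType) (e f h k : R) : 0 < e -> h <= 1 -> 0 < k -> e <= f ->
  - e * k < f + - e * h.
Proof. nra. Qed.

Lemma barrier_arith2 (R : realType) (e f h k : R) : 0 < e -> 0 <= f -> h < k ->
  - e * k < f + - e * h.
Proof. nra. Qed.

Lemma closed_within_preimage (T : topologicalType) (R : realType) (f : T -> R)
    (K : set T) (P : set R) : closed K -> (forall x, K x -> {for x, continuous f}) ->
  closed P -> closed (K `&` f @^-1` P).
Proof.
move=> cK cf cP x clx.
have Kx : K x by apply: cK => B /clx[y [[Ky _] By]]; exists y.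
split => //; apply: cP => B fB.
by have /clx[y [[Ky Py] By]] : nbhs x (f @^-1` B) := cf x Kx B fB; exists (f y).
Qed.

Lemma closed_preimage (T : topologicalType) (R : realType) (f : T -> R) (P : set R) :
  (forall x, {for x, continuous f}) -> closed P -> closed (f @^-1` P).
Proof.
move=> cf cP; rewrite -[X in closed X]setTI.
by apply: closed_within_preimage => //; exact: closedT.
Qed.

Lemma close_pos (R : realType) (p q : R) : `|p - q| < q -> 0 < p.
Proof. by rewrite ltr_norml => /andP[+ _]; rewrite ltrBrDl subrr. Qed.

Section StrongMax.
Context {R : realType} {n : nat}.
Variables (U : set 'rV[R]_n) (G : 'rV[R]_n -> 'M[R]_n) (u : 'rV[R]_n -> R).
Hypothesis mG : metric_on U G.
Hypothesis su : smooth_on U u.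
Hypothesis u0 : forall x, U x -> 0 < u x.
Let oU : open U. Proof. by case: mG. Qed.

Lemma Ck_cont_within k (f : 'rV[R]_n -> R) (K : set 'rV[R]_n) :
  Ck_on k U f -> K `<=` U -> {within K, continuous f}.
Proof.
move=> cf KU; apply: continuous_in_subspaceT => x /set_mem /KU Ux.
exact: Ck_cont cf Ux.
Qed.

Lemma sqdist_cont (y x : 'rV[R]_n) : {for x, continuous (sqdist y)}.
Proof. exact: Ck_cont (Ck_sqdist 0 y openT) I. Qed.

Lemma closed_sqdist_le (y : 'rV[R]_n) (r : R) : closed [set x | sqdist y x <= r].
Proof.
have H (x : 'rV[R]_n) : {for x, continuous (sqdist y)} by apply: sqdist_cont.
exact: (@closed_preimage 'rV[R]_n R (sqdist y) [set t | t <= r] H (@closed_le _ r)).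
Qed.

Lemma midpoint_sqdist (y z x : 'rV[R]_n) : let m := 2^-1 *: (y + z) in
  sqdist y x = 2 * sqdist m x + 2 * sqdist m z - sqdist z x /\ sqdist y z = 4 * sqdist m z.
Proof.
move=> m; rewrite /sqdist !mulr_sumr -big_split -sumrB; split; apply: eq_bigr => a _ /=.
  by rewrite !mxE; field.
by rewrite !mxE; field.
Qed.

Lemma norm_dist_le (x y z : 'rV[R]_n) (p q r : R) : `|x - y| <= p -> `|y - z| <= q ->
  p + q <= r -> `|x - z| <= r.
Proof.
move=> xy yz pq; apply: le_trans pq; rewrite (le_trans (ler_distD y _ _)) //.
exact: lerD.
Qed.

(* Hopf's argument without normal derivatives: [z1] is the only zero of [f] on
   a closed ball touching the zero set, so subtracting a small multiple of a
   barrier creates an interior minimum near [z1]. *)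
Lemma strong_min_local (f : 'rV[R]_n -> R) (z0 : 'rV[R]_n) :
  Ck_on 2 U f -> (forall x, U x -> 0 <= f x) -> (forall x, U x -> Lop G u f x <= 0) ->
  U z0 -> f z0 = 0 ->
  exists2 r : R, 0 < r & forall y : 'rV[R]_n, `|y - z0| < r -> f y = 0.
Proof.
move=> cf f0 Lf Uz0 fz0.
have [rho0 rho00 Hrho0] := open_ball_in oU Uz0.
pose rho := rho0 / 2; have rho_gt0 : 0 < rho by rewrite divr_gt0.
have BU (x : 'rV[R]_n) : `|x - z0| <= rho -> U x.
  by move=> xz; apply: Hrho0; rewrite (le_lt_trans xz) // /rho ltr_pdivrMr // mulr_natr mulr2n ltrDl.
(* The factor [n + 1] compensates between the sup norm and [sqdist]: it puts every such [y] at
   Euclidean distance less than [rho / 2] from [z0]. *)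
pose r := rho / 2 / n.+1%:R; have r0 : 0 < r by rewrite !divr_gt0.
have rrho : r <= rho / 2 by rewrite ler_pdivrMr // ler_peMr ?ler1n // ltW // divr_gt0.
exists r => // y yz0; apply: contrapT => fy.
have Uy : U y by apply: BU; rewrite ltW // (lt_le_trans yz0) // (le_trans rrho) // ler_pdivrMr // ler_peMr ?ler1n // ltW.
have fy0 : 0 < f y by rewrite lt0r f0 // andbT; apply/eqP.
pose Z := [set x | `|x - z0| <= rho] `&` f @^-1` [set 0].
have Zc : compact Z.
  apply: (subclosed_compact _ (@cball_compact R n z0 rho)); last by move=> x [].
  apply: closed_within_preimage; last exact: closed_eq.
    exact: compact_closed (@norm_hausdorff _ _) (@cball_compact R n z0 rho).
  by move=> x /BU; exact: Ck_cont cf.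
(* [z1] is a zero of [f] nearest to [y]. Points nearer to [y] than [z1] stay in the large ball
   around [z0], so [f] is positive there. *)
have [z1 z1Z z1min] : exists2 z1, z1 \in Z & forall t, t \in Z -> sqdist y z1 <= sqdist y t.
  apply: compact_EVT_min => //; first by exists z0; split => //=; rewrite subrr normr0 ltW.
  by apply: continuous_in_subspaceT => x _; apply: sqdist_cont.
have [z1B fz1] : `|z1 - z0| <= rho /\ f z1 = 0 by move: z1Z; rewrite inE => -[].
have Uz1 := BU _ z1B.
have dz0 : sqdist y z0 < (rho / 2) ^+ 2.
  apply: (le_lt_trans (sqdist_le _ _)); rewrite distrC.
  have yr : `|y - z0| ^+ 2 <= r ^+ 2 by rewrite lerXn2r ?nnegrE ?(ltW r0) // ltW.
  have rn : rho / 2 = n.+1%:R * r by rewrite /r [RHS]mulrC divfK // pnatr_eq0.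
  apply: (@le_lt_trans _ _ (n%:R * r ^+ 2)); first by rewrite ler_wpM2l.
  have -> : (rho / 2) ^+ 2 = n.+1%:R ^+ 2 * r ^+ 2 by rewrite rn exprMn.
  rewrite (ltr_pM2r (exprn_gt0 2 r0)) -natrX ltr_nat.
  by rewrite (leq_trans (ltnSn n)) // -{1}[n.+1]expn1 leq_pexp2l.
have dz1 : sqdist y z1 < (rho / 2) ^+ 2.
  apply: le_lt_trans dz0; apply: z1min; rewrite inE; split => //=.
  by rewrite subrr normr0 ltW.
have rho2 : 0 < rho / 2 by rewrite divr_gt0.
have inside x : sqdist y x < sqdist y z1 -> 0 < f x.
  move=> xz1; have xB : `|x - z0| <= rho.
    apply: (norm_dist_le (y := y) (p := rho / 2) (q := rho / 2)).
    - by rewrite ltW // sqdist_lt // (lt_trans xz1).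
    - by rewrite (le_trans (ltW yz0)).
    - by rewrite -splitr.
  rewrite lt0r f0 ?andbT; last exact: BU.
  apply/eqP => fx; have : sqdist y z1 <= sqdist y x by apply: z1min; rewrite inE.
  by rewrite leNgt xz1.
have z1y : z1 != y by apply: contraTneq fy0 => <-; rewrite fz1 ltxx.
(* The ball centred at the midpoint [y'] and passing through [z1] lies in the ball around [y] and
   meets its boundary sphere only at [z1], which makes [z1] the only zero in the smaller closed
   ball. *)
pose y' := 2^-1 *: (y + z1); pose R2 := sqdist y' z1.
have z1y' : z1 != y'.
  apply: contra_neq z1y => zy; apply: (sqdist_eq0 (y0 := y)).
  by rewrite (midpoint_sqdist y z1 z1).2 -/y' -zy sqdist_self mulr0.
have touch x : sqdist y' x <= R2 -> x != z1 -> 0 < f x.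
  move=> xR xz; apply: inside; rewrite (midpoint_sqdist y z1 x).1 (midpoint_sqdist y z1 x).2.
  have : 0 < sqdist z1 x.
    by rewrite lt0r sqdist_ge0 andbT; apply: contra_neq xz => /sqdist_eq0.
  rewrite -/y' -/R2; exact: touch_arith.
have [al al0 HL] := hopf_barrier u mG Uz1 z1y'.
set H := expR \o _ in HL.
have cH k : Ck_on k U H by apply: Ck_expR => //; apply: Ck_scale => //; apply: Ck_sqdist.
have [d1 d10 Hd1] := (continuous_eps _ _).1 (Ck_cont (Lop_Ck mG su u0 (cH 2)) Uz1) _ HL.
have [d2 d20 Hd2] := open_ball_in oU Uz1.
pose s := Num.min d1 d2 / 2.
have d12 : 0 < Num.min d1 d2 by rewrite lt_min d10 d20.
have s0 : 0 < s by rewrite divr_gt0.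
have sd : s < Num.min d1 d2 by rewrite /s ltr_pdivrMr // mulr_natr mulr2n ltrDl.
have B1U x : `|x - z1| <= s -> U x /\ 0 < Lop G u H x.
  move=> xs; have := le_lt_trans xs sd; rewrite lt_min => /andP[/Hd1 h1 /Hd2 h2].
  by split; [exact: h2|exact: close_pos h1].
have H1 x : H x <= 1.
  rewrite /H /= -expR0 ler_expR mulNr oppr_le0 mulr_ge0 ?sqdist_ge0 //; exact: ltW.
have H0 x : 0 < H x by apply: expR_gt0.
pose K := [set x : 'rV[R]_n | `|x - z1| <= s].
have cK : compact K := @cball_compact R n z1 s.
(* Away from [z1], the part of the small neighbourhood lying in the ball around [y'] is compact and
   free of zeros; this fixes the size [e] of the perturbation. *)
pose Sp := K `&` ([set x | s <= `|x - z1|] `&` [set x | sqdist y' x <= R2]).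
have cSp : compact Sp.
  apply: (subclosed_compact _ cK); last by move=> x [].
  apply: closedI; first exact: compact_closed (@norm_hausdorff _ _) cK.
  apply: closedI.
    have cn (x : 'rV[R]_n) : {for x, continuous (fun x : 'rV[R]_n => `|x - z1|)}.
      apply: continuous_comp; last exact: norm_continuous.
      by apply: continuousB; [exact: cvg_id|exact: cst_continuous].
    exact: (@closed_preimage 'rV[R]_n R _ [set t | s <= t] cn (@closed_ge _ s)).
  exact: closed_sqdist_le.
have [e e0 He] : exists2 e : R, 0 < e & forall x, Sp x -> e <= f x.
  have [Sp0|/set0P/negP] := pselect (Sp !=set0); last first.
    by rewrite negbK => /eqP ->; exists 1.
  have [c cS cmin] := compact_EVT_min Sp0 cSp
    (Ck_cont_within cf (fun x (Sx : Sp x) => (B1U x Sx.1).1)).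
  exists (f c) => [|x Sx]; last by apply: cmin; rewrite inE.
  move: cS; rewrite inE => -[_ [cs cR]]; apply: touch => //.
  by apply: contraTneq cs => ->; rewrite /= subrr normr0 -ltNge.
have cw : Ck_on 2 U (fun x => f x + - e * H x) := Ck_add oU cf (Ck_scale (- e) oU (cH 2)).
have Kz1 : K z1 by rewrite /K /= subrr normr0 ltW.
have [p pK pmin] := compact_EVT_min (ex_intro _ z1 Kz1) cK
    (Ck_cont_within cw (fun x (Kx : K x) => (B1U x Kx).1)).
have pK' : K p by rewrite inE in pK.
have pz1 : f p + - e * H p <= - e * H z1.
  by have := pmin z1; rewrite inE fz1 add0r; apply.
(* At the rim either [p] is in the ball around [y'], where [f >= e] dominates the barrier, or it is
   outside, where the barrier is below its value at [z1]. In both cases [p] would have a larger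
   value than [z1]. *)
have ps : `|p - z1| < s.
  rewrite ltNge; apply/negP => sp; move: pz1; apply/negP; rewrite -ltNge.
  have fp0 : 0 <= f p := f0 _ (B1U p pK').1.
  have [pR|pR] := leP (sqdist y' p) R2.
    have ep : e <= f p by apply: He.
    exact: barrier_arith1 e0 (H1 p) (H0 z1) ep.
  have Hp : H p < H z1 by rewrite /H /= ltr_expR !mulNr ltrN2 ltr_pM2l.
  exact: barrier_arith2.
pose W := [set x : 'rV[R]_n | `|x - z1| < s].
have oW : open W.
  apply: open_of_balls => x xW; exists (s - `|x - z1|) => [|v vx]; first by rewrite subr_gt0.
  by rewrite /W /= (le_lt_trans (ler_distD x _ _)) // -ltrBrDr.
have WK : W `<=` K by move=> x /ltW.
have := Lop_local_min u mG oW (fun x Wx => (B1U x (WK x Wx)).1) ps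
   (Ck_sub (fun x Wx => (B1U x (WK x Wx)).1) cw)
   (fun x Wx => pmin x (mem_set (WK x Wx))).
have [Up LHp] := B1U p pK'.
rewrite (Lop_lin u mG (- e) Up cf (cH 2)) leNgt mulNr subr_lt0 => /negP; apply.
by rewrite (le_lt_trans (Lf _ Up)) // mulr_gt0.
Qed.
End StrongMax.

(** * The static equations in a chart *)

Section StaticLocal.
Context {R : realType} {n : nat}.
Variables (U : set 'rV[R]_n) (G : 'rV[R]_n -> 'M[R]_n) (u : 'rV[R]_n -> R).
Hypothesis mG : metric_on U G.
Hypothesis su : smooth_on U u.
Hypothesis u0 : forall x, U x -> 0 < u x.
Hypothesis ric : forall x, U x ->
  u x *: ricci_coord G x = hessian_coord G u x - (n%:R * u x) *: G x.
Hypothesis hlap : forall x, U x -> lap G u x = n%:R * u x.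
Let oU : open U. Proof. by case: mG. Qed.

Lemma sum_gradv_G x : U x ->
  \sum_a \sum_b gradv G u a x * G x a b * gradv G u b x = gradnorm G u x.
Proof.
move=> Ux; apply: eq_bigr => a _; rewrite -(lower_gradv mG u a Ux) mulr_sumr.
by apply: eq_bigr => b _; rewrite mulrA.
Qed.

(** Bochner gives [2 |D^2u|^2 + 2 n |Du|^2 + 2 Ric(Du, Du)]. The static equation turns the Ricci
    term into [2 D^2u(Du, Du)/u - 2 n |Du|^2], whose first part is removed by the drift. *)
Lemma Lop_gradnorm x : U x ->
  Lop G u (gradnorm G u) x = 2 * sqtrace (G x) (hessian_coord G u x).
Proof.
move=> Ux; rewrite /Lop (bochner mG Ux (su 3)).
have dl a : partial a (lap G u) x = n%:R * partial a u x.
  rewrite (eq_partial a oU Ux (fun y Uy => hlap Uy)) (partialZ _ (Ck_derivable (su 1) Ux)) //.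
under [X in _ + X + _]eq_bigr do rewrite dl mulrCA.
rewrite -mulr_sumr -/(gradnorm G u x).
have un : u x != 0 by rewrite gt_eqF // u0.
have ricE a m : ricci_coord G x a m = (u x)^-1 * hessian_coord G u x a m - n%:R * G x a m.
  have := congr1 (fun M : 'M[R]_n => (u x)^-1 * M a m) (ric Ux).
  by rewrite !mxE mulKf // => ->; rewrite mulrBr -mulrA mulrCA mulKf.
pose HH := \sum_a \sum_m gradv G u a x * hessian_coord G u x a m * gradv G u m x.
have -> : \sum_a \sum_m gradv G u a x * ricci_coord G x a m * gradv G u m x =
   (u x)^-1 * HH - n%:R * gradnorm G u x.
  rewrite -sum_gradv_G // !mulr_sumr -sumrB; apply: eq_bigr => a _ /=.
  by rewrite !mulr_sumr -sumrB; apply: eq_bigr => m _ /=; rewrite ricE; ring.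
have -> : \sum_a gradv G u a x * partial a (gradnorm G u) x = 2 * HH.
  rewrite mulr_sumr; apply: eq_bigr => a _.
  rewrite (partial_gradnorm mG a Ux (su 2)) mulrCA; congr (_ * _); rewrite mulr_sumr.
  apply: eq_bigr => m _; rewrite (hess_sym mG _ _ Ux (su 2)).
  by rewrite [X in _ * X = _]mulrC mulrA.
by ring.
Qed.

(** The term [2 |Du|^2] from the chain rule cancels the drift, so [u^2] is a strict subsolution
    whatever the gradient is. *)
Lemma Lop_sq x : U x -> Lop G u (fun y => u y ^+ 2) x = 2 * n%:R * u x ^+ 2.
Proof.
move=> Ux; have un : u x != 0 by rewrite gt_eqF // u0.
have E y a : U y -> partial a (fun y => u y ^+ 2) y = (2 * u y) * partial a u y.
  move=> Uy; have du : derivable u y (delta_mx 0 a) := Ck_derivable (su 1) Uy.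
  by rewrite (partialM du du) mulr_natl mulr2n mulrDl.
rewrite (Lop_chain u mG Ux (su 2) (Ck_scale 2 oU (su 1)) E (B := 2)) => [|a].
  by rewrite /Lop hlap // -/(gradnorm G u x); field.
by rewrite (partialZ _ (Ck_derivable (su 1) Ux)).
Qed.

(** Completing the square: the trace of the Hessian is [n u], so [u G] is the trace part and the
    cross terms collapse. *)
Lemma sqtrace_traceless x : U x -> sqtrace (G x) (hessian_coord G u x - u x *: G x) =
  sqtrace (G x) (hessian_coord G u x) - n%:R * u x ^+ 2.
Proof.
move=> Ux; have uG : G x \in unitmx by case: mG => _ _ /(_ _ Ux) /posdef_unit.
have E (S : 'M[R]_n) : sqtrace (G x) S = \tr ((invmx (G x) *m S) *m (invmx (G x) *m S)).
  by rewrite /sqtrace mulmxA.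
have := hlap Ux; rewrite /lap !E mulmxBr -scalemxAr mulVmx //.
set A := invmx (G x) *m hessian_coord G u x => trA.
rewrite scalemx1 mulmxBl !mulmxBr mul_mx_scalar !mul_scalar_mx !raddfB /=.
rewrite !mxtraceZ mxtrace_scalar trA -mulr_natl; ring.
Qed.

Lemma Lop_deficit (c : R) x : U x ->
  Lop G u (fun y => u y ^+ 2 - c - gradnorm G u y) x =
  - (2 * sqtrace (G x) (hessian_coord G u x - u x *: G x)).
Proof.
move=> Ux; have cu2 : Ck_on 2 U (fun y => u y ^+ 2) := Ck_mul oU (su 2) (su 2).
have cW : Ck_on 2 U (gradnorm G u).
  apply: (Ck_sum _ _ oU) => a.
  exact: (Ck_mul oU (gradv_Ck mG a (su 3)) (Ck_partial a (su 3))).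
have E1 : (fun y => u y ^+ 2 - c - gradnorm G u y) =
    (fun y => (u y ^+ 2 + (-1) * gradnorm G u y) + (- c) * 1).
  by apply/funext => y; ring.
rewrite E1 (Lop_lin u mG _ Ux (Ck_add oU cu2 (Ck_scale (-1) oU cW)) (Ck_cst 2 U 1)).
rewrite (Lop_lin u mG _ Ux cu2 cW) Lop_sq // Lop_gradnorm // sqtrace_traceless //.
have -> : Lop G u (fun=> 1) x = 0.
  rewrite (Lop_chain u mG (B := 0) Ux (su 2) (Ck_cst 1 U 0)) => [|y a _|a].
  - by rewrite !mul0r addr0.
  - by rewrite (partial_cst a 1 y) mul0r.
  - by rewrite (partial_cst a 0 x) mul0r.
by ring.
Qed.
End StaticLocal.

(** * Charts *)

Lemma line_continuous (R : realType) (V : normedModType R) (z w : V) :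
  continuous (fun t : R => z + t *: w).
Proof.
move=> t; apply/continuous_eps => e e0; have w0 : 0 < `|w| + 1 by rewrite ltr_wpDl.
exists (e / (`|w| + 1)); first exact: divr_gt0.
move=> s; rewrite ltr_pdivlMr // => H; rewrite opprD addrACA subrr add0r -scalerBl normrZ.
by apply: le_lt_trans H; rewrite ler_wpM2l // lerDl.
Qed.

Lemma star_connected (R : realType) n (S : set 'rV[R]_n) (z : 'rV[R]_n) : S z ->
  (forall (x : 'rV[R]_n) (t : R), S x -> 0 <= t <= 1 -> S (z + t *: (x - z))) -> connected S.
Proof.
move=> Sz HS.
pose seg (x : 'rV[R]_n) := (fun t : R => z + t *: (x - z)) @` [set` `[0 : R, 1]].
have -> : S = \bigcup_(x in S) seg x.
  apply/seteqP; split => [x Sx|x [y Sy [t /=]]].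
    exists x => //; exists 1; first by rewrite /= in_itv /= ler01 lexx.
    by rewrite scale1r addrC subrK.
  by rewrite in_itv /= => t01 <-; apply: HS.
apply: bigcup_connected.
  exists z => x _; exists 0; first by rewrite /= in_itv /= ler01 lexx.
  by rewrite scale0r addr0.
move=> x _; apply: connected_continuous_connected; first exact: segment_connected.
exact: continuous_subspaceT (@line_continuous _ _ _ _).
Qed.

Lemma ball_connected (R : realType) n (z : 'rV[R]_n) (r : R) : 0 < r ->
  connected [set x : 'rV[R]_n | `|x - z| < r].
Proof.
move=> r0; apply: (@star_connected R n _ z) => [|x t /= xr /andP[t0 t1]].
  by rewrite /= subrr normr0.
by rewrite addrC addKr normrZ ger0_norm // (le_lt_trans _ xr) // ler_piMl.
Qed.

Lemma open_norm_ball (R : realType) (V : normedModType R) (z : V) (r : R) :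
  open [set x : V | `|x - z| < r].
Proof.
apply: open_of_balls => x xW; exists (r - `|x - z|) => [|v vx]; first by rewrite subr_gt0.
by rewrite /= (le_lt_trans (ler_distD x _ _)) // -ltrBrDr.
Qed.

(** Relative openness and closedness are asked for point by point, which is the form in which local
    arguments, such as the strong minimum principle or uniqueness of solutions, deliver them. *)
Lemma connected_clopen (T : topologicalType) (N Z : set T) : connected N -> Z !=set0 ->
  Z `<=` N -> (forall p, Z p -> nbhs p [set q | N q -> Z q]) ->
  (forall p, N p -> ~ Z p -> nbhs p [set q | ~ Z q]) -> Z = N.
Proof.
move=> cN Z0 ZN oZ cZ; apply: cN => //.
  exists (\bigcup_(U in [set U | open U /\ U `&` N `<=` Z]) U).
    by apply: bigcup_open => U [].
  apply/seteqP; split => [p Zp|p [Np [U [oU UZ] Up]]]; last exact: UZ.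
  split; first exact: ZN.
  have [U [oU Up UH]] : exists U, [/\ open U, U p & U `<=` [set q | N q -> Z q]].
    by have := oZ p Zp; rewrite nbhsE => -[U [oU Up] UH]; exists U.
  by exists U => //; split => // q [Uq Nq]; apply: UH.
exists (closure Z); first exact: closed_closure.
apply/seteqP; split => [p Zp|p [Np clp]]; first by split; [exact: ZN|exact: subset_closure].
apply: contrapT => nZ; have [q [Zq nZq]] := clp _ (cZ p Np nZ); exact: nZq.
Qed.

Lemma jacobianE (R : realType) n (F : 'rV[R]_n -> 'rV[R]_n) x :
  (forall b, differentiable (fun y => F y 0 b) x) -> 'J F x = jac F x.
Proof.
move=> dF; have df := rV_differentiable dF.
apply/matrixP => a b; rewrite [RHS]mxE partialE.
have := derive_mx (diff_derivable df : derivable F x (delta_mx 0 a)); rewrite deriveEjacobian //.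
by rewrite -rowE => /matrixP /(_ 0 b); rewrite !mxE.
Qed.

Section Manifold.
Context {R : realType} {n : nat} {M : topologicalType}.
Variable A : atlas R n M.
Hypothesis sA : smooth_atlas A.
Implicit Types (i j : chart_ix A) (O : set M) (f : M -> R).

Definition chart_on i O : set 'rV[R]_n := chart_img i `&` chart_inv i @^-1` O.

Lemma chart_on_open i O : open O -> open (chart_on i O).
Proof.
move=> oO; rewrite openE => x [Ix Ox].
have h1 : nbhs x (chart_img i) by apply: open_nbhs_nbhs; split => //; apply: atlas_img_open.
have h2 : nbhs x (chart_inv i @^-1` O).
  by apply: (atlas_inv_cont sA Ix); apply: open_nbhs_nbhs.
exact: filterI h1 h2.
Qed.

Lemma chart_imgP i p : chart_dom i p -> chart_img i (chart i p).
Proof. by move=> ip; exists p. Qed.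

Lemma chart_img_dom i x : chart_img i x ->
  chart_dom i (chart_inv i x) /\ chart i (chart_inv i x) = x.
Proof. by move=> [p ip <-]; rewrite (atlas_chartK sA ip). Qed.

Lemma chart_onP i O p : chart_dom i p -> O p -> chart_on i O (chart i p).
Proof.
by move=> ip Op; split; [exact: chart_imgP|rewrite /= (atlas_chartK sA ip)].
Qed.

Lemma chart_on_image i O : chart i @` (chart_dom i `&` O) = chart_on i O.
Proof.
apply/seteqP; split => [_ [p [ip Op] <-]|x [Ix Ox]]; first exact: chart_onP.
by have [d e] := chart_img_dom Ix; exists (chart_inv i x).
Qed.

Definition CkM k O f := forall i, Ck_on k (chart_on i O) (f \o chart_inv i).

Lemma smooth_CkM k f : smooth_fun A f -> CkM k setT f.
Proof. by move=> sf i; apply: Ck_sub (sf i k) => x []. Qed.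

Lemma CkM_sub k O O' f : O' `<=` O -> CkM k O f -> CkM k O' f.
Proof. by move=> OO cf i; apply: Ck_sub (cf i) => x [Ix Ox]; split => //; apply: OO. Qed.

Lemma CkM_cont k O f p : open O -> CkM k O f -> O p -> {for p, continuous f}.
Proof.
move=> oO cf Op; pose i := chart_at A p; have ip := atlas_cover sA p.
have cg : {for p, continuous ((f \o chart_inv i) \o chart i)}.
  apply: continuous_comp; first by apply: atlas_chart_cont.
  exact: Ck_cont (cf i) (chart_onP ip Op).
rewrite /prop_for /continuous_at in cg *.
rewrite /= (atlas_chartK sA ip) in cg; apply: cvg_trans cg.
apply: near_eq_cvg; have := open_nbhs_nbhs (conj (atlas_dom_open sA i) ip).
by apply: filterS => q iq /=; rewrite (atlas_chartK sA iq).
Qed.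

Definition transition i j := chart j \o chart_inv i.

Lemma transition_Ck k i j b : Ck_on k (chart_on i (chart_dom j)) (fun x => transition i j x 0 b).
Proof. by have := atlas_transition sA i j; rewrite chart_on_image => /(_ b k). Qed.

Lemma small_connected p O : open O -> O p ->
  exists W : set M, [/\ open W, W p, W `<=` O & connected W].
Proof.
move=> oO Op; pose i := chart_at A p; have ip := atlas_cover sA p.
have [r r0 Hr] := open_ball_in (@chart_on_open i O oO) (chart_onP ip Op).
pose B := [set x : 'rV[R]_n | `|x - chart i p| < r].
have WE : chart_inv i @` B = chart_dom i `&` chart i @^-1` B.
  apply/seteqP; split => [_ [x Bx <-]|q [iq Bq]].
    by have [d e] := chart_img_dom (Hr _ Bx).1; split => //=; rewrite e.
  by exists (chart i q) => //; rewrite (atlas_chartK sA iq).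
exists (chart_inv i @` B); split.
- rewrite WE openE => q [iq Bq]; apply: filterI.
    exact: open_nbhs_nbhs (conj (atlas_dom_open sA i) iq).
  have := atlas_chart_cont sA iq; apply.
  by apply: open_nbhs_nbhs; split => //; exact: open_norm_ball.
- by exists (chart i p); [rewrite /B /= subrr normr0|rewrite (atlas_chartK sA ip)].
- by move=> _ [x /Hr[_ Ox] <-].
- apply: connected_continuous_connected; first exact: ball_connected.
  apply: continuous_in_subspaceT => x /set_mem /Hr[Ix _]; by apply: atlas_inv_cont.
Qed.

Lemma component_nbhs (B : set M) (x p : M) : open B -> B p -> connected_component B x !=set0 ->
  closure (connected_component B x) p ->
  exists W, [/\ open W, W p & W `<=` connected_component B x].
Proof.
move=> oB Bp N0 clp; have [W [oW Wp WB cW]] := small_connected oB Bp.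
exists W; split => //; have [q [Nq Wq]] := clp W (open_nbhs_nbhs (conj oW Wp)).
move=> w Ww; apply: (connected_component_trans Nq).
by apply: (connected_component_max Wq WB cW).
Qed.

Variable g : metric_field A.
Hypothesis rg : riemannian_metric g.

Definition gloc i (x : 'rV[R]_n) : 'M[R]_n := g i (chart_inv i x).

Lemma metric_on_sub (U V : set 'rV[R]_n) (G : 'rV[R]_n -> 'M[R]_n) : open V -> V `<=` U ->
  metric_on U G -> metric_on V G.
Proof.
move=> oV VU [oU sG pG]; split => // [k a b|x Vx]; last by apply: pG; apply: VU.
exact: Ck_sub VU (sG k a b).
Qed.

Lemma gloc_metric i : metric_on (chart_img i) (gloc i).
Proof.
split; first exact: atlas_img_open.
  by move=> k a b; apply: (metric_smooth rg).
move=> x Ix; have [d _] := chart_img_dom Ix; rewrite /gloc.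
by split; [exact: (Defs.metric_sym rg d)|exact: (metric_pos rg d)].
Qed.

Lemma gloc_metric_on i O : open O -> metric_on (chart_on i O) (gloc i).
Proof.
move=> oO; apply: (metric_on_sub _ _ (gloc_metric i)) => [|x []//].
exact: chart_on_open.
Qed.

Lemma gloc_change i j x : chart_on i (chart_dom j) x ->
  gloc i x = pullback (jac (transition i j) x) (gloc j (transition i j x)).
Proof.
move=> [Ix jx]; have [ix xE] := chart_img_dom Ix.
rewrite /gloc /transition /= (atlas_chartK sA jx) (metric_change rg ix jx) xE.
rewrite jacobianE // => b.
by have [] := Ck_diff (@chart_on_open i _ (atlas_dom_open sA j))
  (transition_Ck 1 i j b) (conj Ix jx).
Qed.

(** * Independence of gradients, Hessians and Laplacians of the chart *)

Section ChangeOfChart.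
Variables (O : set M) (f : M -> R) (i j : chart_ix A) (p : M).
Hypotheses (oO : open O) (cf : CkM 2 O f) (Op : O p) (ip : chart_dom i p) (jp : chart_dom j p).
Let OO := O `&` chart_dom j.
Let oOO : open OO. Proof. by apply: openI => //; apply: atlas_dom_open. Qed.
Let W := chart_on i OO.
Let V := chart_on j O.
Let kap := transition i j.
Let Wp : W (chart i p). Proof. exact: chart_onP. Qed.
Let kapV x : W x -> V (kap x).
Proof.
move=> [Ix [Ox jx]]; rewrite /kap /transition /=; exact: chart_onP.
Qed.
Let kapC b : Ck_on 2 W (fun x => kap x 0 b).
Proof. by apply: Ck_sub (transition_Ck 2 i j b) => x [Ix [Ox jx]]. Qed.
Let mW : metric_on W (gloc i). Proof. exact: gloc_metric_on. Qed.
Let mV : metric_on V (gloc j). Proof. exact: gloc_metric_on. Qed.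
Let GE x : W x -> gloc i x = 1 *: pullback (jac kap x) (gloc j (kap x)).
Proof. by move=> [Ix [Ox jx]]; rewrite scale1r; apply: gloc_change. Qed.
Let fE x : W x -> (f \o chart_inv i) x = ((f \o chart_inv j) \o kap) x.
Proof. by move=> [Ix [Ox jx]]; rewrite /= (atlas_chartK sA jx). Qed.
Let kp : kap (chart i p) = chart j p.
Proof. by rewrite /kap /transition /= (atlas_chartK sA ip). Qed.
Let oW : open W. Proof. exact: chart_on_open. Qed.

Lemma eq_gradv (G : 'rV[R]_n -> 'M[R]_n) (f1 f2 : 'rV[R]_n -> R) (U : set 'rV[R]_n) l x :
  open U -> U x -> (forall y, U y -> f1 y = f2 y) -> gradv G f1 l x = gradv G f2 l x.
Proof.
by move=> oU Ux H; apply: eq_bigr => b _; rewrite (eq_partial b oU Ux H).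
Qed.

Lemma eq_gradnorm (G : 'rV[R]_n -> 'M[R]_n) (f1 f2 : 'rV[R]_n -> R) (U : set 'rV[R]_n) x :
  open U -> U x -> (forall y, U y -> f1 y = f2 y) -> gradnorm G f1 x = gradnorm G f2 x.
Proof.
move=> oU Ux H; apply: eq_bigr => b _.
by rewrite (eq_partial b oU Ux H) (eq_gradv _ _ oU Ux H).
Qed.

Lemma eq_hess (G : 'rV[R]_n -> 'M[R]_n) (f1 f2 : 'rV[R]_n -> R) (U : set 'rV[R]_n) x :
  open U -> U x -> (forall y, U y -> f1 y = f2 y) ->
  hessian_coord G f1 x = hessian_coord G f2 x.
Proof.
move=> oU Ux H; apply/matrixP => a b; rewrite !mxE.
rewrite (eq_partial a oU Ux (fun y Uy => eq_partial b oU Uy H)); congr (_ - _).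
by apply: eq_bigr => k _; rewrite (eq_partial k oU Ux H).
Qed.

Lemma gradnorm_chart : gradnorm (gloc i) (f \o chart_inv i) (chart i p) =
  gradnorm (gloc j) (f \o chart_inv j) (chart j p).
Proof.
rewrite (eq_gradnorm _ oW Wp fE) -kp.
rewrite (gradnorm_pullback mW mV kapV kapC (oner_neq0 _) GE Wp (Ck_pred (cf j))).
by rewrite invr1 mul1r.
Qed.

Lemma hess_chart : hessian_coord (gloc i) (f \o chart_inv i) (chart i p) =
  pullback (jac kap (chart i p)) (hessian_coord (gloc j) (f \o chart_inv j) (chart j p)).
Proof.
rewrite (eq_hess _ oW Wp fE) -kp.
exact: (hess_pullback_mx mW mV kapV kapC (oner_neq0 _) GE Wp (cf j)).
Qed.

Lemma sqtrace_chart : sqtrace (g i p) (hessian_coord (gloc i) (f \o chart_inv i) (chart i p)) =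
  sqtrace (g j p) (hessian_coord (gloc j) (f \o chart_inv j) (chart j p)).
Proof.
have gi : g i p = gloc i (chart i p) by rewrite /gloc (atlas_chartK sA ip).
have gj : g j p = gloc j (kap (chart i p)) by rewrite kp /gloc (atlas_chartK sA jp).
rewrite hess_chart gi gj (sqtrace_pullback mW mV kapV (oner_neq0 _) GE) //.
by rewrite invr1 expr1n mul1r.
Qed.

Lemma lap_chart : lap (gloc i) (f \o chart_inv i) (chart i p) =
  lap (gloc j) (f \o chart_inv j) (chart j p).
Proof.
rewrite /lap hess_chart (GE Wp) scale1r kp /pullback.
set J := jac kap (chart i p); set S := hessian_coord _ _ _; set G := gloc j (chart j p).
have uP : pullback J G \in unitmx.
  by rewrite /G -kp -[pullback _ _]scale1r -(GE Wp); case: mW => _ _ /(_ _ Wp) /posdef_unit.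
have := uP; rewrite /pullback !unitmx_mul => /andP[/andP[uJ uG] uJT].
have -> : invmx (J *m G *m J^T) *m (J *m S *m J^T) = invmx J^T *m (invmx G *m S) *m J^T.
  apply: (can_inj (mulKmx uP)); rewrite mulKVmx // /pullback.
  by rewrite -!mulmxA mulKVmx // mulKVmx.
by rewrite mxtrace_mulC mulKVmx.
Qed.
End ChangeOfChart.
End Manifold.

Lemma posdef_lower (R : realType) n (P : 'M[R]_n) : posdef P ->
  exists2 c : R, 0 < c & forall v : 'rV[R]_n, c * \sum_a v 0 a ^+ 2 <= (v *m P *m v^T) 0 0.
Proof.
move=> /posdef_factor[Q uQ ->].
pose C := \sum_a \sum_i invmx Q i a ^+ 2.
have C0 : 0 <= C by do 2!apply: sumr_ge0 => ? _; apply: sqr_ge0.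
have C1 : 0 < C + 1 by rewrite ltr_wpDl.
exists (C + 1)^-1 => [|v]; first by rewrite invr_gt0.
rewrite mulrC ler_pdivrMr //.
have -> : (v *m (Q *m Q^T) *m v^T) 0 0 = \sum_i (v *m Q) 0 i ^+ 2.
  by rewrite -row_mul_trE trmx_mul !mulmxA.
set S := \sum_i (v *m Q) 0 i ^+ 2; have S0 : 0 <= S by apply: sumr_ge0 => i _; apply: sqr_ge0.
apply: (@le_trans _ _ (S * C)); last by rewrite ler_wpM2l // lerDl.
rewrite mulr_sumr; apply: ler_sum => a _.
have -> : v 0 a = \sum_i (v *m Q) 0 i * invmx Q i a.
  by rewrite -[in LHS](mulmxK uQ v) mxE.
exact: cauchy_schwarz_sum.
Qed.

Lemma pd_min_arith (R : realType) (c S h0 h n : R) : 0 < c -> 0 <= S -> 0 <= n ->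
  c * S <= h0 -> `|h - h0| <= c / (4 * (n + 1)) * (n * S) -> 0 <= h + 2 * - (c / 4) * S.
Proof.
move=> c0 S0 n0 hS; rewrite ler_norml => /andP[+ _].
have : c / (4 * (n + 1)) * (n * S) <= c / 4 * S.
  have -> : c / (4 * (n + 1)) * (n * S) = c / 4 * S * (n / (n + 1)).
    by field; apply: lt0r_neq0; rewrite ltr_wpDl.
  rewrite ler_piMr ?mulr_ge0 ?divr_ge0 ?(ltW c0) //.
  by rewrite ler_pdivrMr ?mul1r ?lerDl // ltr_wpDl.
have : 0 <= c * S by rewrite mulr_ge0 // ltW.
lra.
Qed.

Lemma abs_amgm (R : realType) (x y : R) : `|x * y| <= 2^-1 * (x ^+ 2 + y ^+ 2).
Proof.
have h1 := sqr_ge0 (x - y); have h2 := sqr_ge0 (x + y).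
by rewrite ler_norml; apply/andP; split; nra.
Qed.

Lemma hessform_close (R : realType) n (f : 'rV[R]_n -> R) x x0 (v : 'rV[R]_n) (e : R) :
  (forall a b, `|partial a (partial b f) x - partial a (partial b f) x0| <= e) ->
  `|hessform f x v - hessform f x0 v| <= e * (n%:R * \sum_a v 0 a ^+ 2).
Proof.
move=> H; rewrite /hessform -sumrB (le_trans (ler_norm_sum _ _ _)) //.
have S2 : \sum_a \sum_b (v 0 a ^+ 2 + v 0 b ^+ 2) = 2 * (n%:R * \sum_a v 0 a ^+ 2).
  under eq_bigr do rewrite big_split /= sumr_const card_ord -mulr_natl.
  rewrite big_split /= sumr_const card_ord -mulr_sumr -[X in _ + X]mulr_natl.
  by rewrite [2 * _]mulr_natl mulr2n.
have E : e * (n%:R * \sum_a v 0 a ^+ 2) =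
    \sum_a \sum_b (e * (2^-1 * (v 0 a ^+ 2 + v 0 b ^+ 2))).
  rewrite -[n%:R * _](mulKf (_ : 2 != 0 :> R)) ?pnatr_eq0 // -S2 !mulr_sumr; apply: eq_bigr => a _.
  by rewrite !mulr_sumr.
rewrite E; apply: ler_sum => a _; rewrite -sumrB (le_trans (ler_norm_sum _ _ _)) //.
apply: ler_sum => b _; rewrite -mulrBr normrM mulrC ler_pM //.
exact: abs_amgm.
Qed.

(** The Hessian at [x0] is at least [c]. Near [x0] it loses at most [c / 4] by continuity, and
    subtracting [(c / 4) * sqdist x0] costs another [c / 2]; what is left is nonnegative and
    Taylor's formula applies. *)
Lemma nondegenerate_min (R : realType) n (U : set 'rV[R]_n) (f : 'rV[R]_n -> R) (x0 : 'rV[R]_n) :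
  open U -> Ck_on 2 U f -> U x0 -> (forall a, partial a f x0 = 0) ->
  posdef (\matrix_(a, b) partial a (partial b f) x0) ->
  exists c r : R, [/\ 0 < c, 0 < r &
    forall x : 'rV[R]_n, `|x - x0| < r -> U x /\ f x0 + c * sqdist x0 x <= f x].
Proof.
move=> oU cf Ux0 df0 pH; have [c c0 Hc] := posdef_lower pH.
(* [hessform_close] turns an entrywise error [e] into an error [e * n] on the form, hence the factor
   [n + 1]. *)
pose e := c / (4 * (n%:R + 1)).
have n1 : 0 < n%:R + 1 :> R by rewrite ltr_wpDl.
have e0 : 0 < e by rewrite divr_gt0 // mulr_gt0.
have [r r0 Hr] : exists2 r : R, 0 < r & forall y : 'rV[R]_n, `|y - x0| < r ->
    U y /\ forall a b, `|partial a (partial b f) y - partial a (partial b f) x0| < e.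
  have H1 : nbhs x0 U := open_nbhs_nbhs (conj oU Ux0).
  have H2 : \forall y \near x0, forall a b : 'I_n,
      `|partial a (partial b f) y - partial a (partial b f) x0| < e.
    apply: (@filter_forall _ _ (fun a y => forall b,
      `|partial a (partial b f) y - partial a (partial b f) x0| < e) (nbhs x0) _) => a.
    apply: (@filter_forall _ _ (fun b y =>
      `|partial a (partial b f) y - partial a (partial b f) x0| < e) (nbhs x0) _) => b.
    have cc : {for x0, continuous (partial a (partial b f))}.
      exact: Ck_cont (Ck_partial a (Ck_partial b cf)) Ux0.
    by apply/nbhs_norm_ball; apply: (continuous_eps _ _).1 cc _ e0.
  have H : nbhs x0 (fun y => U y /\ forall a b,
    `|partial a (partial b f) y - partial a (partial b f) x0| < e) :=
    @filterI _ _ (nbhs_filter x0) _ _ H1 H2.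
  by have [d d0 Hd] := (nbhs_norm_ball x0 _).1 H; exists d.
exists (c / 4), r; split => [|//|x xr]; first by rewrite divr_gt0.
split; first by have [] := Hr _ xr.
pose g y := f y + (- (c / 4)) * sqdist x0 y.
have cg : Ck_on 2 U g := Ck_add oU cf (Ck_scale _ oU (Ck_sqdist 2 x0 oU)).
have dg a : partial a g x0 = 0.
  by rewrite (partial_addsq x0 _ a oU (Ck_pred cf) Ux0) df0 subrr !mulr0 addr0.
have seg (t : R) : 0 <= t <= 1 -> `|x0 + t *: (x - x0) - x0| < r.
  move=> /andP[t0 t1]; rewrite addrC addKr normrZ ger0_norm //.
  by rewrite (le_lt_trans _ xr) // ler_piMl.
have [s [t [/andP[s0 s1] /seg tr E]]] := taylor2 oU cg (fun t ht => (Hr _ (seg t ht)).1) dg.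
have Hpos : 0 <= hessform g (x0 + t *: (x - x0)) (x - x0).
  rewrite (hessform_le (x - x0) (fun a b =>
    partial2_addsq x0 (- (c / 4)) a b oU cf (Hr _ tr).1)).
  apply: (@pd_min_arith R c _ (hessform f x0 (x - x0)) _ n%:R) => //.
  - by apply: sumr_ge0 => a _; apply: sqr_ge0.
  - by rewrite hessform_mx; apply: Hc.
  - by apply: hessform_close => a b; apply: ltW; apply: (Hr _ tr).2.
have : 0 <= g x - g x0.
  have -> : x = x0 + (x - x0) by rewrite [x0 + _]addrC subrK.
  by rewrite E; exact: mulr_ge0.
by rewrite /g sqdist_self mulr0 addr0 subr_ge0 mulNr lerBrDr.
Qed.

(** The half-balls on which one coordinate difference is positive all contain [w1]. The opposite
    half-ball for the axis [a] meets the positive one of any other axis at [wa a], and such an axis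
    exists because [n >= 2]. Together they cover the punctured ball. *)
Lemma punctured_ball_connected (R : realType) n (z : 'rV[R]_n) (r : R) : (2 <= n)%N -> 0 < r ->
  connected [set x : 'rV[R]_n | `|x - z| < r /\ x != z].
Proof.
move=> n2 r0.
pose H (s : R) (a : 'I_n) := [set x : 'rV[R]_n | `|x - z| < r /\ 0 < s * (x 0 a - z 0 a)].
have cH s a x0 : H s a x0 -> connected (H s a).
  move=> Hx0; apply: (@star_connected R n _ x0) => // x t [xr xa] /andP[t0 t1].
  have [x0r x0a] := Hx0; split.
    have -> : x0 + t *: (x - x0) - z = (1 - t) *: (x0 - z) + t *: (x - z).
      by apply/rowP => b; rewrite !mxE; ring.
    rewrite (le_lt_trans (ler_normD _ _)) // !normrZ (ger0_norm t0) ger0_norm ?subr_ge0 //.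
    have [->|tn] := eqVneq t 0; first by rewrite subr0 mul1r mul0r addr0.
    have -> : r = (1 - t) * r + t * r by ring.
    rewrite ler_ltD //; first by rewrite ler_wpM2l ?subr_ge0 // ltW.
    by rewrite ltr_pM2l // lt0r tn.
  rewrite !mxE; have -> : s * (x0 0 a + t * (x 0 a - x0 0 a) - z 0 a) =
     (1 - t) * (s * (x0 0 a - z 0 a)) + t * (s * (x 0 a - z 0 a)) by ring.
  have [->|tn] := eqVneq t 0; first by rewrite subr0 mul1r mul0r addr0.
  apply: ltr_wpDl; first by rewrite mulr_ge0 ?subr_ge0 ?(ltW x0a).
  by rewrite mulr_gt0 // lt0r tn.
pose e := r / 2; have e0 : 0 < e by rewrite divr_gt0.
have er : e < r by rewrite /e ltr_pdivrMr // mulr_natr mulr2n ltrDl.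
pose w1 : 'rV[R]_n := z + const_mx e.
pose wa (a : 'I_n) : 'rV[R]_n := z + \row_b (if b == a then - e else e).
have w1r : `|w1 - z| < r.
  rewrite addrC addKr; apply: (le_lt_trans _ er); apply: norm_le_coord => [|b]; first exact: ltW.
  by rewrite mxE gtr0_norm.
have war a : `|wa a - z| < r.
  rewrite addrC addKr; apply: (le_lt_trans _ er); apply: norm_le_coord => [|b]; first exact: ltW.
  by rewrite mxE; case: ifP => _; rewrite ?normrN gtr0_norm.
have Hw1 a : H 1 a w1 by split => //; rewrite !mxE [z 0 a + _]addrC addrK mul1r.
have Hwa a b : b != a -> H 1 b (wa a).
  by move=> /negbTE ba; split => //; rewrite !mxE ba [z 0 b + _]addrC addrK mul1r.
have Hwaa a : H (-1) a (wa a).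
  by split => //; rewrite !mxE eqxx [z 0 a + _]addrC addrK mulrNN mul1r.
pose C := \bigcup_(a in [set: 'I_n]) H 1 a.
have cC : connected C.
  apply: bigcup_connected; first by exists w1 => a _; apply: Hw1.
  by move=> a _; apply: (cH 1 a w1).
have other (a : 'I_n) : exists b : 'I_n, b != a.
  have n0 : (0 < n)%N by apply: leq_trans n2.
  have [->|] := eqVneq a (Ordinal n0); last by move=> an; exists (Ordinal n0); rewrite eq_sym.
  by exists (Ordinal n2).
have CE a : connected (C `|` H (-1) a).
  apply: connectedU => //; last exact: (cH (-1) a (wa a)).
  by exists (wa a); split => //; have [b ba] := other a; exists b => //; apply: Hwa.
have -> : [set x : 'rV[R]_n | `|x - z| < r /\ x != z] =
    \bigcup_(a in [set: 'I_n]) (C `|` H (-1) a).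
  apply/seteqP; split => [x [xr xz]|x [a _ [[b _ [xr xb]]|[xr xa]]]].
  - have [a xa] : exists a, x 0 a != z 0 a.
      apply: contrapT => /forallNP Hx; move/eqP: xz; apply; apply/rowP => a.
      by apply/eqP; apply: contrapT => /negP; apply: Hx.
    exists a => //; have [xa0|xa0] := ltP (z 0 a) (x 0 a).
      by left; exists a => //; split => //; rewrite mul1r subr_gt0.
    by right; split => //; rewrite mulN1r opprB subr_gt0 lt_neqAle xa xa0.
  - by split => //; apply: contraTneq xb => ->; rewrite subrr mulr0 ltxx.
  - by split => //; apply: contraTneq xa => ->; rewrite subrr mulr0 ltxx.
have n0 : (0 < n)%N by apply: leq_trans n2.
apply: bigcup_connected => [|a _]; last exact: CE.
by exists w1 => a _; left; exists (Ordinal n0).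
Qed.

(** * Vanishing of the deficit *)

Lemma nbhs_preimage (T T' : topologicalType) (f : T -> T') (P : set T') (x : T) :
  {for x, continuous f} -> open P -> P (f x) -> nbhs x (f @^-1` P).
Proof. by move=> cf oP Px; apply: cf; apply: open_nbhs_nbhs. Qed.

Lemma sq_bound (R : realType) (t : R) : 0 < t -> t <= t ^+ 2 + 1.
Proof. by move=> t0; nra. Qed.

Lemma ln_arith (R : realType) (f d e l : R) : 0 < e -> 0 < f -> l <= - (d / e) -> d <= f - e * l.
Proof.
move=> e0 f0; rewrite lerNr ler_pdivrMr // => H.
by rewrite -mulrN -[d]add0r lerD ?(ltW f0) // mulrC.
Qed.

(** With [q = u^2 - u_min^2], [w = u] and [f = |Du|^2] this is the operator applied to [ln q]. The
    sign comes from [n q - 2 f >= (n - 2) q]. *)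
Lemma lnQ_arith (R : realType) (n : nat) (q w f : R) : (3 <= n)%N -> 0 < q -> 0 < w -> f <= q ->
  0 < q^-1 * (2 * n%:R * w ^+ 2) - q^-1 ^+ 2 * ((2 * w) ^+ 2 * f).
Proof.
move=> n3 q0 w0 fq; have n3' : 3 <= n%:R :> R by rewrite ler_nat.
have -> : q^-1 * (2 * n%:R * w ^+ 2) - q^-1 ^+ 2 * ((2 * w) ^+ 2 * f) =
    2 * (q^-1 * w) ^+ 2 * (n%:R * q - 2 * f) by field; apply: lt0r_neq0.
rewrite mulr_gt0 //; first by rewrite mulr_gt0 // exprn_gt0 // mulr_gt0 // invr_gt0.
by nra.
Qed.

Section Static.
Context {R : realType} {n : nat} {M : topologicalType}.
Variables (A : atlas R n M) (g : metric_field A) (u : M -> R).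
Hypothesis hn : (3 <= n)%N.
Hypothesis hst : static_triple g u.
Let sA : smooth_atlas A. Proof. by case: (static_manifold hst). Qed.
Let hM : hausdorff_space M. Proof. by case: (static_manifold hst). Qed.
Let rg : riemannian_metric g := static_metric hst.
Let su : smooth_fun A u := static_smooth hst.
Let u0 p : 0 < u p := static_pos hst p.
Implicit Types (i j : chart_ix A) (O K : set M) (p q : M).

Lemma open_chart_img i : open (chart_img i).
Proof. exact: atlas_img_open. Qed.

Definition deficit p := u p ^+ 2 - u_min u ^+ 2 - grad_normsq g u p.

Lemma u_cont p : {for p, continuous u}.
Proof. exact: (CkM_cont sA openT (smooth_CkM 0 su)). Qed.

(** If no set of the exhaustion contained the sublevel set, a sequence of its points leaving every
    one of them would have bounded values of [u]. *)
Lemma sublevel_compact (T : R) : compact [set p | u p <= T].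
Proof.
have [K [cK _ Kcov] HK] := static_infinity hst.
have [k Hk] : exists k : nat, [set p | u p <= T] `<=` K k.
  apply: contrapT => /forallNP H.
  have /choice[x Hx] k : exists p, u p <= T /\ ~ K k p.
    by have /existsNP[p /not_implyP[uT nK]] := H k; exists p.
  have /cvgryPgt /(_ T) [N _ HN] := HK x (fun k => (Hx k).2).
  by have := HN N (leqnn N); rewrite /= ltNge (Hx N).1.
apply: (subclosed_compact _ (cK k)) => //.
exact: (closed_preimage (P := [set t | t <= T]) u_cont (@closed_le _ T)).
Qed.

Lemma u_min_attained : exists2 p, u p = u_min u & forall q, u_min u <= u q.
Proof.
have [p0 _] : [set: M] !=set0.
  apply: contrapT => /set0P /negP; rewrite negbK => /eqP E.
  by apply: (static_noncompact hst); rewrite E; apply: compact0.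
have [z zK zmin] : exists2 z, z \in [set p | u p <= u p0] &
    forall t, t \in [set p | u p <= u p0] -> u z <= u t.
  apply: compact_EVT_min; [by exists p0; rewrite /=|exact: sublevel_compact|].
  by apply: continuous_in_subspaceT => x _; apply: u_cont.
have zle q : u z <= u q.
  have [qp|qp] := leP (u q) (u p0); first by apply: zmin; rewrite inE.
  by move: zK; rewrite inE /= => /le_trans; apply; exact: ltW.
have <- : u z = u_min u; last by exists z.
apply/le_anti/andP; split.
  by apply: lb_le_inf; [exists (u z), z|move=> _ [q _ <-]].
by apply: ge_inf; [exists (u z) => _ [q _ <-]|exists z].
Qed.

Lemma u_min_le q : u_min u <= u q.
Proof. by have [_ _] := u_min_attained. Qed.

Lemma u_min_gt0 : 0 < u_min u.
Proof. by have [p <- _] := u_min_attained. Qed.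

Definition uloc i := u \o chart_inv i.

Lemma uloc_gt0 i x : chart_img i x -> 0 < uloc i x.
Proof. by move=> _; apply: u0. Qed.

Lemma ricci_loc i x : chart_img i x -> uloc i x *: ricci_coord (gloc g i) x =
  hessian_coord (gloc g i) (uloc i) x - (n%:R * uloc i x) *: gloc g i x.
Proof.
move=> Ix; have [d e] := chart_img_dom sA Ix.
by have := static_ric hst d; rewrite /ricci /hessian e.
Qed.

Lemma laplacian_loc i x : chart_img i x -> lap (gloc g i) (uloc i) x = n%:R * uloc i x.
Proof.
move=> Ix; have [d e] := chart_img_dom sA Ix; set p := chart_inv i x in d e.
rewrite -e /uloc (lap_chart sA rg openT (smooth_CkM 2 su) I d (atlas_cover sA p)).
rewrite [RHS]/= e -/p -(static_lap hst p) /laplacian /lap /hessian.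
by rewrite /gloc (atlas_chartK sA (atlas_cover sA p)).
Qed.

Lemma grad_normsq_loc i p : chart_dom i p ->
  grad_normsq g u p = gradnorm (gloc g i) (uloc i) (chart i p).
Proof.
move=> ip; rewrite (gradnorm_chart sA rg openT (smooth_CkM 2 su) I ip (atlas_cover sA p)).
by rewrite gradnorm_form /grad_normsq /gloc (atlas_chartK sA (atlas_cover sA p)).
Qed.

Lemma deficit_loc i x : chart_img i x -> (deficit \o chart_inv i) x =
  uloc i x ^+ 2 - u_min u ^+ 2 - gradnorm (gloc g i) (uloc i) x.
Proof.
by move=> Ix; have [d e] := chart_img_dom sA Ix; rewrite /= /deficit (grad_normsq_loc d) e.
Qed.

Lemma deficit_Ck k : CkM A k setT deficit.
Proof.
move=> i; have oI := @open_chart_img i.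
have mG := gloc_metric sA rg i.
have H : Ck_on k (chart_img i) (fun x => uloc i x ^+ 2 - u_min u ^+ 2 -
    gradnorm (gloc g i) (uloc i) x).
  apply: (Ck_subr oI).
    by apply: (Ck_subr oI); [exact: (Ck_mul oI (su i k) (su i k))|exact: Ck_cst].
  apply: (Ck_sum _ _ oI) => a.
  exact: (Ck_mul oI (gradv_Ck mG a (su i k.+1)) (Ck_partial a (su i k.+1))).
by apply: (Ck_sub _ (Ck_eq oI (fun x Ix => esym (deficit_loc Ix)) H)) => x [].
Qed.

Lemma deficit_cont p : {for p, continuous deficit}.
Proof. exact: (CkM_cont sA openT (deficit_Ck 0)). Qed.

Definition MLop (w : M -> R) i x := Lop (gloc g i) (uloc i) (w \o chart_inv i) x.

Lemma MLop_deficit i x : chart_img i x -> MLop deficit i x =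
  - (2 * sqtrace (gloc g i x) (hessian_coord (gloc g i) (uloc i) x - uloc i x *: gloc g i x)).
Proof.
move=> Ix; have oI := @open_chart_img i.
have mG := gloc_metric sA rg i.
rewrite -(Lop_deficit mG (su i) (@uloc_gt0 i) (@ricci_loc i) (@laplacian_loc i) (u_min u ^+ 2) Ix).
rewrite /MLop /Lop /lap (eq_hess _ oI Ix (@deficit_loc i)); congr (_ - _ * _).
by apply: eq_bigr => a _; rewrite (eq_partial a oI Ix (@deficit_loc i)).
Qed.

Lemma traceless_sym i x : chart_img i x ->
  (hessian_coord (gloc g i) (uloc i) x - uloc i x *: gloc g i x)^T =
  hessian_coord (gloc g i) (uloc i) x - uloc i x *: gloc g i x.
Proof.
move=> Ix; have mG := gloc_metric sA rg i; have [_ _ /(_ _ Ix) [sG _]] := mG.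
rewrite linearB linearZ /= sG; congr (_ - _).
by apply/matrixP => a b; rewrite mxE; exact: (hess_sym mG _ _ Ix (su i 2)).
Qed.

Lemma MLop_deficit_le0 i x : chart_img i x -> MLop deficit i x <= 0.
Proof.
move=> Ix; rewrite MLop_deficit // oppr_le0 mulr_ge0 //.
by apply: sqtrace_ge0 (traceless_sym Ix); have [_ _ /(_ _ Ix)] := gloc_metric sA rg i.
Qed.

(** At a minimum the operator is nonnegative, but it is at most zero on the deficit and positive on
    [w]. This is applied to the two strict subsolutions [u^2] and [ln (u^2 - u_min^2)]. *)
Lemma no_interior_min O (w : M -> R) (e : R) p : open O -> O p -> CkM A 2 O w -> 0 < e ->
  0 < MLop w (chart_at A p) (chart (chart_at A p) p) ->
  (forall q, O q -> deficit p - e * w p <= deficit q - e * w q) -> False.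
Proof.
set i := chart_at A p => oO Op cw e0 Lw H; have ip : chart_dom i p := atlas_cover sA p.
have mG := gloc_metric_on sA rg i oO; set U := chart_on i O in mG.
have oU : open U by case: mG.
have Up : U (chart i p) by apply: chart_onP.
have cF : Ck_on 2 U (deficit \o chart_inv i) := CkM_sub (@subsetT _ O) (deficit_Ck 2) i.
have : 0 <= Lop (gloc g i) (uloc i) (fun y => (deficit \o chart_inv i) y +
    - e * (w \o chart_inv i) y) (chart i p).
  apply: (@Lop_local_min R n U (gloc g i) (uloc i) mG _ U (chart i p) oU (@subset_refl _ U) Up
    (Ck_add oU cF (Ck_scale (- e) oU (cw i)))) => y [Iy Oy].
  by rewrite /= (atlas_chartK sA ip) !mulNr; exact: H.
rewrite (Lop_lin _ mG (- e) Up cF (cw i)) leNgt mulNr => /negP; apply.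
by rewrite subr_lt0 (le_lt_trans (MLop_deficit_le0 (chart_imgP ip))) // mulr_gt0.
Qed.

Lemma MLop_sq i x : chart_img i x -> MLop (fun p => u p ^+ 2) i x = 2 * n%:R * uloc i x ^+ 2.
Proof.
move=> Ix.
exact: (Lop_sq (gloc_metric sA rg i) (su i) (@uloc_gt0 i) (@laplacian_loc i) Ix).
Qed.

Lemma sq_CkM k : CkM A k setT (fun p => u p ^+ 2).
Proof.
move=> i; have oI := @open_chart_img i.
by apply: (Ck_sub _ (Ck_mul oI (su i k) (su i k))) => x [].
Qed.

(** * A component of the complement of the minimum set *)

Section Component.
Variable N : set M.
Hypothesis hN : is_component (~` MINset u) N.

Lemma nMIN_open : open (~` MINset u).
Proof.
apply: closed_openC; exact: (closed_preimage (P := [set u_min u]) u_cont (@closed_eq _ _)).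
Qed.

Lemma nMIN p : (~` MINset u) p -> u_min u < u p.
Proof. by move=> H; rewrite lt_neqAle u_min_le andbT; apply/eqP => E; apply: H. Qed.

Lemma N_sub : N `<=` ~` MINset u.
Proof. by case: hN => x _ ->; apply: connected_component_sub. Qed.

Lemma N_connected : connected N.
Proof. by case: hN => x _ ->; apply: component_connected. Qed.

Lemma N_nonempty : N !=set0.
Proof. by case: hN => x Bx ->; exists x; apply: connected_component_refl. Qed.

Lemma N_nbhs p : (~` MINset u) p -> closure N p -> exists W, [/\ open W, W p & W `<=` N].
Proof.
case: hN => x Bx NE; rewrite NE => Bp clp.
apply: (component_nbhs sA nMIN_open Bp _ clp).
by exists x; apply: connected_component_refl.
Qed.

Lemma N_open : open N.
Proof.
rewrite openE => p Np; have [W [oW Wp WN]] := N_nbhs (N_sub Np) (subset_closure Np).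
by apply: filterS WN _; apply: open_nbhs_nbhs.
Qed.

Lemma closureN_MIN p : closure N p -> ~ N p -> u p = u_min u.
Proof.
move=> clp nNp; apply: contrapT => Bp.
by have [W [_ Wp WN]] := N_nbhs Bp clp; apply: nNp; apply: WN.
Qed.

Lemma MIN_grad p : u p = u_min u -> grad_normsq g u p = 0.
Proof.
move=> up; pose i := chart_at A p; have ip : chart_dom i p := atlas_cover sA p.
rewrite (grad_normsq_loc ip); apply: big1 => a _.
rewrite (local_min_partial a (@open_chart_img i) (su i 1) (chart_imgP ip)) ?mulr0 //.
by move=> y _; rewrite /uloc /= (atlas_chartK sA ip) up u_min_le.
Qed.

Lemma MIN_deficit p : u p = u_min u -> deficit p = 0.
Proof. by move=> up; rewrite /deficit (MIN_grad up) up subrr subr0. Qed.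

Lemma closure_N_compact (T : R) : compact (closure N `&` [set p | u p <= T]).
Proof.
apply: (subclosed_compact _ (@sublevel_compact T)); last by move=> p [].
apply: closedI; first exact: closed_closure.
exact: (closed_preimage (P := [set t | t <= T]) u_cont (@closed_le _ T)).
Qed.

(** The hypothesis is the unfolded form of a nonnegative liminf. The deficit minus a small multiple
    of [u^2] is minimised over the part of the closure of [N] below a high level: the boundary of
    [N] is excluded because the deficit vanishes there, the top level because it lies outside [K],
    and the interior by [no_interior_min]. *)
Lemma deficit_ge0 : (forall e : R, 0 < e ->
    exists2 K, compact K & forall p, N p -> ~ K p -> - e < deficit p) ->
  forall p, N p -> 0 <= deficit p.
Proof.
move=> H p0 Np0; rewrite leNgt; apply/negP => Fp0.
pose e := - deficit p0 / 2; have e0 : 0 < e by rewrite divr_gt0 ?oppr_gt0.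
have E2 : deficit p0 = - (e + e) by rewrite -splitr opprK.
have [K cK HK] := H _ e0.
have [T0 KT] : exists T0, K `<=` [set p | u p <= T0].
  have [K0|/set0P/negP] := pselect (K !=set0); last first.
    by rewrite negbK => /eqP ->; exists 0.
  have [c _ Hc] := @compact_EVT_max _ _ u _ K0 cK (continuous_in_subspaceT (fun x _ => @u_cont x)).
  by exists (u c) => q Kq; apply: Hc; rewrite inE.
(* The extra [1] puts the level [u = T] strictly above all values on [K], so the hypothesis applies
   on it. *)
pose T := Num.max (u p0) (T0 + 1).
have T00 : 0 < T by rewrite lt_max u0.
(* Below level [T] the perturbation is at most [e / 2], so a minimum of [h] still has a deficit
   below [- e]. *)
pose d := e / (2 * T ^+ 2).
have d0 : 0 < d by rewrite divr_gt0 // mulr_gt0 // exprn_gt0.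
pose h q := deficit q - d * u q ^+ 2.
have hT q : u q <= T -> deficit q - e < h q.
  move=> uT; rewrite ltrD2l ltrN2; apply: (@le_lt_trans _ _ (d * T ^+ 2)).
    by rewrite ler_wpM2l ?(ltW d0) // lerXn2r ?nnegrE // ltW.
  have -> : d * T ^+ 2 = e / 2 by rewrite /d; field; apply: lt0r_neq0.
  by rewrite ltr_pdivrMr // mulr_natr mulr2n ltrDl.
have hcont q : {for q, continuous h}.
  by apply: (CkM_cont sA openT _ I (k := 0)) => i; apply: (Ck_subr _ (deficit_Ck 0 i) (Ck_scale d _ (sq_CkM 0 i))); apply: chart_on_open => //; exact: openT.
have [z zC zmin] : exists2 z, z \in closure N `&` [set p | u p <= T] &
    forall t, t \in closure N `&` [set p | u p <= T] -> h z <= h t.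
  apply: compact_EVT_min; [|exact: closure_N_compact|].
    by exists p0; split; [exact: subset_closure|rewrite /= le_max lexx].
  by apply: continuous_in_subspaceT => x _; apply: hcont.
move: zC; rewrite inE => -[clz uz].
have hz : h z <= deficit p0.
  apply: (@le_trans _ _ (h p0)); last first.
    by rewrite gerBl mulr_ge0 ?(ltW d0) // ltW // exprn_gt0.
  by apply: zmin; rewrite inE; split; [exact: subset_closure|rewrite /= le_max lexx].
have Fz : deficit z < - e.
  by have := lt_le_trans (hT z uz) hz; rewrite E2 opprD ltrD2r.
have Nz : N z.
  apply: contrapT => nNz; move: Fz; rewrite (MIN_deficit (closureN_MIN clz nNz)).
  by rewrite oppr_gt0 ltNge (ltW e0).
have uzT : u z < T.
  rewrite lt_neqAle uz andbT; apply/eqP => uzT; have nKz : ~ K z.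
    by move=> /KT; rewrite /= uzT leNgt /T lt_max ltrDl ltr01 orbT.
  by have := HK z Nz nKz; rewrite ltNge (ltW Fz).
pose O := N `&` [set p | u p < T].
have oO : open O.
  apply: openI; first exact: N_open.
  by have := open_comp (D := [set t : R | t < T]) (fun x _ => @u_cont x) (@open_lt _ T).
apply: (@no_interior_min O (fun p => u p ^+ 2) d z) => //.
- exact: CkM_sub (@subsetT _ O) (sq_CkM 2).
- rewrite MLop_sq; last exact: chart_imgP (atlas_cover sA z).
  rewrite mulr_gt0 ?exprn_gt0 ?mulr_gt0 ?ltr0n //; last exact: uloc_gt0 (chart_imgP (atlas_cover sA z)).
  exact: leq_trans hn.
- move=> q [Nq uq]; apply: zmin; rewrite inE; split; first exact: subset_closure.
  exact: ltW.
Qed.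

Hypothesis F0 : forall p, N p -> 0 <= deficit p.

Let Q p := u p ^+ 2 - u_min u ^+ 2.

Lemma Q_gt0 p : N p -> 0 < Q p.
Proof.
by move=> /N_sub /nMIN Hp; rewrite subr_gt0 ltrXn2r ?nnegrE ?(ltW u_min_gt0) // ltW.
Qed.

Lemma Q_CkM k : CkM A k setT Q.
Proof.
by move=> i; apply: (Ck_subr _ (sq_CkM k i) (Ck_cst _ _ _)); apply: chart_on_open => //; exact: openT.
Qed.

Lemma MLop_lnQ_gt0 p : N p ->
  0 < MLop (@ln R \o Q) (chart_at A p) (chart (chart_at A p) p).
Proof.
move=> Np; set i := chart_at A p; have ip : chart_dom i p := atlas_cover sA p.
have mG := gloc_metric_on sA rg i N_open; set U := chart_on i N in mG.
have oU : open U by case: mG.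
have Up : U (chart i p) by apply: chart_onP.
have cQ : Ck_on 2 U (Q \o chart_inv i) := CkM_sub (@subsetT _ N) (Q_CkM 2) i.
have csq : Ck_on 2 U (fun y => uloc i y ^+ 2) := CkM_sub (@subsetT _ N) (sq_CkM 2) i.
have Q0 x : U x -> 0 < (Q \o chart_inv i) x by move=> [_ Nx]; apply: Q_gt0.
rewrite /MLop (_ : (@ln R \o Q) \o chart_inv i = @ln R \o (Q \o chart_inv i)) //.
have cu : Ck_on 1 U (uloc i) := Ck_sub (fun x (Ux : U x) => Ux.1) (su i 1).
rewrite (Lop_ln (uloc i) mG Q0 Up cQ).
set x := chart i p in Up *.
have Ix : chart_img i x by case: Up.
have QE : Q \o chart_inv i = (fun y => uloc i y ^+ 2 + (- u_min u ^+ 2) * 1).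
  by apply/funext => y; rewrite mulr1.
have LQ : Lop (gloc g i) (uloc i) (Q \o chart_inv i) x = 2 * n%:R * uloc i x ^+ 2.
  rewrite QE (Lop_lin _ mG _ Up csq (Ck_cst 2 U 1)).
  have -> : Lop (gloc g i) (uloc i) (fun=> 1) x = 0.
    rewrite (Lop_chain (uloc i) mG (B := 0) Up (CkM_sub (@subsetT _ N) (smooth_CkM 2 su) i) (Ck_cst 1 U 0)).
    - by rewrite !mul0r addr0.
    - by move=> y a _; rewrite (partial_cst a 1 y) mul0r.
    - by move=> a; rewrite (partial_cst a 0 x) mul0r.
  by rewrite mulr0 addr0; exact: MLop_sq Ix.
have dQ a : partial a (Q \o chart_inv i) x = 2 * uloc i x * partial a (uloc i) x.
  have du : derivable (uloc i) x (delta_mx 0 a) := Ck_derivable cu Up.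
  have du2 : derivable (fun y => uloc i y ^+ 2) x (delta_mx 0 a) := Ck_derivable (Ck_pred csq) Up.
  have d1 : derivable (fun=> (- u_min u ^+ 2) * 1 : R) x (delta_mx 0 a) := Ck_derivable (Ck_cst 1 U _) Up.
  rewrite QE (partialD du2 d1) (partial_cst a _ x) addr0 (partialM du du).
  by rewrite mulr_natl mulr2n mulrDl.
have GQ : gradnorm (gloc g i) (Q \o chart_inv i) x =
    (2 * uloc i x) ^+ 2 * gradnorm (gloc g i) (uloc i) x.
  rewrite /gradnorm mulr_sumr; apply: eq_bigr => a _.
  have -> : gradv (gloc g i) (Q \o chart_inv i) a x = 2 * uloc i x * gradv (gloc g i) (uloc i) a x.
    by rewrite /gradv mulr_sumr; apply: eq_bigr => b _; rewrite dQ mulrCA.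
  by rewrite dQ; ring.
have := F0 Np; rewrite /deficit (grad_normsq_loc ip) -/x -/(Q p) subr_ge0 LQ GQ => Gle.
have -> : (Q \o chart_inv i) x = Q p by rewrite /= (atlas_chartK sA ip).
exact: lnQ_arith hn (Q_gt0 Np) (uloc_gt0 Ix) Gle.
Qed.

Lemma Q_cont p : {for p, continuous Q}.
Proof. exact: (CkM_cont sA openT (Q_CkM 0)). Qed.

Lemma Q_compact (a b : R) : compact (closure N `&` [set p | a <= Q p /\ Q p <= b]).
Proof.
apply: (subclosed_compact _ (@sublevel_compact (b + u_min u ^+ 2 + 1))).
  apply: closedI; first exact: closed_closure.
  apply: (@closedI _ [set p | a <= Q p] [set p | Q p <= b]).
    exact: (closed_preimage (P := [set t | a <= t]) Q_cont (@closed_ge _ a)).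
  exact: (closed_preimage (P := [set t | t <= b]) Q_cont (@closed_le _ b)).
move=> p [_ [_]]; rewrite /= /Q lerBlDr => H; apply: (le_trans (sq_bound (u0 p))).
by rewrite lerD2r.
Qed.

Lemma level_bound : (forall p, N p -> 0 < deficit p) ->
  exists2 d : R, 0 < d & forall p, N p -> Q p = 1 -> d <= deficit p.
Proof.
move=> pos; pose S := closure N `&` [set p | 1 <= Q p /\ Q p <= 1].
have SN p : S p -> N p.
  move=> [clp [Q1 _]]; apply: contrapT => nNp; move: Q1.
  by rewrite /Q (closureN_MIN clp nNp) subrr leNgt ltr01.
have [S0|/set0P/negP] := pselect (S !=set0); last first.
  rewrite negbK => /eqP S0; exists 1 => // p Np Qp; suff : S p by rewrite S0.
  by split; [exact: subset_closure|rewrite /= Qp].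
have [c cS cmin] := compact_EVT_min S0 (@Q_compact 1 1)
  (continuous_in_subspaceT (fun x _ => @deficit_cont x)).
rewrite inE in cS; exists (deficit c) => [|p Np Qp]; first exact: pos (SN _ cS).
by apply: cmin; rewrite inE; split; [exact: subset_closure|rewrite /= Qp].
Qed.

Lemma closure_N_full : (forall p, closure N p -> nbhs p (closure N)) -> closure N = setT.
Proof.
move=> H; apply: connected_clopen (static_connected hst) _ _ _ _ => //.
- by have [x Nx] := N_nonempty; exists x; exact: subset_closure.
- by move=> p /H; apply: filterS => q clq _.
- move=> p _ ncl; apply: open_nbhs_nbhs; split => //.
  by apply: closed_openC; exact: closed_closure.
Qed.

(** Otherwise [N] would be closed as well as open, hence all of [M], although [u] attains its
    minimum outside [N]. *)
Lemma N_boundary : exists2 p, closure N p & u p = u_min u.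
Proof.
apply: contrapT => H; have clN : closure N = N.
  apply/seteqP; split; last exact: subset_closure.
  by move=> p clp; apply: contrapT => nNp; apply: H; exists p => //; exact: closureN_MIN.
have NT : N = setT.
  rewrite -{1}clN; apply: closure_N_full; rewrite clN => p Np.
  by apply: open_nbhs_nbhs; split => //; exact: N_open.
have [p up _] := u_min_attained.
by have : N p by [rewrite NT]; move=> /N_sub; apply.
Qed.

(** If the deficit were positive on [N], the function [h] would exceed its value at [q] on both rims
    of the region [k <= Q <= 1]: at [Q = 1] the logarithm vanishes and the deficit is at least [d],
    at [Q = k] the logarithm is very negative. An interior minimum would then contradict
    [no_interior_min]. *)
Lemma exists_zero : exists2 z, N z & deficit z = 0.
Proof.
apply: contrapT => nz.
have pos p : N p -> 0 < deficit p.
  by move=> Np; rewrite lt0r F0 // andbT; apply/eqP => Fp; apply: nz; exists p.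
have [d d0 Hd] := level_bound pos; have [b clb ub] := N_boundary.
have [q [Nq [Fq Qq]]] : exists q, N q /\ deficit q < d /\ Q q < 1.
  have n1 : nbhs b [set q | deficit q < d].
    apply: (nbhs_preimage (P := [set t | t < d]) (@deficit_cont b) (@open_lt _ d)).
    by rewrite (MIN_deficit ub).
  have n2 : nbhs b [set q | Q q < 1].
    apply: (nbhs_preimage (f := Q) (P := [set t : R | t < 1]) (@Q_cont b) (@open_lt _ 1)).
    by rewrite /= /Q ub subrr.
  by have [q [Nq [h1 h2]]] := clb _ (filterI n1 n2); exists q.
have Qq0 := Q_gt0 Nq; have lnq : ln (Q q) < 0 by rewrite ln_lt0 // Qq0.
(* Chosen so that [h q] is the mean of [deficit q] and [d], hence below [d]. *)
pose e := (d - deficit q) / (2 * - ln (Q q)).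
have e0 : 0 < e by rewrite divr_gt0 ?subr_gt0 // mulr_gt0 ?oppr_gt0.
pose h p := deficit p - e * ln (Q p).
have hq : h q < d.
  have -> : h q = deficit q + (d - deficit q) / 2 by rewrite /h /e; field; apply: ltr0_neq0.
  by rewrite -ltrBrDl ltr_pdivrMr // mulr_natr mulr2n ltrDl subr_gt0.
(* The first entry keeps [q] in the region; the second makes [- e * ln k] at least [d], so that [h]
   exceeds [d] on the inner rim. *)
pose k := Num.min (Q q) (expR (- (d / e))).
have k0 : 0 < k by rewrite lt_min Qq0 expR_gt0.
have clNQ p : closure N p -> 0 < Q p -> N p.
  move=> clp Qp; apply: contrapT => nNp; move: Qp.
  by rewrite /Q (closureN_MIN clp nNp) subrr ltxx.
have ck : CkM A 2 N (@ln R \o Q).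
  move=> i; have oU := @chart_on_open _ _ _ _ sA i _ N_open.
  rewrite (_ : (@ln R \o Q) \o chart_inv i = @ln R \o (Q \o chart_inv i)) //.
  apply: (Ck_ln oU) => [x [_ Nx]|]; first exact: Q_gt0.
  exact: (CkM_sub (@subsetT _ N) (Q_CkM 2)).
have hC : CkM A 0 N h.
  move=> i; have oU := @chart_on_open _ _ _ _ sA i _ N_open.
  exact: (Ck_subr oU (CkM_sub (@subsetT _ N) (deficit_Ck 0) i)
    (Ck_scale e oU (Ck_pred (Ck_pred (ck i))))).
pose S := closure N `&` [set p | k <= Q p /\ Q p <= 1].
have SN p : S p -> N p by move=> [clp [kQ _]]; apply: clNQ => //; exact: lt_le_trans kQ.
have Sq : S q by split; [exact: subset_closure|rewrite /= (ltW Qq) ge_min lexx].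
have [z zS zmin] : exists2 z, z \in S & forall t, t \in S -> h z <= h t.
  apply: compact_EVT_min; [by exists q|exact: Q_compact|].
  apply: continuous_in_subspaceT => x /set_mem /SN Nx.
  exact: (CkM_cont sA N_open hC Nx).
rewrite inE in zS; have Nz := SN _ zS; have [_ [kz z1]] := zS.
have hz : h z < d by apply: le_lt_trans hq; apply: zmin; rewrite inE.
have Fz := pos _ Nz.
have kz' : k < Q z.
  rewrite lt_neqAle kz andbT; apply/eqP => kE; move: hz; apply/negP; rewrite -leNgt.
  have : ln (Q z) <= - (d / e).
    rewrite -[leRHS]expRK ler_ln ?posrE ?expR_gt0 // -?kE //.
    by rewrite ge_min lexx orbT.
  exact: ln_arith.
have z1' : Q z < 1.
  rewrite lt_neqAle z1 andbT; apply/eqP => Qz; move: hz; apply/negP; rewrite -leNgt.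
  by rewrite /h Qz ln1 mulr0 subr0; exact: Hd.
pose O := N `&` (Q @^-1` [set t | k < t] `&` Q @^-1` [set t | t < 1]).
have oO : open O.
  apply: openI; first exact: N_open.
  apply: openI; apply: open_comp => [x _|]; [exact: Q_cont|exact: open_gt|exact: Q_cont|exact: open_lt].
apply: (@no_interior_min O (@ln R \o Q) e z) => //.
- by apply: CkM_sub ck => x [].
- exact: MLop_lnQ_gt0.
- move=> p [Np [kp p1]]; apply: zmin; rewrite inE; split; first exact: subset_closure.
  by split; apply: ltW.
Qed.

Lemma deficit_zero p : N p -> deficit p = 0.
Proof.
have [z Nz Fz] := exists_zero.
suff <- : N `&` [set p | deficit p = 0] = N by move=> [].
apply: connected_clopen N_connected _ _ _ _; first by exists z.
- by move=> q [].
- move=> q [Nq Fq]; pose i := chart_at A q; have iq : chart_dom i q := atlas_cover sA q.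
  have mG := gloc_metric_on sA rg i N_open; set U := chart_on i N in mG.
  have Uq : U (chart i q) by apply: chart_onP.
  have [r r0 Hr] := @strong_min_local R n U (gloc g i) (uloc i) mG
    (fun k => Ck_sub (fun x (Ux : U x) => Ux.1) (su i k)) (fun x Ux => @uloc_gt0 i x Ux.1)
    (deficit \o chart_inv i) (chart i q) (CkM_sub (@subsetT _ N) (deficit_Ck 2) i)
    (fun x Ux => F0 Ux.2) (fun x Ux => MLop_deficit_le0 Ux.1) Uq
    (etrans (congr1 deficit (atlas_chartK sA iq)) Fq).
  have n1 : nbhs q (chart_dom i) := open_nbhs_nbhs (conj (atlas_dom_open sA i) iq).
  have n2 : nbhs q (chart i @^-1` [set x : 'rV[R]_n | `|x - chart i q| < r]).
    apply: (atlas_chart_cont sA iq); apply: open_nbhs_nbhs; split; first exact: open_norm_ball.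
    by rewrite /= subrr normr0.
  apply: filterS (filterI n1 n2) => t [it tr] Nt; split => //.
  by have := Hr _ tr; rewrite /= (atlas_chartK sA it).
- move=> q Nq nq; have Fq : deficit q != 0 by apply/eqP => Fq; apply: nq.
  have : nbhs q (deficit @^-1` [set t | t != 0]).
    exact: (nbhs_preimage (P := [set t | t != 0]) (@deficit_cont q) (@open_neq _ 0) Fq).
  by apply: filterS => t /eqP Ft [_ Ft0].
Qed.

(** The deficit vanishes on [N], so every point is a minimum of it. The operator, which equals minus
    twice a squared norm, is therefore nonnegative, and the norm is zero. *)
Lemma hess_N i x : chart_on i N x ->
  hessian_coord (gloc g i) (uloc i) x = uloc i x *: gloc g i x.
Proof.
move=> Ux; have [Ix Nx] := Ux; have mG := gloc_metric_on sA rg i N_open.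
have pG : posdef (gloc g i x) by case: mG => _ _; apply.
apply/eqP; rewrite -subr_eq0; apply/eqP; apply: (sqtrace_eq0 pG (traceless_sym Ix)).
apply/le_anti/andP; split; last exact: (sqtrace_ge0 pG (traceless_sym Ix)).
have : 0 <= MLop deficit i x.
  apply: (@Lop_local_min R n _ (gloc g i) (uloc i) mG _ _ x (@chart_on_open _ _ _ _ sA i _ N_open)
    (@subset_refl _ _) Ux (CkM_sub (@subsetT _ N) (deficit_Ck 2) i)) => y [_ Ny].
  by rewrite /= !deficit_zero.
by rewrite MLop_deficit // oppr_ge0 pmulr_rle0.
Qed.

Lemma hess_closure_N i p : chart_dom i p -> closure N p -> hessian g u i p = u p *: g i p.
Proof.
move=> ip clp; pose D x a b := hessian_coord (gloc g i) (uloc i) x a b - uloc i x * gloc g i x a b.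
suff H a b : D (chart i p) a b = 0.
  apply/matrixP => a b; have := H a b; rewrite /D /uloc /gloc /= (atlas_chartK sA ip) => /eqP.
  by rewrite subr_eq0 [RHS]mxE => /eqP.
apply: contrapT => /eqP nD; have Ip := chart_imgP ip; have oI := @open_chart_img i.
have mG := gloc_metric sA rg i.
have cD : Ck_on 0 (chart_img i) (fun x => D x a b).
  apply: (Ck_subr oI); first exact: (hess_Ck mG a b (su i 2)).
  by apply: (Ck_mul oI (su i 0)); case: mG => _ /(_ 0) /(_ a b).
have n1 : nbhs (chart i p) [set x | D x a b != 0].
  exact: (nbhs_preimage (P := [set t | t != 0]) (Ck_cont cD Ip) (@open_neq _ 0) nD).
have n2 : nbhs p (chart i @^-1` [set x | D x a b != 0]) := atlas_chart_cont sA ip n1.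
have n3 : nbhs p (chart_dom i) := open_nbhs_nbhs (conj (atlas_dom_open sA i) ip).
have [q [Nq [Dq iq]]] := clp _ (filterI n2 n3).
by move: Dq; rewrite /= /D (hess_N (chart_onP sA iq Nq)) mxE subrr eqxx.
Qed.

(** At a boundary point the Hessian [u g] is positive definite, so a small punctured coordinate ball
    avoids the minimum set. That ball is connected and meets [N], hence lies in the single component
    [N]. *)
Lemma closure_N_nbhs p : closure N p -> nbhs p (closure N).
Proof.
move=> clp; have [Np|nNp] := pselect (N p).
  apply: filterS (@subset_closure _ N) _; apply: open_nbhs_nbhs; split => //; exact: N_open.
have up := closureN_MIN clp nNp; pose i := chart_at A p.
have ip : chart_dom i p := atlas_cover sA p; have Ip := chart_imgP ip; have oI := @open_chart_img i.
have d0 a : partial a (uloc i) (chart i p) = 0.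
  apply: (local_min_partial a oI (su i 1) Ip) => y _.
  by rewrite /uloc /= (atlas_chartK sA ip) up u_min_le.
have pH : posdef (\matrix_(a, b) partial a (partial b (uloc i)) (chart i p)).
  have -> : \matrix_(a, b) partial a (partial b (uloc i)) (chart i p) = u p *: g i p.
    rewrite -(hess_closure_N ip clp); apply/matrixP => a b; rewrite !mxE.
    by rewrite big1 ?subr0 // => k _; rewrite d0 mulr0.
  have [_ _ /(_ _ Ip)] := gloc_metric sA rg i; rewrite /gloc (atlas_chartK sA ip) => -[sP pP].
  split => [|v v0]; first by rewrite linearZ /= sP.
  by rewrite -scalemxAr -scalemxAl mxE mulr_gt0 // pP.
have [c [r [c0 r0 Hr]]] := nondegenerate_min oI (su i 2) Ip d0 pH.
pose B := [set x : 'rV[R]_n | `|x - chart i p| < r /\ x != chart i p].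
have BI x : B x -> chart_img i x by move=> [/Hr[]].
have cB : connected (chart_inv i @` B).
  apply: connected_continuous_connected.
    by apply: punctured_ball_connected => //; exact: leq_trans hn.
  apply: continuous_in_subspaceT => x /set_mem /BI Ix; exact: (atlas_inv_cont sA Ix).
have BM : chart_inv i @` B `<=` ~` MINset u.
  move=> _ [x [xr xp] <-] /=; rewrite /MINset /= => ux; have [_] := Hr _ xr.
  rewrite /uloc /= (atlas_chartK sA ip) up ux gerDl leNgt mulr_gt0 // lt0r sqdist_ge0 andbT.
  by apply: contra_neq xp => /sqdist_eq0.
have n1 : nbhs p (chart_dom i) := open_nbhs_nbhs (conj (atlas_dom_open sA i) ip).
have n2 : nbhs p (chart i @^-1` [set x : 'rV[R]_n | `|x - chart i p| < r]).
  apply: (atlas_chart_cont sA ip); apply: open_nbhs_nbhs; split; first exact: open_norm_ball.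
  by rewrite /= subrr normr0.
have [q [Nq [iq qr]]] := clp _ (filterI n1 n2).
have Bq : (chart_inv i @` B) q.
  exists (chart i q); last exact: atlas_chartK.
  split => //; apply/eqP => /(congr1 (chart_inv i)); rewrite !(atlas_chartK sA) // => qp.
  by apply: nNp; rewrite -qp.
have BN : chart_inv i @` B `<=` N.
  have [x Bx NE] := hN; rewrite NE in Nq *.
  by move=> t Bt; apply: (connected_component_trans Nq); exact: (connected_component_max Bq BM cB Bt).
apply: filterS (filterI n1 n2) => t [it tr]; have [->|tp] := pselect (t = p); first exact: clp.
apply: subset_closure; apply: BN; exists (chart i t); last exact: atlas_chartK.
split => //; apply/eqP => /(congr1 (chart_inv i)).
by rewrite !(atlas_chartK sA).
Qed.

Lemma component_rigidity : [/\ closure N = setT, forall p, deficit p = 0 &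
  forall i p, chart_dom i p -> hessian g u i p = u p *: g i p].
Proof.
have clN := closure_N_full closure_N_nbhs; split => // [p|i p ip]; last first.
  by apply: hess_closure_N => //; rewrite clN.
have [Np|nNp] := pselect (N p); first exact: deficit_zero.
by apply: MIN_deficit; apply: closureN_MIN => //; rewrite clN.
Qed.
End Component.

Lemma liminf_rigidity N : is_component (~` MINset u) N ->
  (0 <= liminf_infinity N deficit)%E ->
  [/\ closure N = setT, forall p, deficit p = 0 &
  forall i p, chart_dom i p -> hessian g u i p = u p *: g i p].
Proof.
move=> hN L0; apply: (component_rigidity hN); apply: (deficit_ge0 hN) => e e0.
have : ((- e)%:E < liminf_infinity N deficit)%E.
  by apply: lt_le_trans L0; rewrite lte_fin oppr_lt0.
move=> /ereal_sup_gt[_ [K cK <-] He]; exists K => // p Np nKp; rewrite -lte_fin.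
by apply: lt_le_trans He _; apply: ereal_inf_lbound; exists p.
Qed.

Lemma liminf_le0 N : is_component (~` MINset u) N -> (liminf_infinity N deficit <= 0)%E.
Proof.
move=> hN; rewrite leNgt; apply/negP => L0.
have [clN F _] := liminf_rigidity hN (ltW L0).
have [_ [K cK <-] HK] := ereal_sup_gt L0.
(* If [N] is contained in [K], then [M], the closure of [N], is compact. Otherwise a point of [N]
   off [K] has a positive deficit, although the deficit is identically zero. *)
have [NK|/existsNP[p /not_implyP[Np nKp]]] := pselect (N `<=` K).
  apply: (static_noncompact hst); rewrite -clN.
  apply: (subclosed_compact _ cK); first exact: closed_closure.
  rewrite [X in _ `<=` X](closure_id K).1; last exact: compact_closed hM cK.
  exact: closure_subset.
have : (0 < (deficit p)%:E)%E.
  by apply: lt_le_trans HK _; apply: ereal_inf_lbound; exists p.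
by rewrite F ltxx.
Qed.
End Static.

(** * Ordinary differential equations *)

Lemma derive_eps (R : realType) (V : normedModType R) (f : V -> R) (x v : V) (l : R) :
  (forall e : R, 0 < e -> exists2 d : R, 0 < d &
     forall h : R, `|h| < d -> `|f (x + h *: v) - f x - h * l| <= e * `|h|) ->
  derivable f x v /\ 'D_v f x = l.
Proof.
move=> H.
have cv : (fun h : R => h^-1 *: ((f \o shift x) (h *: v) - f x)) @ 0^' --> l.
  apply/cvgrPdist_le => e e0; have [d d0 Hd] := H e e0.
  apply/nbhs_norm_ball; exists d => // h; rewrite subr0 => hd h0 /=.
  have h0' : 0 < `|h| by rewrite normr_gt0.
  have -> : l - h^-1 *: (f (h *: v + x) - f x) = - (h^-1 * (f (x + h *: v) - f x - h * l)).
    by rewrite [_ + x]addrC mulrBr mulKf // opprB.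
  by rewrite normrN normrM normfV mulrC ler_pdivrMr //; apply: Hd.
split; last exact: cvg_lim cv.
by apply/cvg_ex; exists l.
Qed.

Lemma is_derive_eps (R : realType) (f : R -> R) (t l : R) :
  (forall e : R, 0 < e -> exists2 d : R, 0 < d &
     forall s : R, `|s - t| < d -> `|f s - f t - (s - t) * l| <= e * `|s - t|) ->
  is_derive t 1 f l.
Proof.
move=> H; suff [h1 h2] : derivable f t 1 /\ 'D_1 f t = l by exact: DeriveDef.
apply: derive_eps => e e0; have [d d0 Hd] := H e e0; exists d => // h hd.
have hE : t + h *: 1 - t = h by rewrite addrC addKr [_ *: _]mulr1.
by have := Hd (t + h *: 1); rewrite hE; apply.
Qed.

Lemma is_derive_mulc (R : realType) (t c : R) : is_derive t 1 (fun s : R => s * c) c.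
Proof.
apply: is_derive_eps => e e0; exists 1 => // s _.
by rewrite -!mulrBl subrr mul0r normr0 mulr_ge0 // ltW.
Qed.

Lemma derive_bound_between (R : realType) (f f' : R -> R) (K s t : R) :
  (forall x, Num.min s t <= x <= Num.max s t -> is_derive x 1 f (f' x) /\ `|f' x| <= K) ->
  `|f t - f s| <= K * `|t - s|.
Proof.
wlog st : s t / s <= t => [W H|].
  have [st|/ltW ts] := leP s t; first exact: W.
  by rewrite distrC [`|t - s|]distrC; apply: W => //; rewrite minC maxC.
rewrite (min_idPl st) (max_idPr st) => H.
have cf : {within `[s, t], continuous f}.
  by apply: derivable_within_continuous => x; rewrite in_itv => /H[dfx _]; exact: ex_derive.
have Hi (x : R) : x \in `]s, t[ -> is_derive x 1 f (f' x).
  by move=> /subset_itv_oo_cc; rewrite in_itv => /H[].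
have [x + ->] := MVT_segment st Hi cf; rewrite in_itv => /H[_ bx].
by rewrite normrM ler_wpM2r.
Qed.

Lemma derive_bound (R : realType) (f f' : R -> R) (c r K s t : R) :
  (forall s, `|s - c| < r -> is_derive s 1 f (f' s)) -> (forall s, `|s - c| < r -> `|f' s| <= K) ->
  `|s - c| < r -> `|t - c| < r -> `|f t - f s| <= K * `|t - s|.
Proof.
move=> df bf sr tr; apply: derive_bound_between => x /andP[sx xt].
suff xr : `|x - c| < r by split; [exact: df|exact: bf].
move: sr tr; rewrite !ltr_norml => /andP[h1 h2] /andP[h3 h4] {df bf}.
by move: sx xt; case: (leP s t) => _ h5 h6; apply/andP; split; lra.
Qed.

Lemma derive_zero_const (R : realType) (f : R -> R) (c r s t : R) :
  (forall s, `|s - c| < r -> is_derive s 1 f 0) -> `|s - c| < r -> `|t - c| < r -> f t = f s.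
Proof.
move=> df sr tr; apply/eqP; rewrite -subr_eq0 -normr_le0.
have := derive_bound (f' := fun=> 0) (K := 0) df _ sr tr; rewrite mul0r; apply.
by move=> x _; rewrite normr0.
Qed.

Lemma is_derive_cont (R : realType) (f : R -> R) (t l : R) :
  is_derive t 1 f l -> {for t, continuous f}.
Proof. by move=> df; apply: differentiable_continuous; apply/derivable1_diffP; exact: ex_derive. Qed.

Lemma limit_derive_arith (R : realType) (x y z h e n : R) : 0 <= n ->
  `|x| <= e -> `|y| <= e -> `|z| <= (e + h) * n -> e * (n + 2) <= h * n ->
  `|z + x - y| <= (2 * h) * n.
Proof.
move=> n0 xe ye zn H; rewrite (le_trans (ler_normB _ _)) // (le_trans (lerD (ler_normD _ _) ye)) //.
by rewrite (le_trans (lerD (lerD zn xe) (lexx _))) //; nra.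
Qed.

(* The derivatives converge uniformly near [t], so the difference quotients of
   [f] inherit the mean value bound of the approximants. *)
Lemma limit_derive (R : realType) (f phi : R -> R) (t r : R) : 0 < r ->
  (forall e : R, 0 < e -> exists fe fe' : R -> R, forall s, `|s - t| < r ->
     [/\ is_derive s 1 fe (fe' s), `|fe s - f s| <= e & `|fe' s - phi s| <= e]) ->
  {for t, continuous phi} -> is_derive t 1 f (phi t).
Proof.
move=> r0 cvf cphi; apply: is_derive_eps => e0 e00.
pose e := e0 / 2; have e_gt0 : 0 < e by rewrite divr_gt0.
have [d d0 Hd] := (continuous_eps _ _).1 cphi e e_gt0.
exists (Num.min d r) => [|s]; first by rewrite lt_min d0 r0.
rewrite lt_min => /andP[sd sr]; have [->|st] := eqVneq s t.
  by rewrite !subrr mul0r subr0 !normr0 mulr0.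
have n0 : 0 < `|s - t| by rewrite normr_gt0 subr_eq0.
(* The approximant is chosen after [s]: two errors [h] on the values and [h * |s - t|] on the
   derivative add up to exactly [e * |s - t|]. *)
pose h := e * `|s - t| / (`|s - t| + 2).
have n2 : 0 < `|s - t| + 2 by rewrite ltr_wpDr.
have h0 : 0 < h by rewrite divr_gt0 // mulr_gt0.
have [fk [fk' Hk]] := cvf h h0.
have tt : `|t - t| < r by rewrite subrr normr0.
pose g x := fk x - x * phi t.
have dg x : `|x - t| < `|s - t| + Num.min (d - `|s - t|) (r - `|s - t|) ->
    is_derive x 1 g (fk' x - phi t).
  rewrite -ltrBlDl lt_min !ltrBlDl !subrKC => /andP[_ xr].
  by have [dx _ _] := Hk x xr; exact: is_deriveB dx (is_derive_mulc x (phi t)).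
have gb x : `|x - t| < `|s - t| + Num.min (d - `|s - t|) (r - `|s - t|) ->
    `|fk' x - phi t| <= h + e.
  rewrite -ltrBlDl lt_min !ltrBlDl !subrKC => /andP[xd xr].
  have -> : fk' x - phi t = (fk' x - phi x) + (phi x - phi t) by rewrite addrA subrK.
  by rewrite (le_trans (ler_normD _ _)) // lerD ?(ltW (Hd _ _)) //; by case: (Hk x xr).
have m0 : 0 < Num.min (d - `|s - t|) (r - `|s - t|) by rewrite lt_min !subr_gt0 sd sr.
have := derive_bound dg gb (s := t) (t := s).
rewrite subrr normr0 ltr_wpDl // ltrDl m0 => /(_ isT isT) B.
have -> : f s - f t - (s - t) * phi t =
    (g s - g t) + (fk t - f t) - (fk s - f s) by rewrite /g; ring.
have -> : e0 = 2 * e by rewrite /e mulrC divfK.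
have [[_ ht _] [_ hs _]] := (Hk t tt, Hk s sr).
apply: (limit_derive_arith (ltW n0) ht hs B).
by rewrite /h divfK // gt_eqF.
Qed.

(** The integral starts at [-1], so that [0] is an interior time. Times below [1] in absolute value
    are enough for Picard iteration. *)
Lemma primitive (R : realType) (f : R -> R) : continuous f ->
  exists2 F : R -> R, F 0 = 0 & forall t : R, `|t| < 1 -> is_derive t 1 F (f t).
Proof.
move=> cf; pose mu := @lebesgue_measure R.
pose G (x : R) := (\int[mu]_(t in `[(-1 : R), x]) f t)%R.
have fi : mu.-integrable `[(-1 : R), 1] (EFin \o f).
  apply: continuous_compact_integrable; first exact: segment_compact.
  exact: continuous_subspaceT.
exists (fun x => G x - G 0) => [|t]; first by rewrite subrr.
rewrite ltr_norml => /andP[t1 t2].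
have [dG GE] := continuous_FTC1_closed t2 fi t1 (cf t).
have E : 'D_1 G t = f t := etrans (esym (derive1E _ _)) GE.
have dG' : is_derive t 1 G (f t) := DeriveDef dG E.
by rewrite -[f t]subr0; apply: is_deriveB.
Qed.

(** The intervals of radius [D k] around [u k] are nested, and the supremum of their left ends lies
    in all of them. This gives the limit together with its rate, which the later estimates need. *)
Lemma geometric_limit (R : realType) (u : nat -> R) (C r : R) : 0 <= C -> 0 <= r -> r < 1 ->
  (forall k, `|u k.+1 - u k| <= C * r ^+ k) ->
  exists l, forall k, `|u k - l| <= C * r ^+ k / (1 - r).
Proof.
move=> C0 r0 r1 H; pose D k := C * r ^+ k / (1 - r).
have r1' : 0 < 1 - r by rewrite subr_gt0.
have DS k : D k = C * r ^+ k + D k.+1.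
  by rewrite /D exprS; field; apply: lt0r_neq0.
have inc k : u k - D k <= u k.+1 - D k.+1.
  by have := H k; rewrite ler_norml => /andP[+ _]; rewrite (DS k); lra.
have dec k : u k.+1 + D k.+1 <= u k + D k.
  by have := H k; rewrite ler_norml => /andP[_]; rewrite (DS k); lra.
have D0 k : 0 <= D k by rewrite divr_ge0 ?mulr_ge0 ?exprn_ge0 // ltW.
have incn i j : u i - D i <= u (i + j)%N - D (i + j)%N.
  by elim: j => [|j IH]; rewrite ?addn0 // addnS (le_trans IH).
have decn i j : u (i + j)%N + D (i + j)%N <= u i + D i.
  by elim: j => [|j IH]; rewrite ?addn0 // addnS (le_trans (dec _)).
have cross i j : u i - D i <= u j + D j.
  rewrite (le_trans (incn i j)) // (le_trans _ (decn j i)) // addnC lerD2l.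
  by rewrite (@le_trans _ _ 0) // oppr_le0.
pose S := [set x | exists k, x = u k - D k].
have Sub j : ubound S (u j + D j) by move=> _ [k ->].
exists (sup S) => k; rewrite -/(D k) ler_norml; apply/andP; split.
  rewrite lerBrDl -lerBrDr opprK; apply: ge_sup; first by exists (u 0%N - D 0%N), 0%N.
  exact: Sub.
rewrite lerBlDl -lerBlDr; apply: ub_le_sup; first by exists (u 0%N + D 0%N).
by exists k.
Qed.

Lemma rV_continuous (R : realType) m (T : normedModType R) (c : T -> 'rV[R]_m) (t : T) :
  (forall b, {for t, continuous (fun s => c s 0 b)}) -> {for t, continuous c}.
Proof.
move=> H; apply/continuous_eps => e e0.
have N : nbhs t [set s | forall b, `|c s 0 b - c t 0 b| < e].
  apply: (@filter_forall _ _ (fun b s => `|c s 0 b - c t 0 b| < e) (nbhs t) _) => b.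
  by apply/nbhs_norm_ball; apply: (continuous_eps _ _).1 (H b) _ e0.
have [d d0 Hd] := (nbhs_norm_ball _ _).1 N; exists d => // s sd.
by apply: norm_lt_coord => // b; rewrite !mxE; apply: Hd.
Qed.

Lemma rV_coord_continuous (R : realType) m (T : normedModType R) (c : T -> 'rV[R]_m) (t : T) b :
  {for t, continuous c} -> {for t, continuous (fun s => c s 0 b)}.
Proof.
move=> /continuous_eps ct; apply/continuous_eps => e /ct[d d0 Hd]; exists d => // s /Hd.
by apply: le_lt_trans; have := coord_le_norm (c s - c t) b; rewrite !mxE.
Qed.

Definition curve_deriv (R : realType) m (c : R -> 'rV[R]_m) (t : R) (v : 'rV[R]_m) : Prop :=
  forall b, is_derive t 1 (fun s => c s 0 b) (v 0 b).

Lemma curve_deriv_cont (R : realType) m (c : R -> 'rV[R]_m) (t : R) v :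
  curve_deriv c t v -> {for t, continuous c}.
Proof. by move=> H; apply: rV_continuous => b; apply: is_derive_cont (H b). Qed.

Lemma curve_bound (R : realType) m (c c' : R -> 'rV[R]_m) (K t : R) : 0 <= K ->
  (forall s, `|s| <= `|t| -> curve_deriv c s (c' s)) -> (forall s, `|s| <= `|t| -> `|c' s| <= K) ->
  `|c t - c 0| <= K * `|t|.
Proof.
move=> K0 dc bc; apply: norm_le_coord => [|b]; first by rewrite mulr_ge0.
rewrite !mxE -[X in _ * `|X|]subr0.
apply: (@derive_bound_between R (fun s => c s 0 b) (fun s => c' s 0 b)) => x /andP[x0 x1].
have xt : `|x| <= `|t|.
  rewrite ler_norml (le_trans _ x0) /=; last by rewrite le_min oppr_le0 normr_ge0 lerNl ler_normr lexx orbT.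
  by rewrite (le_trans x1) // ge_max normr_ge0 ler_norm.
by split; [exact: dc|rewrite (le_trans (coord_le_norm _ _)) // bc].
Qed.

Lemma gronwall_arith (R : realType) (D d L e r s : R) : 0 <= D -> 0 <= e -> L * r <= 2^-1 -> 0 <= L ->
  0 <= s -> s <= r -> D <= d + (L * D + e) * s -> D <= 2 * d + 2 * r * e.
Proof.
move=> D0 e0 Lr L0 s0 sr H.
have h1 : L * D * s <= 2^-1 * D.
  have -> : L * D * s = (L * s) * D by ring.
  by rewrite ler_wpM2r // (le_trans _ Lr) // ler_wpM2l.
have h2 : e * s <= e * r by rewrite ler_wpM2l.
lra.
Qed.

(* The maximum of [|c1 - c2|] absorbs itself because [L * r <= 1 / 2]. *)
Lemma gronwall (R : realType) m (c1 c2 d1 d2 : R -> 'rV[R]_m) (r L e : R) (t : R) :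
  0 <= L -> 0 <= e -> L * r <= 2^-1 ->
  (forall s, `|s| < r -> curve_deriv c1 s (d1 s)) ->
  (forall s, `|s| < r -> curve_deriv c2 s (d2 s)) ->
  (forall s, `|s| < r -> `|d1 s - d2 s| <= L * `|c1 s - c2 s| + e) ->
  `|t| < r -> `|c1 t - c2 t| <= 2 * `|c1 0 - c2 0| + 2 * r * e.
Proof.
move=> L0 e0 Lr H1 H2 H tr; pose c s := c1 s - c2 s.
have dc s : `|s| < r -> curve_deriv c s (d1 s - d2 s).
  move=> sr b; rewrite !mxE.
  have -> : (fun s => c s 0 b) = (fun s => c1 s 0 b - c2 s 0 b).
    by apply/funext => x; rewrite !mxE.
  exact: is_deriveB (H1 s sr b) (H2 s sr b).
pose I := [set` `[- `|t|, `|t|]].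
have Ir s : I s -> `|s| < r.
  by rewrite /I /= in_itv /= -ler_norml => st; apply: le_lt_trans tr.
have cI : {within I, continuous (fun s => `|c s|)}.
  apply: continuous_in_subspaceT => s /set_mem /Ir sr.
  by apply: (continuous_comp (curve_deriv_cont (dc s sr))); apply: norm_continuous.
have It : I t by rewrite /I /= in_itv /= -ler_norml.
have [s sI smax] := compact_EVT_max (ex_intro _ t It) (@segment_compact _ _ _) cI.
have sr : `|s| < r by apply: Ir; rewrite inE in sI.
have D x : `|x| <= `|s| -> `|c x| <= `|c s|.
  move=> xs; apply: smax; rewrite inE /I /= in_itv /= -ler_norml (le_trans xs) //.
  by move: sI; rewrite inE /I /= in_itv /= -ler_norml.
have r0 : 0 < r by apply: le_lt_trans tr.
have K0 : 0 <= L * `|c s| + e by rewrite addr_ge0 // mulr_ge0.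
have step : `|c s - c 0| <= (L * `|c s| + e) * `|s|.
  apply: (curve_bound K0) => x xs; first exact: dc (le_lt_trans xs sr).
  rewrite (le_trans (H _ (le_lt_trans xs sr))) // lerD2r ler_wpM2l //; exact: D.
have ts : `|c t| <= `|c s| by apply: smax; rewrite inE.
apply: (le_trans ts); apply: (gronwall_arith (normr_ge0 _) e0 Lr L0 (normr_ge0 s) (ltW sr)).
by apply: (le_trans _ (lerD (lexx _) step)); rewrite -[X in `|X| <= _](subrKC (c 0)) ler_normD.
Qed.

Lemma vec_geometric_limit (R : realType) m (u : nat -> 'rV[R]_m) (C r : R) :
  0 <= C -> 0 <= r -> r < 1 -> (forall k, `|u k.+1 - u k| <= C * r ^+ k) ->
  exists l, forall k, `|u k - l| <= C * r ^+ k / (1 - r).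
Proof.
move=> C0 r0 r1 H.
have /choice[l Hl] b : exists l, forall k, `|u k 0 b - l| <= C * r ^+ k / (1 - r).
  apply: geometric_limit => // k; apply: le_trans (H k).
  by have := coord_le_norm (u k.+1 - u k) b; rewrite !mxE.
exists (\row_b l b) => k; apply: norm_le_coord => [|b]; last by rewrite !mxE.
by rewrite divr_ge0 ?mulr_ge0 ?exprn_ge0 // subr_ge0 ltW.
Qed.

Lemma geometric_small (R : realType) (C r e : R) : 0 <= r -> r < 1 -> 0 < e ->
  exists k, C * r ^+ k <= e.
Proof.
move=> r0 r1 e0; have C1 : 0 < `|C| + 1 by rewrite ltr_wpDl.
have /cvgrPdist_le /(_ (e / (`|C| + 1)) (divr_gt0 e0 C1)) [k _ Hk] : (fun k => r ^+ k) @ \oo --> (0 : R).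
  by apply: cvg_expr; rewrite ger0_norm.
exists k; have := Hk k (leqnn k); rewrite /= sub0r normrN ger0_norm ?exprn_ge0 //.
rewrite ler_pdivlMr // mulrC; apply: le_trans.
by rewrite ler_wpM2r ?exprn_ge0 // (le_trans (ler_norm _)) // lerDl.
Qed.

Lemma clamp_lip (R : realType) (a b x y : R) :
  `|Num.max a (Num.min b x) - Num.max a (Num.min b y)| <= `|x - y|.
Proof.
wlog xy : x y / y <= x => [W|].
  have [|/ltW] := leP y x; first exact: W.
  by rewrite distrC [`|x - y|]distrC; exact: W.
rewrite [leRHS]ger0_norm ?subr_ge0 // ler_norml.
case: (leP b x) => bx; case: (leP b y) => by_;
 [case: (leP a b) => ? | case: (leP a b) => ?; case: (leP a y) => ? |
  case: (leP a x) => ?; case: (leP a b) => ? | case: (leP a x) => ?; case: (leP a y) => ?];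
 apply/andP; split; lra.
Qed.

(* Picard iteration; freezing time at [`|t| <= tau] keeps the integrands
   continuous on the whole line. *)
Lemma picard (R : realType) m (V : 'rV[R]_m -> 'rV[R]_m) (L tau : R) (x : 'rV[R]_m) :
  0 <= L -> (forall y z, `|V y - V z| <= L * `|y - z|) -> 0 < tau -> tau < 1 -> L * tau <= 2^-1 ->
  exists c : R -> 'rV[R]_m, c 0 = x /\ forall t, `|t| < tau -> curve_deriv c t (V (c t)).
Proof.
move=> L0 lipV tau0 tau1 Ltau.
have cV y : {for y, continuous V}.
  apply/continuous_eps => e e0; have L1 : 0 < L + 1 by rewrite ltr_wpDl.
  exists (e / (L + 1)) => [|z]; first exact: divr_gt0.
  rewrite ltr_pdivlMr // => zy; apply: (le_lt_trans (lipV _ _)).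
  by apply: le_lt_trans zy; rewrite mulrC ler_wpM2l // lerDl.
pose K (t : R) := Num.max (- tau) (Num.min tau t).
have Kcont t : {for t, continuous K}.
  by apply/continuous_eps => e e0; exists e => // s; apply: le_lt_trans; exact: clamp_lip.
have Kt t : `|t| < tau -> K t = t.
  rewrite ltr_norml => /andP[t1 t2]; rewrite /K (min_idPr (ltW t2)).
  exact: max_idPr (ltW t1).
have Kb t : `|K t| < 1.
  apply: le_lt_trans tau1; rewrite ler_norml /K le_max lexx /= ge_max ge_min lexx /= andbT.
  by rewrite (@le_trans _ _ 0) // ?oppr_le0 ltW.
pose good (c : R -> 'rV[R]_m) := forall t, `|t| < 1 -> {for t, continuous c}.
(* Choice needs a value for every curve, so the Picard step is left arbitrary on curves that are not
   continuous on the time interval. *)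
have /choice[step Hstep] (c : R -> 'rV[R]_m) : exists c' : R -> 'rV[R]_m, good c ->
    [/\ good c', c' 0 = x & forall t, `|t| < tau -> curve_deriv c' t (V (c t))].
  have [gc|] := pselect (good c); last by exists c.
  pose f b t := V (c (K t)) 0 b.
  have cf b : continuous (f b).
    move=> t; have ck : {for t, continuous (c \o K)}.
      by apply: continuous_comp; [exact: Kcont|apply: gc; exact: Kb].
    apply: (@rV_coord_continuous R m _ (fun t => V (c (K t)))).
    by apply: (continuous_comp ck); exact: cV.
  have /choice[F HF] b : exists F : R -> R, F 0 = 0 /\
      forall t : R, `|t| < 1 -> is_derive t 1 F (f b t).
    by have [F F0 dF] := primitive (cf b); exists F.
  exists (fun t => x + \row_b F b t) => _.
  have dc t : `|t| < 1 -> curve_deriv (fun t => x + \row_b F b t) t (V (c (K t))).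
    move=> t1 b; rewrite (_ : (fun _ => _) = (fun s => x 0 b + F b s)); last first.
      by apply/funext => s; rewrite !mxE.
    rewrite -[V _ 0 b]add0r; apply: is_deriveD; exact: (HF b).2.
  split => [t /dc||t tt]; first exact: curve_deriv_cont.
    by apply/rowP => b; rewrite !mxE (HF b).1 addr0.
  by rewrite -{2}(Kt _ tt); apply: dc; exact: lt_trans tau1.
pose c k := iter k step (fun=> x).
have gck k : good (c k).
  by elim: k => [|k IH]; [move=> t _; exact: cst_continuous|have [] := Hstep _ IH].
have c0 k : c k 0 = x by case: k => [|k] //; have [] := Hstep _ (gck k).
have dc k t : `|t| < tau -> curve_deriv (c k.+1) t (V (c k t)).
  by move=> tt; have [_ _] := Hstep _ (gck k); apply.
pose C := `|V x|.
have C0 : 0 <= C := normr_ge0 _.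
have P0 k : 0 <= C * 2^-1 ^+ k by apply: mulr_ge0 => //; apply: exprn_ge0; rewrite invr_ge0.
have diff k t : `|t| < tau -> `|c k.+1 t - c k t| <= C * 2^-1 ^+ k.
  elim: k t => [|k IH] t tt.
    have -> : c 0%N t = c 1%N 0 by rewrite c0.
    rewrite expr0 mulr1; apply: (@le_trans _ _ (C * `|t|)); last first.
      by rewrite -[leRHS]mulr1; apply: ler_wpM2l; [exact: normr_ge0|exact: ltW (lt_trans tt tau1)].
    apply: (@curve_bound R m (c 1%N) (fun s => V (c 0%N s)) C t (normr_ge0 _)) => s st.
      by apply: dc; exact: le_lt_trans tt.
    exact: lexx.
  pose w s := c k.+2 s - c k.+1 s.
  have -> : c k.+2 t - c k.+1 t = w t - w 0 by rewrite /w !c0 subrr subr0.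
  have Ck0 : 0 <= L * (C * 2^-1 ^+ k) := mulr_ge0 L0 (P0 k).
  apply: (@le_trans _ _ (L * (C * 2^-1 ^+ k) * `|t|)).
    apply: (@curve_bound R m w (fun s => V (c k.+1 s) - V (c k s)) _ _ Ck0) => s st.
      move=> b; rewrite (_ : (fun _ => _) = (fun s => c k.+2 s 0 b - c k.+1 s 0 b)); last first.
        by apply/funext => y; rewrite !mxE.
      by rewrite !mxE; apply: is_deriveB; apply: dc; exact: le_lt_trans tt.
    by rewrite (le_trans (lipV _ _)) // ler_wpM2l // IH // (le_lt_trans st).
  have -> : C * 2^-1 ^+ k.+1 = 2^-1 * (C * 2^-1 ^+ k) by rewrite exprS mulrCA.
  rewrite mulrAC; apply: ler_wpM2r (P0 k) _ _ _.
  by apply: le_trans Ltau; rewrite ler_wpM2l // ltW.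
have half1 : 2^-1 < 1 :> R by rewrite invf_lt1 // ltr1n.
have half0 : 0 <= 2^-1 :> R by rewrite invr_ge0.
have /choice[d Hd] t : exists l, `|t| < tau ->
    forall k, `|c k t - l| <= C * 2^-1 ^+ k / (1 - 2^-1).
  have [tt|nt] := pselect (`|t| < tau); last by exists 0.
  have [l Hl] := @vec_geometric_limit R m (fun k => c k t) C 2^-1 (normr_ge0 _) half0 half1 (fun k => diff k t tt).
  by exists l.
have dsmall e : 0 < e -> exists k, forall t, `|t| < tau ->
    `|c k t - d t| <= e /\ `|c k.+1 t - d t| <= e.
  move=> e0; have [k Hk] := geometric_small (C / (1 - 2^-1)) half0 half1 e0.
  exists k => t tt; have E j : C * 2^-1 ^+ j / (1 - 2^-1) = C / (1 - 2^-1) * 2^-1 ^+ j by rewrite mulrAC.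
  split; rewrite (le_trans (Hd t tt _)) // E // exprS (le_trans _ Hk) // mulrCA.
  by rewrite ler_piMl ?(ltW half1) // mulr_ge0 ?exprn_ge0 // divr_ge0 // subr_ge0 ltW.
have z0 : `|0 : R| < tau by rewrite normr0.
have d0 : d 0 = x.
  apply/eqP; rewrite -subr_eq0 -normr_le0; apply/ler_addgt0Pl => e e0; rewrite addr0.
  by have [k /(_ 0 z0) [+ _]] := dsmall e e0; rewrite c0 distrC.
exists d; split => // t tt b.
have L1 : 0 < L + 1 by rewrite ltr_wpDl.
have rt : 0 < tau - `|t| by rewrite subr_gt0.
have near s : `|s - t| < tau - `|t| -> `|s| < tau.
  rewrite ltrBrDr; apply: le_lt_trans.
  by rewrite -[X in `|X| <= _](subrK t) (le_trans (ler_normD _ _)).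
have cd : {for t, continuous d}.
  apply/continuous_eps => e e0; have e3 : 0 < e / 3 by rewrite divr_gt0.
  have [k Hk] := dsmall _ e3.
  have t1 : `|t| < 1 := lt_trans tt tau1.
  have [r r0 Hr] := (continuous_eps _ _).1 (gck k t t1) _ e3.
  exists (Num.min r (tau - `|t|)) => [|s]; first by rewrite lt_min r0.
  rewrite lt_min => /andP[/Hr sr /near stau].
  have [h1 _] := Hk s stau; have [h2 _] := Hk t tt.
  rewrite (le_lt_trans (ler_distD (c k s) _ _)) // distrC.
  have -> : e = e / 3 + (e / 3 + e / 3) by field.
  rewrite ler_ltD // (le_lt_trans (ler_distD (c k t) _ _)) // addrC [X in _ < X]addrC.
  by rewrite ler_ltD.
apply: (@limit_derive R (fun s => d s 0 b) (fun s => V (d s) 0 b) t (tau - `|t|) rt) => [e e0|].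
  have e1 : 0 < Num.min e (e / (L + 1)) by rewrite lt_min e0 divr_gt0.
  have [k Hk] := dsmall _ e1; exists (fun s => c k.+1 s 0 b), (fun s => V (c k s) 0 b) => s /near sr.
  have [h1 h2] := Hk s sr; split; first exact: dc.
    have := coord_le_norm (c k.+1 s - d s) b; rewrite !mxE => /le_trans; apply.
    by rewrite (le_trans h2) // ge_min lexx.
  have := coord_le_norm (V (c k s) - V (d s)) b; rewrite !mxE => /le_trans; apply.
  rewrite (le_trans (lipV _ _)) //; move: h1; rewrite le_min => /andP[_].
  by rewrite ler_pdivlMr // mulrC; apply: le_trans; rewrite ler_wpM2r // lerDl.
apply: (@rV_coord_continuous R m _ (fun s => V (d s))).
by apply: (continuous_comp cd); exact: cV.
Qed.

Lemma fin_pos_min (R : realType) (I : finType) (f : I -> R) : (forall i, 0 < f i) ->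
  exists2 r : R, 0 < r & forall i, r <= f i.
Proof.
move=> f0; exists (\big[Num.min/1]_i f i); first by apply: lt_bigmin.
by move=> i; apply: bigmin_le.
Qed.

Lemma segment_in_ball (R : realType) m (z x y : 'rV[R]_m) (r t : R) :
  `|x - z| < r -> `|y - z| < r -> 0 <= t <= 1 -> `|x + t *: (y - x) - z| < r.
Proof.
move=> xr yr /andP[t0 t1].
have -> : x + t *: (y - x) - z = (1 - t) *: (x - z) + t *: (y - z).
  by apply/rowP => b; rewrite !mxE; ring.
rewrite (le_lt_trans (ler_normD _ _)) // !normrZ (ger0_norm t0) ger0_norm ?subr_ge0 //.
have [->|tn] := eqVneq t 0; first by rewrite subr0 mul1r mul0r addr0.
have -> : r = (1 - t) * r + t * r by ring.
by rewrite ler_ltD ?ler_wpM2l ?subr_ge0 ?(ltW xr) // ltr_pM2l // lt0r tn.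
Qed.

Lemma clamp_in (R : realType) (z r y : R) : 0 <= r ->
  `|Num.max (z - r) (Num.min (z + r) y) - z| <= r.
Proof.
move=> r0; rewrite ler_norml; case: (leP (z + r) y) => h1.
  by case: (leP (z - r) (z + r)) => h2; apply/andP; split; lra.
by case: (leP (z - r) y) => h2; apply/andP; split; lra.
Qed.

Section Lipschitz.
Context {R : realType} {m : nat}.
Implicit Types (U : set 'rV[R]_m) (z x y v : 'rV[R]_m).

Lemma Ck1_lipschitz p U (F : 'rV[R]_m -> 'rV[R]_p) z : open U ->
  (forall b, Ck_on 1 U (fun x => F x 0 b)) -> U z ->
  exists r L : R, [/\ 0 < r, 0 <= L, forall x, `|x - z| < r -> U x &
    forall x y, `|x - z| < r -> `|y - z| < r -> `|F x - F y| <= L * `|x - y|].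
Proof.
move=> oU cF Uz.
pose K b a : R := `|partial a (fun x => F x 0 b) z| + 1.
have N1 : nbhs z U := open_nbhs_nbhs (conj oU Uz).
have N2 : nbhs z [set x | forall b a, `|partial a (fun x => F x 0 b) x| <= K b a].
  apply: (@filter_forall _ _ (fun b x => forall a, `|partial a (fun x => F x 0 b) x| <= K b a) (nbhs z) _) => b.
  apply: (@filter_forall _ _ (fun a x => `|partial a (fun x => F x 0 b) x| <= K b a) (nbhs z) _) => a.
  have [d d0 Hd] := (continuous_eps _ _).1 (Ck_cont (Ck_partial a (cF b)) Uz) 1 ltr01.
  apply/nbhs_norm_ball; exists d => // x /Hd /ltW H.
  rewrite -[X in `|X| <= _](subrK (partial a (fun x => F x 0 b) z)).
  by rewrite (le_trans (ler_normD _ _)) // addrC lerD2l.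
have [r r0 Hr] := (nbhs_norm_ball _ _).1 (@filterI _ _ (nbhs_filter z) _ _ N1 N2).
have K0 b a : 0 <= K b a by rewrite addr_ge0.
exists r, (\sum_b \sum_a K b a); split => // [|x /Hr[]//|x y xr yr].
  by do 2!apply: sumr_ge0 => ? _.
apply: norm_le_coord => [|b].
  by rewrite mulr_ge0 //; do 2!apply: sumr_ge0 => ? _.
rewrite !mxE; have HU (t : R) : 0 <= t <= 1 -> `|y + t *: (x - y) - z| < r := segment_in_ball yr xr.
have [t /HU /Hr[Ut Kt] E] : exists2 t : R, 0 <= t <= 1 &
    F (y + (x - y)) 0 b - F y 0 b = 'D_(x - y) (fun x => F x 0 b) (y + t *: (x - y)).
  apply: (@MVT01 R m (fun x => F x 0 b)) => t /HU /Hr[Ut _]; apply: diff_derivable.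
  by have [] := Ck_diff oU (cF b) Ut.
rewrite subrKC in E; rewrite E (Ck_diff oU (cF b) Ut).2.
rewrite (le_trans (ler_norm_sum _ _ _)) //.
apply: (@le_trans _ _ (\sum_a K b a * `|x - y|)).
  apply: ler_sum => a _; rewrite normrM mulrC ler_pM //; exact: coord_le_norm.
rewrite -mulr_suml ler_wpM2r // (bigD1 b) //= lerDl.
by do 2!apply: sumr_ge0 => ? _.
Qed.

(** The first derivatives are Lipschitz near [z], so the remainder is quadratic with a constant
    uniform in the base point [y]. Uniformity matters because the base point will move along a
    trajectory. *)
Lemma Ck2_remainder p U (V : 'rV[R]_m -> 'rV[R]_p) z : open U ->
  (forall b, Ck_on 2 U (fun x => V x 0 b)) -> U z ->
  exists r L : R, [/\ 0 < r, 0 <= L, forall x, `|x - z| < r -> U x &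
    forall y v, `|y - z| < r -> `|y + v - z| < r ->
    `|V (y + v) - V y - \row_b \sum_c v 0 c * partial c (fun x => V x 0 b) y| <= L * `|v| ^+ 2].
Proof.
move=> oU cV Uz.
have /choice[w Hw] b : exists w : R * R, [/\ 0 < w.1, 0 <= w.2, forall x, `|x - z| < w.1 -> U x &
    forall x y, `|x - z| < w.1 -> `|y - z| < w.1 ->
    `|(\row_c partial c (fun x => V x 0 b) x) - \row_c partial c (fun x => V x 0 b) y| <= w.2 * `|x - y|].
  have [|r [L H]] := @Ck1_lipschitz m U (fun x => \row_c partial c (fun x => V x 0 b) x) z oU _ Uz.
    move=> c; rewrite (_ : (fun x => _) = partial c (fun x => V x 0 b)).
      exact: Ck_partial.
    by apply/funext => x; rewrite mxE.
  by exists (r, L).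
have w10 b : 0 < (w b).1 by case: (Hw b).
have [r1 r10 Hr1] := fin_pos_min w10.
have [r2 r20 Hr2] := open_ball_in oU Uz.
exists (Num.min r1 r2), (\sum_b m%:R * (w b).2); split => [|||y v].
- by rewrite lt_min r10 r20.
- by apply: sumr_ge0 => b _; rewrite mulr_ge0 //; case: (Hw b).
- by move=> x; rewrite lt_min => /andP[_ /Hr2].
move=> yr yvr; have S0 : 0 <= (\sum_b m%:R * (w b).2) by apply: sumr_ge0 => b _; rewrite mulr_ge0 //; case: (Hw b).
apply: norm_le_coord => [|b]; first by rewrite mulr_ge0 // exprn_ge0.
have [w1 w2 _ Hb] := Hw b.
have small x : `|x - z| < Num.min r1 r2 -> `|x - z| < (w b).1 /\ U x.
  rewrite lt_min => /andP[h1 h2]; split; last exact: Hr2.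
  exact: lt_le_trans h1 (Hr1 b).
have HU (t : R) : 0 <= t <= 1 -> `|y + t *: v - z| < Num.min r1 r2.
  by move=> t01; have := segment_in_ball yr yvr t01; rewrite [y + v]addrC addrK.
have [t t01 E] : exists2 t : R, 0 <= t <= 1 &
    V (y + v) 0 b - V y 0 b = 'D_v (fun x => V x 0 b) (y + t *: v).
  apply: (@MVT01 R m (fun x => V x 0 b)) => t /HU /small[_ Ut]; apply: diff_derivable.
  by have [] := Ck_diff oU (cV b) Ut.
have [tb Ut] := small _ (HU t t01); have [yb _] := small _ yr.
rewrite !mxE E (Ck_diff oU (cV b) Ut).2 -sumrB (le_trans (ler_norm_sum _ _ _)) //.
apply: (@le_trans _ _ (\sum_(c < m) (w b).2 * `|v| ^+ 2)).
  apply: ler_sum => c _; rewrite -mulrBr normrM expr2 mulrCA.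
  rewrite ler_pM // ?coord_le_norm //.
  have := coord_le_norm ((\row_c partial c (fun x => V x 0 b) (y + t *: v)) -
     \row_c partial c (fun x => V x 0 b) y) c; rewrite !mxE => /le_trans; apply.
  rewrite (le_trans (Hb _ _ tb yb)) // ler_wpM2l // addrC addKr normrZ.
  by move: t01 => /andP[t0 t1]; rewrite ger0_norm // ler_piMl.
have -> : \sum_(c < m) (w b).2 * `|v| ^+ 2 = m%:R * (w b).2 * `|v| ^+ 2.
  by rewrite sumr_const card_ord mulr_natl -mulrnAl.
apply: ler_wpM2r; first exact: exprn_ge0.
rewrite (bigD1 b) //= lerDl.
by apply: sumr_ge0 => b' _; rewrite mulr_ge0 //; case: (Hw b').
Qed.

(** Retraction onto the closed sup-norm ball. Being 1-Lipschitz, it extends a field that is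
    Lipschitz on a ball to a globally Lipschitz one. *)
Definition clampv (z : 'rV[R]_m) (r : R) (y : 'rV[R]_m) : 'rV[R]_m :=
  \row_a Num.max (z 0 a - r) (Num.min (z 0 a + r) (y 0 a)).

Lemma clampv_lip z r x y : `|clampv z r x - clampv z r y| <= `|x - y|.
Proof.
apply: norm_le_coord => // a; rewrite !mxE (le_trans (clamp_lip _ _ _ _)) //.
by have := coord_le_norm (x - y) a; rewrite !mxE.
Qed.

Lemma clampv_in z r y : 0 <= r -> `|clampv z r y - z| <= r.
Proof.
by move=> r0; apply: norm_le_coord => // a; rewrite !mxE clamp_in.
Qed.

Lemma clampv_id z r y : `|y - z| <= r -> clampv z r y = y.
Proof.
move=> yr; apply/rowP => a; rewrite !mxE.
have := le_trans (coord_le_norm (y - z) a) yr; rewrite !mxE ler_norml => /andP[h1 h2].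
have h3 : y 0 a <= z 0 a + r by rewrite -lerBlDl.
have h4 : z 0 a - r <= y 0 a by rewrite addrC -lerBrDr.
by rewrite (min_idPr h3) (max_idPr h4).
Qed.

(** [picard] is applied to the clamped field, which is globally Lipschitz with speed at most [K].
    For times below [tau] a solution starting within [r / 2] moves by at most [r / 2], so it stays
    where clamping is the identity and solves the original equation. *)
Lemma flow_exists U (V : 'rV[R]_m -> 'rV[R]_m) z : open U ->
  (forall b, Ck_on 1 U (fun x => V x 0 b)) -> U z ->
  exists r tau (phi : R -> 'rV[R]_m -> 'rV[R]_m), [/\ 0 < r, 0 < tau,
    forall x, `|x - z| < r -> phi 0 x = x &
    forall t x, `|t| < tau -> `|x - z| < r ->
      U (phi t x) /\ curve_deriv (fun s => phi s x) t (V (phi t x))].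
Proof.
move=> oU cV Uz; have [r0 [L [r00 L0 HU HL]]] := Ck1_lipschitz oU cV Uz.
pose r := r0 / 2; have r_gt0 : 0 < r by rewrite divr_gt0.
have rr0 : r < r0 by rewrite /r ltr_pdivrMr // mulr_natr mulr2n ltrDl.
have cin x : `|clampv z r x - z| < r0 := le_lt_trans (clampv_in z x (ltW r_gt0)) rr0.
pose W x := V (clampv z r x).
have lipW x y : `|W x - W y| <= L * `|x - y|.
  by rewrite (le_trans (HL _ _ (cin x) (cin y))) // ler_wpM2l // clampv_lip.
pose K := `|V z| + L * r0.
have K0 : 0 <= K by rewrite addr_ge0 // mulr_ge0 // ltW.
have bW x : `|W x| <= K.
  rewrite -[W x](subrKC (V z)) (le_trans (ler_normD _ _)) // lerD2l.
  rewrite (le_trans (HL _ _ (cin x) _)) ?subrr ?normr0 //.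
  by rewrite ler_wpM2l // ltW.
pose tau := Num.min 2^-1 (Num.min (2^-1 / (L + 1)) (r / 2 / (K + 1))).
have L1 : 0 < L + 1 by rewrite ltr_wpDl.
have K1 : 0 < K + 1 by rewrite ltr_wpDl.
have tau0 : 0 < tau by rewrite !lt_min invr_gt0 ltr0n /= !divr_gt0 // invr_gt0.
have tau1 : tau < 1 by rewrite gt_min invf_lt1 // ltr1n.
have Ltau : L * tau <= 2^-1.
  apply: (@le_trans _ _ ((L + 1) * tau)); first by rewrite ler_wpM2r ?lerDl // ltW.
  by rewrite mulrC -ler_pdivlMr // /tau !ge_min lexx orbT.
have Ktau : K * tau <= r / 2.
  apply: (@le_trans _ _ ((K + 1) * tau)); first by rewrite ler_wpM2r ?lerDl // ltW.
  by rewrite mulrC -ler_pdivlMr // /tau !ge_min lexx !orbT.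
have /choice[c Hc] x : exists c : R -> 'rV[R]_m, c 0 = x /\
    forall t, `|t| < tau -> curve_deriv c t (W (c t)).
  exact: (picard x L0 lipW tau0 tau1 Ltau).
exists (r / 2), tau, (fun t x => c x t); split => // [|x _|t x tt xr].
- by rewrite divr_gt0.
- by case: (Hc x).
have [c0 dc] := Hc x.
have cr : `|c x t - z| <= r.
  rewrite (le_trans (ler_distD x _ _)) // [leRHS]splitr lerD ?(ltW xr) // -{2}c0.
  apply: le_trans Ktau; apply: (@le_trans _ _ (K * `|t|)); last by rewrite ler_wpM2l // ltW.
  apply: (@curve_bound R m (c x) (fun s => W (c x s)) K t K0) => s st; last exact: bW.
  by apply: dc; exact: le_lt_trans tt.
split; first by apply: HU; exact: le_lt_trans rr0.
by have := dc t tt; rewrite /W (clampv_id cr).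
Qed.
End Lipschitz.

(** * Smooth dependence of flows on the initial point *)

Section Flow.
Context {R : realType}.

Definition flow_on m (U : set 'rV[R]_m) (V : 'rV[R]_m -> 'rV[R]_m) z r tau
    (phi : R -> 'rV[R]_m -> 'rV[R]_m) : Prop :=
  [/\ 0 < r, 0 < tau, forall x, `|x - z| < r -> phi 0 x = x &
    forall t x, `|t| < tau -> `|x - z| < r ->
      U (phi t x) /\ curve_deriv (fun s => phi s x) t (V (phi t x))].

Definition nball m (z : 'rV[R]_m) (r : R) := [set x : 'rV[R]_m | `|x - z| < r].

Lemma flow_on_shrink m (U U' : set 'rV[R]_m) V z r tau phi r' tau' :
  U `<=` U' -> 0 < r' -> 0 < tau' -> r' <= r -> tau' <= tau ->
  flow_on U V z r tau phi -> flow_on U' V z r' tau' phi.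
Proof.
move=> UU r0 t0 rr tt [_ _ h1 h2]; split => // [x xr|t x tx xr].
  by apply: h1; exact: lt_le_trans rr.
have [h3 h4] := h2 t x (lt_le_trans tx tt) (lt_le_trans xr rr).
by split => //; exact: UU.
Qed.

(** All dimensions and all fields are quantified inside, because the inductive step applies the
    property to a field on a space of twice the dimension. *)
Definition flow_Ck_prop k := forall m (U : set 'rV[R]_m) (V : 'rV[R]_m -> 'rV[R]_m) z,
  open U -> (forall j b, Ck_on j U (fun x => V x 0 b)) -> U z ->
  exists r tau phi, flow_on U V z r tau phi /\
    forall t b, `|t| < tau -> Ck_on k (nball z r) (fun x => phi t x 0 b).

Lemma flow_lipschitz m (V : 'rV[R]_m -> 'rV[R]_m) z r tau phi rho L t x y : 0 <= L ->
  L * tau <= 2^-1 ->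
  (forall x y, `|x - z| < rho -> `|y - z| < rho -> `|V x - V y| <= L * `|x - y|) ->
  flow_on (nball z rho) V z r tau phi -> `|t| < tau -> `|x - z| < r -> `|y - z| < r ->
  `|phi t x - phi t y| <= 2 * `|x - y|.
Proof.
move=> L0 Ltau HL [_ _ p0 Hp] tt xr yr.
have := @gronwall R m (fun s => phi s x) (fun s => phi s y) (fun s => V (phi s x))
  (fun s => V (phi s y)) tau L 0 t L0 (lexx 0) Ltau.
rewrite mulr0 addr0 (p0 _ xr) (p0 _ yr); apply => // s st.
- by have [] := Hp s x st xr.
- by have [] := Hp s y st yr.
- by rewrite addr0; apply: HL; [have [] := Hp s x st xr|have [] := Hp s y st yr].
Qed.

Lemma flow_C0 : flow_Ck_prop 0.
Proof.
move=> m U V z oU cV Uz.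
have [rho [L [rho0 L0 HU HL]]] := Ck1_lipschitz oU (cV 1) Uz.
have oB : open (nball z rho) by exact: open_norm_ball.
have Bz : nball z rho z by rewrite /nball /= subrr normr0.
have [r [tau [phi fl]]] := flow_exists oB (fun b => Ck_sub HU (cV 1 b)) Bz.
have [r0 tau0 p0 _] := fl; have L1 : 0 < L + 1 by rewrite ltr_wpDl.
pose tau' := Num.min tau (2^-1 / (L + 1)).
have tau'0 : 0 < tau' by rewrite lt_min tau0 divr_gt0 // invr_gt0.
have Ltau : L * tau' <= 2^-1.
  apply: (@le_trans _ _ ((L + 1) * tau')); first by rewrite ler_wpM2r ?lerDl // ltW.
  by rewrite mulrC -ler_pdivlMr // /tau' ge_min lexx orbT.
have tt : tau' <= tau by rewrite ge_min lexx.
have fl' := flow_on_shrink (@subset_refl _ _) r0 tau'0 (lexx r) tt fl.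
exists r, tau', phi; split; first exact: flow_on_shrink HU r0 tau'0 (lexx r) (lexx _) fl'.
move=> t b ttau; split => // x xr; apply: rV_coord_continuous; apply/continuous_eps => e e0.
have [d d0 Hd] := open_ball_in (@open_norm_ball R _ z r) xr.
exists (Num.min d (e / 2)) => [|y]; first by rewrite lt_min d0 divr_gt0.
rewrite lt_min => /andP[/Hd yr ye].
rewrite (le_lt_trans (flow_lipschitz L0 Ltau HL fl' ttau yr xr)) //.
by rewrite mulrC -ltr_pdivlMr.
Qed.

Section Augmented.
Variables (m : nat) (V : 'rV[R]_m -> 'rV[R]_m).

Definition dfield (x xi : 'rV[R]_m) : 'rV[R]_m :=
  \row_b \sum_c xi 0 c * partial c (fun x => V x 0 b) x.

(** The field of the variational equation: the first half follows [V], the second half its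
    linearisation along the first. *)
Definition augmented (y : 'rV[R]_(m + m)) : 'rV[R]_(m + m) :=
  row_mx (V (lsubmx y)) (dfield (lsubmx y) (rsubmx y)).

Lemma norm_lsubmx (y : 'rV[R]_(m + m)) : `|lsubmx y| <= `|y|.
Proof. by apply: norm_le_coord => // b; rewrite mxE coord_le_norm. Qed.

Lemma norm_rsubmx (y : 'rV[R]_(m + m)) : `|rsubmx y| <= `|y|.
Proof. by apply: norm_le_coord => // b; rewrite mxE coord_le_norm. Qed.

Lemma norm_row_mx (x xi : 'rV[R]_m) (c : R) : `|x| < c -> `|xi| < c -> `|row_mx x xi| < c.
Proof.
move=> h1 h2; apply: norm_lt_coord => [|b]; first exact: le_lt_trans h1.
case: (split_ordP b) => j ->; rewrite ?row_mxEl ?row_mxEr.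
  exact: le_lt_trans (coord_le_norm _ _) h1.
exact: le_lt_trans (coord_le_norm _ _) h2.
Qed.

(** The second half starts at a basis vector, of norm 1. The bound 2 keeps it controlled for a short
    time and makes the error estimates uniform. *)
Definition aug_dom (z : 'rV[R]_m) (rho : R) : set 'rV[R]_(m + m) :=
  [set y | `|lsubmx y - z| < rho /\ `|rsubmx y| < 2].

Lemma aug_dom_open z rho : open (aug_dom z rho).
Proof.
apply: open_of_balls => y [h1 h2].
exists (Num.min (rho - `|lsubmx y - z|) (2 - `|rsubmx y|)) => [|w].
  by rewrite lt_min !subr_gt0 h1.
rewrite lt_min => /andP[w1 w2]; split.
  rewrite (le_lt_trans (ler_distD (lsubmx y) _ _)) // -ltrBrDr.
  by rewrite (le_lt_trans _ w1) // -linearB norm_lsubmx.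
rewrite -[rsubmx w](subrK (rsubmx y)) (le_lt_trans (ler_normD _ _)) // -ltrBrDr.
by rewrite (le_lt_trans _ w2) // -linearB norm_rsubmx.
Qed.

Lemma augmented_Ck z rho U : open U -> (forall j b, Ck_on j U (fun x => V x 0 b)) ->
  nball z rho `<=` U -> forall j b, Ck_on j (aug_dom z rho) (fun y => augmented y 0 b).
Proof.
move=> oU cV BU j b; have oA := @aug_dom_open z rho.
have lift (h : 'rV[R]_m -> R) : Ck_on j U h -> Ck_on j (aug_dom z rho) (h \o lsubmx).
  move=> ch; apply: (Ck_comp oA oU) => // [y [yl _]|c]; first exact: BU.
  rewrite (_ : (fun x => _) = (fun y : 'rV[R]_(m + m) => y 0 (lshift m c))); first exact: Ck_coord.
  by apply/funext => y; rewrite mxE.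
case: (split_ordP b) => c ->.
  rewrite (_ : (fun y => _) = (fun x => V x 0 c) \o lsubmx); first exact: lift.
  by apply/funext => y; rewrite /augmented row_mxEl.
rewrite (_ : (fun y => _) = (fun y : 'rV[R]_(m + m) => \sum_d y 0 (rshift m d) *
    (partial d (fun x => V x 0 c) \o lsubmx) y)); last first.
  apply/funext => y; rewrite /augmented row_mxEr mxE; apply: eq_bigr => d _.
  by rewrite mxE.
apply: (Ck_sum _ _ oA) => d; apply: (Ck_mul oA); first exact: Ck_coord.
by apply: lift; apply: Ck_partial.
Qed.
End Augmented.

Lemma dfieldZ m (V : 'rV[R]_m -> 'rV[R]_m) x (h : R) xi : dfield V x (h *: xi) = h *: dfield V x xi.
Proof.
by apply/rowP => b; rewrite !mxE mulr_sumr; apply: eq_bigr => c _; rewrite mxE mulrA.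
Qed.

Lemma is_derive_near (f g : R -> R) (t d l : R) : 0 < d ->
  (forall s, `|s - t| < d -> f s = g s) -> is_derive t 1 f l -> is_derive t 1 g l.
Proof.
move=> d0 H; apply: near_eq_is_derive.
by apply/nbhs_norm_ball; exists d => // s /H.
Qed.

Lemma small_time (tau t : R) : `|t| < tau -> 0 < tau - `|t| /\
  forall s, `|s - t| < tau - `|t| -> `|s| < tau.
Proof.
rewrite subr_gt0 => tt; split => // s; rewrite ltrBrDr; apply: le_lt_trans.
by rewrite -[X in `|X| <= _](subrK t) (le_trans (ler_normD _ _)).
Qed.

(* The derivative of the flow in direction [a] is the second half of the
   augmented flow starting at [(x, e_a)]; differentiability is Gronwall applied
   to [phi t (x + h e_a)] and [phi t x + h eta]. *)
Lemma flow_step k : flow_Ck_prop k -> forall m (U : set 'rV[R]_m) (V : 'rV[R]_m -> 'rV[R]_m) z, open U ->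
  (forall j b, Ck_on j U (fun x => V x 0 b)) -> U z ->
  exists r tau phi, [/\ flow_on U V z r tau phi,
    forall t b, `|t| < tau -> Ck_on k.+1 (nball z r) (fun x => phi t x 0 b) &
    forall t x a, `|t| < tau -> `|x - z| < r ->
      curve_deriv (fun s => \row_b partial a (fun y => phi s y 0 b) x) t
        (dfield V (phi t x) (\row_b partial a (fun y => phi t y 0 b) x))].
Proof.
move=> IH m U V z oU cV Uz.
have [r1 [L [r10 L0 HU HL]]] := Ck1_lipschitz oU (cV 1) Uz.
have [r2 [Lam [r20 Lam0 _ HR]]] := Ck2_remainder oU (cV 2) Uz.
(* Half of the available radius is reserved for the displacement [h *: eta], whose norm is at most
   [2 * |h| < rho]. *)
pose rho := Num.min r1 r2 / 2.
have m0 : 0 < Num.min r1 r2 by rewrite lt_min r10.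
have rho0 : 0 < rho by rewrite divr_gt0.
have rho2 : rho + rho = Num.min r1 r2 by rewrite -splitr.
have rr : rho <= Num.min r1 r2 by rewrite -rho2 lerDl ltW.
have BU : nball z rho `<=` U.
  move=> x /lt_le_trans /(_ rr); rewrite lt_min => /andP[/HU //].
have oB : open (nball z rho) by exact: open_norm_ball.
have Bz : nball z rho z by rewrite /nball /= subrr normr0.
have [r3 [tau3 [phi [fl3 cphi]]]] := IH m _ V z oB (fun j b => Ck_sub BU (cV j b)) Bz.
pose e (a : 'I_m) : 'rV[R]_m := delta_mx 0 a.
have /choice[w Hw] a : exists w : R * R * (R -> 'rV[R]_(m + m) -> 'rV[R]_(m + m)),
    flow_on (aug_dom z rho) (augmented V) (row_mx z (e a)) w.1.1 w.1.2 w.2 /\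
    forall t b, `|t| < w.1.2 -> Ck_on k (nball (row_mx z (e a)) w.1.1) (fun x => w.2 t x 0 b).
  have Az : aug_dom z rho (row_mx z (e a)).
    by rewrite /aug_dom /= row_mxKl row_mxKr subrr normr0 norm_delta_mx ltr1n.
  have [r [tau [psi H]]] := IH _ _ _ _ (@aug_dom_open m z rho) (augmented_Ck oU cV BU) Az.
  by exists (r, tau, psi).
have rw0 a : 0 < (w a).1.1 by have [[]] := Hw a.
have tw0 a : 0 < (w a).1.2 by have [[]] := Hw a.
have [r4 r40 Hr4] := fin_pos_min rw0; have [tau4 tau40 Htau4] := fin_pos_min tw0.
have [r30 tau30 _ _] := fl3.
have L1 : 0 < L + 1 by rewrite ltr_wpDl.
pose r := Num.min r3 r4; pose tau := Num.min (Num.min tau3 tau4) (Num.min 1 (2^-1 / (L + 1))).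
have r0 : 0 < r by rewrite lt_min r30.
have tau0 : 0 < tau by rewrite !lt_min tau30 tau40 ltr01 divr_gt0 // invr_gt0.
have tt3 : tau <= tau3 by rewrite !ge_min lexx.
have tt4 a : tau <= (w a).1.2 by apply: le_trans (Htau4 a); rewrite !ge_min lexx orbT.
have tau1 : tau <= 1 by rewrite !ge_min lexx !orbT.
have Ltau : L * tau <= 2^-1.
  apply: (@le_trans _ _ ((L + 1) * tau)); first by rewrite ler_wpM2r ?lerDl // ltW.
  by rewrite mulrC -ler_pdivlMr // /tau !ge_min lexx !orbT.
have rr3 : r <= r3 by rewrite ge_min lexx.
have fl := flow_on_shrink (@subset_refl _ _) r0 tau0 rr3 tt3 fl3.
have [_ _ phi0 Hphi] := fl.
pose X a t x := lsubmx ((w a).2 t (row_mx x (e a))).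
pose eta a t x := rsubmx ((w a).2 t (row_mx x (e a))).
have inr a x : `|x - z| < r -> `|row_mx x (e a) - row_mx z (e a)| < (w a).1.1.
  move=> xr; rewrite opp_row_mx add_row_mx subrr; apply: norm_row_mx; last by rewrite normr0.
  by rewrite (lt_le_trans xr) // (le_trans _ (Hr4 a)) // ge_min lexx orbT.
have aug a t x : `|t| < tau -> `|x - z| < r ->
    [/\ nball z rho (X a t x), `|eta a t x| < 2, curve_deriv (fun s => X a s x) t (V (X a t x)) &
      curve_deriv (fun s => eta a s x) t (dfield V (X a t x) (eta a t x))].
  move=> tt xr; have [[_ _ _ Hfl] _] := Hw a.
  have [[h1 h2] h3] := Hfl t _ (lt_le_trans tt (tt4 a)) (inr a x xr).
  split => // b.
    have := h3 (lshift m b); rewrite /augmented row_mxEl; congr (is_derive _ _ _ _).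
    by apply/funext => s; rewrite /X mxE.
  have := h3 (rshift m b); rewrite /augmented row_mxEr; congr (is_derive _ _ _ _).
  by apply/funext => s; rewrite /eta mxE.
have aug0 a x : `|x - z| < r -> X a 0 x = x /\ eta a 0 x = e a.
  move=> xr; have [[_ _ Hfl _] _] := Hw a.
  by rewrite /X /eta Hfl; [rewrite row_mxKl row_mxKr|exact: inr].
have toL x y : nball z rho x -> nball z rho y -> `|V x - V y| <= L * `|x - y|.
  move=> /lt_le_trans /(_ rr); rewrite lt_min => /andP[h1 _].
  by move=> /lt_le_trans /(_ rr); rewrite lt_min => /andP[h2 _]; exact: HL.
(* The first half of the augmented flow solves the same equation as [phi] with the same initial
   value, so Gronwall identifies the two. *)
have XE a t x : `|t| < tau -> `|x - z| < r -> X a t x = phi t x.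
  move=> tt xr; apply/eqP; rewrite -subr_eq0 -normr_le0.
  have := @gronwall R m (fun s => X a s x) (fun s => phi s x) (fun s => V (X a s x))
    (fun s => V (phi s x)) tau L 0 t L0 (lexx 0) Ltau.
  rewrite (phi0 _ xr) (aug0 a x xr).1 subrr normr0 !mulr0 addr0; apply => // s st.
  - by have [] := aug a s x st xr.
  - by have [] := Hphi s x st xr.
  - by rewrite addr0; apply: toL; [have [] := aug a s x st xr|have [] := Hphi s x st xr].
have der a t x : `|t| < tau -> `|x - z| < r -> forall h : R, 2 * `|h| < rho ->
    `|x + h *: e a - z| < r ->
    `|phi t (x + h *: e a) - (phi t x + h *: eta a t x)| <= 8 * Lam * `|h| ^+ 2.
  (* [E] bounds the residual with which [phi s x + h *: eta] solves the equation, namely [Lam] times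
     the square of a displacement of norm at most [2 * |h|]. Gronwall multiplies it by
     [2 * tau <= 2], whence the constant 8. *)
  move=> tt xr h hr xhr; pose E := Lam * (4 * `|h| ^+ 2).
  have E0 : 0 <= E by rewrite !mulr_ge0 // exprn_ge0.
  apply: (@le_trans _ _ (2 * tau * E)); last first.
    rewrite (_ : 8 * Lam * _ = 2 * 1 * E); last by rewrite /E; ring.
    by rewrite ler_wpM2r // ler_wpM2l.
  have := @gronwall R m (fun s => phi s (x + h *: e a)) (fun s => phi s x + h *: eta a s x)
    (fun s => V (phi s (x + h *: e a))) (fun s => V (phi s x) + h *: dfield V (phi s x) (eta a s x))
    tau L E t L0 E0 Ltau.
  rewrite (phi0 _ xr) (phi0 _ xhr) (aug0 a x xr).2 subrr normr0 mulr0 add0r; apply => // s st.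
  - by have [] := Hphi s _ st xhr.
  - have [_ h1] := Hphi s x st xr; have [_ _ _ h2] := aug a s x st xr.
    move=> b; rewrite (_ : (fun _ => _) = (fun s => phi s x 0 b + h *: eta a s x 0 b)); last first.
      by apply/funext => y; rewrite !mxE.
    rewrite !mxE -[h * _]/(h *: _); apply: is_deriveD; first exact: h1.
    by apply: is_deriveZ; have := h2 b; rewrite (XE a s x st xr) mxE.
  - have [h1 _] := Hphi s x st xr; have [h3 _] := Hphi s _ st xhr; have [_ h2 _ _] := aug a s x st xr.
    have he : `|h *: eta a s x| <= 2 * `|h| by rewrite normrZ mulrC ler_wpM2r // ltW.
    have c2 : `|phi s x + h *: eta a s x - z| < Num.min r1 r2.
      rewrite addrAC -rho2 (le_lt_trans (ler_normD _ _)) // ltrD //.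
      exact: le_lt_trans hr.
    have c1 := lt_le_trans h1 rr; have c3 := lt_le_trans h3 rr.
    rewrite (le_trans (ler_distD (V (phi s x + h *: eta a s x)) _ _)) // lerD //.
      by apply: HL; [move: c3|move: c2]; rewrite lt_min => /andP[].
    rewrite opprD addrA -dfieldZ.
    have c1' : `|phi s x - z| < r2 by move: c1; rewrite lt_min => /andP[].
    have c2' : `|phi s x + h *: eta a s x - z| < r2 by move: c2; rewrite lt_min => /andP[].
    rewrite (le_trans (HR _ _ c1' c2')) // ler_wpM2l //.
    rewrite (_ : 4 * _ = (2 * `|h|) ^+ 2); last by ring.
    by rewrite lerXn2r ?nnegrE // mulr_ge0.
have dphi a t x b : `|t| < tau -> `|x - z| < r ->
    derivable (fun y => phi t y 0 b) x (e a) /\ partial a (fun y => phi t y 0 b) x = eta a t x 0 b.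
  move=> tt xr; rewrite partialE; apply: derive_eps => ep ep0.
  have [d d0 Hd] := open_ball_in (@open_norm_ball R _ z r) xr.
  have L8 : 0 < 8 * Lam + 1 by rewrite ltr_wpDl // mulr_ge0.
  exists (Num.min d (Num.min (rho / 2) (ep / (8 * Lam + 1)))) => [|h].
    by rewrite !lt_min d0 !divr_gt0.
  rewrite !lt_min => /and3P[hd hrho hep].
  have xhr : `|x + h *: e a - z| < r.
    by apply: Hd; rewrite addrC addKr normrZ norm_delta_mx mulr1.
  have hr : 2 * `|h| < rho by rewrite mulrC -ltr_pdivlMr.
  have := coord_le_norm (phi t (x + h *: e a) - (phi t x + h *: eta a t x)) b.
  rewrite !mxE opprD addrA => /le_trans; apply; apply: (le_trans (der a t x tt xr h hr xhr)).
  rewrite expr2 mulrA ler_wpM2r //; rewrite ltr_pdivlMr // in hep.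
  by rewrite (le_trans _ (ltW hep)) // mulrC ler_wpM2l // lerDl.
exists r, tau, phi; split => [|t b tt|t x a tt xr].
- exact: flow_on_shrink BU r0 tau0 (lexx _) (lexx _) fl.
- have oN : open (nball z r) by exact: open_norm_ball.
  apply: (@Ck_intro R m k _ _ (fun a x => eta a t x 0 b) oN) => [x xr|a x xr|a].
  + exact: Ck_cont (cphi t b (lt_le_trans tt tt3)) (lt_le_trans xr rr3).
  + exact: dphi.
  + have [_ /(_ t (rshift m b) (lt_le_trans tt (tt4 a))) H] := Hw a.
    rewrite (_ : (fun x => _) = (fun y => (w a).2 t y 0 (rshift m b)) \o (fun x => row_mx x (e a))); last first.
      by apply/funext => x; rewrite /eta mxE.
    apply: (Ck_comp oN (@open_norm_ball R _ _ _) _ _ H) => [x xr|c]; first exact: inr.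
    case: (split_ordP c) => d ->.
      rewrite (_ : (fun x => _) = (fun x : 'rV[R]_m => x 0 d)); first exact: Ck_coord.
      by apply/funext => x; rewrite row_mxEl.
    rewrite (_ : (fun x => _) = (fun x : 'rV[R]_m => e a 0 d)); first exact: Ck_cst.
    by apply/funext => x; rewrite row_mxEr.
- have [_ _ _ H] := aug a t x tt xr; have [d0 Hd] := small_time tt.
  move=> b; rewrite mxE; apply: (is_derive_near d0 (f := fun s => eta a s x 0 b)).
    by move=> s /Hd st; rewrite mxE (dphi a s x b st xr).2.
  have := H b; rewrite XE // mxE; congr (is_derive _ _ _ _); apply: eq_bigr => c _.
  by rewrite mxE (dphi a t x c tt xr).2.
Qed.

Theorem flow_Ck k : flow_Ck_prop k.
Proof.
elim: k => [|k IH]; first exact: flow_C0.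
move=> m U V z oU cV Uz; have [r [tau [phi [H1 H2 _]]]] := flow_step IH oU cV Uz.
by exists r, tau, phi.
Qed.
End Flow.

(** * The homothetic flow *)

Lemma is_derive_sum' (R : realType) (I : finType) (f : I -> R -> R) (l : I -> R) (t : R) :
  (forall i, is_derive t 1 (f i) (l i)) -> is_derive t 1 (fun s => \sum_i f i s) (\sum_i l i).
Proof.
move=> H; suff E (r : seq I) : is_derive t 1 (fun s : R => \sum_(i <- r) f i s) (\sum_(i <- r) l i) by exact: E.
elim: r => [|i r IH].
  rewrite big_nil (_ : (fun s => _) = cst 0); first exact: is_derive_cst.
  by apply/funext => s; rewrite big_nil.
rewrite big_cons (_ : (fun s => _) = (fun s : R => f i s + \sum_(i <- r) f i s)).
  exact: is_deriveD.
by apply/funext => s; rewrite big_cons.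
Qed.

Lemma is_derive_prod3 (R : realType) (f g h : R -> R) (f' g' h' t : R) :
  is_derive t 1 f f' -> is_derive t 1 g g' -> is_derive t 1 h h' ->
  is_derive t 1 (fun s => f s * g s * h s) (f' * g t * h t + f t * g' * h t + f t * g t * h').
Proof.
move=> df dg dh; apply: is_derive_eq (is_deriveM (is_deriveM df dg) dh) _.
change (f t * g t * h' + h t * (f t * g' + g t * f') = f' * g t * h t + f t * g' * h t + f t * g t * h').
ring.
Qed.

Lemma is_derive_exp2 (R : realType) (c t : R) :
  is_derive t 1 (fun s : R => expR (c * s)) (c * expR (c * t)).
Proof.
have dl : is_derive t 1 (fun s : R => c * s) c.
  by rewrite (_ : (fun s => _) = (fun s : R => s * c)); [exact: is_derive_mulc|apply/funext => s; exact: mulrC].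
rewrite mulrC; exact: (is_derive1_comp (is_derive_expR (c * t)) dl).
Qed.

Lemma is_derive_cancel (R : realType) (f g : R -> R) (c t : R) :
  is_derive t 1 f (c * f t) -> is_derive t 1 g (- c * g t) -> is_derive t 1 (fun s => f s * g s) 0.
Proof.
move=> df dg; apply: is_derive_eq (is_deriveM df dg) _; change (f t * (- c * g t) + g t * (c * f t) = 0).
ring.
Qed.

Lemma curve_chain (R : realType) m (U : set 'rV[R]_m) (f : 'rV[R]_m -> R) (c : R -> 'rV[R]_m)
    (t : R) (v : 'rV[R]_m) : open U -> Ck_on 1 U f -> U (c t) -> curve_deriv c t v ->
  is_derive t 1 (fun s => f (c s)) (\sum_a v 0 a * partial a f (c t)).
Proof.
move=> oU cf Uc dc; have [df Df] := Ck_diff oU cf Uc.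
have dct : derivable c t 1.
  by apply/derivable_mxP => i j; rewrite (ord1 i); have := dc j => dcj; exact: ex_derive.
have Dc : 'D_1 c t = v.
  rewrite derive_mx //; apply/rowP => b; rewrite mxE; have := dc b => dcb; exact: derive_val.
have dc' : differentiable c t by apply/derivable1_diffP.
have dfc : differentiable (f \o c) t by apply: differentiable_comp.
apply: DeriveDef; first exact: diff_derivable.
by rewrite -Df -Dc (deriveE _ dfc) (diff_comp dc' df) /= (deriveE _ df) (deriveE _ dc').
Qed.

Section Homothety.
Context {R : realType} {n : nat}.
Variables (U : set 'rV[R]_n) (G : 'rV[R]_n -> 'M[R]_n) (q : 'rV[R]_n -> R).
Hypothesis mG : metric_on U G.
Hypothesis sq : smooth_on U q.
Hypothesis hq : forall x, U x -> hessian_coord G q x = G x.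
Let oU : open U. Proof. by case: mG. Qed.
Let sG k : Ck_mx k U G. Proof. by case: mG. Qed.

(** The Lie derivative of a metric along a gradient is twice the Hessian of the potential, which
    here is the metric itself. *)
Lemma lie_derivative_metric x c d : U x ->
  \sum_e partial c (gradv G q e) x * G x e d
  + \sum_e gradv G q e x * partial e (fun y => G y c d) x
  + \sum_e partial d (gradv G q e) x * G x c e = 2 * G x c d.
Proof.
move=> Ux.
have E a b : \sum_l G x a l * partial b (gradv G q l) x =
    G x a b - 2^-1 * \sum_k gradv G q k x * chr1 G b k a x.
  rewrite -{2}(hq Ux) -(lower_gradD mG a b Ux (sq 2)) /gradD.
  under [X in _ = X - _]eq_bigr do rewrite mulrDr mulr_sumr.
  rewrite big_split /= -[LHS]addr0 -addrA; congr (_ + _); apply/esym/eqP.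
  rewrite subr_eq0 exchange_big mulr_sumr.
  apply/eqP; apply: eq_bigr => k _; rewrite mulrCA -(lower_christoffel mG a b k Ux) mulr_sumr.
  by apply: eq_bigr => l _; rewrite mulrA mulrC.
have -> : \sum_e partial c (gradv G q e) x * G x e d =
    G x d c - 2^-1 * \sum_k gradv G q k x * chr1 G c k d x.
  by rewrite -E; apply: eq_bigr => e _; rewrite mulrC (Gsym mG e d Ux).
have -> : \sum_e partial d (gradv G q e) x * G x c e =
    G x c d - 2^-1 * \sum_k gradv G q k x * chr1 G d k c x.
  by rewrite -E; apply: eq_bigr => e _; rewrite mulrC.
have -> : \sum_e gradv G q e x * partial e (fun y => G y c d) x =
    2^-1 * \sum_k gradv G q k x * chr1 G c k d x + 2^-1 * \sum_k gradv G q k x * chr1 G d k c x.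
  rewrite -mulrDr -big_split mulr_sumr; apply: eq_bigr => k _ /=; rewrite /chr1.
  have S e i j : partial e (fun y => G y i j) x = partial e (fun y => G y j i) x.
    by apply: (eq_partial e oU Ux) => y Uy; exact: (Gsym mG).
  by rewrite (S c k d) (S d c k) (S k d c); field.
by rewrite (Gsym mG d c Ux); ring.
Qed.

Definition ngradv (x : 'rV[R]_n) : 'rV[R]_n := \row_a - gradv G q a x.

Lemma ngradv_Ck k b : Ck_on k U (fun x => ngradv x 0 b).
Proof.
apply: (@Ck_eq _ _ k U (fun x => - gradv G q b x) _ oU) => [x _|]; first by rewrite mxE.
by apply: (Ck_opp oU); exact: (gradv_Ck mG b (sq k.+1)).
Qed.

(** Time derivative of the pulled-back metric along the flow of [- grad q]: the variational equation
    gives the outer terms and the motion of the base point the middle one. Their sum is minus the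
    Lie derivative, read through [J]. *)
Lemma pullback_rate (J : 'I_n -> 'I_n -> R) x a b : U x ->
  \sum_c \sum_d ((\sum_e J a e * partial e (fun y => ngradv y 0 c) x) * G x c d * J b d
   + J a c * (\sum_e ngradv x 0 e * partial e (fun y => G y c d) x) * J b d
   + J a c * G x c d * (\sum_e J b e * partial e (fun y => ngradv y 0 d) x)) =
  - 2 * \sum_c \sum_d J a c * G x c d * J b d.
Proof.
move=> Ux.
have pE e c : partial e (fun y => ngradv y 0 c) x = - partial e (gradv G q c) x.
  have dg : derivable (gradv G q c) x (delta_mx 0 e) := Ck_derivable (gradv_Ck mG c (sq 2)) Ux.
  rewrite -mulN1r -(partialZ (-1) dg); congr (partial _ _ _).
  by apply/funext => y; rewrite mxE mulN1r.
under eq_bigr do rewrite !big_split /=.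
rewrite !big_split /=.
have -> : \sum_c \sum_d (\sum_e J a e * partial e (fun y => ngradv y 0 c) x) * G x c d * J b d =
    - \sum_c \sum_d J a c * (\sum_e partial c (gradv G q e) x * G x e d) * J b d.
  rewrite exchange_big [in RHS]exchange_big -sumrN; apply: eq_bigr => d _ /=.
  rewrite -!mulr_suml -mulNr; congr (_ * _); rewrite -sumrN.
  under [RHS]eq_bigr do rewrite mulr_sumr -sumrN.
  under [LHS]eq_bigr do rewrite mulr_suml.
  rewrite exchange_big; apply: eq_bigr => c _; apply: eq_bigr => e _.
  by rewrite pE mulrN mulNr mulrA.
have -> : \sum_c \sum_d J a c * G x c d * (\sum_e J b e * partial e (fun y => ngradv y 0 d) x) =
    - \sum_c \sum_d J a c * (\sum_e partial d (gradv G q e) x * G x c e) * J b d.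
  rewrite -sumrN; apply: eq_bigr => c _ /=.
  under eq_bigr do rewrite -mulrA.
  under [X in _ = - X]eq_bigr do rewrite -mulrA.
  rewrite -!mulr_sumr -mulrN; congr (_ * _); rewrite -sumrN.
  under [RHS]eq_bigr do rewrite mulr_suml -sumrN.
  under [LHS]eq_bigr do rewrite mulr_sumr.
  rewrite exchange_big; apply: eq_bigr => e _; apply: eq_bigr => d _.
  by rewrite pE; ring.
have -> : \sum_c \sum_d J a c * (\sum_e ngradv x 0 e * partial e (fun y => G y c d) x) * J b d =
    - \sum_c \sum_d J a c * (\sum_e gradv G q e x * partial e (fun y => G y c d) x) * J b d.
  rewrite -sumrN; apply: eq_bigr => c _; rewrite -sumrN; apply: eq_bigr => d _.
  rewrite -mulNr -mulrN; congr (_ * _ * _); rewrite -sumrN; apply: eq_bigr => e _.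
  by rewrite mxE mulNr.
rewrite -!opprD -!big_split mulNr mulr_sumr; congr (- _); apply: eq_bigr => c _ /=.
rewrite -!big_split mulr_sumr; apply: eq_bigr => d _ /=.
by rewrite -!mulrDl -!mulrDr lie_derivative_metric //; ring.
Qed.

(** By [pullback_rate] every entry of [expR (2 * t)] times the pulled-back metric is constant in
    time, and at time [0] it is an entry of [G]. *)
Lemma flow_homothety z r tau phi : U z -> flow_on U ngradv z r tau phi ->
  (forall t b, `|t| < tau -> Ck_on 2 (nball z r) (fun x => phi t x 0 b)) ->
  (forall t x a, `|t| < tau -> `|x - z| < r ->
      curve_deriv (fun s => \row_b partial a (fun y => phi s y 0 b) x) t
        (dfield ngradv (phi t x) (\row_b partial a (fun y => phi t y 0 b) x))) ->
  forall t x, `|t| < tau -> `|x - z| < r ->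
    G x = expR (2 * t) *: pullback (jac (phi t) x) (G (phi t x)).
Proof.
move=> Uz [r0 tau0 phi0 Hphi] cphi dJ t x tt xr.
apply/matrixP => a b.
pose J s a c := partial a (fun y => phi s y 0 c) x.
pose P s := \sum_c \sum_d J s a c * G (phi s x) c d * J s b d.
have PE s : (expR (2 * s) *: pullback (jac (phi s) x) (G (phi s x))) a b = expR (2 * s) * P s.
  rewrite !mxE /P exchange_big; congr (_ * _); apply: eq_bigr => d _.
  by rewrite !mxE mulr_suml; apply: eq_bigr => c _; rewrite !mxE.
have dJs (s : R) a' c : `|s| < tau -> is_derive s 1 (fun s => J s a' c)
    (\sum_e J s a' e * partial e (fun y => ngradv y 0 c) (phi s x)).
  move=> st; have := dJ s x a' st xr c; rewrite mxE.
  set f1 := (fun s => _); rewrite (_ : f1 = (fun s => J s a' c)); last first.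
    by apply/funext => y; rewrite /f1 mxE.
  by congr (is_derive _ _ _ _); apply: eq_bigr => e _; rewrite mxE.
have dP (s : R) : `|s| < tau -> is_derive s 1 P (- 2 * P s).
  move=> st; have [Us ds] := Hphi s x st xr.
  have dG c d : is_derive s 1 (fun s => G (phi s x) c d)
      (\sum_e ngradv (phi s x) 0 e * partial e (fun y => G y c d) (phi s x)).
    exact: (curve_chain oU (sG 1 c d) Us ds).
  rewrite -(pullback_rate (J s) a b Us); apply: is_derive_sum' => c; apply: is_derive_sum' => d.
  apply: (is_derive_prod3 (dJs s a c st) (dG c d) (dJs s b d st)).
have dE (s : R) : `|s - 0| < tau -> is_derive s 1 (fun s => expR (2 * s) * P s) 0.
  rewrite subr0 => st; have e1 : is_derive s 1 (fun s : R => expR (2 * s)) (2 * expR (2 * s)).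
    exact: is_derive_exp2.
  exact: is_derive_cancel e1 (dP s st).
have z0 : `|0 - 0 : R| < tau by rewrite subrr normr0.
have tt' : `|t - 0| < tau by rewrite subr0.
rewrite PE (derive_zero_const dE z0 tt') mulr0 expR0 mul1r /P.
have J0 a' c : J 0 a' c = (c == a')%:R.
  rewrite /J -(partial_coord c a' x).
  by apply: (eq_partial a' (@open_norm_ball R _ z r) xr) => y yr; rewrite phi0.
rewrite phi0 // (bigD1 a) //= (bigD1 b) //= !J0 !eqxx mul1r mulr1.
rewrite big1 ?addr0 => [|d /negbTE db]; last by rewrite J0 db mulr0.
rewrite big1 ?addr0 // => c /negbTE ca.
by rewrite big1 // => d _; rewrite J0 ca !mul0r.
Qed.
End Homothety.

Lemma Ck_local (R : realType) n k (U : set 'rV[R]_n) (f : 'rV[R]_n -> R) :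
  (forall x, U x -> exists W, [/\ open W, W x & Ck_on k W f]) -> Ck_on k U f.
Proof.
elim: k f => [|k IH] f H.
  by split => // x /H[W [_ Wx cf]]; exact: Ck_cont cf Wx.
split=> [x /H[W [_ Wx cf]]|a]; first exact: Ck_cont cf Wx.
split=> [x /H[W [_ Wx cf]]|]; first exact: Ck_derivable cf Wx.
by apply: IH => x /H[W [oW Wx cf]]; exists W; split => //; exact: Ck_partial.
Qed.

(** * Norms of gradients and Hessians as functions on the manifold *)

Section Intrinsic.
Context {R : realType} {n : nat} {M : topologicalType}.
Variable A : atlas R n M.
Hypothesis sA : smooth_atlas A.
Variable h : metric_field A.
Hypothesis rh : riemannian_metric h.
Implicit Types (i j : chart_ix A) (O : set M) (f : M -> R).

Lemma CkM_one_chart k i O f : open O -> O `<=` chart_dom i ->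
  Ck_on k (chart_on i O) (f \o chart_inv i) -> CkM A k O f.
Proof.
move=> oO Oi cf j; have oj := @chart_on_open _ _ _ _ sA j _ oO.
have oi := @chart_on_open _ _ _ _ sA i _ oO.
have := Ck_comp oj oi (F := transition j i) _ _ cf => H.
apply: (Ck_eq oj _ (H _ _)) => [x [Ix Ox]|x [Ix Ox]|b].
- by rewrite /= /transition /= (atlas_chartK sA) //; exact: Oi.
- by rewrite /transition /=; apply: chart_onP => //; exact: Oi.
- by apply: Ck_sub (transition_Ck sA k j i b) => x [Ix Ox]; split => //; exact: Oi.
Qed.

Lemma CkM_local k O f : (forall p, O p -> exists W, [/\ open W, W p & CkM A k W f]) -> CkM A k O f.
Proof.
move=> H i; apply: Ck_local => x [Ix /H[W [oW Wx cW]]].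
by exists (chart_on i W); split => //; exact: chart_on_open.
Qed.

Definition mgrad f p := let i := chart_at A p in gradnorm (gloc h i) (f \o chart_inv i) (chart i p).

Definition mhess2 f p := let i := chart_at A p in
  sqtrace (h i p) (hessian_coord (gloc h i) (f \o chart_inv i) (chart i p)).

(** Polarisation of [mgrad]: whatever rescales [mgrad] automatically rescales inner products of
    gradients as well. *)
Definition minner f1 f2 p := 2^-1 * (mgrad (fun q => f1 q + f2 q) p - mgrad f1 p - mgrad f2 p).

Lemma mgrad_chart i O f p : open O -> CkM A 2 O f -> O p -> chart_dom i p ->
  mgrad f p = gradnorm (gloc h i) (f \o chart_inv i) (chart i p).
Proof. move=> oO cf Op ip; exact: (gradnorm_chart sA rh oO cf Op (atlas_cover sA p) ip). Qed.

Lemma mhess2_chart i O f p : open O -> CkM A 2 O f -> O p -> chart_dom i p ->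
  mhess2 f p = sqtrace (h i p) (hessian_coord (gloc h i) (f \o chart_inv i) (chart i p)).
Proof. move=> oO cf Op ip; exact: (sqtrace_chart sA rh oO cf Op (atlas_cover sA p) ip). Qed.

Lemma CkM_add k O f1 f2 : open O -> CkM A k O f1 -> CkM A k O f2 -> CkM A k O (fun p => f1 p + f2 p).
Proof.
by move=> oO c1 c2 i; exact: (Ck_add (@chart_on_open _ _ _ _ sA i _ oO) (c1 i) (c2 i)).
Qed.

Lemma CkM_scale k O c f : open O -> CkM A k O f -> CkM A k O (fun p => c * f p).
Proof. by move=> oO c1 i; exact: (Ck_scale c (@chart_on_open _ _ _ _ sA i _ oO) (c1 i)). Qed.

Lemma minner_chart i O f1 f2 p : open O -> CkM A 2 O f1 -> CkM A 2 O f2 -> O p -> chart_dom i p ->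
  minner f1 f2 p = \sum_a gradv (gloc h i) (f1 \o chart_inv i) a (chart i p) *
    partial a (f2 \o chart_inv i) (chart i p).
Proof.
move=> oO c1 c2 Op ip; rewrite /minner.
rewrite (mgrad_chart oO (CkM_add oO c1 c2) Op ip) (mgrad_chart oO c1 Op ip) (mgrad_chart oO c2 Op ip).
have mG := gloc_metric_on sA rh i oO; have Ux := chart_onP sA ip Op.
set x := chart i p in Ux *; set F1 := f1 \o _; set F2 := f2 \o _.
have d1 a : derivable F1 x (delta_mx 0 a) := Ck_derivable (Ck_pred (c1 i)) Ux.
have d2 a : derivable F2 x (delta_mx 0 a) := Ck_derivable (Ck_pred (c2 i)) Ux.
have pE a : partial a ((fun q => f1 q + f2 q) \o chart_inv i) x = partial a F1 x + partial a F2 x.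
  exact: (partialD (d1 a) (d2 a)).
have gE a : gradv (gloc h i) ((fun q => f1 q + f2 q) \o chart_inv i) a x =
    gradv (gloc h i) F1 a x + gradv (gloc h i) F2 a x.
  by rewrite /gradv -big_split; apply: eq_bigr => b _ /=; rewrite pE mulrDr.
have sym : \sum_a gradv (gloc h i) F2 a x * partial a F1 x =
    \sum_a gradv (gloc h i) F1 a x * partial a F2 x.
  rewrite /gradv; under eq_bigr do rewrite mulr_suml.
  rewrite exchange_big; apply: eq_bigr => b _ /=; rewrite mulr_suml.
  by apply: eq_bigr => a _; rewrite (invsym mG a b Ux); ring.
rewrite /gradnorm; under eq_bigr do rewrite gE pE mulrDl !mulrDr.
by rewrite !big_split /= sym; field.
Qed.

Lemma coord_CkM k i b : CkM A k (chart_dom i) (fun p => chart i p 0 b).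
Proof. by move=> j; apply: transition_Ck. Qed.

End Intrinsic.

(** * The gradient flow on the manifold and its time-one map *)

Section Cone.
Context {R : realType} {n : nat} {M : topologicalType}.
Variable A : atlas R n M.
Hypothesis sA : smooth_atlas A.
Hypothesis hM : hausdorff_space M.
Variable h : metric_field A.
Hypothesis rh : riemannian_metric h.
Variable q : M -> R.
Hypothesis sq : smooth_fun A q.
Hypothesis hq : forall i x, chart_img i x ->
  hessian_coord (gloc h i) (q \o chart_inv i) x = gloc h i x.
Hypothesis gq : forall p, mgrad h q p = 2 * q p.
Hypothesis kq : forall T, compact [set p | q p <= T].
Implicit Types (i j : chart_ix A) (O : set M) (f : M -> R) (p z : M) (c : R -> M).

(** An integral curve of [- grad q], tested against functions instead of coordinates. No chart
    enters, so shifting and gluing solutions is formal; [sol_coord] recovers the equation in a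
    chart. *)
Definition sol c (t : R) := {for t, continuous c} /\
  forall O f, open O -> O (c t) -> CkM A 2 O f ->
    is_derive t 1 (f \o c) (- minner h q f (c t)).

Lemma minner_q i O f p : open O -> CkM A 2 O f -> O p -> chart_dom i p ->
  - minner h q f p = \sum_a ngradv (gloc h i) (q \o chart_inv i) (chart i p) 0 a *
    partial a (f \o chart_inv i) (chart i p).
Proof.
move=> oO cf Op ip; rewrite (minner_chart sA rh oO (CkM_sub (@subsetT _ O) (smooth_CkM 2 sq)) cf Op ip).
by rewrite -sumrN; apply: eq_bigr => a _; rewrite mxE mulNr.
Qed.

Lemma is_derive_shift (f : R -> R) (t0 t l : R) :
  is_derive (t0 + t) 1 f l -> is_derive t 1 (fun s => f (t0 + s)) l.
Proof.
move=> df; have dg : is_derive t 1 (fun s : R => t0 + s) 1.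
  by rewrite -[1 in X in is_derive _ _ _ X]add0r; apply: is_deriveD.
by rewrite -[l]mulr1; exact: (@is_derive1_comp R f (fun s => t0 + s) t l 1 df dg).
Qed.

Lemma shift_continuous (t0 t : R) : {for t, continuous (fun s : R => t0 + s)}.
Proof.
apply/continuous_eps => e e0; exists e => // s; apply: le_lt_trans.
by rewrite opprD addrACA subrr add0r.
Qed.

Lemma sol_shift c (t0 t : R) : sol c (t0 + t) -> sol (fun s => c (t0 + s)) t.
Proof.
move=> [cc H]; split.
  by apply: (@continuous_comp _ _ _ (fun s => t0 + s) c) => //; exact: shift_continuous.
by move=> O f oO Oc cf; exact: (is_derive_shift (H O f oO Oc cf)).
Qed.

Lemma sol_near c c' (t d : R) : 0 < d -> (forall s, `|s - t| < d -> c s = c' s) -> sol c t -> sol c' t.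
Proof.
move=> d0 E [cc H]; have Et : c t = c' t by apply: E; rewrite subrr normr0.
split.
  have N : nbhs t [set s | c s = c' s] by apply/nbhs_norm_ball; exists d => // s /E.
  by rewrite /prop_for /continuous_at -Et; apply: cvg_trans cc; exact: near_eq_cvg N.
move=> O f oO Oc cf; rewrite -Et; apply: (is_derive_near d0 (f := f \o c)).
  by move=> s /E /= ->.
by apply: (H O f oO _ cf); rewrite Et.
Qed.

Lemma sol_coord i c (t : R) b : sol c t -> chart_dom i (c t) ->
  is_derive t 1 (fun s => chart i (c s) 0 b)
    (ngradv (gloc h i) (q \o chart_inv i) (chart i (c t)) 0 b).
Proof.
move=> [_ H] it; have := H _ _ (atlas_dom_open sA i) it (@coord_CkM _ _ _ _ sA 2 i b).
rewrite (minner_q (atlas_dom_open sA i) (@coord_CkM _ _ _ _ sA 2 i b) it it).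
congr (is_derive _ _ _ _); rewrite (bigD1 b) //=.
have pE a : partial a ((fun p => chart i p 0 b) \o chart_inv i) (chart i (c t)) = (b == a)%:R.
  rewrite -(partial_coord b a (chart i (c t))).
  have oI : open (chart_img i) by case: (gloc_metric sA rh i).
  apply: (eq_partial a oI (chart_imgP it)) => x Ix.
  by have [_ xE] := chart_img_dom sA Ix; rewrite /= xE.
rewrite pE eqxx mulr1 big1 ?addr0 // => a ab.
by rewrite pE eq_sym (negbTE ab) mulr0.
Qed.

Lemma continuous_near (T : topologicalType) (c : R -> T) (t : R) (P : set T) :
  {for t, continuous c} -> open P -> P (c t) -> exists2 d : R, 0 < d & forall s, `|s - t| < d -> P (c s).
Proof. by move=> cc oP Pt; exact: ((nbhs_norm_ball _ _).1 (nbhs_preimage cc oP Pt)). Qed.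

Lemma sol_local_unique c1 c2 (t0 d : R) : 0 < d ->
  (forall s, `|s - t0| < d -> sol c1 s) -> (forall s, `|s - t0| < d -> sol c2 s) -> c1 t0 = c2 t0 ->
  exists2 d', 0 < d' & forall s, `|s - t0| < d' -> c1 s = c2 s.
Proof.
move=> d0 s1 s2 E0; pose i := chart_at A (c1 t0); have it : chart_dom i (c1 t0) := atlas_cover sA _.
have mG := gloc_metric sA rh i; have oI : open (chart_img i) by case: mG.
pose V := ngradv (gloc h i) (q \o chart_inv i).
have [r [L [r0 L0 HU HL]]] := Ck1_lipschitz oI (ngradv_Ck mG (sq i) 1) (chart_imgP it).
pose B := chart_dom i `&` chart i @^-1` (nball (chart i (c1 t0)) r).
have oB : open B.
  rewrite openE => p [ip Bp]; have n1 := open_nbhs_nbhs (conj (atlas_dom_open sA i) ip).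
  apply: filterI => //.
  exact: (nbhs_preimage (atlas_chart_cont sA ip) (@open_norm_ball _ _ _ _) Bp).
have tt : `|t0 - t0| < d by rewrite subrr normr0.
have B1 : B (c1 t0) by split => //=; rewrite /nball /= subrr normr0.
have B2 : B (c2 t0) by rewrite -E0.
have [d1 d10 H1] := continuous_near (s1 _ tt).1 oB B1.
have [d2 d20 H2] := continuous_near (s2 _ tt).1 oB B2.
have L1 : 0 < L + 1 by rewrite ltr_wpDl.
pose tau := Num.min (Num.min d (2^-1 / (L + 1))) (Num.min d1 d2).
have tau0 : 0 < tau by rewrite !lt_min d0 d10 d20 divr_gt0 // invr_gt0.
have Ltau : L * tau <= 2^-1.
  apply: (@le_trans _ _ ((L + 1) * tau)); first by rewrite ler_wpM2r ?lerDl // ltW.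
  by rewrite mulrC -ler_pdivlMr // /tau !ge_min lexx orbT.
have small s : `|s| < tau -> [/\ `|t0 + s - t0| < d, B (c1 (t0 + s)) & B (c2 (t0 + s))].
  rewrite !lt_min => /andP[/andP[h1 _] /andP[h2 h3]].
  have e : `|t0 + s - t0| = `|s| by rewrite addrC addKr.
  by split; rewrite ?e //; [apply: H1|apply: H2]; rewrite e.
have dc c' : (forall s, `|s - t0| < d -> sol c' s) -> (forall s, `|s| < tau -> B (c' (t0 + s))) ->
    forall s, `|s| < tau -> curve_deriv (fun s => chart i (c' (t0 + s))) s (V (chart i (c' (t0 + s)))).
  move=> sc Bc s st b; apply: (@is_derive_shift (fun s => chart i (c' s) 0 b)).
  by apply: sol_coord; [apply: sc; have [] := small s st|have [] := Bc s st].
exists tau => // s st; rewrite -(subrKC t0 s).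
have ss : `|s - t0| < tau by [].
have := @gronwall R n (fun s => chart i (c1 (t0 + s))) (fun s => chart i (c2 (t0 + s)))
  (fun s => V (chart i (c1 (t0 + s)))) (fun s => V (chart i (c2 (t0 + s)))) tau L 0 (s - t0) L0 (lexx 0) Ltau.
rewrite addr0 -E0 subrr normr0 !mulr0 addr0 => /(_ _ _ _ ss) G.
have [_ [i1 _] [i2 _]] := small _ ss.
rewrite -(atlas_chartK sA i1) -(atlas_chartK sA i2); congr (chart_inv i _).
apply/eqP; rewrite -subr_eq0 -normr_le0; apply: G => x xt.
- by apply: dc => // y yt; have [] := small y yt.
- by apply: dc => // y yt; have [] := small y yt.
- by have [_ [_ h1] [_ h2]] := small x xt; rewrite addr0; exact: HL.
Qed.

Lemma open_itv_ball (a b t : R) : a < t < b ->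
  exists2 d, 0 < d & forall s, `|s - t| < d -> a < s < b.
Proof.
move=> /andP[at_ tb]; exists (Num.min (t - a) (b - t)) => [|s].
  by rewrite lt_min !subr_gt0 at_.
rewrite lt_min !ltr_norml => /andP[/andP[h1 _] /andP[_ h2]]; apply/andP; split; lra.
Qed.

(** The coincidence set is relatively open by [sol_local_unique] and relatively closed because [M]
    is Hausdorff. *)
Lemma sol_unique c1 c2 (a b t0 : R) : a < t0 < b -> (forall s, a < s < b -> sol c1 s) ->
  (forall s, a < s < b -> sol c2 s) -> c1 t0 = c2 t0 -> forall t, a < t < b -> c1 t = c2 t.
Proof.
move=> t0ab s1 s2 E0 t tab.
suff ZE : [set t | a < t < b /\ c1 t = c2 t] = [set t | a < t < b].
  by have : [set t | a < t < b /\ c1 t = c2 t] t by [rewrite ZE]; case.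
apply: connected_clopen.
- by apply/connected_intervalP => x y /= /andP[h1 h2] /andP[h3 h4] z /andP[h5 h6];
  apply/andP; split; [exact: lt_le_trans h5|exact: le_lt_trans h4].
- by exists t0.
- by move=> x [].
- move=> x [xab Ex]; have [d d0 Hd] := open_itv_ball xab.
  have [d' d'0 Hd'] := sol_local_unique d0 (fun s sd => s1 s (Hd s sd)) (fun s sd => s2 s (Hd s sd)) Ex.
  by apply/nbhs_norm_ball; exists d' => // y /Hd'.
- move=> x xab nE; have Ex : c1 x != c2 x by apply/eqP => Ex; apply: nE.
  have := hM; rewrite open_hausdorff => /(_ _ _ Ex)[[B1 B2] /= [/set_mem B1x /set_mem B2x] [V1 V2 /eqP B12]].
  apply: filterS (filterI (nbhs_preimage (s1 x xab).1 V1 B1x) (nbhs_preimage (s2 x xab).1 V2 B2x)).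
  by move=> y [y1 y2] [_ Ey]; have : (B1 `&` B2) (c1 y) by [split => //; rewrite Ey]; rewrite B12.
Qed.

(** A relation, because global existence is known only in [reach_exists]. Each instance carries a
    solution on an open interval around both times, so solutions can be compared and concatenated
    before that. *)
Definition reach p (t : R) z := exists c (a b : R), [/\ a < 0 < b, a < t < b,
  forall s, a < s < b -> sol c s, c 0 = p & c t = z].

Lemma reach_unique p (t : R) z z' : reach p t z -> reach p t z' -> z = z'.
Proof.
move=> [c [a [b [ab tab sc c0 <-]]]] [c' [a' [b' [ab' tab' sc' c0' <-]]]].
have I0 : Num.max a a' < 0 < Num.min b b'.
  by move: ab ab' => /andP[h1 h2] /andP[h3 h4]; rewrite gt_max h1 h3 lt_min h2 h4.
have It : Num.max a a' < t < Num.min b b'.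
  by move: tab tab' => /andP[h1 h2] /andP[h3 h4]; rewrite gt_max h1 h3 lt_min h2 h4.
apply: (sol_unique I0 _ _ _ It) => [s|s|]; last by rewrite c0.
  by rewrite gt_max lt_min => /andP[/andP[h1 _] /andP[h2 _]]; apply: sc; rewrite h1.
by rewrite gt_max lt_min => /andP[/andP[_ h1] /andP[_ h2]]; apply: sc'; rewrite h1.
Qed.

Lemma reach_inv p (t : R) z : reach p t z -> reach z (- t) p.
Proof.
move=> [c [a [b [ab tab sc c0 ct]]]]; exists (fun s => c (t + s)), (a - t), (b - t).
move: ab tab => /andP[h1 h2] /andP[h3 h4]; split.
- by rewrite subr_lt0 subr_gt0 h3.
- by apply/andP; split; lra.
- by move=> s /andP[h5 h6]; apply: sol_shift; apply: sc; apply/andP; split; lra.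
- by rewrite addr0.
- by rewrite subrr.
Qed.

(* The two solutions agree on the overlap of their intervals, which contains
   the junction time, so the glued curve is locally one of them. *)
Lemma reach_trans p (t s : R) z w : reach p t z -> reach z s w -> reach p (t + s) w.
Proof.
move=> [c1 [a1 [b1 [/andP[a10 b10] /andP[a1t b1t] s1 c10 c1t]]]].
move=> [c2 [a2 [b2 [/andP[a20 b20] /andP[a2s b2s] s2 c20 c2s]]]].
pose e x := c2 (x - t).
have se x : a2 + t < x < b2 + t -> sol e x.
  move=> /andP[h1 h2]; rewrite /e; under eq_fun do rewrite addrC.
  by apply: sol_shift; apply: s2; apply/andP; split; lra.
have agree x : a1 < x < b1 -> a2 + t < x < b2 + t -> c1 x = e x.
  move=> /andP[h1 h2] /andP[h3 h4].
  have It : Num.max a1 (a2 + t) < t < Num.min b1 (b2 + t).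
    by rewrite gt_max lt_min a1t b1t gtrDr ltrDr a20.
  have Ix : Num.max a1 (a2 + t) < x < Num.min b1 (b2 + t) by rewrite gt_max lt_min h1 h2 h3.
  apply: (sol_unique It _ _ _ Ix) => [y|y|]; last by rewrite /e subrr c20.
    by rewrite gt_max lt_min => /andP[/andP[h5 _] /andP[h6 _]]; apply: s1; rewrite h5.
  by rewrite gt_max lt_min => /andP[/andP[_ h5] /andP[_ h6]]; apply: se; rewrite h5.
pose c x := if a1 < x < b1 then c1 x else e x.
have cE1 x : a1 < x < b1 -> c x = c1 x by rewrite /c => ->.
have cE2 x : a2 + t < x < b2 + t -> c x = e x.
  by rewrite /c; case: ifP => // h1 h2; exact: agree.
exists c, (Num.min a1 (a2 + t)), (Num.max b1 (b2 + t)); split.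
- by rewrite gt_min lt_max a10 b10.
- by rewrite gt_min lt_max; apply/andP; split; apply/orP; right; lra.
- move=> x; rewrite gt_min lt_max => /andP[h1 h2].
  have [h3|h3] := boolP (a1 < x < b1).
    have [d d0 Hd] := open_itv_ball h3.
    by apply: (sol_near d0 _ (s1 x h3)) => y /Hd /cE1 ->.
  have h4 : a2 + t < x < b2 + t.
    move: h3; rewrite negb_and -!leNgt => /orP[xa|bx].
      have x1 : (a1 < x) = false by apply/negbTE; rewrite -leNgt.
      move: h1; rewrite x1 /= => -> /=.
      by rewrite (le_lt_trans xa) // (lt_trans a1t) // ltrDr.
    have x1 : (x < b1) = false by apply/negbTE; rewrite -leNgt.
    move: h2; rewrite x1 /= => ->; rewrite andbT.
    by rewrite (lt_le_trans _ bx) // (lt_trans _ b1t) // gtrDr.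
  have [d d0 Hd] := open_itv_ball h4.
  by apply: (sol_near d0 _ (se x h4)) => y /Hd /cE2 ->.
- by rewrite cE1 ?a10.
- by rewrite cE2 /e ?[t + s]addrC ?addrK // ltrD2r a2s ltrD2r.
Qed.

Lemma q_CkM k O : CkM A k O q.
Proof. exact: CkM_sub (@subsetT _ O) (smooth_CkM k sq). Qed.

Lemma minner_qq p : minner h q q p = 2 * q p.
Proof.
have ip := atlas_cover sA p.
rewrite (minner_chart sA rh openT (q_CkM 2 setT) (q_CkM 2 setT) I ip).
by have := mgrad_chart sA rh openT (q_CkM 2 setT) I ip; rewrite gq => ->.
Qed.

(** Along a solution the derivative of [q] is [- |Dq|^2 = - 2 q]. The resulting control of [q]
    confines trajectories to compact sets over bounded times, in both directions. *)
Lemma reach_q p (t : R) z : reach p t z -> q z = expR (- 2 * t) * q p.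
Proof.
move=> [c [a [b [/andP[a0 b0] /andP[at_ tb] sc <- <-]]]].
have dq s : Num.min 0 t <= s <= Num.max 0 t ->
    is_derive s 1 (fun s => expR (2 * s) * q (c s)) 0 /\ `|0 : R| <= 0.
  move=> /andP[h1 h2]; split; last by rewrite normr0.
  have sab : a < s < b.
    by rewrite (lt_le_trans _ h1) ?lt_min ?a0 //= (le_lt_trans h2) // gt_max b0.
  have [_ H] := sc s sab; have := H setT q openT I (q_CkM 2 setT).
  rewrite minner_qq -mulNr => H'.
  exact: is_derive_cancel (is_derive_exp2 2 s) H'.
have := derive_bound_between dq; rewrite mul0r normr_le0 subr_eq0 mulr0 expR0 mul1r => /eqP <-.
by rewrite mulrA -expRD mulNr addNr expR0 mul1r.
Qed.

Lemma q_zero_grad i p a : q p = 0 -> chart_dom i p -> partial a (q \o chart_inv i) (chart i p) = 0.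
Proof.
move=> qp ip; apply: (gradnorm_eq0 (gloc_metric sA rh i) _ (chart_imgP ip)).
by rewrite -(mgrad_chart sA rh openT (q_CkM 2 setT) I ip) gq qp mulr0.
Qed.

Lemma q_zero_reach p (t : R) : q p = 0 -> reach p t p.
Proof.
move=> qp.
exists (fun=> p), (- (`|t| + 1)), (`|t| + 1); split => //.
- by rewrite oppr_lt0 ltr_wpDl.
- by rewrite -ltr_norml ltrDl.
- move=> s _; split; first exact: cst_continuous.
  move=> O f oO Op cf; have ip := atlas_cover sA p.
  rewrite (minner_chart sA rh oO (q_CkM 2 O) cf Op ip) big1 ?oppr0; first exact: is_derive_cst.
  move=> a _; rewrite /gradv big1 ?mul0r // => b _; rewrite (q_zero_grad b qp ip) mulr0 //.
Qed.

(* [E] scales the metric by [expR (- 2 * t)] on [W], and its differential at a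
   zero of [q] is a multiple of the identity; phrasing this through functions
   makes composition of such maps immediate. *)
Definition homothetic (t : R) (W : set M) (E : M -> M) := forall O f, open O -> CkM A 2 O f ->
  [/\ open (W `&` E @^-1` O), CkM A 2 (W `&` E @^-1` O) (f \o E),
    forall p, W p -> O (E p) -> mgrad h (f \o E) p = expR (- 2 * t) * mgrad h f (E p) /\
      mhess2 h (f \o E) p = expR (- 4 * t) * mhess2 h f (E p) &
    forall p, W p -> O p -> q p = 0 -> E p = p /\ forall i a, chart_dom i p ->
      partial a ((f \o E) \o chart_inv i) (chart i p) =
      expR (- t) * partial a (f \o chart_inv i) (chart i p)].

Lemma homothetic_comp s t W E1 E2 : (forall p, W p -> W (E1 p)) ->
  homothetic s W E1 -> homothetic t W E2 -> homothetic (s + t) W (E2 \o E1).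
Proof.
move=> W1 H1 H2 O f oO cf; have [W2 c2 h2 k2] := H2 O f oO cf.
have [W3 c1 h1 k1] := H1 _ _ W2 c2.
have E : W `&` (E2 \o E1) @^-1` O = W `&` E1 @^-1` (W `&` E2 @^-1` O).
  by apply/seteqP; split => [p [Wp Op]|p [Wp [W1p Op]]] //; split => //; split => //; exact: W1.
have e (c : R) : expR (c * (s + t)) = expR (c * s) * expR (c * t) by rewrite mulrDr expRD.
rewrite E; split => // p Wp Op; last first.
  move=> qp; have [E2p p2] := k2 p Wp Op qp.
  have [E1p p1] := k1 p Wp (conj Wp (eq_ind_r O Op E2p)) qp.
  split=> [|i a ip]; first by rewrite /= E1p.
  by rewrite opprD expRD -mulrA -p2 // -p1.
have [g1 l1] := h1 p Wp (conj (W1 _ Wp) Op).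
have [g2 l2] := h2 _ (W1 _ Wp) Op.
by rewrite !e -!mulrA -g2 -l2 -g1 -l1.
Qed.

(** Both differentials change by the same Jacobian, so that one is [k] times the other in one chart
    implies it in every chart around [p]. *)
Lemma partial_radial_chart O O' f E p i j a (k : R) : open O -> open O' -> CkM A 2 O f ->
  CkM A 2 O' (f \o E) -> O p -> O' p -> chart_dom i p -> chart_dom j p ->
  (forall b, partial b ((f \o E) \o chart_inv i) (chart i p) =
    k * partial b (f \o chart_inv i) (chart i p)) ->
  partial a ((f \o E) \o chart_inv j) (chart j p) = k * partial a (f \o chart_inv j) (chart j p).
Proof.
move=> oO oO' cf cfE Op O'p ip jp H.
have E1 (V : set M) (F : M -> R) : open V -> CkM A 2 V F -> V p ->
    partial a (F \o chart_inv j) (chart j p) =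
    \sum_b partial a (fun x => transition j i x 0 b) (chart j p) * partial b (F \o chart_inv i) (chart i p).
  move=> oV cF Vp; have oVi : open (V `&` chart_dom i) by apply: openI => //; exact: atlas_dom_open.
  have oW := @chart_on_open _ _ _ _ sA j _ oVi; have Vip : (V `&` chart_dom i) p by [].
  have Wx := chart_onP sA jp Vip.
  have tE : transition j i (chart j p) = chart i p by rewrite /transition /= (atlas_chartK sA jp).
  rewrite (eq_partial a oW Wx (g := (F \o chart_inv i) \o transition j i)) => [|x [_ [_ ix]]].
    have Vx : chart_on i V (transition j i (chart j p)) by rewrite tE; exact: chart_onP.
    have [|_ ->] := partial_comp a (@chart_on_open _ _ _ _ sA i _ oV) Vx (Ck_pred (cF i)) _.
      move=> b; have c1 : Ck_on 1 (chart_on j (V `&` chart_dom i)) (fun x => transition j i x 0 b).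
        by apply: Ck_sub (transition_Ck sA 1 j i b) => x [Jx [_ ix]].
      by have [] := Ck_diff oW c1 Wx.
    by rewrite tE.
  by rewrite /= /transition /= (atlas_chartK sA ix).
rewrite (E1 _ _ oO' cfE O'p) (E1 _ _ oO cf Op) mulr_sumr; apply: eq_bigr => b _.
by rewrite H mulrCA.
Qed.

(** At a zero of [q] the gradient vanishes and the Hessian equals the metric, so [- grad q] has
    minus the identity as its linearisation. The variational equation becomes [J' = - J]. *)
Lemma radial_jac i p r tau (phi : R -> 'rV[R]_n -> 'rV[R]_n) (x0 : 'rV[R]_n) t b d :
  q p = 0 -> chart_dom i p -> nball x0 r (chart i p) ->
  (forall s, `|s| < tau -> phi s (chart i p) = chart i p) ->
  (forall t x a, `|t| < tau -> `|x - x0| < r ->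
      curve_deriv (fun s => \row_b partial a (fun y => phi s y 0 b) x) t
        (dfield (ngradv (gloc h i) (q \o chart_inv i)) (phi t x) (\row_b partial a (fun y => phi t y 0 b) x))) ->
  (forall x, `|x - x0| < r -> phi 0 x = x) -> `|t| < tau ->
  partial b (fun y => phi t y 0 d) (chart i p) = expR (- t) * (d == b)%:R.
Proof.
move=> qp ip Bp fixp dphi phi0 tt; set x := chart i p in Bp fixp *.
have mG := gloc_metric sA rh i; have Ix : chart_img i x := chart_imgP ip.
have oI : open (chart_img i) by case: mG.
have dV (c e : 'I_n) : partial c (fun y => ngradv (gloc h i) (q \o chart_inv i) y 0 e) x = - (e == c)%:R.
  have -> : partial c (fun y => ngradv (gloc h i) (q \o chart_inv i) y 0 e) x =
      - partial c (gradv (gloc h i) (q \o chart_inv i) e) x.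
    have dg : derivable (gradv (gloc h i) (q \o chart_inv i) e) x (delta_mx 0 c) :=
      Ck_derivable (gradv_Ck mG e (sq i 2)) Ix.
    rewrite -mulN1r -(partialZ (-1) dg); congr (partial _ _ _).
    by apply/funext => y; rewrite mxE mulN1r.
  congr (- _); have g0 k : gradv (gloc h i) (q \o chart_inv i) k x = 0.
    by rewrite /gradv big1 // => a _; rewrite (q_zero_grad a qp ip) mulr0.
  have := gradDE mG e c Ix (sq i 2); rewrite /gradD big1 => [|k _]; last by rewrite g0 mulr0.
  rewrite addr0 => ->; rewrite -(sum_inv_G mG e c Ix); apply: eq_bigr => a _.
  by rewrite (hq Ix).
pose J (s : R) := partial b (fun y => phi s y 0 d) x.
have dJ (s : R) : `|s| < tau -> is_derive s 1 J (- 1 * J s).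
  move=> st; have := dphi s x b st Bp d; rewrite mxE.
  set f1 := (fun s => _); rewrite (_ : f1 = J); last by apply/funext => y; rewrite /f1 mxE.
  congr (is_derive _ _ _ _); rewrite fixp // (bigD1 d) //= big1 => [|c cd].
    by rewrite dV eqxx mxE mulrN mulr1 addr0 mulN1r.
  by rewrite dV eq_sym (negbTE cd) oppr0 mulr0.
have dE (s : R) : `|s - 0| < tau -> is_derive s 1 (fun s => expR (1 * s) * J s) 0.
  by rewrite subr0 => st; exact: is_derive_cancel (is_derive_exp2 1 s) (dJ s st).
have tau0 : 0 < tau by apply: le_lt_trans tt.
have z0 : `|0 - 0 : R| < tau by rewrite subrr normr0.
have tt' : `|t - 0| < tau by rewrite subr0.
have := derive_zero_const dE z0 tt'; rewrite mulr0 expR0 !mul1r => E.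
have J0 : J 0 = (d == b)%:R.
  rewrite /J -(partial_coord d b x).
  by apply: (eq_partial b (@open_norm_ball R _ x0 r) Bp) => y yr; rewrite phi0.
by rewrite -J0 -E mulrA -expRD addNr expR0 mul1r.
Qed.

Definition local_flow (tau : R) z := exists (W : set M) (psi : R -> M -> M),
  [/\ open W, W z, forall p, W p -> psi 0 p = p,
      forall t p, `|t| < tau -> W p -> sol (fun s => psi s p) t &
      forall t, `|t| < tau -> homothetic t W (psi t)].

Lemma local_flow_exists z : exists2 tau, 0 < tau & local_flow tau z.
Proof.
pose i := chart_at A z; have iz : chart_dom i z := atlas_cover sA z.
have mG := gloc_metric sA rh i; have oI : open (chart_img i) by case: mG.
pose V := ngradv (gloc h i) (q \o chart_inv i).
have [r [tau [phi [fl cphi dphi]]]] := flow_step (@flow_Ck R 1) oI (ngradv_Ck mG (sq i)) (chart_imgP iz).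
have hom := flow_homothety mG (sq i) (@hq i) (chart_imgP iz) fl cphi dphi.
have [r0 tau0 phi0 Hphi] := fl.
pose W := chart_dom i `&` chart i @^-1` (nball (chart i z) r).
have oB : open (nball (chart i z) r) by exact: open_norm_ball.
have oW : open W.
  rewrite openE => p [ip Bp]; have n1 := open_nbhs_nbhs (conj (atlas_dom_open sA i) ip).
  by apply: filterI => //; exact: (nbhs_preimage (atlas_chart_cont sA ip) oB Bp).
pose psi t p := chart_inv i (phi t (chart i p)).
have Wz : W z by split => //=; rewrite /nball /= subrr normr0.
have fimg t p : `|t| < tau -> W p -> chart_dom i (psi t p) /\ chart i (psi t p) = phi t (chart i p).
  by move=> tt [ip Bp]; have [Up _] := Hphi t _ tt Bp; exact: (chart_img_dom sA Up).
have ps_sol t p : `|t| < tau -> W p -> sol (fun s => psi s p) t.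
  move=> tt Wp; have [ip Bp] := Wp; have [Up dUp] := Hphi t _ tt Bp; split.
    apply: (@continuous_comp _ _ _ (fun s => phi s (chart i p)) (chart_inv i)).
      exact: curve_deriv_cont dUp.
    exact: (atlas_inv_cont sA Up).
  move=> O f oO Of cf; have [it tE] := fimg t p tt Wp.
  rewrite (minner_q oO cf Of it) tE.
  exact: (curve_chain (@chart_on_open _ _ _ _ sA i _ oO) (Ck_pred (cf i)) (conj Up Of) dUp).
exists tau => //; exists W, psi; split => //.
- by move=> p [ip Bp]; rewrite /psi phi0 // (atlas_chartK sA ip).
- move=> t tt O f oO cf.
  have phc b : Ck_on 2 (nball (chart i z) r) (fun x => phi t x 0 b) := cphi t b tt.
  have phcont x : nball (chart i z) r x -> {for x, continuous (phi t)}.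
    by move=> Bx; apply: rV_continuous => b; exact: Ck_cont (phc b) Bx.
  have pscont p : W p -> {for p, continuous (psi t)}.
    move=> [ip Bp]; have [Up _] := Hphi t _ tt Bp.
    apply: (@continuous_comp _ _ _ (phi t \o chart i) (chart_inv i)).
      by apply: continuous_comp; [exact: atlas_chart_cont|exact: phcont].
    exact: (atlas_inv_cont sA Up).
  have oWO : open (W `&` psi t @^-1` O).
    rewrite openE => p [Wp Op]; apply: filterI; first exact: open_nbhs_nbhs.
    exact: (nbhs_preimage (pscont p Wp) oO Op).
  have oi := @chart_on_open _ _ _ _ sA i _ oWO.
  have sub x : chart_on i (W `&` psi t @^-1` O) x -> [/\ nball (chart i z) r x, chart_img i x &
      chart_on i O (phi t x)].
    move=> [Ix [[ip Bp] Op]]; have [_ xE] := chart_img_dom sA Ix.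
    move: Bp Op; rewrite /= /psi xE => Bx Ox; split => //; split => //.
    by have [] := Hphi t x tt Bx.
  have fE x : chart_on i (W `&` psi t @^-1` O) x ->
      ((f \o psi t) \o chart_inv i) x = ((f \o chart_inv i) \o phi t) x.
    by move=> [Ix _]; have [_ xE] := chart_img_dom sA Ix; rewrite /= /psi xE.
  have phc' b : Ck_on 2 (chart_on i (W `&` psi t @^-1` O)) (fun x => phi t x 0 b).
    by apply: Ck_sub (phc b) => x /sub[].
  have cfp : CkM A 2 (W `&` psi t @^-1` O) (f \o psi t).
    apply: (CkM_one_chart sA (i := i) oWO) => [p [[]]//|].
    apply: (Ck_eq oi (fun x Ux => esym (fE x Ux))).
    by apply: (Ck_comp oi (@chart_on_open _ _ _ _ sA i _ oO) _ phc' (cf i)) => x /sub[].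
  split => // p Wp Op; last first.
    move=> qp; have [ip Bp] := Wp; have fixp s : `|s| < tau -> psi s p = p.
      move=> st; apply: reach_unique (q_zero_reach s qp).
      exists (psi^~ p), (- tau), tau; split => //.
      + by rewrite oppr_lt0 tau0.
      + by rewrite -ltr_norml.
      + by move=> y; rewrite -ltr_norml => yt; exact: ps_sol.
      + by rewrite /psi phi0 // (atlas_chartK sA ip).
    have phx s : `|s| < tau -> phi s (chart i p) = chart i p.
      by move=> st; have [_ <-] := fimg s p st Wp; rewrite fixp.
    split=> [|j a jp]; first exact: fixp.
    have WOp : (W `&` psi t @^-1` O) p by split => //=; rewrite fixp.
    have step := @partial_radial_chart O (W `&` psi t @^-1` O) f (psi t) p i j a (expR (- t)) oO oWO cf cfp Op WOp ip jp.
    apply: step => b.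
    have Ux : chart_on i (W `&` psi t @^-1` O) (chart i p).
      exact: chart_onP.
    rewrite (eq_partial b oi Ux fE).
    have oO' := @chart_on_open _ _ _ _ sA i _ oO.
    have dph d : differentiable (fun y => phi t y 0 d) (chart i p) by have [] := Ck_diff oi (phc' d) Ux.
    have Vph : chart_on i O (phi t (chart i p)) by have [] := sub _ Ux.
    have [_ ->] := partial_comp b oO' Vph (Ck_pred (cf i)) dph.
    rewrite phx // (bigD1 b) //= big1 => [|d db].
      by rewrite addr0 (radial_jac b b qp ip Bp phx dphi phi0 tt) eqxx mulr1.
    by rewrite (radial_jac b d qp ip Bp phx dphi phi0 tt) (negbTE db) mulr0 mul0r.
  have [ip Bp] := Wp.
  have Ux : chart_on i (W `&` psi t @^-1` O) (chart i p) by apply: chart_onP.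
  have [it tE] := fimg t p tt Wp.
  have mW := gloc_metric_on sA rh i oWO; have mO := gloc_metric_on sA rh i oO.
  have GE x : chart_on i (W `&` psi t @^-1` O) x ->
      gloc h i x = expR (2 * t) *: pullback (jac (phi t) x) (gloc h i (phi t x)).
    by move=> /sub[Bx _ _]; exact: hom.
  have e0 : expR (2 * t) != 0 by rewrite gt_eqF // expR_gt0.
  have sub3 x : chart_on i (W `&` psi t @^-1` O) x -> chart_on i O (phi t x) by move=> /sub[].
  have eV (k : R) : (expR (k * t))^-1 = expR (- k * t) by rewrite -expRN mulNr.
  split.
    rewrite (mgrad_chart sA rh oWO cfp (conj Wp Op) ip) (mgrad_chart sA rh oO cf Op it) tE.
    rewrite (eq_gradnorm _ oi Ux fE).
    by rewrite (gradnorm_pullback mW mO sub3 phc' e0 GE Ux (Ck_pred (cf i))) eV.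
  rewrite (mhess2_chart sA rh oWO cfp (conj Wp Op) ip) (mhess2_chart sA rh oO cf Op it) tE.
  rewrite (eq_hess _ oi Ux fE) (hess_pullback_mx mW mO sub3 phc' e0 GE Ux (cf i)).
  have gp : h i p = gloc h i (chart i p) by rewrite /gloc (atlas_chartK sA ip).
  have gp' : h i (psi t p) = gloc h i (phi t (chart i p)) by rewrite -tE /gloc (atlas_chartK sA it).
  rewrite gp gp' (sqtrace_pullback mW mO sub3 e0 GE _ Ux) eV -expRM_natl; congr (expR _ * _).
  by ring.
Qed.

(** Local lifetimes depend on the point; compactness of the sublevel set, applied to the lifetimes
    [1 / (k + 1)], provides a common one. *)
Lemma local_flow_uniform (T : R) : exists2 tau, 0 < tau & forall z, q z <= T -> local_flow tau z.
Proof.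
have := (@compact_near_coveringP M _).1 (@kq T) nat \oo
   (fun k z => local_flow k.+1%:R^-1 z) _ => H.
have [N _ HN] : \forall k \near \oo, [set p | q p <= T] `<=` (fun z => local_flow k.+1%:R^-1 z).
  apply: H => z _; have [tau tau0 [W [psi [oW Wz H0 H1 H2]]]] := local_flow_exists z.
  exists (W, [set k | (k.+1%:R^-1 < tau)]) => /=.
    split; first exact: open_nbhs_nbhs.
    exact: near_infty_natSinv_lt (PosNum tau0).
  move=> [z' k] /= [Wz' kt]; exists W, psi; split => // [t p tk Wp|t tk].
    by apply: H1 => //; exact: lt_trans kt.
  by apply: H2; exact: lt_trans kt.
exists N.+1%:R^-1; first by rewrite invr_gt0.
by move=> z /HN; apply => /=.
Qed.

Lemma q_ge0 p : 0 <= q p.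
Proof.
have ip := atlas_cover sA p; have mG := gloc_metric sA rh (chart_at A p).
by have := gradnorm_ge0 mG (q \o chart_inv (chart_at A p)) (chart_imgP ip); rewrite -/(mgrad h q p) gq pmulr_rge0.
Qed.

Lemma local_flow_reach tau z : local_flow tau z -> exists W psi, [/\ open W, W z,
   forall t p, `|t| < tau -> W p -> reach p t (psi t p) &
   forall t, `|t| < tau -> homothetic t W (psi t)].
Proof.
move=> [W [psi [oW Wz H0 H1 H2]]]; exists W, psi; split => // t p tt Wp.
have tau0 : 0 < tau by apply: le_lt_trans tt.
exists (fun s => psi s p), (- tau), tau; split => //.
- by rewrite oppr_lt0 tau0.
- by rewrite -ltr_norml.
- by move=> s; rewrite -ltr_norml => st; exact: H1.
- exact: H0.
Qed.

(** Time is cut into steps shorter than the common lifetime on [{q <= T}]. By [reach_q] the value of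
    [q] never exceeds [T] on the way, even backwards in time, so the next step is always
    available. *)
Lemma reach_exists p (t : R) : exists z, reach p t z.
Proof.
pose T := expR (2 * `|t|) * q p.
have [tau tau0 Htau] := local_flow_uniform T.
have [N tN] : exists N : nat, `|t| / N.+1%:R < tau.
  exists (Num.truncn (`|t| / tau)).
  by rewrite ltr_pdivrMr ?ltr0n // mulrC -ltr_pdivrMr // truncnS_gt.
pose s := t / N.+1%:R.
have step k : (k <= N.+1)%N -> exists z, reach p (k%:R * s) z.
  elim: k => [|k IH] kN.
    have pT : q p <= T by rewrite /T ler_peMl ?q_ge0 // -expR0 ler_expR mulr_ge0.
    have [W [psi [_ Wz H _]]] := local_flow_reach (Htau p pT).
    by exists (psi 0 p); rewrite mul0r; apply: H => //; rewrite normr0.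
  have [z Hz] := IH (ltnW kN).
  have qz : q z <= T.
    have ks : - (k%:R * s) <= `|t|.
      have -> : k%:R * s = t * (k%:R / N.+1%:R) by rewrite /s mulrCA.
      rewrite (le_trans (ler_norm _)) // normrN normrM [X in _ * X]ger0_norm ?divr_ge0 //.
      by rewrite ler_piMr // ler_pdivrMr // mul1r ler_nat ltnW.
    by rewrite (reach_q Hz) ler_wpM2r ?q_ge0 // ler_expR mulNr -mulrN ler_wpM2l.
  have [W [psi [_ Wz H _]]] := local_flow_reach (Htau z qz).
  exists (psi s z); rewrite -addn1 natrD mulrDl mul1r; apply: reach_trans Hz _.
  by apply: H => //; rewrite /s normrM normfV [X in _ / X]ger0_norm.
have [z Hz] := step N.+1 (leqnn _); exists z.
by rewrite /s mulrCA divff ?mulr1 // in Hz; rewrite pnatr_eq0.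
Qed.

Definition flow_map (t : R) p : M := projT1 (cid (reach_exists p t)).

Lemma flow_mapP (t : R) p : reach p t (flow_map t p).
Proof. exact: projT2 (cid (reach_exists p t)). Qed.

Lemma flow_map_add (s t : R) : flow_map (s + t) = flow_map t \o flow_map s.
Proof.
apply/funext => p; apply: reach_unique (flow_mapP _ _) _.
exact: reach_trans (flow_mapP s p) (flow_mapP t _).
Qed.

Lemma flow_map_inj (t : R) : injective (flow_map t).
Proof.
move=> p p' E; apply: (reach_unique (reach_inv (flow_mapP t p))).
by rewrite E; exact: reach_inv (flow_mapP t p').
Qed.

Lemma q_flow_map (t : R) p : q (flow_map t p) = expR (- 2 * t) * q p.
Proof. exact: reach_q (flow_mapP t p). Qed.

Lemma CkM_eq k O f g : open O -> (forall p, O p -> f p = g p) -> CkM A k O f -> CkM A k O g.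
Proof.
move=> oO E cf i; apply: (Ck_eq (@chart_on_open _ _ _ _ sA i _ oO) _ (cf i)) => x [_ Ox].
exact: E.
Qed.

Lemma eq_mgrad O f g p : open O -> O p -> (forall p, O p -> f p = g p) -> mgrad h f p = mgrad h g p.
Proof.
move=> oO Op E; apply: (eq_gradnorm _ (@chart_on_open _ _ _ _ sA _ _ oO)).
  exact: (chart_onP sA (atlas_cover sA p) Op).
by move=> x [_ Ox]; exact: E.
Qed.

Lemma eq_mhess2 O f g p : open O -> O p -> (forall p, O p -> f p = g p) -> mhess2 h f p = mhess2 h g p.
Proof.
move=> oO Op E; rewrite /mhess2; congr (sqtrace _ _).
apply: (eq_hess _ (@chart_on_open _ _ _ _ sA _ _ oO)).
  exact: (chart_onP sA (atlas_cover sA p) Op).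
by move=> x [_ Ox]; exact: E.
Qed.

Lemma q_cont p : {for p, continuous q}.
Proof. exact: (CkM_cont sA openT (q_CkM 0 setT)). Qed.

Lemma open_sublevel (T : R) : open [set p | q p < T].
Proof. exact: (open_comp (D := [set t | t < T]) (fun x _ => @q_cont x) (@open_lt _ T)). Qed.

(** Around each point the global flow agrees with a local one by uniqueness, and regularity, scaling
    and radial derivatives are all local. *)
Lemma homothetic_small (T tau s : R) : (forall z, q z <= T -> local_flow tau z) -> `|s| < tau ->
  homothetic s [set p | q p < T] (flow_map s).
Proof.
move=> H st O f oO cf; pose Om := [set p | q p < T].
have loc p : (Om `&` flow_map s @^-1` O) p -> exists V psi, [/\ open V, V p,
    V `<=` Om `&` flow_map s @^-1` O, CkM A 2 V (f \o psi) & (forall z, V z -> psi z = flow_map s z) /\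
    (mgrad h (f \o psi) p = expR (- 2 * s) * mgrad h f (psi p) /\
    mhess2 h (f \o psi) p = expR (- 4 * s) * mhess2 h f (psi p)) /\
    (q p = 0 -> forall i a, chart_dom i p -> partial a ((f \o psi) \o chart_inv i) (chart i p) =
      expR (- s) * partial a (f \o chart_inv i) (chart i p))].
  move=> [Tp Op]; have [W [psi [oW Wp Wr Wh]]] := local_flow_reach (H p (ltW Tp)).
  have E z : W z -> psi s z = flow_map s z.
    by move=> Wz; exact: reach_unique (Wr s z st Wz) (flow_mapP s z).
  have [oWO cfp Hp Hp'] := Wh s st O f oO cf.
  exists (Om `&` (W `&` psi s @^-1` O)), (psi s); split.
  - by apply: openI => //; exact: open_sublevel.
  - by split => //; split => //=; rewrite E.
  - by move=> z [Tz [Wz Oz]]; split => //=; rewrite -E.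
  - by apply: CkM_sub cfp => z [].
  - split => [z [_ [/E]]//|]; split; first by apply: Hp => //=; rewrite E.
    move=> qp; have pp : flow_map s p = p := reach_unique (flow_mapP s p) (q_zero_reach s qp).
    by apply: (Hp' p Wp _ qp).2; move: Op; rewrite /= pp.
have oS : open (Om `&` flow_map s @^-1` O).
  by rewrite openE => p /loc[V [psi [oV Vp VS _ _]]]; apply: filterS VS _; exact: open_nbhs_nbhs.
split; [exact: oS| | |].
- apply: (CkM_local sA) => p /loc[V [psi [oV Vp VS cV [E _]]]]; exists V.
  split; [exact: oV|exact: Vp|].
  by apply: (CkM_eq oV _ cV) => z Vz /=; rewrite E.
- move=> p Tp Op; have [V [psi [oV Vp VS cV [E [[E1 E2] _]]]]] := loc p (conj Tp Op).
  have EV z : V z -> (f \o flow_map s) z = (f \o psi) z by move=> Vz /=; rewrite E.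
  by rewrite (eq_mgrad oV Vp EV) (eq_mhess2 oV Vp EV) -E.
- move=> p Tp Op qp; have pp : flow_map s p = p := reach_unique (flow_mapP s p) (q_zero_reach s qp).
  split=> // i a ip; have Op' : (flow_map s @^-1` O) p by rewrite /= pp.
  have [V [psi [oV Vp VS cV [E [_ E3]]]]] := loc p (conj Tp Op').
  rewrite -(E3 qp i a ip).
  apply: (eq_partial a (@chart_on_open _ _ _ _ sA i _ oV) (chart_onP sA ip Vp)) => x [_ Vx].
  by rewrite /= E.
Qed.

(** For nonnegative times [q] does not increase, so each [{q < T}] is mapped into itself and short
    homotheties compose. The sublevel sets exhaust [M], and the conclusions are local. *)
Lemma homothetic_flow (t : R) : 0 <= t -> homothetic t setT (flow_map t).
Proof.
move=> t0.
have HT (T : R) : homothetic t [set p | q p < T] (flow_map t).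
  have [tau tau0 Htau] := local_flow_uniform T.
  have [N tN] : exists N : nat, `|t| / N.+1%:R < tau.
    exists (Num.truncn (`|t| / tau)).
    by rewrite ltr_pdivrMr ?ltr0n // mulrC -ltr_pdivrMr // truncnS_gt.
  pose s := t / N.+1%:R; have s0 : 0 <= s by rewrite divr_ge0.
  have st : `|s| < tau by rewrite /s normrM normfV [X in _ / X]ger0_norm.
  have step k : homothetic (k%:R * s) [set p | q p < T] (flow_map (k%:R * s)).
    elim: k => [|k IH]; first by rewrite mul0r; apply: homothetic_small Htau _; rewrite normr0.
    rewrite -addn1 natrD mulrDl mul1r flow_map_add.
    apply: homothetic_comp IH (homothetic_small Htau st) => p /= pT.
    rewrite q_flow_map (le_lt_trans _ pT) // ler_piMl ?q_ge0 // -expR0 ler_expR mulNr oppr_le0.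
    by rewrite !mulr_ge0.
  by have := step N.+1; rewrite /s mulrCA divff ?mulr1 // pnatr_eq0.
move=> O f oO cf.
have S p : (setT `&` flow_map t @^-1` O) p -> exists V, [/\ open V, V p,
    V `<=` setT `&` flow_map t @^-1` O & CkM A 2 V (f \o flow_map t)].
  move=> [_ Op]; have [oV cV _ _] := HT (q p + 1) O f oO cf.
  by eexists; split; [exact: oV|by split => //=; rewrite ltrDl|move=> z []|].
split => [||p _ Op|p _ Op].
- by rewrite openE => p /S[V [oV Vp VS _]]; apply: filterS VS _; exact: open_nbhs_nbhs.
- by apply: (CkM_local sA) => p /S[V [oV Vp _ cV]]; exists V.
- have [_ _ H _] := HT (q p + 1) O f oO cf; apply: H => //=; by rewrite ltrDl.
- have [_ _ _ H] := HT (q p + 1) O f oO cf; apply: H => //=; by rewrite ltrDl.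
Qed.

Lemma flow_map_cont (t : R) : 0 <= t -> continuous (flow_map t).
Proof.
move=> t0; apply/continuousP => O oO.
by have [+ _ _ _] := homothetic_flow t0 oO (q_CkM 2 O); rewrite setTI.
Qed.

(** Exactly what the linearisation uses of the time-one map; the flow itself does not reappear
    afterwards. *)
Definition radial_homothety (lam : R) (E : M -> M) := [/\ 0 < lam < 1, continuous E, injective E,
  forall p, q (E p) = lam ^+ 2 * q p &
  forall O f, open O -> CkM A 2 O f -> [/\ open (E @^-1` O), CkM A 2 (E @^-1` O) (f \o E),
    forall p, O (E p) -> mgrad h (f \o E) p = lam ^+ 2 * mgrad h f (E p) /\
      mhess2 h (f \o E) p = lam ^+ 4 * mhess2 h f (E p) &
    forall p, O p -> q p = 0 -> E p = p /\ forall i a, chart_dom i p ->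
      partial a ((f \o E) \o chart_inv i) (chart i p) = lam * partial a (f \o chart_inv i) (chart i p)]].

Lemma radial_homothety_exists : exists lam E, radial_homothety lam E.
Proof.
have eX k : expR (- k%:R * 1 : R) = expR (-1) ^+ k.
  by rewrite -expRM_natl mulr1 mulrN1.
exists (expR (-1)), (flow_map 1); split.
- by rewrite expR_gt0 -[ltRHS]expR0 ltr_expR oppr_lt0 ltr01.
- exact: flow_map_cont.
- exact: flow_map_inj.
- by move=> p; rewrite q_flow_map -eX.
move=> O f oO cf; have [] := homothetic_flow ler01 oO cf.
rewrite setTI => h1 h2 h3 h4; split => // p Op; last by move=> qp; exact: h4.
by have [-> ->] := h3 p I Op; rewrite -!eX.
Qed.
End Cone.

(** * Koenigs linearisation *)

Lemma line_derivable (R : realType) (V : normedModType R) (f : V -> R) (x v : V) (l : R) :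
  is_derive (0 : R) 1 (fun s : R => f (x + s *: v)) l -> derivable f x v /\ 'D_v f x = l.
Proof.
have E : (fun h : R => h^-1 *: ((f \o shift x) (h *: v) - f x)) =
    (fun h : R => h^-1 *: (((fun s : R => f (x + s *: v)) \o shift 0) (h *: 1) - f (x + 0 *: v))).
  by apply/funext => h; rewrite /= scale0r !addr0 (addrC _ x) [_ *: 1]mulr1.
by move=> [d1 d2]; split; [rewrite /derivable E|rewrite /derive E].
Qed.

Lemma uniform_limit_continuous (R : realType) (V : normedModType R) (W : set V) (g : V -> R) : open W ->
  (forall e : R, 0 < e -> exists2 G : V -> R, forall y, W y -> {for y, continuous G} &
    forall y, W y -> `|G y - g y| <= e) -> forall y, W y -> {for y, continuous g}.
Proof.
move=> oW H y Wy; apply/continuous_eps => e e0; have e3 : 0 < e / 3 by rewrite divr_gt0.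
have [G cG HG] := H _ e3; have [d1 d10 H1] := (continuous_eps _ _).1 (cG y Wy) _ e3.
have [d2 d20 H2] := (nbhs_norm_ball _ _).1 (open_nbhs_nbhs (conj oW Wy)).
exists (Num.min d1 d2) => [|z]; first by rewrite lt_min d10.
rewrite lt_min => /andP[/H1 h1 /H2 /HG h2]; have h3 := HG y Wy.
have -> : g z - g y = (g z - G z) + (G z - G y) + (G y - g y) by rewrite -addrA subrKA subrKA.
have -> : e = e / 3 + e / 3 + e / 3 by field.
rewrite (le_lt_trans (ler_normD _ _)) // ltr_leD // (le_lt_trans (ler_normD _ _)) // ler_ltD //.
by rewrite distrC.
Qed.

(** * Limits of functions whose Hessians decay geometrically *)

Section UniformLimit.
Context {R : realType} {n : nat}.
Implicit Types (U W : set 'rV[R]_n) (f F : 'rV[R]_n -> R).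

(** Along each coordinate line [limit_derive] differentiates the limit, and local uniform
    convergence makes both [F] and the [g a] continuous. *)
Lemma uniform_limit_C1 U F (g : 'I_n -> 'rV[R]_n -> R) : open U ->
  (forall x, U x -> exists W, [/\ open W, W x & forall e : R, 0 < e -> exists2 G, Ck_on 1 W G &
    forall y, W y -> `|G y - F y| <= e /\ forall a, `|partial a G y - g a y| <= e]) ->
  Ck_on 1 U F /\ forall x a, U x -> partial a F x = g a x.
Proof.
move=> oU H.
have cF x : U x -> {for x, continuous F}.
  move=> /H[W [oW Wx HW]]; apply: (uniform_limit_continuous oW _ Wx) => e /HW[G cG HG].
  by exists G => y Wy; [exact: Ck_cont cG Wy|exact: (HG y Wy).1].
have cg x a : U x -> {for x, continuous (g a)}.
  move=> /H[W [oW Wx HW]]; apply: (uniform_limit_continuous oW _ Wx) => e /HW[G cG HG].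
  by exists (partial a G) => y Wy; [exact: Ck_cont (Ck_partial a cG) Wy|exact: (HG y Wy).2].
have D x a : U x -> derivable F x (delta_mx 0 a) /\ partial a F x = g a x.
  move=> Ux; have [W [oW Wx HW]] := H x Ux; rewrite partialE.
  have [r r0 Hr] := (nbhs_norm_ball _ _).1 (open_nbhs_nbhs (conj oW Wx)).
  have inW (s : R) : `|s - 0| < r -> W (x + s *: delta_mx 0 a).
    move=> sr; apply: Hr; rewrite addrC addKr normrZ norm_delta_mx mulr1; by rewrite subr0 in sr.
  apply: line_derivable; have := @limit_derive R (fun s => F (x + s *: delta_mx 0 a))
    (fun s => g a (x + s *: delta_mx 0 a)) 0 r r0.
  rewrite scale0r addr0; apply.
    move=> e /HW[G cG HG]; exists (fun s => G (x + s *: delta_mx 0 a)),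
      (fun s => partial a G (x + s *: delta_mx 0 a)) => s /inW Ws.
    split; [|exact: (HG _ Ws).1|exact: (HG _ Ws).2].
    by rewrite partialE; apply: is_derive_line; exact: Ck_derivable cG Ws.
  apply: continuous_comp; last by rewrite scale0r addr0; exact: cg.
  by apply: cvgD; [exact: cvg_cst|apply: cvgZr_tmp; exact: cvg_id].
split => [|x a Ux]; last by have [] := D x a Ux.
split => // a; split => [x Ux|]; first by have [] := D x a Ux.
apply: (@Ck_eq _ _ 0 U (g a) _ oU) => [x Ux|]; first by have [_ ->] := D x a Ux.
by split => // x; exact: cg.
Qed.

Variables (r : R).
Hypotheses (r0 : 0 <= r) (r1 : r < 1).

Lemma geometric_limit_C1 U F (f : nat -> 'rV[R]_n -> R) (g : 'I_n -> 'rV[R]_n -> R) : open U ->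
  (forall k, Ck_on 1 U (f k)) ->
  (forall x, U x -> exists W C, [/\ open W, W x, W `<=` U & forall k y, W y ->
    `|f k y - F y| <= C * r ^+ k /\ forall a, `|partial a (f k) y - g a y| <= C * r ^+ k]) ->
  Ck_on 1 U F /\ forall x a, U x -> partial a F x = g a x.
Proof.
move=> oU cf H; apply: uniform_limit_C1 => // x /H[W [C [oW Wx WU HW]]]; exists W; split => // e e0.
have [k Hk] := geometric_small C r0 r1 e0; exists (f k) => [|y Wy]; first exact: Ck_sub WU (cf k).
by have [h1 h2] := HW k y Wy; split => [|a]; exact: le_trans Hk.
Qed.

(** [D + 1] stands for the square root of [D]; the loss is harmless and the constants remain
    polynomial. *)
Lemma sqr_le_bound (x D s : R) : 0 <= D -> 0 <= s -> x ^+ 2 <= D * s ^+ 2 -> `|x| <= (D + 1) * s.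
Proof.
move=> D0 s0 H; rewrite -[leRHS]ger0_norm; last by rewrite mulr_ge0 // addr_ge0.
rewrite -ler_sqr ?nnegrE // !real_normK ?num_real // (le_trans H) // exprMn ler_wpM2r ?exprn_ge0 //.
by nra.
Qed.

Lemma locally_bounded U f x : open U -> Ck_on 0 U f -> U x ->
  exists K, nbhs x [set y | `|f y| <= K].
Proof.
move=> oU cf Ux; have [d d0 Hd] := (continuous_eps _ _).1 (Ck_cont cf Ux) 1 ltr01.
exists (`|f x| + 1); apply/nbhs_norm_ball; exists d => // y /Hd /ltW h.
by rewrite /= -[X in `|X|](subrK (f x)) addrC (le_trans (ler_normD _ _)) // lerD2l.
Qed.

Lemma locally_bounded_fam (I : finType) U (f : I -> 'rV[R]_n -> R) x : open U ->
  (forall i, Ck_on 0 U (f i)) -> U x -> exists K, 0 <= K /\ nbhs x [set y | forall i, `|f i y| <= K].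
Proof.
move=> oU cf Ux; have [K HK] := choice (fun i => locally_bounded oU (cf i) Ux).
exists (\sum_i `|K i|); split; first exact: sumr_ge0.
apply: (@filter_forall _ _ (fun i y => `|f i y| <= \sum_i `|K i|) (nbhs x) _) => i.
apply: filterS (HK i) => y /= h; apply: (le_trans h); apply: (le_trans (ler_norm _)).
by rewrite (bigD1 i) //= lerDl sumr_ge0.
Qed.

Variables (U : set 'rV[R]_n) (G : 'rV[R]_n -> 'M[R]_n).
Hypothesis mG : metric_on U G.
Let oU : open U. Proof. by case: mG. Qed.

(* The bounds on the gradients make the differentials converge, and those on
   the Hessians give the limit g of the differentials the equation
   d_c g_a = \sum_k Gamma^k_ca g_k, from which smoothness is bootstrapped. *)
Lemma flat_limit (f : nat -> 'rV[R]_n -> R) F (C : R) : 0 <= C ->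
  (forall k, Ck_on 2 U (f k)) ->
  (forall k x, U x -> [/\ `|f k x - F x| <= C * r ^+ k,
     gradnorm G (fun y => f k.+1 y - f k y) x <= C * r ^+ k ^+ 2 &
     sqtrace (G x) (hessian_coord G (f k) x) <= C * r ^+ k ^+ 2]) ->
  smooth_on U F /\ forall x, U x -> exists D, forall k a, `|partial a (f k) x - partial a F x| <= D * r ^+ k.
Proof.
move=> C0 cf H.
have rk k : 0 <= r ^+ k by rewrite exprn_ge0.
have r1' : 0 < 1 - r by rewrite subr_gt0.
have pd x : U x -> posdef (G x) by case: mG => _ _; apply.
have step x K : U x -> (forall p : 'I_n * 'I_n, `|G x p.1 p.2| <= K) -> forall k a,
    `|partial a (f k.+1) x - partial a (f k) x| <= (C * K + 1) * r ^+ k.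
  move=> Ux HK k a; have [_ h _] := H k x Ux.
  have K0 : 0 <= K := le_trans (normr_ge0 _) (HK (a, a)).
  have GK : G x a a <= K := le_trans (ler_norm _) (HK (a, a)).
  pose v := \row_b partial b (fun y => f k.+1 y - f k y) x.
  have va : v 0 a = partial a (f k.+1) x - partial a (f k) x.
    by rewrite mxE (partialB (Ck_derivable (Ck_pred (cf k.+1)) Ux) (Ck_derivable (Ck_pred (cf k)) Ux)).
  rewrite -va; apply: sqr_le_bound; [exact: mulr_ge0|exact: rk|].
  apply: (le_trans (covector_bound v a (pd x Ux))).
  rewrite mulrAC; apply: (le_trans (ler_wpM2l (inv_form_ge0 v (pd x Ux)) GK)).
  by apply: ler_wpM2r => //; move: h; rewrite gradnorm_form.
(* Bounds at each single point are enough to define the limits [g]; constants uniform near a point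
   are supplied afterwards, in [loc]. *)
pose N x := \big[Num.max/0]_(p : 'I_n * 'I_n) `|G x p.1 p.2|.
have NG x p : `|G x p.1 p.2| <= N x by exact: (le_bigmax _ (fun p : 'I_n * 'I_n => `|G x p.1 p.2|)).
have ex a (x : 'rV[R]_n) : exists l : R, U x -> forall k, `|partial a (f k) x - l| <= (C * N x + 1) * r ^+ k / (1 - r).
  have [Ux|nU] := pselect (U x); last by exists 0.
  have D0 : 0 <= C * N x + 1 by rewrite addr_ge0 // mulr_ge0 // bigmax_ge_id.
  have [l Hl] := @geometric_limit R (fun k => partial a (f k) x) _ r D0 r0 r1 (fun k => step x (N x) Ux (NG x) k a).
  by exists l.
have ex' a : exists ga : 'rV[R]_n -> R, forall x, U x -> forall k,
    `|partial a (f k) x - ga x| <= (C * N x + 1) * r ^+ k / (1 - r).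
  by have [ga Hga] := choice (ex a); exists ga.
have [g Hg] := choice ex'.
pose phi c a x := \sum_m christoffel G m c a x * g m x.
have loc x : U x -> exists W D, [/\ open W, W x, W `<=` U & forall k y, W y ->
    [/\ `|f k y - F y| <= D * r ^+ k, forall a, `|partial a (f k) y - g a y| <= D * r ^+ k &
      forall c a, `|partial c (partial a (f k)) y - phi c a y| <= D * r ^+ k]].
  move=> Ux.
  have [K [K0 HK]] := @locally_bounded_fam ('I_n * 'I_n)%type U (fun p y => G y p.1 p.2) x oU
    (fun p => let: And3 _ h _ := mG in h 0%N p.1 p.2) Ux.
  have [L [L0 HL]] := @locally_bounded_fam ('I_n * ('I_n * 'I_n))%type U (fun p => christoffel G p.1 p.2.1 p.2.2)
    x oU (fun p => chr_smooth mG 0 p.1 p.2.1 p.2.2) Ux.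
  have := @filterI _ _ (nbhs_filter x) _ _ (@filterI _ _ (nbhs_filter x) _ _ HK HL) (open_nbhs_nbhs (conj oU Ux)).
  rewrite nbhsE => -[W [oW Wx] HW].
  pose D1 := (C * K + 1) / (1 - r); pose D2 := C * K ^+ 2 + 1.
  have D10 : 0 <= D1 by rewrite divr_ge0 ?(ltW r1') // addr_ge0 // mulr_ge0.
  have D20 : 0 <= D2 by rewrite addr_ge0 // mulr_ge0 // exprn_ge0.
  have D30 : 0 <= n%:R * L * D1 by rewrite mulr_ge0 // mulr_ge0.
  exists W, (C + D1 + (D2 + n%:R * L * D1)); split => // [y /HW[]//|k y Wy].
  have [[GK GL] Uy] := HW y Wy; have [h1 _ h3] := H k y Uy.
  have gE a : `|partial a (f k) y - g a y| <= D1 * r ^+ k.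
    apply: (le_trans (Hg a y Uy k)); rewrite /D1 mulrAC; apply: ler_wpM2r; first exact: rk.
    apply: ler_wpM2r; first by rewrite invr_ge0 ltW.
    by rewrite lerD2r; apply: ler_wpM2l => //; apply: bigmax_le => // p _; exact: GK.
  split.
  - by apply: (le_trans h1); apply: ler_wpM2r; [exact: rk|rewrite -addrA lerDl addr_ge0 // addr_ge0].
  - move=> a; apply: (le_trans (gE a)); apply: ler_wpM2r; [exact: rk|].
    by rewrite addrAC lerDr addr_ge0 // addr_ge0.
  - move=> c a; apply: (@le_trans _ _ ((D2 + n%:R * L * D1) * r ^+ k)); last first.
      by apply: ler_wpM2r; [exact: rk|rewrite lerDr addr_ge0].
    (* The second partials are the Hessian, which is [O(r ^+ k)], plus Christoffel symbols times
       first partials, which converge. So they converge to [phi]. *)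
    have hE : partial c (partial a (f k)) y = hessian_coord G (f k) y c a +
        \sum_m christoffel G m c a y * partial m (f k) y by rewrite mxE subrK.
    rewrite hE /phi -addrA -sumrB mulrDl (le_trans (ler_normD _ _)) //; apply: lerD.
      apply: sqr_le_bound; [by rewrite mulr_ge0 // exprn_ge0|exact: rk|].
      have sS : (hessian_coord G (f k) y)^T = hessian_coord G (f k) y.
        by apply/matrixP => i j; rewrite [LHS]mxE (hess_sym mG j i Uy (cf k)).
      apply: (le_trans (sym_entry_bound c a (pd y Uy) sS)); rewrite mulrAC.
      have S0 := sqtrace_ge0 (pd y Uy) sS.
      apply: (le_trans (ler_wpM2l S0 (_ : _ <= K ^+ 2))); last by apply: ler_wpM2r => //; rewrite exprn_ge0.
      apply: (le_trans (ler_norm _)); rewrite normrM expr2.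
      by apply: ler_pM => //; [exact: (GK (c, c))|exact: (GK (a, a))].
    apply: (le_trans (ler_norm_sum _ _ _)); apply: (@le_trans _ _ (\sum_(m < n) L * (D1 * r ^+ k))).
      apply: ler_sum => m _; rewrite -mulrBr normrM; apply: ler_pM => //.
      exact: (GL (m, (c, a))).
    by rewrite sumr_const card_ord -[_ *+ n]mulr_natl !mulrA.
have [cF dF] : Ck_on 1 U F /\ forall x a, U x -> partial a F x = g a x.
  apply: (geometric_limit_C1 oU (fun k => Ck_pred (cf k))) => x /loc[W [D [oW Wx WU HW]]].
  by exists W, D; split => // k y /(HW k)[].
have dg a : Ck_on 1 U (g a) /\ forall x c, U x -> partial c (g a) x = phi c a x.
  apply: (geometric_limit_C1 (g := fun c => phi c a) oU (fun k => Ck_partial a (cf k))) => x /loc[W [D [oW Wx WU HW]]].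
  by exists W, D; split => // k y /(HW k)[_ h1 h2]; split.
have sg k a : Ck_on k U (g a).
  elim: k a => [|k IH] a; first exact: Ck_pred (dg a).1.
  split => [x|c]; first exact: Ck_cont (dg a).1.
  split => [x|]; first exact: Ck_derivable (dg a).1.
  apply: (Ck_eq oU (f := phi c a)) => [x Ux|]; first by rewrite (dg a).2.
  by apply: (Ck_sum _ _ oU) => m; apply: (Ck_mul oU); [exact: (chr_smooth mG)|exact: IH].
split.
- case=> [|k]; first exact: Ck_pred cF.
  split => [x|a]; first exact: Ck_cont cF.
  split => [x|]; first exact: Ck_derivable cF.
  by apply: (Ck_eq oU (f := g a)) => [x Ux|]; [rewrite dF|exact: sg].
- move=> x Ux; have [W [D [_ Wx _ HW]]] := loc x Ux; exists D => k a.
  by rewrite dF //; have [] := HW k x Wx.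
Qed.
End UniformLimit.

Lemma hess_scale (R : realType) n (U : set 'rV[R]_n) (G : 'rV[R]_n -> 'M[R]_n) (f : 'rV[R]_n -> R) (c : R) x :
  metric_on U G -> U x -> Ck_on 2 U f ->
  hessian_coord G (fun y => c * f y) x = c *: hessian_coord G f x.
Proof.
move=> mG Ux cf; have z0 : Ck_on 2 U (fun=> 0 : R) := Ck_cst 2 _ 0.
apply/matrixP => a b; rewrite [RHS]mxE.
have := hess_lin mG c a b Ux z0 cf.
have -> : (fun y => 0 + c * f y) = (fun y => c * f y) by apply/funext => y; rewrite add0r.
move=> ->; rewrite [X in X + _](_ : _ = 0) ?add0r // mxE.
have p0 d y : partial d (fun=> 0 : R) y = 0 by exact: partial_cst.
rewrite (_ : partial b (fun=> 0) = fun=> 0); last by apply/funext => y; exact: p0.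
by rewrite p0 big1 ?subrr // => k _; rewrite p0 mulr0.
Qed.

Section Koenigs.
Context {R : realType} {n : nat} {M : topologicalType}.
Variable A : atlas R n M.
Hypothesis sA : smooth_atlas A.
Hypothesis hM : hausdorff_space M.
Hypothesis cM : connected [set: M].
Hypothesis M0 : [set: M] !=set0.
Variable h : metric_field A.
Hypothesis rh : riemannian_metric h.
Variable q : M -> R.
Hypothesis sq : smooth_fun A q.
Hypothesis hq : forall i x, chart_img i x ->
  hessian_coord (gloc h i) (q \o chart_inv i) x = gloc h i x.
Hypothesis gq : forall p, mgrad h q p = 2 * q p.
Hypothesis kq : forall T, compact [set p | q p <= T].
Variables (lam : R) (E : M -> M).
Hypothesis HE : radial_homothety h q lam E.
Let q0 p : 0 <= q p := q_ge0 sA rh gq p.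
Let lam0 : 0 < lam. Proof. by case: HE => /andP[]. Qed.
Let lam1 : lam < 1. Proof. by case: HE => /andP[]. Qed.
Let qc p : {for p, continuous q} := @q_cont _ _ _ A sA q sq p.
Implicit Types (i j : chart_ix A) (O : set M) (f : M -> R) (p z : M).

(** [q] attains its minimum because its sublevel sets are compact, and at the minimum
    [2 q = |Dq|^2 = 0]. *)
Lemma zero_exists : exists p, q p = 0.
Proof.
have [p0 _] := M0.
have [z zK zmin] : exists2 z, z \in [set p | q p <= q p0] & forall t, t \in [set p | q p <= q p0] -> q z <= q t.
  apply: compact_EVT_min; [by exists p0; rewrite /=|exact: kq|].
  by apply: continuous_in_subspaceT => x _; apply: qc.
have zle t : q z <= q t.
  have [tp|tp] := leP (q t) (q p0); first by apply: zmin; rewrite inE.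
  by move: zK; rewrite inE /= => /le_trans; apply; exact: ltW.
exists z; pose i := chart_at A z; have iz : chart_dom i z := atlas_cover sA z.
have oI : open (chart_img i) by case: (gloc_metric sA rh i).
have g0 : mgrad h q z = 0.
  rewrite /mgrad -/i /gradnorm big1 // => a _.
  rewrite (local_min_partial a oI (sq i 1) (chart_imgP iz)) ?mulr0 // => y _.
  by rewrite /= (atlas_chartK sA iz).
by apply/eqP; have /eqP := gq z; rewrite g0 eq_sym mulf_eq0 pnatr_eq0 /=.
Qed.

Lemma zero_chart i p : q p = 0 -> chart_dom i p -> exists c r : R, [/\ 0 < c, 0 < r &
  forall x : 'rV[R]_n, `|x - chart i p| < r -> chart_img i x /\ c * sqdist (chart i p) x <= q (chart_inv i x)].
Proof.
move=> qp ip; have mG := gloc_metric sA rh i; have oI : open (chart_img i) by case: mG.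
have Ip := chart_imgP ip; have d0 a := q_zero_grad sA rh sq gq a qp ip.
have pH : posdef (\matrix_(a, b) partial a (partial b (q \o chart_inv i)) (chart i p)).
  have -> : \matrix_(a, b) partial a (partial b (q \o chart_inv i)) (chart i p) = gloc h i (chart i p).
    rewrite -(hq Ip); apply/matrixP => a b; rewrite !mxE.
    by rewrite big1 ?subr0 // => k _; rewrite d0 mulr0.
  by case: mG => _ _; apply.
have [c [r [c0 r0 Hr]]] := nondegenerate_min oI (sq i 2) Ip d0 pH.
by exists c, r; split => // x /Hr; rewrite /= (atlas_chartK sA ip) qp add0r.
Qed.

(** That [q] is bounded on the connecting set is what allows a single iterate of [E] to push the
    whole set into a small sublevel set. *)
Lemma sublevel_path p1 p2 : exists T C, [/\ connected C, C p1, C p2 & C `<=` [set p | q p < T]].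
Proof.
pose Z := [set z | exists T C, [/\ connected C, C p1, C z & C `<=` [set p | q p < T]]].
have ext z w : Z z -> forall W, connected W -> W z -> W w -> W `<=` [set p | q p < q z + 1] \/
    W `<=` [set p | q p < q w + 1] -> Z w.
  move=> [T [C [cC C1 Cz CT]]] W cW Wz Ww WT; exists (Num.max T (Num.max (q z + 1) (q w + 1))), (C `|` W); split.
  - by apply: connectedU => //; exists z.
  - by left.
  - by right.
  - move=> x [/CT|Wx]; rewrite /= !lt_max; first by move=> ->.
    by case: WT => /(_ _ Wx) /= ->; rewrite ?orbT.
have small z : exists W, [/\ open W, W z, W `<=` [set p | q p < q z + 1] & connected W].
  by apply: (small_connected sA (open_sublevel sA sq _)); rewrite /= ltrDl.
suff ZT : Z = setT by have : Z p2 by rewrite ZT.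
apply: connected_clopen cM _ _ _ _ => //.
- exists p1; exists (q p1 + 1), [set p1]; split => //; first exact: connected1.
  by move=> x ->; rewrite /= ltrDl.
- move=> z Zz; have [W [oW Wz WT cW]] := small z.
  by apply: filterS (open_nbhs_nbhs (conj oW Wz)) => w Ww _; apply: (ext z w Zz W) => //; left.
- move=> z _ nZ; have [W [oW Wz WT cW]] := small z.
  apply: filterS (open_nbhs_nbhs (conj oW Wz)) => w Ww Zw; apply: nZ.
  by apply: (ext w z Zw W) => //; right.
Qed.

Lemma q_iter k p : q (iter k E p) = lam ^+ (2 * k) * q p.
Proof.
elim: k => [|k IH]; first by rewrite mul1r.
by have [_ _ _ H _] := HE; rewrite /= H IH mulrA -exprD mulnS.
Qed.

Lemma iter_cont k : continuous (iter k E).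
Proof.
have [_ cE _ _ _] := HE; elim: k => [|k IH] p; first exact: cvg_id.
by apply: (@continuous_comp _ _ _ (iter k E) E); [exact: IH|exact: cE].
Qed.

Lemma zero_fixed p : q p = 0 -> E p = p.
Proof. by move=> qp; have [_ _ _ _ H] := HE; have [_ _ _ /(_ p I qp)[]] := H setT q openT (q_CkM sq 2 setT). Qed.

Lemma pow_small (T eta : R) : 0 < eta -> exists k, lam ^+ (2 * k) * T < eta.
Proof.
move=> e0; have e2 : 0 < eta / 2 by rewrite divr_gt0.
have l2 : lam ^+ 2 < 1 by rewrite expr_lt1 // ltW.
have [k Hk] := geometric_small T (exprn_ge0 2 (ltW lam0)) l2 e2.
exists k; rewrite exprM mulrC (le_lt_trans Hk) // ltr_pdivrMr // mulr_natr mulr2n ltrDl //.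
Qed.

(* A connected set joining two zeros is pushed by the iterates of [E] into an
   arbitrarily small sublevel set, whose part near the first zero is clopen. *)
Lemma zero_unique p1 p2 : q p1 = 0 -> q p2 = 0 -> p1 = p2.
Proof.
move=> q1 q2; pose i := chart_at A p1; have ip : chart_dom i p1 := atlas_cover sA p1.
have [c [r [c0 r0 Hr]]] := zero_chart q1 ip; set x1 := chart i p1 in Hr.
pose r2 := r / 2; have r20 : 0 < r2 by rewrite divr_gt0.
have r2r : r2 < r by rewrite /r2 ltr_pdivrMr // mulr_natr mulr2n ltrDl.
pose W := chart_dom i `&` chart i @^-1` (nball x1 r2).
have oW : open W.
  rewrite openE => p [iq Bp]; have n1 := open_nbhs_nbhs (conj (atlas_dom_open sA i) iq).
  apply: filterI => //.
  exact: (nbhs_preimage (atlas_chart_cont sA iq) (@open_norm_ball _ _ _ _) Bp).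
pose K := chart_inv i @` [set x | `|x - x1| <= r2].
have cK : closed K.
  apply: (compact_closed hM); apply: continuous_compact; last exact: cball_compact.
  apply: continuous_in_subspaceT => x /set_mem /= xr; apply: (atlas_inv_cont sA).
  by have [] := Hr x (le_lt_trans xr r2r).
(* On the sphere of radius [r2] around [x1] the growth of [q] gives at least this value, so the set
   [{q < eta}] does not meet it. *)
pose eta := c * r2 ^+ 2; have eta0 : 0 < eta by rewrite mulr_gt0 // exprn_gt0.
have [T [C [cC C1 C2 CT]]] := sublevel_path p1 p2.
have [k Hk] := pow_small T eta0.
pose N := iter k E @` C.
have fix1 p : q p = 0 -> iter k E p = p.
  by move=> qp; elim: k {Hk N} => //= k ->; exact: zero_fixed.
have N1 : N p1 by exists p1 => //; exact: fix1.
have N2 : N p2 by exists p2 => //; exact: fix1.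
have cN : connected N.
  by apply: connected_continuous_connected cC _; apply: continuous_subspaceT; exact: iter_cont.
have Nq z : N z -> q z < eta.
  move=> [x /CT /= xT <-]; rewrite q_iter (le_lt_trans _ Hk) // ler_wpM2l ?exprn_ge0 ?(ltW lam0) //.
  exact: ltW.
have NKW z : N z -> K z -> W z.
  move=> /Nq qz [x /= xr xz]; have [Ix qx] := Hr x (le_lt_trans xr r2r).
  have [d e] := chart_img_dom sA Ix; rewrite -xz; split => //; rewrite /= e /nball /=.
  rewrite lt_neqAle xr andbT; apply/eqP => xE; move: qz; rewrite -xz ltNge => /negP; apply.
  by apply: le_trans qx; rewrite ler_pM2l // -xE norm_sqdist.
have WK z : W z -> K z by move=> [iz Bz]; exists (chart i z); [exact: ltW|exact: atlas_chartK].
suff ZN : [set z | N z /\ W z] = N.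
  have [_ [i2 B2]] : [set z | N z /\ W z] p2 by rewrite ZN.
  have [_] := Hr (chart i p2) (lt_trans B2 r2r); rewrite (atlas_chartK sA i2) q2 pmulr_rle0 // => sq0.
  have sd0 : sqdist x1 (chart i p2) = 0 by apply/le_anti; rewrite sq0 sqdist_ge0.
  by rewrite -(atlas_chartK sA ip) -(atlas_chartK sA i2) (sqdist_eq0 sd0).
apply: connected_clopen cN _ _ _ _.
- by exists p1; split => //; split => //=; rewrite /nball /= subrr normr0.
- by move=> z [].
- by move=> z [Nz Wz]; apply: filterS (open_nbhs_nbhs (conj oW Wz)) => w Ww Nw.
- move=> z Nz nZ; have nK : (~` K) z by move=> Kz; apply: nZ; split => //; exact: NKW.
  apply: filterS (open_nbhs_nbhs (conj (closed_openC cK) nK)) => w nKw [_ /WK]; exact: nKw.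
Qed.

(** Sublevel sets form a neighbourhood base of the zero: on the compact part of [{q <= 1}] outside
    [W] the minimum of [q] is positive, the zero being unique. *)
Lemma zero_nbhs p W : q p = 0 -> open W -> W p -> exists2 eta : R, 0 < eta & forall z, q z < eta -> W z.
Proof.
move=> qp oW Wp; pose K := [set z | q z <= 1] `&` ~` W.
have cK : compact K.
  apply: (subclosed_compact _ (@kq 1)); last by move=> z [].
  apply: closedI; last exact: open_closedC.
  exact: compact_closed hM (@kq 1).
have [K0|/set0P/negP] := pselect (K !=set0); last first.
  rewrite negbK => /eqP K0; exists 1 => // z qz; apply: contrapT => nW.
  by have : K z by [split; [exact: ltW|]]; rewrite K0.
have [z zK zmin] := compact_EVT_min K0 cK (continuous_in_subspaceT (fun x _ => @qc x)).
rewrite inE in zK; have qz : 0 < q z.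
  rewrite lt0r q0 andbT; apply/eqP => qz; case: zK => _; apply.
  by rewrite (zero_unique qz qp).
exists (Num.min 1 (q z)) => [|w]; first by rewrite lt_min ltr01.
rewrite lt_min => /andP[w1 wz]; apply: contrapT => nW.
by have := zmin w; rewrite inE leNgt wz => /(_ _)/negP; apply => //; split => //; exact: ltW.
Qed.

Variable p0 : M.
Hypothesis qp0 : q p0 = 0.
Let i0 := chart_at A p0.
Let x0 := chart i0 p0.
Let O0 := chart_dom i0.
Let ip0 : O0 p0 := atlas_cover sA p0.
Let oO0 : open O0 := atlas_dom_open sA i0.
Let mG0 : metric_on (chart_img i0) (gloc h i0) := gloc_metric sA rh i0.
Let oI0 : open (chart_img i0). Proof. by case: mG0. Qed.

Lemma near_zero (P : set 'rV[R]_n) : nbhs x0 P ->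
  exists2 eta : R, 0 < eta & forall z, q z < eta -> O0 z /\ P (chart i0 z).
Proof.
move=> /nbhs_norm_ball[d d0 Hd]; pose W := O0 `&` chart i0 @^-1` (nball x0 d).
have oW : open W.
  rewrite openE => p [iq Bp]; have n1 := open_nbhs_nbhs (conj oO0 iq).
  apply: filterI => //.
  exact: (nbhs_preimage (atlas_chart_cont sA iq) (@open_norm_ball _ _ _ _) Bp).
have Wp : W p0 by split => //=; rewrite /nball /= subrr normr0.
have [eta e0 He] := zero_nbhs qp0 oW Wp; exists eta => // z /He[iz Bz].
by split => //; exact: Hd.
Qed.

Lemma nbhs_open_chart O : open O -> O p0 -> nbhs x0 (chart_on i0 O).
Proof.
move=> oO Op; apply: open_nbhs_nbhs; split; first exact: (@chart_on_open _ _ _ _ sA i0 _ oO).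
exact: (chart_onP sA ip0 Op).
Qed.

Lemma q_lower : exists2 c : R, 0 < c & exists2 r : R, 0 < r & forall x : 'rV[R]_n, `|x - x0| < r ->
  chart_img i0 x /\ c * sqdist x0 x <= q (chart_inv i0 x).
Proof. by have [c [r [c0 r0 Hr]]] := zero_chart qp0 ip0; exists c => //; exists r. Qed.

(** Vanishing to first order gives [|df| <= L |x - x0|] and [|f| <= n L |x - x0|^2] near [x0], while
    [|x - x0|^2 <= q / c]. Bounds by [q] are wanted because [q] scales exactly under [E]. *)
Lemma quadratic_bound O f : open O -> O p0 -> CkM A 2 O f -> f p0 = 0 ->
  (forall a, partial a (f \o chart_inv i0) x0 = 0) ->
  exists eta C : R, [/\ 0 < eta, 0 <= C & forall z, q z < eta -> [/\ O z, `|f z| <= C * q z &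
    mgrad h f z <= C * q z]].
Proof.
move=> oO Op cf f0 df0; pose U := chart_on i0 O.
have oU : open U := @chart_on_open _ _ _ _ sA i0 _ oO.
have Ux : U x0 := chart_onP sA ip0 Op; pose F := f \o chart_inv i0.
have cD b : Ck_on 1 U (fun x => (\row_a partial a F x) 0 b).
  apply: (@Ck_eq _ _ 1 U (partial b F) _ oU) => [x _|]; first by rewrite mxE.
  exact: Ck_partial (cf i0).
have [r1 [L [r10 L0 HU HL]]] := Ck1_lipschitz oU cD Ux.
have [c c0 [r2 r20 Hq]] := q_lower.
pose K a b : R := `|invmx (gloc h i0 x0) a b| + 1.
have N1 : nbhs x0 [set x | forall a b, `|invmx (gloc h i0 x) a b| <= K a b].
  apply: (@filter_forall _ _ (fun a x => forall b, `|invmx (gloc h i0 x) a b| <= K a b) (nbhs x0) _) => a.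
  apply: (@filter_forall _ _ (fun b x => `|invmx (gloc h i0 x) a b| <= K a b) (nbhs x0) _) => b.
  have [d d0 Hd] := (continuous_eps _ _).1 (Ck_cont (inv_smooth mG0 0 a b) (chart_imgP ip0)) 1 ltr01.
  apply/nbhs_norm_ball; exists d => // x /Hd /ltW H.
  rewrite -[X in `|X| <= _](subrK (invmx (gloc h i0 x0) a b)).
  by rewrite (le_trans (ler_normD _ _)) // addrC lerD2l.
have N2 : nbhs x0 (nball x0 (Num.min r1 r2)).
  by apply/nbhs_norm_ball; exists (Num.min r1 r2) => //; rewrite lt_min r10.
have [eta e0 He] := near_zero (@filterI _ _ (nbhs_filter x0) _ _ N1 N2).
pose S := \sum_a \sum_b K a b.
have K0 a b : 0 <= K a b by rewrite addr_ge0.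
have S0 : 0 <= S by do 2!apply: sumr_ge0 => ? _.
have C0 : 0 <= (n%:R * L + S * L ^+ 2) / c.
  by rewrite divr_ge0 ?(ltW c0) // addr_ge0 // mulr_ge0 // exprn_ge0.
exists eta, ((n%:R * L + S * L ^+ 2) / c); split => // z /He[iz [Kz Bz]].
move: Bz; rewrite /nball /= lt_min => /andP[z1 z2].
have [_ qz] := Hq _ z2; rewrite (atlas_chartK sA iz) in qz.
have [_ Oz] := HU _ z1; rewrite /= (atlas_chartK sA iz) in Oz.
set x := chart i0 z in Kz z1 z2 qz.
have x0b : `|x0 - x0| < r1 by rewrite subrr normr0.
have dF (y : 'rV[R]_n) a : `|y - x0| < r1 -> `|partial a F y| <= L * `|y - x0|.
  move=> yr; apply: le_trans (HL _ _ yr x0b).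
  have := coord_le_norm ((\row_a partial a F y) - \row_a partial a F x0) a.
  by rewrite !mxE df0 subr0.
have nq : `|x - x0| ^+ 2 <= q z / c.
  by rewrite ler_pdivlMr // mulrC (le_trans _ qz) // ler_pM2l // norm_sqdist.
have qc0 : 0 <= q z / c by rewrite divr_ge0 // ltW.
split => //.
- have seg (t : R) : 0 <= t <= 1 -> `|x0 + t *: (x - x0) - x0| < r1 := segment_in_ball x0b z1.
  have [t t01 FE] : exists2 t : R, 0 <= t <= 1 &
      F (x0 + (x - x0)) - F x0 = 'D_(x - x0) F (x0 + t *: (x - x0)).
    apply: (@MVT01 R n F) => t /seg /HU Ut; apply: diff_derivable.
    by have [] := Ck_diff oU (cf i0) Ut.
  have F0 : F x0 = 0 by rewrite /F /= (atlas_chartK sA ip0).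
  have Fz : F x = f z by rewrite /F /= (atlas_chartK sA iz).
  rewrite subrKC F0 subr0 Fz (Ck_diff oU (cf i0) (HU _ (seg t t01))).2 in FE.
  rewrite FE (le_trans (ler_norm_sum _ _ _)) //.
  apply: (@le_trans _ _ (\sum_(a < n) L * `|x - x0| ^+ 2)).
    apply: ler_sum => a _; rewrite normrM expr2 mulrCA ler_pM ?coord_le_norm //.
    rewrite (le_trans (dF _ a (seg t t01))) // ler_wpM2l // addrC addKr normrZ.
    by move/andP: t01 => [t0 t1]; rewrite ger0_norm // ler_piMl.
  rewrite sumr_const card_ord -[_ *+ n]mulr_natl mulrA.
  apply: (@le_trans _ _ (n%:R * L * (q z / c))); first by rewrite ler_wpM2l // mulr_ge0.
  have -> : (n%:R * L + S * L ^+ 2) / c * q z = n%:R * L * (q z / c) + S * L ^+ 2 * (q z / c).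
    by field; apply: lt0r_neq0.
  by rewrite lerDl !mulr_ge0 ?exprn_ge0 // invr_ge0 ltW.
- rewrite (mgrad_chart sA rh oO cf Oz iz) /gradnorm /gradv -/x -/F.
  apply: (@le_trans _ _ (S * (L ^+ 2 * `|x - x0| ^+ 2))); last first.
    apply: (@le_trans _ _ (S * L ^+ 2 * (q z / c))).
      by rewrite mulrA ler_wpM2l // mulr_ge0 // exprn_ge0.
    have -> : (n%:R * L + S * L ^+ 2) / c * q z = n%:R * L * (q z / c) + S * L ^+ 2 * (q z / c).
      by field; apply: lt0r_neq0.
    by rewrite lerDr !mulr_ge0 // invr_ge0 ltW.
  rewrite mulr_suml; apply: ler_sum => a _; rewrite !mulr_suml; apply: ler_sum => b _.
  rewrite (le_trans (ler_norm _)) // !normrM -mulrA ler_pM // -exprMn expr2.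
  by rewrite ler_pM // dF.
Qed.

Lemma mhess2_bound O f : open O -> O p0 -> CkM A 2 O f ->
  exists eta C : R, [/\ 0 < eta, 0 <= C & forall z, q z < eta -> O z /\ mhess2 h f z <= C].
Proof.
move=> oO Op cf; pose U := chart_on i0 O.
have oU : open U := @chart_on_open _ _ _ _ sA i0 _ oO.
have Ux : U x0 := chart_onP sA ip0 Op; pose F := f \o chart_inv i0.
have mU : metric_on U (gloc h i0) := gloc_metric_on sA rh i0 oO.
have cH : Ck_mx 0 U (hessian_coord (gloc h i0) F) by move=> a b; exact: (hess_Ck mU a b (cf i0)).
have cI : Ck_mx 0 U (fun x => invmx (gloc h i0 x)) by move=> a b; exact: (inv_smooth mU 0 a b).
have cS : Ck_on 0 U (fun x => sqtrace (gloc h i0 x) (hessian_coord (gloc h i0) F x)).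
  apply: (Ck_sum _ _ oU) => a.
  exact: (Ck_mulmx oU (Ck_mulmx oU (Ck_mulmx oU cI cH) cI) cH a a).
pose C := `|sqtrace (gloc h i0 x0) (hessian_coord (gloc h i0) F x0)| + 1.
have [d d0 Hd] := (continuous_eps _ _).1 (Ck_cont cS Ux) 1 ltr01.
have N1 : nbhs x0 (nball x0 d) by apply/nbhs_norm_ball; exists d.
have [eta e0 He] := near_zero (@filterI _ _ (nbhs_filter x0) _ _ (nbhs_open_chart oO Op) N1).
exists eta, C; split => // [|z /He[iz [[_ Oz] Bz]]]; first by rewrite addr_ge0.
rewrite /= (atlas_chartK sA iz) in Oz; split => //.
rewrite (mhess2_chart sA rh oO cf Oz iz).
have -> : h i0 z = gloc h i0 (chart i0 z) by rewrite /gloc (atlas_chartK sA iz).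
have := ltW (Hd _ Bz); rewrite ler_norml => /andP[_]; rewrite lerBlDl => /le_trans; apply.
by rewrite /C lerD2r ler_norm.
Qed.

Lemma minner_near O f1 f2 (e : R) : open O -> O p0 -> CkM A 2 O f1 -> CkM A 2 O f2 -> 0 < e ->
  exists2 eta : R, 0 < eta & forall z, q z < eta -> O z /\ `|minner h f1 f2 z - minner h f1 f2 p0| < e.
Proof.
move=> oO Op c1 c2 e0; pose U := chart_on i0 O.
have oU : open U := @chart_on_open _ _ _ _ sA i0 _ oO.
have Ux : U x0 := chart_onP sA ip0 Op; pose F1 := f1 \o chart_inv i0; pose F2 := f2 \o chart_inv i0.
have mU : metric_on U (gloc h i0) := gloc_metric_on sA rh i0 oO.
have cS : Ck_on 0 U (fun x => \sum_a gradv (gloc h i0) F1 a x * partial a F2 x).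
  apply: (Ck_sum _ _ oU) => a.
  exact: (Ck_mul oU (gradv_Ck mU a (Ck_pred (c1 i0))) (Ck_partial a (Ck_pred (c2 i0)))).
have [d d0 Hd] := (continuous_eps _ _).1 (Ck_cont cS Ux) e e0.
have N1 : nbhs x0 (nball x0 d) by apply/nbhs_norm_ball; exists d.
have [eta eta0 He] := near_zero (@filterI _ _ (nbhs_filter x0) _ _ (nbhs_open_chart oO Op) N1).
exists eta => // z /He[iz [[_ Oz] Bz]]; rewrite /= (atlas_chartK sA iz) in Oz; split => //.
rewrite (minner_chart sA rh oO c1 c2 Oz iz) (minner_chart sA rh oO c1 c2 Op ip0); exact: Hd.
Qed.

Lemma iter_homothety k O f : open O -> CkM A 2 O f -> [/\ open (iter k E @^-1` O),
  CkM A 2 (iter k E @^-1` O) (f \o iter k E) & forall p, O (iter k E p) ->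
    mgrad h (f \o iter k E) p = lam ^+ (2 * k) * mgrad h f (iter k E p) /\
    mhess2 h (f \o iter k E) p = lam ^+ (4 * k) * mhess2 h f (iter k E p)].
Proof.
move=> oO cf; elim: k => [|k [oK cK HK]].
  by split => // p Op; rewrite !mul1r.
have [_ _ _ _ H] := HE; have [W1 c1 H1 _] := H _ _ oK cK.
have EE : iter k.+1 E = iter k E \o E by apply/funext => p; rewrite iterSr.
rewrite EE; split => // p Op; have [g1 k1] := H1 p Op; have [g2 k2] := HK (E p) Op.
by rewrite (g1 : mgrad h (f \o (iter k E \o E)) p = _) (k1 : mhess2 h (f \o (iter k E \o E)) p = _) g2 k2 !mulrA -!exprD !mulnS.
Qed.

Lemma iter_minner k O f1 f2 p : open O -> CkM A 2 O f1 -> CkM A 2 O f2 -> O (iter k E p) ->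
  minner h (f1 \o iter k E) (f2 \o iter k E) p = lam ^+ (2 * k) * minner h f1 f2 (iter k E p).
Proof.
move=> oO c1 c2 Op; have [_ _ /(_ p Op)[h1 _]] := iter_homothety k oO c1.
have [_ _ /(_ p Op)[h2 _]] := iter_homothety k oO c2.
have [_ _ /(_ p Op)[h3 _]] := iter_homothety k oO (CkM_add sA oO c1 c2).
by rewrite /minner h1 h2 (h3 : mgrad h (fun x => f1 (iter k E x) + f2 (iter k E x)) p = _); ring.
Qed.

Lemma mgrad_scale O f (c : R) p : open O -> CkM A 2 O f -> O p ->
  mgrad h (fun z => c * f z) p = c ^+ 2 * mgrad h f p.
Proof.
move=> oO cf Op; have ip := atlas_cover sA p.
exact: (gradnorm_scale _ c (chart_onP sA ip Op) (Ck_pred (cf _))).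
Qed.

Lemma minner_scale O f1 f2 (c : R) p : open O -> CkM A 2 O f1 -> CkM A 2 O f2 -> O p ->
  minner h (fun z => c * f1 z) (fun z => c * f2 z) p = c ^+ 2 * minner h f1 f2 p.
Proof.
move=> oO c1 c2 Op; rewrite /minner (mgrad_scale c oO c1 Op) (mgrad_scale c oO c2 Op).
rewrite (eq_mgrad sA h oO Op (g := fun z => c * (f1 z + f2 z))); last by move=> z _; rewrite mulrDr.
by rewrite (mgrad_scale c oO (CkM_add sA oO c1 c2) Op); ring.
Qed.

Lemma mhess2_scale O f (c : R) p : open O -> CkM A 2 O f -> O p ->
  mhess2 h (fun z => c * f z) p = c ^+ 2 * mhess2 h f p.
Proof.
move=> oO cf Op; have ip := atlas_cover sA p; set i := chart_at A p in ip.
have mU := gloc_metric_on sA rh i oO; have Ux := chart_onP sA ip Op.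
rewrite /mhess2 -/i; set F := f \o chart_inv i.
rewrite (hess_scale c mU Ux (cf i) : hessian_coord _ ((fun z => c * f z) \o chart_inv i) _ = _).
by rewrite /sqtrace -!(scalemxAr, scalemxAl) scalerA mxtraceZ expr2.
Qed.

Variable Q : 'M[R]_n.
Hypothesis uQ : Q \in unitmx.
Hypothesis hQ : h i0 p0 = Q *m Q^T.

(** Linear in the chart around [p0]. The factor [Q] of the metric makes the differentials
    orthonormal at [p0], see [minner_ell]. *)
Definition ell (b : 'I_n) p := \sum_a (chart i0 p 0 a - x0 0 a) * Q a b.

Lemma ell_CkM k b : CkM A k O0 (ell b).
Proof.
move=> j; have oj := @chart_on_open _ _ _ _ sA j _ oO0.
apply: (Ck_sum _ _ oj) => a; apply: (Ck_mul oj _ (Ck_cst _ _ _)).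
exact: (Ck_subr oj (@coord_CkM _ _ _ _ sA k i0 a j) (Ck_cst _ _ _)).
Qed.

Lemma ell_p0 b : ell b p0 = 0.
Proof. by apply: big1 => a _; rewrite subrr mul0r. Qed.

Lemma ell_partial b c x : chart_img i0 x -> partial c (ell b \o chart_inv i0) x = Q c b.
Proof.
move=> Ix; pose L (y : 'rV[R]_n) := \sum_a (y 0 a - x0 0 a) * Q a b.
rewrite (eq_partial c oI0 Ix (g := L)) => [|y Iy]; last first.
  by have [_ e] := chart_img_dom sA Iy; rewrite /= /ell e.
have d1 a : derivable (fun y : 'rV[R]_n => y 0 a) x (delta_mx 0 c) := Ck_derivable (@Ck_coord _ _ 0.+1 _ a oI0) Ix.
have d0 (k : R) : derivable (fun=> k) x (delta_mx 0 c) := Ck_derivable (Ck_cst 1 _ k) Ix.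
have dB a : derivable (fun y : 'rV[R]_n => y 0 a - x0 0 a) x (delta_mx 0 c) := derivableB (d1 a) (d0 _).
rewrite (partial_sum _ (fun a => derivableM (dB a) (d0 (Q a b)))) (bigD1 c) //= big1 => [|a ac].
  rewrite (partialM (dB c) (d0 _)) (partialB (d1 c) (d0 _)) !partial_cst partial_coord eqxx.
  by rewrite subr0 mulr0 add0r mulr1 addr0.
rewrite (partialM (dB a) (d0 _)) (partialB (d1 a) (d0 _)) !partial_cst partial_coord (negbTE ac).
by rewrite subrr !mulr0 addr0.
Qed.

Lemma minner_ell a b : minner h (ell a) (ell b) p0 = (a == b)%:R.
Proof.
have Ix : chart_img i0 x0 := chart_imgP ip0.
rewrite (minner_chart sA rh oO0 (ell_CkM 2 a) (ell_CkM 2 b) ip0 ip0).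
have gE : gloc h i0 x0 = Q *m Q^T by rewrite /gloc (atlas_chartK sA ip0).
have -> : \sum_c gradv (gloc h i0) (ell a \o chart_inv i0) c x0 * partial c (ell b \o chart_inv i0) x0 =
    (Q^T *m invmx (Q *m Q^T) *m Q) b a.
  rewrite mxE; under eq_bigr do rewrite ell_partial //.
  under [RHS]eq_bigr do rewrite mxE mulr_suml.
  rewrite [RHS]exchange_big; apply: eq_bigr => c _ /=; rewrite mulrC mulr_sumr.
  by apply: eq_bigr => d _; rewrite ell_partial // gE mxE mulrA.
have uQT : Q^T \in unitmx by rewrite unitmx_tr.
rewrite -[invmx _](_ : invmx Q^T *m invmx Q = _); last first.
  apply: (can_inj (mulKmx (_ : Q *m Q^T \in unitmx))); first by rewrite unitmx_mul uQ.
  by rewrite mulmxV ?unitmx_mul ?uQ // -mulmxA mulKVmx // mulmxV.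
by rewrite mulKVmx // mulVmx // mxE eq_sym.
Qed.

Definition yk (k : nat) b p := lam^-1 ^+ k * ell b (iter k E p).

Lemma pow_le (T eta : R) k0 k : (k0 <= k)%N -> lam ^+ (2 * k0) * T < eta -> 0 <= T -> lam ^+ (2 * k) * T < eta.
Proof.
move=> kk H T0; apply: le_lt_trans H; rewrite ler_wpM2r // ler_wiXn2l ?(ltW lam0) ?(ltW lam1) //.
by rewrite leq_mul2l.
Qed.

Lemma lamV_pow k m : lam^-1 ^+ k * lam ^+ (k + m) = lam ^+ m.
Proof. by rewrite exprD mulrA exprVn mulVf ?mul1r // expf_neq0 // gt_eqF. Qed.

Lemma yk_CkM k b : open (iter k E @^-1` O0) /\ CkM A 2 (iter k E @^-1` O0) (yk k b).
Proof.
have [W1 c1 _] := iter_homothety k oO0 (ell_CkM 2 b); split; first exact: W1.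
exact: (CkM_scale sA _ W1 c1).
Qed.

(** The difference of consecutive terms is [lam^-k] times [v \o iter k E], with [v] of second order
    at [p0], hence bounded by [q], and [q] has shrunk by [lam ^+ (2 * k)]. For squared gradients the
    factors [lam^-2k] and [lam^2k] cancel and [q] gives the decay; for squared Hessians [lam^-2k]
    meets [lam^4k]. The index [k0] brings [iter k E z] close to [p0]. *)
Lemma yk_step b (T : R) : exists (k0 : nat) (C : R), 0 <= C /\ forall k : nat, (k0 <= k)%N -> forall z, q z < T ->
  [/\ O0 (iter k E z), `|yk k.+1 b z - yk k b z| <= C * lam ^+ k,
    mgrad h (fun z => yk k.+1 b z - yk k b z) z <= C * lam ^+ k ^+ 2 &
    mhess2 h (yk k b) z <= C * lam ^+ k ^+ 2].
Proof.
have [_ _ _ _ H] := HE; have [oE cE _ HE4] := H _ _ oO0 (ell_CkM 2 b).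
pose Ov := O0 `&` E @^-1` O0; have oOv : open Ov by exact: openI.
pose v z := lam^-1 * ell b (E z) - ell b z.
have Ovp : Ov p0 by split => //=; rewrite (zero_fixed qp0).
have c1 : CkM A 2 Ov (fun z => lam^-1 * (ell b \o E) z) := CkM_scale sA lam^-1 oOv (CkM_sub (@subIsetr _ _ _) cE).
have c2 : CkM A 2 Ov (ell b) := CkM_sub (@subIsetl _ _ _) (ell_CkM 2 b).
have cv : CkM A 2 Ov v by move=> j; exact: (Ck_subr (@chart_on_open _ _ _ _ sA j _ oOv) (c1 j) (c2 j)).
have v0 : v p0 = 0 by rewrite /v (zero_fixed qp0) ell_p0 mulr0 subrr.
have Ux : chart_on i0 Ov x0 := chart_onP sA ip0 Ovp.
(* The differential of [E] at [p0] is [lam] times the identity, which the factor [lam^-1] undoes. *)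
have dv a : partial a (v \o chart_inv i0) x0 = 0.
  have d1 : derivable (fun x => lam^-1 * ((ell b \o E) \o chart_inv i0) x) x0 (delta_mx 0 a) := Ck_derivable (Ck_pred (c1 i0)) Ux.
  have d2 : derivable (ell b \o chart_inv i0) x0 (delta_mx 0 a) := Ck_derivable (Ck_pred (c2 i0)) Ux.
  have d3 : derivable ((ell b \o E) \o chart_inv i0) x0 (delta_mx 0 a).
    exact: (Ck_derivable (Ck_pred (cE i0)) (conj Ux.1 Ux.2.2)).
  rewrite (partialB d1 d2 : partial a (v \o chart_inv i0) x0 = _) (partialZ lam^-1 d3).
  by rewrite (HE4 p0 ip0 qp0).2 // mulKf ?subrr // gt_eqF.
have [eta1 [C1 [e10 C10 H1]]] := quadratic_bound oOv Ovp cv v0 dv.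
have [eta2 [C2 [e20 C20 H2]]] := mhess2_bound oO0 ip0 (ell_CkM 2 b).
have [T0|T0] := ltP T 0.
  by exists 0%N, 0; split => // k _ z qz; have := lt_trans qz T0; rewrite ltNge q0.
have e120 : 0 < Num.min eta1 eta2 by rewrite lt_min e10.
have [k0 Hk0] := pow_small T e120.
pose C := C1 * T + C2; have C0 : 0 <= C by rewrite addr_ge0 // mulr_ge0.
exists k0, C; split => // k kk z qz.
have CT : C1 * T <= C by rewrite /C lerDl.
have lk : 0 <= lam ^+ k by rewrite exprn_ge0 // ltW.
have qk : q (iter k E z) <= lam ^+ k ^+ 2 * T.
  by rewrite q_iter mulnC exprM ler_wpM2l ?exprn_ge0 // ltW.
have : q (iter k E z) < Num.min eta1 eta2.
  by rewrite (le_lt_trans qk) // -exprM mulnC; exact: pow_le Hk0 T0.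
rewrite lt_min => /andP[/H1[[Oz OEz] vz gz] /H2[_ hz]].
have dE x : yk k.+1 b x - yk k b x = lam^-1 ^+ k * v (iter k E x).
  by rewrite /yk /v iterS exprSr mulrBr mulrA.
have lV : lam^-1 ^+ k * lam ^+ k ^+ 2 = lam ^+ k.
  by rewrite expr2 -exprD lamV_pow.
have lV2 : (lam^-1 ^+ k) ^+ 2 * lam ^+ (2 * k) = 1.
  by rewrite mulnC exprM -exprMn exprVn mulVf ?expr1n // expf_neq0 // gt_eqF.
have lV0 : 0 <= lam^-1 ^+ k by rewrite exprn_ge0 // invr_ge0 ltW.
have [oV cV /(_ z (conj Oz OEz)) [gv _]] := iter_homothety k oOv cv.
have [oL cL /(_ z Oz) [_ hL]] := iter_homothety k oO0 (ell_CkM 2 b).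
split => //.
- rewrite dE normrM ger0_norm // -lV mulrCA; apply: ler_wpM2l => //; apply: (le_trans vz).
  apply: (@le_trans _ _ (C1 * (lam ^+ k ^+ 2 * T))); first exact: ler_wpM2l.
  by rewrite mulrCA mulrC; apply: ler_wpM2r => //; rewrite exprn_ge0.
- rewrite (eq_mgrad sA h openT I (g := fun x => lam^-1 ^+ k * (v \o iter k E) x)) => [|x _]; last exact: dE.
  rewrite (mgrad_scale _ oV cV (conj Oz OEz)) gv mulrA lV2 mul1r; apply: (le_trans gz).
  apply: (@le_trans _ _ (C1 * (lam ^+ k ^+ 2 * T))); first exact: ler_wpM2l.
  by rewrite mulrCA mulrC; apply: ler_wpM2r => //; rewrite exprn_ge0.
- rewrite (mhess2_scale _ oL cL Oz : mhess2 h (yk k b) z = _) hL.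
  have -> : (4 * k = 2 * k + 2 * k)%N by rewrite -mulnDl.
  rewrite exprD -mulrA mulrA lV2 mul1r mulrC mulnC exprM; apply: ler_wpM2r; first by rewrite exprn_ge0.
  by rewrite (le_trans hz) // /C lerDr mulr_ge0.
Qed.

Lemma geo_limit_unique (u : nat -> R) (l l' C C' : R) k1 k2 :
  (forall k, (k1 <= k)%N -> `|u k - l| <= C * lam ^+ k) ->
  (forall k, (k2 <= k)%N -> `|u k - l'| <= C' * lam ^+ k) -> l = l'.
Proof.
move=> H1 H2; apply/eqP; rewrite -subr_eq0 -normr_le0; apply/ler_addgt0Pl => e e0; rewrite addr0.
have [k Hk] := geometric_small (`|C| + `|C'|) (ltW lam0) lam1 e0.
pose m := maxn k (maxn k1 k2).
have mk : lam ^+ m <= lam ^+ k by rewrite ler_wiXn2l ?(ltW lam0) ?(ltW lam1) // leq_maxl.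
have m1 : (k1 <= m)%N by rewrite /m !leq_max leqnn orbT.
have m2 : (k2 <= m)%N by rewrite /m !leq_max leqnn !orbT.
have l0 : 0 <= lam ^+ m by rewrite exprn_ge0 // ltW.
rewrite (le_trans (ler_distD (u m) _ _)) // distrC (le_trans (lerD (H1 m m1) (H2 m m2))) //.
have S0 : 0 <= `|C| + `|C'| := addr_ge0 (normr_ge0 _) (normr_ge0 _).
rewrite -mulrDl; apply: le_trans (ler_wpM2r l0 (lerD (ler_norm C) (ler_norm C'))) _.
exact: le_trans (ler_wpM2l S0 mk) Hk.
Qed.

Lemma geo_limit (u : nat -> R) (C : R) k0 : 0 <= C ->
  (forall k, (k0 <= k)%N -> `|u k.+1 - u k| <= C * lam ^+ k) ->
  exists l, forall k, (k0 <= k)%N -> `|u k - l| <= C / (1 - lam) * lam ^+ k.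
Proof.
move=> C0 H; have lk : 0 <= lam ^+ k0 by rewrite exprn_ge0 // ltW.
have H' k : `|u (k.+1 + k0)%N - u (k + k0)%N| <= C * lam ^+ k0 * lam ^+ k.
  by rewrite -mulrA -exprD (addnC k0); exact: H (leq_addl _ _).
have [l Hl] := @geometric_limit R (fun k => u (k + k0)%N) (C * lam ^+ k0) lam (mulr_ge0 C0 lk) (ltW lam0) lam1 H'.
exists l => k kk; have := Hl (k - k0)%N; rewrite subnK // => /le_trans; apply.
by rewrite mulrAC -[C * _ / _]mulrAC -mulrA -exprD subnKC.
Qed.

Lemma ylim_exists b z : exists l, exists k0 C, forall k, (k0 <= k)%N -> `|yk k b z - l| <= C * lam ^+ k.
Proof.
have [k0 [C [C0 H]]] := yk_step b (q z + 1).
have qz : q z < q z + 1 by rewrite ltrDl.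
have [l Hl] := @geo_limit (fun k => yk k b z) C k0 C0 (fun k kk => let: And4 _ x _ _ := H k kk z qz in x).
by exists l, k0, (C / (1 - lam)).
Qed.

Definition ylim b z : R := projT1 (cid (ylim_exists b z)).

Lemma ylim_rate b (T : R) : exists (k0 : nat) (C : R), [/\ 0 <= C, forall (k : nat) z, (k0 <= k)%N -> q z < T ->
    `|yk k b z - ylim b z| <= C * lam ^+ k & forall (k : nat) z, (k0 <= k)%N -> q z < T ->
  [/\ O0 (iter k E z), mgrad h (fun z => yk k.+1 b z - yk k b z) z <= C * lam ^+ k ^+ 2 &
    mhess2 h (yk k b) z <= C * lam ^+ k ^+ 2]].
Proof.
have [k0 [C [C0 H]]] := yk_step b T; have l1 : 0 < 1 - lam by rewrite subr_gt0.
have CC : C <= C / (1 - lam) by rewrite ler_pdivlMr // ler_piMr // gerBl ltW.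
exists k0, (C / (1 - lam)); split => [|k z kk qz|k z kk qz].
- by rewrite divr_ge0 // ltW.
- have step (j : nat) : (k0 <= j)%N -> `|yk j.+1 b z - yk j b z| <= C * lam ^+ j by move=> kj; have [] := H j kj z qz.
  have [l Hl] := @geo_limit (fun k => yk k b z) C k0 C0 step.
  have [k1 [C1 H1]] := projT2 (cid (ylim_exists b z)).
  have -> : ylim b z = l := geo_limit_unique H1 Hl.
  exact: Hl.
- have [h1 _ h2 h3] := H k kk z qz; have l2 : 0 <= lam ^+ k ^+ 2 by rewrite exprn_ge0 // exprn_ge0 // ltW.
  by split => //; [rewrite (le_trans h2) // ler_wpM2r|rewrite (le_trans h3) // ler_wpM2r].
Qed.

Lemma ylim_chart b (T : R) i : smooth_on (chart_on i [set p | q p < T]) (ylim b \o chart_inv i) /\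
  forall z, q z < T -> chart_dom i z -> exists (k0 : nat) (D : R), forall k : nat, (k0 <= k)%N -> forall a,
    `|partial a (yk k b \o chart_inv i) (chart i z) - partial a (ylim b \o chart_inv i) (chart i z)| <=
      D * lam ^+ k.
Proof.
have [k0 [C [C0 H1 H2]]] := ylim_rate b T; pose O := [set p | q p < T].
have oO : open O := open_sublevel sA sq T.
have mU := gloc_metric_on sA rh i oO.
have cy (k : nat) : (k0 <= k)%N -> CkM A 2 O (yk k b).
  move=> kk; have [_ c] := yk_CkM k b; apply: (CkM_sub _ c) => z Oz; by have [] := H2 k z kk Oz.
have cd (k : nat) : (k0 <= k)%N -> CkM A 2 O (fun z => yk k.+1 b z - yk k b z).
  move=> kk j; have oj := @chart_on_open _ _ _ _ sA j _ oO.
  exact: (Ck_subr oj (cy k.+1 (leqW kk) j) (cy k kk j)).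
have mono (k : nat) : lam ^+ (k + k0) <= lam ^+ k.
  by rewrite ler_wiXn2l ?(ltW lam0) ?(ltW lam1) // leq_addr.
have l0 (k : nat) : 0 <= lam ^+ k by rewrite exprn_ge0 // ltW.
have mono2 (k : nat) : lam ^+ (k + k0) ^+ 2 <= lam ^+ k ^+ 2 by rewrite lerXn2r ?nnegrE.
have Hf k x : chart_on i O x -> [/\ `|yk (k + k0) b (chart_inv i x) - ylim b (chart_inv i x)| <= C * lam ^+ k,
     gradnorm (gloc h i) (fun y => yk (k.+1 + k0) b (chart_inv i y) - yk (k + k0) b (chart_inv i y)) x <= C * lam ^+ k ^+ 2 &
     sqtrace (gloc h i x) (hessian_coord (gloc h i) (yk (k + k0) b \o chart_inv i) x) <= C * lam ^+ k ^+ 2].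
  move=> [Ix Ox]; have [d e] := chart_img_dom sA Ix; have kk : (k0 <= k + k0)%N := leq_addl k k0.
  have h0 := H1 _ _ kk Ox; have [_ g1 h1] := H2 _ _ kk Ox.
  rewrite (mgrad_chart sA rh oO (cd _ kk) Ox d) e in g1.
  rewrite (mhess2_chart sA rh oO (cy _ kk) Ox d) e in h1.
  split; [apply: (le_trans h0)|apply: (le_trans g1)|apply: (le_trans h1)]; exact: ler_wpM2l.
(* The estimates hold from [k0] on, so the sequence is shifted by [k0]; since [lam < 1] the same
   constant serves. *)
have [sF HD] := flat_limit (ltW lam0) lam1 mU C0 (fun k => cy _ (leq_addl k k0) i) Hf.
split => // z Tz iz; have [D HDz] := HD _ (chart_onP sA iz Tz).
exists k0, (D * lam^-1 ^+ k0) => k kk a; have := HDz (k - k0)%N a.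
by rewrite subnK // -(lamV_pow k0 (k - k0)) subnKC // mulrA.
Qed.

Lemma ylim_smooth b : smooth_fun A (ylim b).
Proof.
move=> i k; apply: Ck_local => x Ix; exists (chart_on i [set p | q p < q (chart_inv i x) + 1]); split.
- exact: (@chart_on_open _ _ _ _ sA i _ (open_sublevel sA sq _)).
- by split => //=; rewrite ltrDl.
- exact: (ylim_chart b _ i).1.
Qed.

Lemma rate_cvg (u : nat -> R) (l D : R) (k0 : nat) :
  (forall k : nat, (k0 <= k)%N -> `|u k - l| <= D * lam ^+ k) -> u @ \oo --> l.
Proof.
move=> H; apply/cvgrPdist_le => e e0.
have [k1 Hk] := geometric_small `|D| (ltW lam0) lam1 e0.
exists (maxn k0 k1) => // k; rewrite /= geq_max => /andP[h0 h1]; rewrite distrC.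
have lk : 0 <= lam ^+ k by rewrite exprn_ge0 // ltW.
apply: (le_trans (H k h0)); apply: (le_trans (ler_wpM2r lk (ler_norm D))).
apply: le_trans Hk; apply: ler_wpM2l => //.
by rewrite ler_wiXn2l ?(ltW lam0) ?(ltW lam1).
Qed.

(** The inner product of the [k]-th approximants at [z] equals that of [ell a] and [ell b] at
    [iter k E z], as the powers of [lam] cancel. These points tend to [p0], where the differentials
    are orthonormal. *)
Lemma minner_ylim a b z : minner h (ylim a) (ylim b) z = (a == b)%:R.
Proof.
pose i := chart_at A z; have iz : chart_dom i z := atlas_cover sA z; pose x := chart i z.
have qz : q z < q z + 1 by rewrite ltrDl.
rewrite (minner_chart sA rh openT (smooth_CkM 2 (ylim_smooth a)) (smooth_CkM 2 (ylim_smooth b)) I iz) -/x.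
have cv c d : (fun k => partial d (yk k c \o chart_inv i) x) @ \oo --> partial d (ylim c \o chart_inv i) x.
  have [k0 [D HD]] := (ylim_chart c _ i).2 z qz iz.
  by apply: (@rate_cvg _ _ D k0) => k kk; exact: HD.
pose s k := \sum_c gradv (gloc h i) (yk k a \o chart_inv i) c x * partial c (yk k b \o chart_inv i) x.
have s1 : s @ \oo --> \sum_c gradv (gloc h i) (ylim a \o chart_inv i) c x * partial c (ylim b \o chart_inv i) x.
  apply: (@cvg_big _ _ _ _ _ add_continuous) => c _; apply: cvgM; last exact: cv.
  by apply: (@cvg_big _ _ _ _ _ add_continuous) => d _; apply: cvgM; [exact: cvg_cst|exact: cv].
have s2 : s @ \oo --> ((a == b)%:R : R).
  apply/cvgrPdist_lt => e e0.
  have [eta eta0 He] := minner_near oO0 ip0 (ell_CkM 2 a) (ell_CkM 2 b) e0.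
  have [k1 Hk1] := pow_small (q z) eta0.
  have [k2 [C2 [_ _ H2]]] := ylim_rate a (q z + 1).
  exists (maxn k1 k2) => // k; rewrite /= geq_max => /andP[h1 h2]; rewrite distrC.
  have [Oz _ _] := H2 k z h2 qz.
  have -> : s k = minner h (ell a) (ell b) (iter k E z).
    have [oK ca] := yk_CkM k a; have [_ cb] := yk_CkM k b.
    rewrite /s /x -(minner_chart sA rh oK ca cb Oz iz).
    have [_ ca' _] := iter_homothety k oO0 (ell_CkM 2 a).
    have [_ cb' _] := iter_homothety k oO0 (ell_CkM 2 b).
    rewrite (minner_scale _ oK ca' cb' Oz : minner h (yk k a) (yk k b) z = _).
    rewrite (iter_minner oO0 (ell_CkM 2 a) (ell_CkM 2 b) Oz) mulrA.
    by rewrite mulnC [lam ^+ (k * 2)]exprM -exprMn exprVn mulVf ?expr1n ?mul1r // expf_neq0 // gt_eqF.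
  rewrite -minner_ell; apply: (He _ _).2; rewrite q_iter; exact: pow_le Hk1 (q0 z).
exact: cvg_unique (@Rhausdorff R) _ _ _ _ s1 s2.
Qed.

Lemma ylim_E b z : ylim b (E z) = lam * ylim b z.
Proof.
have [k1 [C1 [_ H1 _]]] := ylim_rate b (q (E z) + 1).
have [k2 [C2 [C20 H2 _]]] := ylim_rate b (q z + 1).
have q1 : q (E z) < q (E z) + 1 by rewrite ltrDl.
have q2 : q z < q z + 1 by rewrite ltrDl.
apply: (@geo_limit_unique (fun k => yk k b (E z)) _ _ C1 (C2 * lam ^+ 2) k1 k2) => k kk; first exact: H1.
have -> : yk k b (E z) = lam * yk k.+1 b z.
  by rewrite /yk exprS -iterSr !mulrA mulfV ?mul1r // gt_eqF.
rewrite -mulrBr normrM gtr0_norm // -mulrA -exprD add2n exprS mulrCA; apply: ler_wpM2l; first exact: ltW.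
exact: H2 (leqW kk) q2.
Qed.

Let w z := \sum_b ell b z * ell b z - 2 * q z.

Lemma sq_defect_partial a x : chart_img i0 x -> partial a (w \o chart_inv i0) x =
  \sum_b 2 * (ell b (chart_inv i0 x) * Q a b) - 2 * partial a (q \o chart_inv i0) x.
Proof.
move=> Ix; have dl b : derivable (ell b \o chart_inv i0) x (delta_mx 0 a).
  exact: (Ck_derivable (Ck_pred (ell_CkM 2 b i0)) (conj Ix (chart_img_dom sA Ix).1)).
have dq : derivable (q \o chart_inv i0) x (delta_mx 0 a) := Ck_derivable (sq i0 1) Ix.
have d1 b : derivable (fun y => (ell b \o chart_inv i0) y * (ell b \o chart_inv i0) y) x (delta_mx 0 a) :=
  derivableM (dl b) (dl b).
have d2 : derivable (fun y => 2 * (q \o chart_inv i0) y) x (delta_mx 0 a) := derivableM (derivable_cst _ _ _) dq.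
rewrite (partialB (derivable_sumr _ _ d1) d2 : partial a (w \o chart_inv i0) x = _) (partialZ 2 dq) (partial_sum _ d1).
congr (_ - _); apply: eq_bigr => b _; rewrite (partialM (dl b) (dl b)) ell_partial //.
by rewrite -[_ + _]mulr2n mulr_natl.
Qed.

Lemma sq_defect_partial2 a c : partial c (partial a (w \o chart_inv i0)) x0 = 0.
Proof.
have Ix : chart_img i0 x0 := chart_imgP ip0.
rewrite (eq_partial c oI0 Ix (fun y Iy => sq_defect_partial a Iy)).
have dl b : derivable (ell b \o chart_inv i0) x0 (delta_mx 0 c).
  exact: (Ck_derivable (Ck_pred (ell_CkM 2 b i0)) (conj Ix (chart_img_dom sA Ix).1)).
have dq : derivable (partial a (q \o chart_inv i0)) x0 (delta_mx 0 c) := Ck_derivable (Ck_partial a (sq i0 2)) Ix.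
have d2 : derivable (fun y => 2 * partial a (q \o chart_inv i0) y) x0 (delta_mx 0 c) := derivableM (derivable_cst _ _ _) dq.
have d0 b : derivable (fun y => (ell b \o chart_inv i0) y * Q a b) x0 (delta_mx 0 c) := derivableM (dl b) (derivable_cst _ _ _).
have d1 b : derivable (fun y => 2 * ((ell b \o chart_inv i0) y * Q a b)) x0 (delta_mx 0 c) := derivableM (derivable_cst _ _ _) (d0 b).
rewrite (partialB (derivable_sumr _ _ d1) d2) (partialZ 2 dq) (partial_sum _ d1).
have hE : partial c (partial a (q \o chart_inv i0)) x0 = \sum_b Q c b * Q a b.
  have := hq Ix; rewrite {2}/gloc (atlas_chartK sA ip0) hQ => /matrixP/(_ c a); rewrite !mxE.
  rewrite big1 ?subr0 => [->|k _]; first by apply: eq_bigr => b _; rewrite mxE.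
  by rewrite (q_zero_grad sA rh sq gq k qp0 ip0) mulr0.
rewrite hE mulr_sumr -sumrB big1 // => b _; rewrite (partialZ 2 (d0 b)) (partialM (dl b) (derivable_cst _ _ _)).
by rewrite ell_partial // [partial c (cst _) x0]partial_cst mulr0 add0r /= [Q a b * _]mulrC subrr.
Qed.

(** At [p0] the value, the differential and the second derivatives of [w] all vanish: the Hessian of
    [q] there is [Q Q^T], half that of the sum of squares. Taylor's formula makes [w] negligible
    against [|x - x0|^2], hence against [q]. *)
Lemma sq_defect_small (e : R) : 0 < e -> exists2 eta : R, 0 < eta & forall z, q z < eta -> `|w z| <= e * q z.
Proof.
move=> e0; have [c c0 [r r0 Hr]] := q_lower; pose F := w \o chart_inv i0.
have Ix : chart_img i0 x0 := chart_imgP ip0.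
have n1 : 0 < n%:R + 1 :> R by rewrite ltr_wpDl.
pose e1 := e * c / (n%:R + 1); have e10 : 0 < e1 by rewrite divr_gt0 // mulr_gt0.
have cF : Ck_on 2 (chart_img i0) F.
  apply: (Ck_subr oI0); last exact: (Ck_mul oI0 (Ck_cst _ _ _) (sq i0 2)).
  apply: (Ck_sum _ _ oI0) => b.
  have cl : Ck_on 2 (chart_img i0) (ell b \o chart_inv i0).
    by apply: Ck_sub (ell_CkM 2 b i0) => y Iy; split => //; exact: (chart_img_dom sA Iy).1.
  exact: (Ck_mul oI0 cl cl).
have dF a : partial a F x0 = 0.
  rewrite sq_defect_partial // (q_zero_grad sA rh sq gq a qp0 ip0) mulr0 subr0 big1 // => b _.
  by rewrite (atlas_chartK sA ip0) ell_p0 mul0r mulr0.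
have F0 : F x0 = 0.
  by rewrite /F /= (atlas_chartK sA ip0) /w qp0 mulr0 subr0 big1 // => b _; rewrite ell_p0 mul0r.
have N2 : nbhs x0 [set y | forall a b, `|partial a (partial b F) y| <= e1].
  apply: (@filter_forall _ _ (fun a y => forall b, `|partial a (partial b F) y| <= e1) (nbhs x0) _) => a.
  apply: (@filter_forall _ _ (fun b y => `|partial a (partial b F) y| <= e1) (nbhs x0) _) => b.
  have [d d0 Hd] := (continuous_eps _ _).1 (Ck_cont (Ck_partial a (Ck_partial b cF)) Ix) e1 e10.
  apply/nbhs_norm_ball; exists d => // y /Hd /ltW; by rewrite sq_defect_partial2 subr0.
have [d d0 Hd] := (nbhs_norm_ball _ _).1 N2.
have d1 : 0 < Num.min d r by rewrite lt_min d0.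
have N : nbhs x0 (nball x0 (Num.min d r)) by apply/nbhs_norm_ball; exists (Num.min d r).
have [eta eta0 He] := near_zero N; exists eta => // z /He[iz Bz].
set x := chart i0 z in Bz; have x0b : `|x0 - x0| < Num.min d r by rewrite subrr normr0.
have seg (t : R) : 0 <= t <= 1 -> `|x0 + t *: (x - x0) - x0| < Num.min d r := segment_in_ball x0b Bz.
have segI (t : R) : 0 <= t <= 1 -> chart_img i0 (x0 + t *: (x - x0)).
  by move=> /seg; rewrite lt_min => /andP[_ /Hr[]].
have [s [t [s01 t01 FE]]] := taylor2 oI0 cF segI dF.
rewrite subrKC F0 subr0 in FE.
have -> : w z = F x by rewrite /F /= (atlas_chartK sA iz).
have Hx : `|x - x0| < r by move: Bz; rewrite /nball /= lt_min => /andP[].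
have [_ qx] := Hr x Hx; rewrite (atlas_chartK sA iz) in qx.
have hb : `|hessform F (x0 + t *: (x - x0)) (x - x0)| <= e1 * (n%:R * sqdist x0 x).
  have h0 : hessform F x0 (x - x0) = 0.
    by rewrite /hessform big1 // => a _; rewrite big1 // => b _; rewrite sq_defect_partial2 mulr0.
  have : `|hessform F (x0 + t *: (x - x0)) (x - x0) - hessform F x0 (x - x0)| <= e1 * (n%:R * \sum_a (x - x0) 0 a ^+ 2).
    apply: hessform_close => a b; rewrite sq_defect_partial2 subr0; apply: Hd.
    by move: (seg t t01); rewrite lt_min => /andP[].
  rewrite h0 subr0 => /le_trans; apply; rewrite ler_wpM2l ?(ltW e10) // ler_wpM2l //.
  by rewrite /sqdist; apply: ler_sum => a _; rewrite !mxE.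
rewrite FE normrM; have s1 : `|s| <= 1 by case/andP: s01 => s0 s1; rewrite ger0_norm.
apply: (le_trans (ler_wpM2r (normr_ge0 _) s1)); rewrite mul1r; apply: (le_trans hb).
have qs : sqdist x0 x <= q z / c by rewrite ler_pdivlMr // mulrC.
apply: (@le_trans _ _ (e1 * ((n%:R + 1) * (q z / c)))).
  rewrite ler_wpM2l ?(ltW e10) //; apply: ler_pM => //; first exact: sqdist_ge0.
  by rewrite lerDl.
by rewrite /e1 le_eqVlt; apply/orP; left; apply/eqP; field; rewrite !gt_eqF.
Qed.

(** The defect of the [k]-th approximants at [z] is [lam^-2k] times [w] at [iter k E z]. There
    [|w| <= e1 * q], and [q] scales by [lam^2k], so the powers cancel and [e1] is arbitrary. *)
Lemma ylim_sq z : \sum_b ylim b z ^+ 2 = 2 * q z.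
Proof.
have qz : q z < q z + 1 by rewrite ltrDl.
have cv b : (fun k => yk k b z) @ \oo --> ylim b z.
  have [k0 [C [_ H _]]] := ylim_rate b (q z + 1).
  by apply: (@rate_cvg _ _ C k0) => k kk; exact: H.
have s1 : (fun k => \sum_b yk k b z * yk k b z) @ \oo --> \sum_b ylim b z * ylim b z.
  by apply: (@cvg_big _ _ _ _ _ add_continuous) => c _; apply: cvgM; exact: cv.
have s2 : (fun k => \sum_b yk k b z * yk k b z) @ \oo --> 2 * q z.
  apply/cvgrPdist_le => e e0; have q1 : 0 < q z + 1 by rewrite ltr_wpDl.
  pose e1 := e / (q z + 1); have e10 : 0 < e1 by rewrite divr_gt0.
  have [eta eta0 He] := sq_defect_small e10; have [k1 Hk1] := pow_small (q z) eta0.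
  exists k1 => // k /= kk.
  have lV : (lam^-1 ^+ k) ^+ 2 * lam ^+ (2 * k) = 1.
    by rewrite mulnC exprM -exprMn exprVn mulVf ?expr1n // expf_neq0 // gt_eqF.
  have -> : 2 * q z - \sum_b yk k b z * yk k b z = - ((lam^-1 ^+ k) ^+ 2 * w (iter k E z)).
    have E2 : (lam^-1 ^+ k) ^+ 2 * (2 * q (iter k E z)) = 2 * q z.
      by rewrite q_iter (mulrCA 2) [LHS]mulrA lV mul1r.
    rewrite /w mulrBr opprB E2; congr (_ - _).
    by rewrite mulr_sumr; apply: eq_bigr => b _; rewrite /yk; ring.
  have lp : 0 <= (lam^-1 ^+ k) ^+ 2 by rewrite exprn_ge0 // exprn_ge0 // invr_ge0 ltW.
  rewrite normrN normrM ger0_norm //.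
  have qk : q (iter k E z) < eta by rewrite q_iter; exact: pow_le Hk1 (q0 z).
  apply: (le_trans (ler_wpM2l lp (He _ qk))); rewrite q_iter mulrCA [X in _ * X]mulrA lV mul1r.
  by rewrite /e1 -mulrA ler_piMr ?(ltW e0) // ler_pdivrMl // mulr1 lerDl.
under eq_bigr do rewrite expr2.
exact: cvg_unique (@Rhausdorff R) _ _ _ _ s1 s2.
Qed.

Lemma koenigs_coordinates : exists y : 'I_n -> M -> R, [/\ forall b, smooth_fun A (y b),
  forall a b z, minner h (y a) (y b) z = (a == b)%:R,
  forall z, \sum_b y b z ^+ 2 = 2 * q z & forall b z, y b (E z) = lam * y b z].
Proof.
by exists ylim; split; [exact: ylim_smooth|exact: minner_ylim|exact: ylim_sq|exact: ylim_E].
Qed.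

End Koenigs.

(** The clause on [z] and [z'] provides one exponent carrying both points into a prescribed
    neighbourhood of [p0]; it serves to globalise injectivity. *)
Lemma flat_coordinates (R : realType) n (M : topologicalType) (A : atlas R n M) (h : metric_field A)
    (q : M -> R) (lam : R) (E : M -> M) :
  smooth_atlas A -> hausdorff_space M -> connected [set: M] -> [set: M] !=set0 ->
  riemannian_metric h -> smooth_fun A q ->
  (forall i x, chart_img i x -> hessian_coord (gloc h i) (q \o chart_inv i) x = gloc h i x) ->
  (forall p, mgrad h q p = 2 * q p) -> (forall T, compact [set p | q p <= T]) ->
  radial_homothety h q lam E ->
  exists p0 (y : 'I_n -> M -> R), [/\ q p0 = 0 /\ (forall z z' W, open W -> W p0 -> exists k, W (iter k E z) /\ W (iter k E z')),
    forall b, smooth_fun A (y b), forall a b z, minner h (y a) (y b) z = (a == b)%:R,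
    forall z, \sum_b y b z ^+ 2 = 2 * q z & forall b z, y b (E z) = lam * y b z].
Proof.
move=> sA hM cM M0 rh sq hq gq kq HE; have [p0 qp0] := zero_exists sA M0 rh sq gq kq.
have ip := atlas_cover sA p0.
have pH : posdef (h (chart_at A p0) p0).
  by split; [exact: Defs.metric_sym rh _ _ ip|exact: metric_pos rh _ _ ip].
have [Q uQ hQ] := posdef_factor pH.
have [y Hy] := koenigs_coordinates sA hM cM rh sq hq gq kq HE qp0 uQ hQ.
case: Hy => y1 y2 y3 y4; exists p0, y; split => //; split => // z z' W oW Wp.
have [eta e0 He] := zero_nbhs sA hM cM rh sq hq gq kq HE qp0 oW Wp.
have [k Hk] := pow_small HE (Num.max (q z) (q z')) e0.
have l0 : 0 <= lam ^+ (2 * k) by case: HE => /andP[l0 _] *; rewrite exprn_ge0 // ltW.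
by exists k; split; apply: He; rewrite (q_iter HE) (le_lt_trans _ Hk) // ler_wpM2l // le_max lexx ?orbT.
Qed.

(** * The developing map *)

Lemma absorb_half (R : realType) (X Y Z C : R) : Y <= X + C * Z -> X <= 2^-1 * Y -> Y <= 2 * C * Z.
Proof. lra. Qed.

Lemma mulmx_norm_le (R : realType) m p (v : 'rV[R]_m) (B : 'M[R]_(m, p)) (K : R) : 0 <= K ->
  (forall a b, `|B a b| <= K) -> `|v *m B| <= m%:R * K * `|v|.
Proof.
move=> K0 HB; apply: norm_le_coord => [|b]; first by rewrite mulr_ge0 // mulr_ge0.
rewrite mxE (le_trans (ler_norm_sum _ _ _)) //.
apply: (@le_trans _ _ (\sum_(a < m) K * `|v|)).
  by apply: ler_sum => a _; rewrite normrM mulrC ler_pM // coord_le_norm.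
by rewrite sumr_const card_ord -[_ *+ m]mulr_natl mulrA.
Qed.

(** * Maps with an explicitly inverted Jacobian, and their continuous inverses *)

Section LocalInverse.
Context {R : realType} {n : nat}.
Variables (U : set 'rV[R]_n) (V : 'rV[R]_n -> 'rV[R]_n) (K : 'rV[R]_n -> 'M[R]_n).
Hypothesis oU : open U.
Hypothesis cV : forall b, Ck_on 2 U (fun x => V x 0 b).
Hypothesis cK : forall k, Ck_mx k U K.
Hypothesis VK : forall x, U x -> jac V x *m K x = 1%:M.

(** The first-order expansion of [V] multiplied by the inverse Jacobian at the same base point.
    Injectivity and differentiability of the inverse are both read off from it. *)
Lemma inverse_remainder z : U z -> exists r C : R, [/\ 0 < r, 0 <= C,
  forall x, `|x - z| < r -> U x & forall (y v : 'rV[R]_n), `|y - z| < r -> `|y + v - z| < r ->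
  `|v - (V (y + v) - V y) *m K y| <= C * `|v| ^+ 2 /\
  forall t : 'rV[R]_n, `|t *m K y| <= C * `|t|].
Proof.
move=> Uz; have [r1 [L [r10 L0 HU HL]]] := Ck2_remainder oU cV Uz.
have [B [B0]] := @locally_bounded_fam R n ('I_n * 'I_n)%type U (fun p y => K y p.1 p.2) z oU (fun p => cK 0 p.1 p.2) Uz.
move=> /nbhs_norm_ball[r2 r20 HB].
have nB : 0 <= n%:R * B by rewrite mulr_ge0.
exists (Num.min r1 r2), (n%:R * B * L + n%:R * B); split.
- by rewrite lt_min r10.
- by rewrite addr_ge0 // mulr_ge0.
- by move=> x; rewrite lt_min => /andP[/HU].
move=> y v; rewrite lt_min => /andP[y1 y2]; rewrite lt_min => /andP[v1 _].
have KB (t : 'rV[R]_n) : `|t *m K y| <= n%:R * B * `|t| by apply: mulmx_norm_le => // a b; exact: (HB y y2 (a, b)).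
split => [|t]; last first.
  by apply: (le_trans (KB t)); apply: ler_wpM2r => //; rewrite lerDr mulr_ge0.
have := HL y v y1 v1; set rho := _ - _ - _ => Hrho.
have -> : v - (V (y + v) - V y) *m K y = - (rho *m K y).
  have {1}-> : v = (v *m jac V y) *m K y by rewrite -mulmxA VK ?mulmx1 //; exact: HU.
  rewrite -mulmxBl -mulNmx; congr (_ *m _).
  have -> : v *m jac V y = \row_b \sum_c v 0 c * partial c (fun x => V x 0 b) y.
    by apply/rowP => b; rewrite !mxE; apply: eq_bigr => c _; rewrite mxE.
  by symmetry; exact: opprB.
rewrite normrN; apply: (le_trans (KB rho)); apply: (le_trans (ler_wpM2l nB Hrho)).
by rewrite mulrA; apply: ler_wpM2r; [rewrite exprn_ge0|rewrite lerDl].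
Qed.

(** If [V x = V y], the remainder estimate gives [|x - y| <= C |x - y|^2], which forces equality
    once [C |x - y| < 1]. *)
Lemma local_injective z : U z -> exists2 r : R, 0 < r & forall x y : 'rV[R]_n, `|x - z| < r -> `|y - z| < r ->
  V x = V y -> x = y.
Proof.
move=> /inverse_remainder[r [C [r0 C0 _ H]]].
have C1 : 0 < 2 * C + 1 by rewrite ltr_wpDl // mulr_ge0.
exists (Num.min r (2 * C + 1)^-1) => [|x y]; first by rewrite lt_min r0 invr_gt0.
rewrite lt_min => /andP[x1 x2]; rewrite lt_min => /andP[y1 y2] E.
have xE : y + (x - y) = x by rewrite addrC subrK.
have [] := H y (x - y) y1; first by rewrite xE.
rewrite xE E subrr mul0mx subr0 => h _.
have v2 : `|x - y| <= `|x - z| + `|y - z| by rewrite -[`|y - z|]normrN opprB (le_trans _ (ler_normD _ _)) // subrKA.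
have v3 : `|x - y| < 2 * (2 * C + 1)^-1.
  by rewrite (le_lt_trans v2) // mulr_natl mulr2n ltrD.
have C2 : C * `|x - y| < 1.
  have [->|nz] := eqVneq C 0; first by rewrite mul0r.
  have Cp : 0 < C by rewrite lt0r nz.
  apply: (@lt_le_trans _ _ (C * (2 * (2 * C + 1)^-1))); first by rewrite ltr_pM2l.
  by rewrite mulrA ler_pdivrMr // mul1r mulrC lerDl.
apply/eqP; rewrite -subr_eq0 -normr_le0 leNgt; apply/negP => v0.
by move: h; rewrite expr2 mulrA leNgt => /negP; apply; rewrite gtr_pMl.
Qed.

Variables (W : set 'rV[R]_n) (F : 'rV[R]_n -> 'rV[R]_n).
Hypothesis oW : open W.
Hypothesis cF : forall w, W w -> {for w, continuous F}.
Hypothesis WU : forall w, W w -> U (F w).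
Hypothesis VF : forall w, W w -> V (F w) = w.

(** Continuity makes the increment [v] of [F] small enough for [C |v|^2] to be absorbed, so
    [|v| <= 2 C |h|]. The quadratic remainder is then [o(h)]. *)
Lemma inverse_partial w (a b : 'I_n) : W w ->
  derivable (fun w : 'rV[R]_n => F w 0 b) w (delta_mx 0 a) /\ partial a (fun w : 'rV[R]_n => F w 0 b) w = K (F w) a b.
Proof.
move=> Ww; have [r [C [r0 C0 _ H]]] := inverse_remainder (WU Ww); rewrite partialE.
have C1 : 0 < 2 * C + 1 by rewrite ltr_wpDl // mulr_ge0.
have [d1 d10 H1] := (nbhs_norm_ball _ _).1 (open_nbhs_nbhs (conj oW Ww)).
have e00 : 0 < Num.min r (2 * C + 1)^-1 by rewrite lt_min r0 invr_gt0.
have [d2 d20 H2] := (continuous_eps _ _).1 (cF Ww) _ e00.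
apply: derive_eps => e e0; pose D := 4 * C ^+ 3 + 1.
have D0 : 0 < D by rewrite ltr_wpDl // mulr_ge0 // exprn_ge0.
exists (Num.min (Num.min d1 d2) (e / D)) => [|h]; first by rewrite !lt_min d10 d20 divr_gt0.
rewrite !lt_min => /andP[/andP[h1 h2] h3].
set w' := w + _; have ww : `|w' - w| = `|h| by rewrite /w' addrC addKr normrZ norm_delta_mx mulr1.
have Ww' : W w' by apply: H1; rewrite ww.
have := H2 w'; rewrite ww => /(_ h2); rewrite lt_min => /andP[f1 f2].
set y := F w in f1 f2 *; set v := F w' - y in f1 f2.
have yv : y + v = F w' by rewrite /v addrC subrK.
have [] := H y v; [by rewrite subrr normr0|by rewrite yv|].
rewrite yv (VF Ww') (VF Ww) => k1 k2; have := k2 (w' - w); rewrite ww => {}k2.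
have v2 : `|v| <= 2 * C * `|h|.
  have vv : `|v| <= C * `|v| ^+ 2 + C * `|h|.
    rewrite -{1}(subrK ((w' - w) *m K y) v); apply: (le_trans (ler_normD _ _)); exact: lerD.
  have Cv : C * `|v| <= 2^-1.
    apply: (@le_trans _ _ (C * (2 * C + 1)^-1)); first by apply: ler_wpM2l => //; exact: ltW.
    by rewrite ler_pdivrMr // mulrDr mulKf ?pnatr_eq0 // lerDl mulr1 invr_ge0.
  have : C * `|v| ^+ 2 <= 2^-1 * `|v| by rewrite expr2 mulrA; apply: ler_wpM2r.
  exact: absorb_half vv.
have e1 : C * `|v| ^+ 2 <= e * `|h|.
  apply: (@le_trans _ _ (C * (2 * C * `|h|) ^+ 2)).
    by apply: ler_wpM2l => //; rewrite lerXn2r ?nnegrE // mulr_ge0 // mulr_ge0.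
  have -> : C * (2 * C * `|h|) ^+ 2 = (4 * C ^+ 3 * `|h|) * `|h| by ring.
  apply: ler_wpM2r => //; apply: (@le_trans _ _ (D * `|h|)).
    by apply: ler_wpM2r => //; rewrite lerDl.
  by rewrite mulrC -ler_pdivlMr // ltW.
apply: le_trans e1; apply: le_trans k1.
have -> : F w' 0 b - y 0 b - h * K y a b = (v - (w' - w) *m K y) 0 b.
  have dw : w' - w = h *: delta_mx 0 a by rewrite /w' addrC addKr.
  by rewrite dw -scalemxAl -rowE /v !mxE.
exact: coord_le_norm.
Qed.

Lemma inverse_smooth b : smooth_on W (fun w : 'rV[R]_n => F w 0 b).
Proof.
move=> k; elim: k b => [|k IH] b; first by split => // w /cF; exact: rV_coord_continuous.
split => [w /cF|a]; first exact: rV_coord_continuous.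
split => [w Ww|]; first exact: (inverse_partial a b Ww).1.
apply: (Ck_eq oW (f := (fun x => K x a b) \o F)) => [w Ww|]; first by rewrite (inverse_partial a b Ww).2.
exact: (Ck_comp oW oU WU IH (cK k a b)).
Qed.
End LocalInverse.

(** * The map given by the flat coordinates is a diffeomorphism *)

Section FlatMap.
Context {R : realType} {n : nat} {M : topologicalType}.
Variable A : atlas R n M.
Hypothesis sA : smooth_atlas A.
Hypothesis hM : hausdorff_space M.
Hypothesis M0 : [set: M] !=set0.
Variable h : metric_field A.
Hypothesis rh : riemannian_metric h.
Variable q : M -> R.
Hypothesis kq : forall T, compact [set p | q p <= T].
Variable y : 'I_n -> M -> R.
Hypothesis ys : forall b, smooth_fun A (y b).
Hypothesis ym : forall a b z, minner h (y a) (y b) z = (a == b)%:R.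
Hypothesis yq : forall z, \sum_b y b z ^+ 2 = 2 * q z.
Implicit Types (i j : chart_ix A) (p z : M).

Definition flat_map p : 'rV[R]_n := \row_b y b p.

Lemma flat_mapE i b : (fun x => (flat_map \o chart_inv i) x 0 b) = y b \o chart_inv i.
Proof. by apply/funext => x; rewrite mxE. Qed.

Lemma flat_map_smooth i k b : Ck_on k (chart_img i) (fun x => (flat_map \o chart_inv i) x 0 b).
Proof. rewrite flat_mapE; exact: ys. Qed.

Let J i x := jac (flat_map \o chart_inv i) x.
Let K i x := (J i x)^T *m invmx (gloc h i x).

(** Orthonormality of the differentials reads [J^T h^-1 J = 1], so the inverse of the Jacobian is
    explicit and as smooth as the metric. *)
Lemma flat_jacK i x : chart_img i x -> J i x *m K i x = 1%:M.
Proof.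
move=> Ix; have mG := gloc_metric sA rh i.
have JE : J i x = \matrix_(a, b) partial a (y b \o chart_inv i) x.
  by apply/matrixP => a b; rewrite !mxE flat_mapE.
apply: mulmx1C; apply/matrixP => a b; rewrite [RHS]mxE -(ym a b (chart_inv i x)).
have [d e] := chart_img_dom sA Ix.
rewrite (minner_chart sA rh openT (smooth_CkM 2 (ys a)) (smooth_CkM 2 (ys b)) I d) e mxE.
apply: eq_bigr => c _; rewrite JE !mxE; congr (_ * _); apply: eq_bigr => k _.
by rewrite mulrC (invsym mG k c Ix) [_^T _ _]mxE JE mxE.
Qed.

Lemma flat_jac_metric i x : chart_img i x -> J i x *m (J i x)^T = gloc h i x.
Proof.
move=> Ix; have [_ _ /(_ x Ix)/posdef_unit uG] := gloc_metric sA rh i.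
by have := flat_jacK Ix; rewrite /K mulmxA => /(congr1 (mulmx^~ (gloc h i x))); rewrite mulmxKV // mul1mx.
Qed.

Lemma flat_K_smooth i k : Ck_mx k (chart_img i) (K i).
Proof.
have mG := gloc_metric sA rh i; have oI : open (chart_img i) by case: mG.
apply: (Ck_mulmx oI) => [b a|a b]; last exact: (inv_smooth mG k a b).
apply: (Ck_eq oI (f := partial a (y b \o chart_inv i))) => [x _|]; first by rewrite !mxE flat_mapE.
exact: Ck_partial (ys b i k.+1).
Qed.

Lemma flat_cont p b : {for p, continuous (y b)}.
Proof. exact: (CkM_cont sA openT (smooth_CkM 0 (ys b)) I). Qed.

(** The squared distance [S] from [flat_map p] to [w] controls [q] and so attains its minimum. At
    the minimum the invertible Jacobian annihilates the difference vector. *)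
Lemma flat_surjective w : exists p, flat_map p = w.
Proof.
have [p1 _] := M0; pose S p := \sum_b (y b p - w 0 b) ^+ 2.
pose T := S p1 + \sum_b w 0 b ^+ 2.
have qS p : q p <= S p + \sum_b w 0 b ^+ 2.
  (* The difference of the two sides is the sum of the squares [(y b p - 2 * w 0 b) ^+ 2]. *)
  have : 2 * q p <= 2 * (S p + \sum_b w 0 b ^+ 2).
    rewrite -yq mulrDr !mulr_sumr -big_split; apply: ler_sum => b _ /=.
    by rewrite -subr_ge0; apply: le_trans (sqr_ge0 (y b p - 2 * w 0 b)) _; rewrite le_eqVlt; apply/orP; left; apply/eqP; ring.
  by rewrite ler_pM2l.
have cS p : {for p, continuous S}.
  apply: cvg_big => [|b _]; first exact: add_continuous.
  by apply: cvgM; apply: cvgB; [exact: flat_cont|exact: cvg_cst|exact: flat_cont|exact: cvg_cst].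
have [z _ zmin] : exists2 z, z \in [set p | q p <= T] & forall t, t \in [set p | q p <= T] -> S z <= S t.
  apply: compact_EVT_min; [by exists p1; exact: qS|exact: kq|].
  by apply: continuous_in_subspaceT => x _; apply: cS.
have zle t : S z <= S t.
  have [tp|tp] := leP (q t) T; first by apply: zmin; rewrite inE.
  apply: (@le_trans _ _ (S p1)); first by apply: zmin; rewrite inE; exact: qS.
  by have := lt_le_trans tp (qS t); rewrite /T ltrD2r => /ltW.
exists z; pose i := chart_at A z; have iz : chart_dom i z := atlas_cover sA z.
have oI : open (chart_img i) by case: (gloc_metric sA rh i).
have Ix := chart_imgP iz; pose x := chart i z.
have cSi : Ck_on 1 (chart_img i) (S \o chart_inv i).
  apply: (Ck_sum _ _ oI) => b; have cb := Ck_subr oI (ys b i 1) (Ck_cst 1 _ (w 0 b)).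
  exact: (Ck_mul oI cb cb).
have dS a : partial a (S \o chart_inv i) x = 0.
  apply: (local_min_partial a oI cSi Ix) => t _.
  by rewrite /= (atlas_chartK sA iz).
have dy b a : derivable (y b \o chart_inv i) x (delta_mx 0 a) := Ck_derivable (ys b i 1) Ix.
have dyw b a : derivable (fun t => (y b \o chart_inv i) t - w 0 b) x (delta_mx 0 a) := derivableB (dy b a) (derivable_cst _ _ _).
pose v : 'cV[R]_n := \col_b (y b z - w 0 b).
have Jv : J i x *m v = 0.
  apply/colP => a; rewrite mxE [RHS]mxE.
  have : 2 * \sum_b J i x a b * v b 0 = 0.
    rewrite -[RHS](dS a) (partial_sum _ (fun b => derivableM (dyw b a) (dyw b a)) : partial a (S \o chart_inv i) x = _) mulr_sumr.
    apply: eq_bigr => b _; rewrite (partialM (dyw b a) (dyw b a)) (partialB (dy b a) (derivable_cst _ _ _)).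
    rewrite [partial a (fun=> w 0 b) x]partial_cst subr0 -[RHS]mulr2n mulr_natl mulrC.
    by rewrite [J i x a b]mxE flat_mapE [v b 0]mxE /= (atlas_chartK sA iz).
  by move/eqP; rewrite mulf_eq0 pnatr_eq0 /= => /eqP.
have Jid := mulmx1C (flat_jacK Ix).
have v0 : v = 0 by rewrite -[v]mul1mx -Jid -mulmxA Jv mulmx0.
apply/rowP => b; apply/eqP; rewrite mxE -subr_eq0; apply/eqP.
by have /colP/(_ b) := v0; rewrite !mxE.
Qed.

Variables (E : M -> M) (lam : R) (p0 : M).
Hypothesis Einj : injective E.
Hypothesis yE : forall b z, y b (E z) = lam * y b z.
Hypothesis toP : forall z z' W, open W -> W p0 -> exists k, W (iter k E z) /\ W (iter k E z').

(** [E] acts as multiplication by [lam] in these coordinates, so two points with equal images keep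
    equal images under iteration. They eventually lie where the map is locally injective, and [E] is
    injective. *)
Lemma flat_injective : injective flat_map.
Proof.
move=> p p' pE; pose i := chart_at A p0; have ip : chart_dom i p0 := atlas_cover sA p0.
have oI : open (chart_img i) by case: (gloc_metric sA rh i).
have [r r0 Hr] := local_injective oI (flat_map_smooth i 2) (@flat_K_smooth i) (@flat_jacK i) (chart_imgP ip).
pose W := chart_dom i `&` chart i @^-1` (nball (chart i p0) r).
have oW : open W.
  rewrite openE => z [iz Bz]; have n1 := open_nbhs_nbhs (conj (atlas_dom_open sA i) iz).
  apply: filterI => //.
  exact: (nbhs_preimage (atlas_chart_cont sA iz) (@open_norm_ball _ _ _ _) Bz).
have Wp : W p0 by split => //=; rewrite /nball /= subrr normr0.
have [k [[k1 b1] [k2 b2]]] := toP p p' oW Wp.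
have yk z b : y b (iter k E z) = lam ^+ k * y b z.
  by elim: k {k1 b1 k2 b2} => [|k IH]; rewrite ?mul1r //= yE IH exprS mulrA.
have ik : iter k E p = iter k E p'.
  rewrite -(atlas_chartK sA k1) -(atlas_chartK sA k2); congr (chart_inv i _).
  apply: (Hr _ _ b1 b2); rewrite /= (atlas_chartK sA k1) (atlas_chartK sA k2).
  apply/rowP => b; rewrite !mxE !yk; congr (_ * _).
  by have /rowP/(_ b) := pE; rewrite !mxE.
by elim: k ik {k1 b1 k2 b2 yk} => //= k IH /Einj.
Qed.

(** The map is proper: the part of a compact sublevel set outside a neighbourhood of [F w] has a
    compact, hence closed, image avoiding [w]. The sublevel condition is open on the target because
    [2 q] is the squared length of the image. *)
Lemma flat_inverse_cont (F : 'rV[R]_n -> M) : cancel flat_map F -> cancel F flat_map -> continuous F.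
Proof.
move=> FK KF w W /= NW; have [V [oV Vw] VW] : exists2 V, open_nbhs (F w) V & V `<=` W.
  by move: NW; rewrite nbhsE => -[V]; exists V.
pose T := q (F w) + 1; pose C := flat_map @` ([set p | q p <= T] `&` ~` V).
have cfm p : {for p, continuous flat_map}.
  apply/cvgrPdist_lt => e e0.
  have N : nbhs p [set z | forall b, `|y b p - y b z| < e].
    apply: (@filter_forall _ _ (fun b z => `|y b p - y b z| < e) (nbhs p) _) => b.
    by have /cvgrPdist_lt/(_ e e0) := @flat_cont p b.
  by apply: filterS N => z Hz; apply: norm_lt_coord => // b; rewrite !mxE.
have cC : closed C.
  apply: compact_closed; first exact: norm_hausdorff.
  apply: continuous_compact; first by apply: continuous_in_subspaceT => z _; exact: cfm.
  apply: (subclosed_compact _ (@kq T)); last by move=> z [].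
  apply: closedI; [exact: compact_closed hM (@kq T)|exact: open_closedC].
have nC : (~` C) w by move=> [z [_ nV] zw]; apply: nV; rewrite -(FK z) zw.
have sc : {for w, continuous (fun v : 'rV[R]_n => \sum_b v 0 b ^+ 2)}.
  have c0 : Ck_on 0 [set: 'rV[R]_n] (fun v : 'rV[R]_n => \sum_b v 0 b ^+ 2).
    by apply: (Ck_sum _ _ openT) => b; exact: (Ck_mul openT (Ck_coord 0 b openT) (Ck_coord 0 b openT)).
  exact: Ck_cont c0 I.
have sw (v : 'rV[R]_n) : \sum_b v 0 b ^+ 2 = 2 * q (F v).
  by rewrite -yq -{1}(KF v); apply: eq_bigr => b _; rewrite mxE.
have N2 : nbhs w [set v : 'rV[R]_n | \sum_b v 0 b ^+ 2 < 2 * T].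
  apply: (cvgr_lt _ sc); rewrite sw ltr_pM2l // ltrDl //.
have N1 : nbhs w (~` C) := open_nbhs_nbhs (conj (closed_openC cC) nC).
apply: filterS (@filterI _ _ (nbhs_filter w) _ _ N1 N2) => v [nCv].
rewrite /= sw ltr_pM2l // => qv; apply: VW; apply: contrapT => nV; apply: nCv.
by exists (F v); [split => //; exact: ltW|exact: KF].
Qed.

Lemma flat_diffeo : exists F : 'rV[R]_n -> M, [/\ cancel flat_map F, cancel F flat_map,
  smooth_map A (euclidean_atlas R n) flat_map & smooth_map (euclidean_atlas R n) A F].
Proof.
have [F KF] := choice flat_surjective.
have FK : cancel flat_map F by move=> p; apply: flat_injective; rewrite KF.
have cF := flat_inverse_cont FK KF.
exists F; split => //.
- split => [p|i [] b k]; last by apply: Ck_sub (flat_map_smooth i k b) => _ [p [ip _] <-]; exact: chart_imgP.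
  apply/cvgrPdist_lt => e e0.
  have N : nbhs p [set z | forall b, `|y b p - y b z| < e].
    apply: (@filter_forall _ _ (fun b z => `|y b p - y b z| < e) (nbhs p) _) => b.
    by have /cvgrPdist_lt/(_ e e0) := @flat_cont p b.
  by apply: filterS N => z Hz; apply: norm_lt_coord => // b; rewrite !mxE.
- split => // -[] j b.
  have oI : open (chart_img j) by case: (gloc_metric sA rh j).
  have oW : open (F @^-1` chart_dom j) by apply: open_comp (atlas_dom_open sA j) => w _; exact: cF.
  have -> : @chart R n _ (euclidean_atlas R n) tt @` (@chart_dom R n _ (euclidean_atlas R n) tt `&` F @^-1` chart_dom j) = F @^-1` chart_dom j.
    by apply/seteqP; split => [_ [w [_ jw] <-]|w jw] //; exists w.
  apply: (inverse_smooth oI (flat_map_smooth j 2) (@flat_K_smooth j) (@flat_jacK j) oW (F := chart j \o F)).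
  + by move=> w jw; apply: continuous_comp; [exact: cF|exact: (atlas_chart_cont sA jw)].
  + by move=> w jw; exact: chart_imgP.
  + by move=> w jw; rewrite /= (atlas_chartK sA jw) KF.
Qed.
End FlatMap.

(** * The flat metric of a rigid static triple *)

Lemma cone_hess_algebra (R : fieldType) (w Gab wa wb Pab S : R) : w != 0 -> 2 != 0 :> R ->
  w * Gab = Pab - 2^-1 * S ->
  (wa * wb + w * Pab) - 2^-1 * (w^-1 * (S + 2 * Pab * (w ^+ 2 - 1))) = Gab + wa * wb.
Proof.
move=> w0 t0 E; have -> : S = 2 * (Pab - w * Gab) by rewrite E; field.
by field; rewrite w0 t0.
Qed.

(* If [D^2 w = w G] and [|Dw|^2 = w^2 - 1], then [G + dw (x) dw] is flat: in the
   hyperboloid model, where [w] is the time coordinate, it is the pull-back of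
   the Euclidean metric by the orthogonal projection onto space. *)
Section ConeMetric.
Context {R : realType} {n : nat}.
Variables (U : set 'rV[R]_n) (G : 'rV[R]_n -> 'M[R]_n) (w : 'rV[R]_n -> R).
Hypothesis mG : metric_on U G.
Hypothesis sw : smooth_on U w.
Hypothesis w0 : forall x, U x -> 0 < w x.
Hypothesis hw : forall x, U x -> hessian_coord G w x = w x *: G x.
Hypothesis gw : forall x, U x -> gradnorm G w x = w x ^+ 2 - 1.
Let oU : open U. Proof. by case: mG. Qed.
Let sG k : Ck_mx k U G. Proof. by case: mG. Qed.
Let pG x : U x -> posdef (G x). Proof. by case: mG => _ _; apply. Qed.

Definition cone_metric x : 'M[R]_n := G x + (\row_a partial a w x)^T *m \row_a partial a w x.

Definition cone_energy x : R := 2^-1 * (w x * w x - 1).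

Lemma cone_metricE x a b : cone_metric x a b = G x a b + partial a w x * partial b w x.
Proof. by rewrite !mxE big_ord1 !mxE. Qed.

Lemma cone_metric_on : metric_on U cone_metric.
Proof.
split => // [k a b|x Ux].
  apply: (Ck_eq oU (f := fun x => G x a b + partial a w x * partial b w x)) => [x _|].
    by rewrite cone_metricE.
  apply: (Ck_add oU (sG k a b)); exact: (Ck_mul oU (Ck_partial a (sw k.+1)) (Ck_partial b (sw k.+1))).
have [sGx pGx] := pG Ux; split => [|v v0]; first by rewrite /cone_metric linearD /= sGx trmx_mul trmxK.
rewrite /cone_metric; set c := \row_a _; rewrite mulmxDr mulmxDl mxE ltr_pwDl ?pGx //.
have -> : v *m (c^T *m c) *m v^T = (v *m c^T) *m (v *m c^T)^T by rewrite trmx_mul trmxK !mulmxA.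
exact: row_mul_tr_ge0.
Qed.

Lemma partial_cone_energy a x : U x -> partial a cone_energy x = w x * partial a w x.
Proof.
move=> Ux; have dw : derivable w x (delta_mx 0 a) := Ck_derivable (sw 1) Ux.
have dc (c : R) : derivable (fun=> c) x (delta_mx 0 a) := derivable_cst _ _ _.
have d2 := derivableM dw dw; have d3 := derivableB d2 (dc 1).
rewrite (partialZ 2^-1 d3 : partial a cone_energy x = _) (partialB d2 (dc 1)) (partialM dw dw).
rewrite [partial a (fun=> 1) x]partial_cst subr0.
have half (t : R) : 2^-1 * (t + t) = t by field.
exact: half.
Qed.

Lemma partial2_cone_energy a b x : U x -> partial a (partial b cone_energy) x =
  partial a w x * partial b w x + w x * partial a (partial b w) x.
Proof.
move=> Ux; rewrite (eq_partial a oU Ux (fun y Uy => partial_cone_energy b Uy)).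
rewrite (partialM (Ck_derivable (sw 1) Ux) (Ck_derivable (Ck_partial b (sw 2)) Ux)).
by rewrite addrC [partial a w x * _]mulrC.
Qed.

Lemma partial_cone_metric l a b x : U x -> partial l (fun y => cone_metric y a b) x =
  partial l (fun y => G y a b) x +
  (partial l (partial a w) x * partial b w x + partial a w x * partial l (partial b w) x).
Proof.
move=> Ux; have E y : U y -> cone_metric y a b = G y a b + partial a w y * partial b w y.
  by move=> _; exact: cone_metricE.
have da c : derivable (partial c w) x (delta_mx 0 l) := Ck_derivable (Ck_partial c (sw 2)) Ux.
have C (s t v z : R) : s * t + v * z = z * v + s * t by rewrite addrC [v * z]mulrC.
rewrite (eq_partial l oU Ux E) (partialD (Ck_derivable (sG 1 a b) Ux) (derivableM (da a) (da b))).
congr (_ + _); rewrite (partialM (da a) (da b)); exact: C.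
Qed.

Lemma chr1_cone a b l x : U x ->
  chr1 cone_metric a b l x = chr1 G a b l x + 2 * partial a (partial b w) x * partial l w x.
Proof.
move=> Ux; rewrite /chr1 !partial_cone_metric //.
rewrite (Schwarz b a oU (sw 2) Ux) (Schwarz l a oU (sw 2) Ux) (Schwarz l b oU (sw 2) Ux).
by move: (partial a (fun y => G y b l) x) (partial b _ x) (partial l _ x) (partial a (partial b w) x)
  (partial a (partial l w) x) (partial b (partial l w) x) (partial a w x) (partial b w x) (partial l w x) => *; ring.
Qed.

(** The cone metric lowers [w^-1 grad w] to [w^-1 (1 + |Dw|^2) dw = w dw], which is the differential
    of the energy. *)
Lemma gradv_cone l x : U x -> gradv cone_metric cone_energy l x = (w x)^-1 * gradv G w l x.
Proof.
move=> Ux; have wx : w x != 0 by rewrite gt_eqF // w0.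
have [_ _ /(_ x Ux)/posdef_unit uH] := cone_metric_on.
pose z : 'cV[R]_n := \col_l ((w x)^-1 * gradv G w l x).
have Hz : cone_metric x *m z = \col_a partial a cone_energy x.
  apply/colP => a; rewrite [LHS]mxE [RHS]mxE partial_cone_energy //.
  under eq_bigr do rewrite cone_metricE [z _ _]mxE mulrDl mulrCA -mulrA (mulrCA (partial _ w x) (w x)^-1).
  rewrite big_split /= -!mulr_sumr (lower_gradv mG w a Ux).
  have -> : \sum_l partial l w x * gradv G w l x = w x ^+ 2 - 1.
    by rewrite -(gw Ux); apply: eq_bigr => k _; rewrite mulrC.
  by move: (partial a w x) => wa; field.
have -> : gradv cone_metric cone_energy l x = (invmx (cone_metric x) *m \col_a partial a cone_energy x) l 0.
  by rewrite mxE; apply: eq_bigr => b _; rewrite [X in _ = _ * X]mxE.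
by rewrite -Hz mulKmx // mxE.
Qed.

(** In the new Christoffel term the Hessian of [w] is multiplied by [w^-1 |Dw|^2 = w - w^-1]. This
    leaves [w^-1 D^2w = G] in addition to [dw (x) dw]. *)
Lemma hess_cone x : U x -> hessian_coord cone_metric cone_energy x = cone_metric x.
Proof.
move=> Ux; apply/matrixP => a b; rewrite (hessE cone_metric_on _ a b Ux) cone_metricE partial2_cone_energy //.
have hab : w x * G x a b = partial a (partial b w) x - 2^-1 * \sum_l gradv G w l x * chr1 G a b l x.
  by rewrite -(hessE mG w a b Ux) hw // mxE.
rewrite -(cone_hess_algebra (partial a w x) (partial b w x) _ _ hab) ?pnatr_eq0 ?gt_eqF ?w0 //.
congr (_ - _ * _); rewrite -(gw Ux) /gradnorm !mulr_sumr -big_split mulr_sumr /=.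
apply: eq_bigr => l _; rewrite gradv_cone // chr1_cone //.
have alg (s t v z c : R) : s * t * (v + z * c) = s * (t * v + z * (t * c)) by ring.
exact: alg.
Qed.

Lemma gradnorm_cone x : U x -> gradnorm cone_metric cone_energy x = 2 * cone_energy x.
Proof.
move=> Ux; have wx : w x != 0 by rewrite gt_eqF // w0.
rewrite /cone_energy mulrA mulfV ?pnatr_eq0 // mul1r -expr2 -(gw Ux) /gradnorm.
apply: eq_bigr => a _; rewrite gradv_cone // partial_cone_energy // mulrACA.
by rewrite mulVf // mul1r.
Qed.
End ConeMetric.

Lemma eq_hess_metric (R : realType) n (G1 G2 : 'rV[R]_n -> 'M[R]_n) (f : 'rV[R]_n -> R) (U : set 'rV[R]_n) x :
  open U -> U x -> (forall y, U y -> G1 y = G2 y) -> hessian_coord G1 f x = hessian_coord G2 f x.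
Proof.
move=> oU Ux H; apply/matrixP => a b; rewrite !mxE; congr (_ - _).
have E c d e : partial c (fun y => G1 y d e) x = partial c (fun y => G2 y d e) x.
  by apply: (eq_partial c oU Ux) => y /H ->.
apply: eq_bigr => k _; congr (_ * _); rewrite /christoffel; congr (_ * _).
by apply: eq_bigr => l _; rewrite !E H.
Qed.

Lemma trmx_scaler (R : comPzRingType) m n (c : R) (B : 'M[R]_(m, n)) : (c *: B)^T = c *: B^T.
Proof. by apply/matrixP => i j; rewrite !mxE. Qed.

Lemma energy_bound (R : realFieldType) (t T : R) : 2^-1 * (t * t - 1) <= T -> t <= T + 1.
Proof. have : 0 <= (t - 1) * (t - 1) by rewrite -expr2 sqr_ge0. lra. Qed.

(** A form without division by the radius, valid at the origin as well: there the default value of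
    [d_enorm] makes both sides the identity. *)
Lemma ads_metricE (R : realType) n (v : 'rV[R]_n) :
  ads_metric tt v = 1%:M - (1 + \sum_a v 0 a ^+ 2)^-1 *: (v^T *m v).
Proof.
have s0 : 0 <= \sum_a v 0 a ^+ 2 by apply: sumr_ge0 => a _; exact: sqr_ge0.
rewrite /ads_metric /d_enorm; set s := \sum_a _ in s0 *.
have e2 : enorm v ^+ 2 = s by rewrite sqr_sqrtr.
have -> : ((enorm v)^-1 *: v)^T *m ((enorm v)^-1 *: v) = s^-1 *: (v^T *m v).
  by rewrite trmx_scaler -scalemxAl -scalemxAr scalerA -expr2 exprVn e2.
rewrite e2 addrCA; congr (_ + _).
have [z|z] := eqVneq s 0.
  have -> : v = 0.
    apply/rowP => a; rewrite mxE; apply/eqP; rewrite -sqrf_eq0 eq_le sqr_ge0 andbT -z.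
    by rewrite /s (bigD1 a) //= lerDl sumr_ge0 // => b _; exact: sqr_ge0.
  by rewrite mulmx0 !scaler0 subr0 oppr0.
rewrite scalerA -scalerBl -scaleNr; congr (_ *: _).
have s1 : 1 + s != 0 by rewrite gt_eqF // ltr_wpDr.
by field; rewrite s1 z.
Qed.

Lemma ads_potentialE (R : realType) n (v : 'rV[R]_n) :
  ads_potential v = Num.sqrt (1 + \sum_a v 0 a ^+ 2).
Proof. by rewrite /ads_potential sqr_sqrtr // sumr_ge0 // => a _; exact: sqr_ge0. Qed.

Section Rigidity.
Context {R : realType} {n : nat} {M : topologicalType}.
Variable A : atlas R n M.
Hypothesis sA : smooth_atlas A.
Hypothesis hM : hausdorff_space M.
Hypothesis cM : connected [set: M].
Hypothesis M0 : [set: M] !=set0.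
Variable g : metric_field A.
Hypothesis rg : riemannian_metric g.
Variables (u : M -> R) (m : R).
Hypothesis m0 : 0 < m.
Hypothesis su : smooth_fun A u.
Hypothesis u0 : forall p, 0 < u p.
Hypothesis ku : forall T, compact [set p | u p <= T].
Hypothesis hu : forall i p, chart_dom i p -> hessian g u i p = u p *: g i p.
Hypothesis gu : forall i p, chart_dom i p ->
  gradnorm (gloc g i) (u \o chart_inv i) (chart i p) = u p ^+ 2 - m ^+ 2.
Implicit Types (i j : chart_ix A) (p z : M).

Let w p := m^-1 * u p.
Let q p := 2^-1 * (w p * w p - 1).
Let h : metric_field A := fun i p => cone_metric (gloc g i) (w \o chart_inv i) (chart i p).
Let mG i : metric_on (chart_img i) (gloc g i) := gloc_metric sA rg i.
Let oI i : open (chart_img i). Proof. by case: (mG i). Qed.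
Let w0 p : 0 < w p. Proof. by rewrite mulr_gt0 // invr_gt0. Qed.

Let sw : smooth_fun A w.
Proof. by move=> i k; exact: (Ck_mul (@oI i) (Ck_cst _ _ _) (su i k)). Qed.

Let hw i x : chart_img i x ->
  hessian_coord (gloc g i) (w \o chart_inv i) x = (w \o chart_inv i) x *: gloc g i x.
Proof.
move=> Ix; have [d e] := chart_img_dom sA Ix.
rewrite (hess_scale m^-1 (mG i) Ix (su i 2) : hessian_coord _ (w \o chart_inv i) x = _).
by rewrite -scalerA; congr (_ *: _); have := hu d; rewrite /hessian e.
Qed.

Let gw i x : chart_img i x ->
  gradnorm (gloc g i) (w \o chart_inv i) x = (w \o chart_inv i) x ^+ 2 - 1.
Proof.
move=> Ix; have [d e] := chart_img_dom sA Ix.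
rewrite (gradnorm_scale _ m^-1 Ix (su i 1) : gradnorm _ (w \o chart_inv i) x = _).
have := gu d; rewrite e => ->; rewrite /= /w mulrBr !exprMn [_ * m ^+ 2]mulrC exprVn mulfV //.
by rewrite expf_neq0 // gt_eqF.
Qed.

Let gloc_cone i x : chart_img i x -> gloc h i x = cone_metric (gloc g i) (w \o chart_inv i) x.
Proof. by move=> Ix; have [d e] := chart_img_dom sA Ix; rewrite /gloc /h e. Qed.

Let wl0 i x : chart_img i x -> 0 < (w \o chart_inv i) x. Proof. by move=> _; exact: w0. Qed.

Lemma cone_riemannian : riemannian_metric h.
Proof.
have mH i := cone_metric_on (mG i) (sw i).
split.
- by move=> i p ip; have [_ _ /(_ _ (chart_imgP ip))[]] := mH i.
- by move=> i p ip; have [_ _ /(_ _ (chart_imgP ip))[]] := mH i.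
- move=> i a b k; have [_ /(_ k a b) c _] := mH i.
  by apply: (Ck_eq (@oI i) _ c) => x Ix; rewrite -(gloc_cone Ix).
- move=> i j p ip jp; pose kap := transition i j; pose U := chart_on i (chart_dom j).
  have oU : open U := @chart_on_open _ _ _ _ sA i _ (atlas_dom_open sA j).
  have Ux : U (chart i p) := chart_onP sA ip jp; set x := chart i p in Ux *.
  have kp : kap x = chart j p by rewrite /kap /transition /= (atlas_chartK sA ip).
  have dk b : differentiable (fun y => kap y 0 b) x := (Ck_diff oU (transition_Ck sA 1 i j b) Ux).1.
  rewrite (jacobianE dk) /h -/x /cone_metric (gloc_change sA rg Ux) -/kap kp.
  have -> : \row_a partial a (w \o chart_inv i) x =
      (\row_a partial a (w \o chart_inv j) (chart j p)) *m (jac kap x)^T.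
    apply/rowP => a; rewrite !mxE.
    have E y : U y -> (w \o chart_inv i) y = ((w \o chart_inv j) \o kap) y.
      by move=> [Iy jy]; rewrite /= /kap /transition /= (atlas_chartK sA jy).
    rewrite (eq_partial a oU Ux E) (partial_comp a (@oI j) _ (sw j 1) dk).2 kp; last exact: chart_imgP.
    by apply: eq_bigr => b _; rewrite !mxE mulrC.
  by rewrite /pullback trmx_mul trmxK mulmxDr mulmxDl !mulmxA.
Qed.

Lemma ads_isometric : exists2 c : R, 0 < c &
   exists2 Phi : M -> 'rV[R]_n, riem_isometry g (@ads_metric R n) Phi &
     forall p, u p = c * ads_potential (Phi p).
Proof.
have rh := cone_riemannian.
have sq : smooth_fun A q.
  move=> i k; apply: (Ck_mul (@oI i) (Ck_cst _ _ _)); apply: (Ck_subr (@oI i) _ (Ck_cst _ _ _)).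
  exact: (Ck_mul (@oI i) (sw i k) (sw i k)).
have hq i x : chart_img i x -> hessian_coord (gloc h i) (q \o chart_inv i) x = gloc h i x.
  move=> Ix; rewrite (eq_hess_metric _ (@oI i) Ix (@gloc_cone i)) (gloc_cone Ix).
  exact: (hess_cone (mG i) (sw i) (@wl0 i) (@hw i) (@gw i) Ix).
have gq p : mgrad h q p = 2 * q p.
  have ip := atlas_cover sA p; rewrite /mgrad; set i := chart_at A p in ip *; have Ix := chart_imgP ip.
  have := gradnorm_cone (mG i) (sw i) (@wl0 i) (@gw i) Ix.
  rewrite /gradnorm /gradv (gloc_cone Ix) => E; rewrite [LHS]E.
  by rewrite /cone_energy /= (atlas_chartK sA ip).
have kq T : compact [set p | q p <= T].
  apply: (subclosed_compact _ (@ku (m * (T + 1)))).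
    have -> : [set p | q p <= T] = q @^-1` [set t | t <= T] by [].
    apply: closed_comp => [p _|]; [exact: (q_cont sA sq)|exact: closed_le].
  move=> p /=; rewrite /q => qT; have -> : u p = m * w p by rewrite /w mulrA mulfV ?mul1r // gt_eqF.
  rewrite ler_pM2l //; exact: energy_bound qT.
have [lam [E HE]] := radial_homothety_exists sA hM rh sq hq gq kq.
have [p0 [y [[_ toP] ys ym yq yE]]] := flat_coordinates sA hM cM M0 rh sq hq gq kq HE.
have [_ _ Einj _ _] := HE.
have [F [FK KF sF sF']] := flat_diffeo sA hM M0 rh kq ys ym yq Einj yE toP.
exists m => //; exists (flat_map y).
  split; first by exists F.
  move=> i [] p ip _; have Ix := chart_imgP ip; set x := chart i p in Ix *.
  have dk b : differentiable (fun t => (flat_map y \o chart_inv i) t 0 b) x :=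
    (Ck_diff (@oI i) (flat_map_smooth ys i 1 b) Ix).1.
  rewrite (jacobianE dk : 'J (@chart _ _ _ (euclidean_atlas R n) tt \o flat_map y \o chart_inv i) x = _).
  set J := jac _ _.
  pose c := \row_a partial a (w \o chart_inv i) x.
  (* The pull-back of the Euclidean metric is [h = g + dw (x) dw], so only the rank-one term remains
     to be matched. *)
  have gE : g i p = J *m J^T - c^T *m c.
    by rewrite (flat_jac_metric sA rh ys ym Ix) (gloc_cone Ix) /cone_metric addrK /gloc (atlas_chartK sA ip).
  (* Differentiating [\sum_b y_b ^+ 2 = 2 q = w ^+ 2 - 1]. Hence the rank-one term of [ads_metricE],
     divided by [1 + |y|^2 = w ^+ 2], pulls back to [dw (x) dw]. *)
  have yJ : flat_map y p *m J^T = w p *: c.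
    apply/rowP => a; rewrite !mxE; have := partial_cone_energy (sw i) a Ix.
    rewrite /= (atlas_chartK sA ip) => <-.
    have dy b : derivable (y b \o chart_inv i) x (delta_mx 0 a) := Ck_derivable (ys b i 1) Ix.
    have dyy b := derivableM (dy b) (dy b).
    rewrite (eq_partial a (@oI i) Ix (g := fun t => 2^-1 * \sum_b (y b \o chart_inv i) t * (y b \o chart_inv i) t)).
      rewrite (partialZ 2^-1 (derivable_sumr _ _ dyy)) (partial_sum _ dyy) mulr_sumr.
      apply: eq_bigr => b _; rewrite (partialM (dy b) (dy b)) [J^T b a]mxE [J a b]mxE flat_mapE mxE /= (atlas_chartK sA ip).
      have half (t : R) : 2^-1 * (t + t) = t by field.
      by rewrite half.
    move=> t _; have := yq (chart_inv i t); under eq_bigr do rewrite expr2.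
    by move=> /= ->; rewrite mulKf ?pnatr_eq0.
  have sE : 1 + \sum_a flat_map y p 0 a ^+ 2 = w p ^+ 2.
    under eq_bigr do rewrite mxE.
    by rewrite yq /q mulrA mulfV ?pnatr_eq0 // mul1r addrC subrK expr2.
  rewrite gE ads_metricE sE /pullback mulmxBr mulmxBl mulmx1; congr (_ - _).
  have yJ' : J *m (flat_map y p)^T = w p *: c^T by rewrite -[J]trmxK -trmx_mul yJ trmx_scaler.
  rewrite -scalemxAr -scalemxAl [J *m _]mulmxA yJ' -mulmxA yJ.
  have -> : (w p *: c^T) *m (w p *: c) = w p ^+ 2 *: (c^T *m c).
    by rewrite -scalemxAl -scalemxAr scalerA expr2.
  rewrite scalerA mulVf ?scale1r //.
    by rewrite expf_neq0 // gt_eqF.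
move=> p; rewrite ads_potentialE.
have -> : 1 + \sum_a flat_map y p 0 a ^+ 2 = w p ^+ 2.
  under eq_bigr do rewrite mxE.
  by rewrite yq /q mulrA mulfV ?pnatr_eq0 // mul1r addrC subrK expr2.
by rewrite sqrtr_sqr gtr0_norm // /w mulrA mulfV ?mul1r // gt_eqF.
Qed.
End Rigidity.

Theorem theorem3p2 (R : realType) (n : nat) (hn : (3 <= n)%N)
    (M : topologicalType) (A : atlas R n M) (g : metric_field A) (u : M -> R)
    (hst : static_triple g u)
    (N : set M) (hN : is_component (~` MINset u) N) :
  let L := liminf_infinity N
             (fun x => u x ^+ 2 - u_min u ^+ 2 - grad_normsq g u x) in
  (L <= 0)%E /\
  (L = 0%E ->
   exists2 c : R, 0 < c &
   exists2 Phi : M -> 'rV[R]_n, riem_isometry g (@ads_metric R n) Phi &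
     forall p, u p = c * ads_potential (Phi p)).
Proof.
move=> L; split=> [|L0]; first exact: (liminf_le0 hn hst hN : (liminf_infinity N (deficit g u) <= 0)%E).
have L1 : (0 <= L)%E by rewrite L0.
have [_ F hu] := liminf_rigidity hn hst hN L1.
have [hM _ sA] := static_manifold hst; have rg := static_metric hst; have su := static_smooth hst.
have M0 : [set: M] !=set0 by have [p _ _] := u_min_attained hst; exists p.
apply: (ads_isometric sA hM (static_connected hst) M0 rg (u_min_gt0 hst) su (static_pos hst)
  (sublevel_compact hst) hu) => i p ip.
by rewrite -(grad_normsq_loc hst ip) -[LHS]addr0 -(F p) /deficit addrC subrK.
Qed.
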